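(* Let $X$ be a smooth projective connected curve over $k$ and let $x$ be any geometric point of $X$. For a geometric formal orbifold $(X,P)$, the category $Vect^0(X,P)^{ss}$ of strongly semistable bundles of degree $0$ on $(X,P)$, together with the fiber functor associated to $x$, is a neutral Tannakian category. The same is true for the subcategory $Nori(X,P)$ of essentially finite bundles on $(X,P)$ and for the subcategory $Etale(X,P)$ of bundles on $(X,P)$ associated to finite étale covers.
   Context: Let $k$ be an algebraically closed field; all curves are over $k$. A covering of smooth projective curves is a finite generically étale (separable) morphism. For a smooth projective curve $X$ and a closed point $x\in X$, $\mathcal{K}_{X,x}$ denotes the fraction field of $\widehat{\mathcal O}_{X,x}$. A branch data on $X$ is a function $P$ assigning to each closed point $x\in X$ a finite Galois extension $P(x)$ of $\mathcal K_{X,x}$ such that $\{x: P(x)\ne \mathcal K_{X,x}\}$ is finite; $O$ denotes the trivial branch data. A formal orbifold is a pair $(X,P)$ with $X$ a smooth projective curve and $P$ a branch data on $X$. A morphism of formal orbifolds $f:(Y,Q)\to(X,P)$ is a covering $f:Y\to X$ such that for every closed point $y\in Y$ the extension $Q(y)/\mathcal K_{X,f(y)}$ contains $P(f(y))/\mathcal K_{X,f(y)}$; it is étale if $Q(y)=P(f(y))$ for all $y$. $(X,P)$ is geometric if there is a connected étale cover $(Y,O)\to(X,P)$. For a finite group $\Gamma$ acting on $Y$, with action map $\mu:\Gamma\times Y\to Y$ and second projection $p$, a $\Gamma$-bundle on $Y$ is a vector bundle $V$ with an isomorphism $\lambda:\mu^*V\to p^*V$ such that $\lambda_g=\lambda|_{g\times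 Y}:g^*V\to V$ satisfy $\lambda_{gh}=\lambda_h\circ h^*\lambda_g$; morphisms are $\Gamma$-equivariant homomorphisms. Fix a connected étale Galois cover $(Y,O)\to(X,P)$ with group $\Gamma$. A vector bundle on $(X,P)$ is a $\Gamma$-bundle $V$ on $Y$, denoted $(Y,\Gamma,V)$ (the category is, up to equivalence by pull-back, independent of the choice of $Y$). Tensor products and duals are those of $\Gamma$-bundles. The degree of $(Y,\Gamma,V)$ is $\deg(V)/|\Gamma|$ and its slope is the degree divided by the rank. A subbundle of $(Y,\Gamma,V)$ is $(Y,\Gamma,W)$ with $W\subset V$ a $\Gamma$-invariant subbundle. $(Y,\Gamma,V)$ is semistable if every subbundle has slope at most that of $(Y,\Gamma,V)$. In characteristic $p>0$ it is strongly semistable if all its Frobenius pull-backs $(Y,\Gamma,(F_Y^n)^*V)$, $n\ge 0$, are semistable, where $F_Y$ is the Frobenius morphism of $Y$; in characteristic $0$ strongly semistable means semistable. $Nori(X,P)$ is the full subcategory of those $(Y,\Gamma,V)$ with $V$ an essentially finite bundle on $Y$ in the sense of Nori. $Etale(X,P)$ is the full subcategory of those $(Y,\Gamma,V)$ whose underlying bundle becomes trivial after pull-back to some connected étale Galois cover $(Y',O)\to(X,P)$ dominating $Y$. The fiber functor associated to a ($k$-valued) geometric point $x$ of $X$ sends $(Y,\Gamma,V)$ to the fiber $V_y$ at a chosen point $y\in Y$ over $x$. *)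

(* Defs.v *)
From HB Require Import structures.
From mathcomp Require Import all_boot all_order all_fingroup all_algebra all_field.
From mathcomp Require Import generic_quotient ring_quotient fraction.
From mathcomp Require Import boolp classical_sets functions cardinality fsbigop.
From mathcomp Require Import ring.

Set Implicit Arguments.
Unset Strict Implicit.
Unset Printing Implicit Defensive.

Import Order.TTheory GRing.Theory Num.Theory.
Local Open Scope classical_set_scope.
Local Open Scope ring_scope.
Local Open Scope quotient_scope.

(* Smooth projective connected curves over k. Such a curve is the abstract   *)
(* nonsingular curve attached to its function field (Hartshorne I.6): its    *)
(* closed points are the discrete valuations of the function field that are  *)
(* trivial on k, its closed sets are the finite sets of points and the whole *)
(* curve, and its local rings are the valuation rings.                       *)

Definition in_ratfun (k L : fieldType) (i : {rmorphism k -> L}) (t a : L) : Prop :=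
  exists p q : {poly k}, (map_poly i q).[t] != 0 /\
    a = (map_poly i p).[t] / (map_poly i q).[t].

Definition function_field (k L : fieldType) (i : {rmorphism k -> L}) : Prop :=
  exists t : L,
    (forall p : {poly k}, p != 0 -> (map_poly i p).[t] != 0) /\
    exists (n : nat) (b : 'I_n -> L), forall a : L,
      exists c : 'I_n -> L,
        (forall j, in_ratfun i t (c j)) /\ a = \sum_j c j * b j.

Record curve (k : closedFieldType) := Curve {
  ff : fieldType;
  kcst : {rmorphism k -> ff};
  curveP : function_field kcst }.

(* The value at 0, which is irrelevant, is normalized to 0. *)
Record place (k : closedFieldType) (X : curve k) := Place {
  vord :> ff X -> int;
  vord0 : vord 0 = 0;
  vordM : forall a b, a != 0 -> b != 0 -> vord (a * b) = vord a + vord b;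
  vordD : forall a b, a != 0 -> b != 0 -> a + b != 0 ->
           Num.min (vord a) (vord b) <= vord (a + b);
  vord_cst : forall c, vord (kcst X c) = 0;
  vord_surj : exists t, vord t = 1 }.

HB.instance Definition _ k (X : curve k) := gen_eqMixin (place X).
HB.instance Definition _ k (X : curve k) := gen_choiceMixin (place X).

Section Places.
Variables (k : closedFieldType) (X : curve k).
Implicit Types (x : place X) (a b : ff X) (n : nat).

(* The n-th power of the maximal ideal of the local ring at x (n = 0: the   *)
(* local ring itself).                                                      *)
Definition in_pow x n : pred (ff X) := fun a => (a == 0) || (n%:Z <= vord x a).
Definition in_ring x : pred (ff X) := in_pow x 0.

Definition zopen (U : set (place X)) : Prop := U = set0 \/ finite_set (~` U).

Lemma in_pow0 x n : in_pow x n 0. Proof. by rewrite /in_pow eqxx. Qed.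

Lemma vord1 x : vord x 1 = 0.
Proof. by rewrite -(rmorph1 (kcst X)) vord_cst. Qed.

Lemma vordN x a : vord x (- a) = vord x a.
Proof.
have [->|a0] := eqVneq a 0; first by rewrite oppr0.
rewrite -mulN1r vordM ?oppr_eq0 ?oner_eq0 //.
by rewrite -(rmorphN1 (kcst X)) vord_cst add0r.
Qed.

Lemma in_powD x n a b : in_pow x n a -> in_pow x n b -> in_pow x n (a + b).
Proof.
rewrite /in_pow; have [->|a0] := eqVneq a 0; first by rewrite add0r.
have [->|b0] := eqVneq b 0; first by rewrite addr0 (negbTE a0).
have [//|ab0 /= ha hb] := eqVneq (a + b) 0.
by apply: le_trans (vordD x a0 b0 ab0); rewrite le_min ha hb.
Qed.

Lemma in_powN x n a : in_pow x n (- a) = in_pow x n a.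
Proof. by rewrite /in_pow oppr_eq0 vordN. Qed.

Lemma in_powM x m n a b : in_pow x m a -> in_pow x n b -> in_pow x (m + n) (a * b).
Proof.
rewrite /in_pow; have [->|a0] := eqVneq a 0; first by rewrite mul0r eqxx.
have [->|b0] := eqVneq b 0; first by rewrite mulr0 eqxx.
by rewrite /= => ha hb; rewrite vordM // mulf_eq0 (negbTE a0) (negbTE b0) PoszD lerD.
Qed.

Lemma in_ringM x n a b : in_ring x a -> in_pow x n b -> in_pow x n (a * b).
Proof. exact: (@in_powM x 0 n). Qed.

Lemma in_ring1 x : in_ring x 1.
Proof. by rewrite /in_ring /in_pow vord1 orbT. Qed.

Lemma in_pow_cst x c : in_ring x (kcst X c).
Proof. by rewrite /in_ring /in_pow vord_cst orbT. Qed.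

Lemma zopenI U V : zopen U -> zopen V -> zopen (U `&` V).
Proof.
case=> [->|fU]; first by left; rewrite set0I.
case=> [->|fV]; first by left; rewrite setI0.
by right; rewrite setCI finite_setU.
Qed.

Lemma zopenT : zopen setT.
Proof. by right; rewrite setCT. Qed.

End Places.

(* Nonconstant morphisms of curves. They need not be morphisms over k: the   *)
(* absolute Frobenius is one. The field cm_loc says that the pull-back of    *)
(* functions is local on the local rings.                                    *)
Record curve_mor (k : closedFieldType) (Y X : curve k) := CurveMor {
  cm_fun : {rmorphism ff X -> ff Y};
  cm_pt : place Y -> place X;
  cm_loc : forall y a, in_ring (cm_pt y) a = in_ring y (cm_fun a);
  cm_cont : forall U, zopen U -> zopen (cm_pt @^-1` U) }.

Definition k_linear (k : closedFieldType) (Y X : curve k) (f : curve_mor Y X) : Prop :=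
  forall c, cm_fun f (kcst X c) = kcst Y c.

Definition covering (k : closedFieldType) (Y X : curve k) (f : curve_mor Y X) : Prop :=
  [/\ k_linear f,
      exists (n : nat) (b : 'I_n -> ff Y), forall a,
        exists c : 'I_n -> ff X, a = \sum_j cm_fun f (c j) * b j
    & forall a, exists q : {poly ff X},
        separable_poly q /\ root (map_poly (cm_fun f) q) a].

Lemma cm_pow k (Y X : curve k) (f : curve_mor Y X) y n a :
  in_pow (cm_pt f y) n a -> in_pow y n (cm_fun f a).
Proof.
have [->|a0] := eqVneq a 0; first by rewrite rmorph0 !in_pow0.
have [t xt] := vord_surj (cm_pt f y).
have t0 : t != 0 by apply/eqP => t0; move/eqP: xt; rewrite t0 vord0 eq_sym oner_eq0.
have ti : vord (cm_pt f y) t^-1 = -1.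
  apply: (addrI (vord (cm_pt f y) t)).
  by rewrite -vordM ?invr_eq0 // divff // vord1 xt subrr.
have ft : in_pow y 1 (cm_fun f t).
  have ft0 : cm_fun f t != 0 by rewrite fmorph_eq0.
  have : ~~ in_ring y (cm_fun f t^-1).
    by rewrite -cm_loc /in_ring /in_pow invr_eq0 (negbTE t0) ti.
  have : vord y (cm_fun f t) + vord y (cm_fun f t)^-1 = 0.
    by rewrite -vordM ?invr_eq0 // divff // vord1.
  rewrite fmorphV /in_ring /in_pow invr_eq0 (negbTE ft0) /= -ltNge.
  by move/eqP; rewrite addr_eq0 => /eqP->; rewrite -oppr_gt0 gtz0_ge1.
elim: n => [|n IHn] in a a0 *; first by rewrite -[in_pow y 0 _]/(in_ring y _) -cm_loc.
move=> ha; have at0 : a / t != 0 by rewrite mulf_neq0 ?invr_eq0.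
rewrite -[a](divfK t0) rmorphM -addn1; apply: in_powM => //.
apply: IHn => //; move: ha; rewrite /in_pow (negbTE a0) (negbTE at0) /=.
by rewrite vordM ?invr_eq0 // ti intS addrC lerBrDr.
Qed.

(* The completed local ring (Cauchy sequences of the local ring modulo null  *)
(* sequences) and its fraction field.                                        *)
Section Completion.
Variables (k : closedFieldType) (X : curve k) (x : place X).

Definition adic_cauchy (u : nat -> ff X) : Prop :=
  (forall i, in_ring x (u i)) /\
  forall n, exists N, forall i j, (N <= i)%N -> (N <= j)%N -> in_pow x n (u i - u j).

Definition adic_null (u : nat -> ff X) : Prop :=
  forall n, exists N, forall i, (N <= i)%N -> in_pow x n (u i).

Definition cauchyb : {pred nat -> ff X} := fun u => `[< adic_cauchy u >].

Fact cauchyb_closed : subring_closed cauchyb.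
Proof.
split.
- apply/asboolP; split=> [i|n]; first exact: in_ring1.
  by exists 0%N => i j _ _; rewrite subrr in_pow0.
- move=> u v /asboolP[ru cu] /asboolP[rv cv]; apply/asboolP; split=> [i|n].
    by apply: in_powD; [exact: ru|rewrite in_powN; exact: rv].
  have [N1 h1] := cu n; have [N2 h2] := cv n; exists (maxn N1 N2) => i j.
  rewrite !geq_max => /andP[i1 i2] /andP[j1 j2].
  have -> : (u - v) i - (u - v) j = (u i - u j) - (v i - v j).
    by rewrite !fctE; ring.
  by apply: in_powD; [exact: h1|rewrite in_powN; exact: h2].
- move=> u v /asboolP[ru cu] /asboolP[rv cv]; apply/asboolP; split=> [i|n].
    exact: in_ringM (ru i) (rv i).
  have [N1 h1] := cu n; have [N2 h2] := cv n; exists (maxn N1 N2) => i j.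
  rewrite !geq_max => /andP[i1 i2] /andP[j1 j2].
  have -> : (u * v) i - (u * v) j = u i * (v i - v j) + v j * (u i - u j).
    by rewrite !fctE; ring.
  by apply: in_powD; apply: in_ringM; [exact: ru|exact: h2|exact: rv|exact: h1].
Qed.
HB.instance Definition _ := GRing.isSubringClosed.Build (nat -> ff X) cauchyb cauchyb_closed.

Record cseq := CSeq { cseq_val :> nat -> ff X; cseqP : cseq_val \in cauchyb }.
HB.instance Definition _ := [isSub for cseq_val].
HB.instance Definition _ := [Choice of cseq by <:].
HB.instance Definition _ := [SubChoice_isSubComNzRing of cseq by <:].

Definition nullb : {pred cseq} := fun u => `[< adic_null u >].

Fact nullb_closed : idealr_closed nullb.
Proof.
split.
- by apply/asboolP => n; exists 0%N => i _; exact: in_pow0.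
- apply/negP => /asboolP /(_ 1%N)[N /(_ N (leqnn N))].
  by rewrite /in_pow /= oner_eq0 vord1.
- move=> a u v /asboolP hu /asboolP hv; apply/asboolP => n.
  have [N1 h1] := hu n; have [N2 h2] := hv n; exists (maxn N1 N2) => i.
  rewrite geq_max => /andP[i1 i2]; apply: in_powD; last exact: h2.
  apply: in_ringM; last exact: h1.
  by have /asboolP[+ _] := cseqP a; exact.
Qed.
HB.instance Definition _ := isIdealr.Build cseq nullb nullb_closed.

Lemma null_away (u : cseq) : u \notin nullb ->
  exists n N, forall i, (N <= i)%N -> ~~ in_pow x n (u i).
Proof.
move=> /asboolP/existsNP[n hn]; exists n.
have /asboolP[_ /(_ n)[N hN]] := cseqP u; exists N => i Ni.
apply/negP => ui; apply: hn; exists N => j Nj.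
by rewrite -[u j](subrK (u i)); apply: in_powD => //; exact: hN.
Qed.

Fact nullb_prime : prime_idealr_closed nullb.
Proof.
move=> u v uv; apply/negPn/negP; rewrite negb_or => /andP[].
move=> /null_away[m [M hM]] /null_away[n [N hN]].
move/asboolP: uv => /(_ (m + n)%N)[P /(_ (maxn P (maxn M N)))].
rewrite leq_maxl => /(_ isT); set i := maxn _ _.
have /hM : (M <= i)%N by rewrite /i !leq_max leqnn orbT.
have /hN : (N <= i)%N by rewrite /i !leq_max leqnn !orbT.
rewrite /in_pow /= fctE mulf_eq0 !negb_or -!ltNge => /andP[v0 vn] /andP[u0 um].
by rewrite (negbTE u0) (negbTE v0) /= vordM // PoszD leNgt ltrD.
Qed.
HB.instance Definition _ := isPrimeIdealrClosed.Build cseq nullb nullb_prime.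

Definition compl_ring : Type := {ideal_quot nullb}.
HB.instance Definition _ := GRing.ComNzRing.on compl_ring.

Let cunit : pred compl_ring := fun a => `[< exists b, b * a = 1 >].
Let cinv (a : compl_ring) : compl_ring :=
  if pselect (exists b, b * a = 1) is left h then projT1 (cid h) else a.
Fact compl_mulVr : {in cunit, left_inverse 1 cinv *%R}.
Proof.
move=> a /asboolP ha; rewrite /cinv; case: pselect => [h|]; last by [].
exact: projT2 (cid h).
Qed.
Fact compl_unitP a b : b * a = 1 -> cunit a.
Proof. by move=> h; apply/asboolP; exists b. Qed.
Fact compl_invr_out : {in [predC cunit], cinv =1 id}.
Proof.
move=> a /asboolP ha; rewrite /cinv; case: pselect => [h|]; last by [].
by case: ha.
Qed.
HB.instance Definition _ :=
  GRing.ComNzRing_hasMulInverse.Build compl_ring compl_mulVr compl_unitP compl_invr_out.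
Fact compl_idom : GRing.integral_domain_axiom compl_ring.
Proof. exact: (@Quotient.rquot_IdomainAxiom cseq nullb). Qed.
HB.instance Definition _ := GRing.ComUnitRing_isIntegral.Build compl_ring compl_idom.

Definition compl_field : fieldType := {fraction compl_ring}.

End Completion.

Section CompletionMap.
Variables (k : closedFieldType) (Y X : curve k) (f : curve_mor Y X) (y : place Y).

Fact cauchy_map (u : cseq (cm_pt f y)) : cm_fun f \o u \in cauchyb y.
Proof.
have /asboolP[ru cu] := cseqP u; apply/asboolP; split=> [i|n].
  exact/cm_pow/ru.
have [N hN] := cu n; exists N => i j Ni Nj.
by rewrite /= -rmorphB; apply/cm_pow/hN.
Qed.

(* The homomorphism of completed local rings induced by f at y. *)
Definition compl_map (a : compl_ring (cm_pt f y)) : compl_ring y :=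
  \pi_(compl_ring y) (CSeq (cauchy_map (repr a))).

End CompletionMap.

Record branch_data (k : closedFieldType) (X : curve k) := BranchData {
  br :> forall x : place X, splittingFieldType (compl_field x);
  br_galois : forall x, galois 1 {:br x};
  br_fin : finite_set [set x | \dim {:br x} != 1%N] }.

Section TrivialBranch.
Variables (k : closedFieldType) (X : curve k).

Let O (x : place X) : splittingFieldType (compl_field x) := (compl_field x)^o.
Fact trivial_galois x : galois 1 {:O x}.
Proof. by rewrite /galois regular_fullv subvv separable_refl -regular_fullv normalFieldf. Qed.
Fact trivial_fin : finite_set [set x | \dim {:O x} != 1%N].
Proof. 
rewrite (_ : [set x | _] = set0) //; apply/seteqP; split=> x //=.
by rewrite regular_fullv dimv1 eqxx.
Qed.
Definition trivial_branch : branch_data X := BranchData trivial_galois trivial_fin.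
End TrivialBranch.

Section OrbifoldMorphisms.
Variables (k : closedFieldType) (Y X : curve k) (f : curve_mor Y X).
Variables (Q : branch_data Y) (P : branch_data X).

(* psi is a homomorphism of extensions of the completed function field of X  *)
(* at f(y), the extension Q(y) being viewed as such through compl_map.       *)
Definition ext_hom (y : place Y) (psi : {rmorphism P (cm_pt f y) -> Q y}) : Prop :=
  forall a : compl_ring (cm_pt f y),
    psi ((tofrac a)%:A) = (tofrac (compl_map a))%:A.

Definition orb_morphism : Prop :=
  covering f /\ forall y, exists psi : {rmorphism P (cm_pt f y) -> Q y}, ext_hom psi.

Definition orb_etale : Prop :=
  covering f /\ forall y, exists psi : {rmorphism P (cm_pt f y) -> Q y},
    ext_hom psi /\ bijective psi.
End OrbifoldMorphisms.

Definition geometric (k : closedFieldType) (X : curve k) (P : branch_data X) : Prop :=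
  exists (Y : curve k) (f : curve_mor Y X), orb_etale f (trivial_branch Y) P.

(* The pull-back of functions makes composition in gT correspond to the      *)
(* composition of automorphisms of Y: (gh)^# = h^# o g^#.                    *)
Record curve_action (k : closedFieldType) (gT : finGroupType) (Y : curve k) := CurveAction {
  ca :> gT -> curve_mor Y Y;
  ca_lin : forall g, k_linear (ca g);
  ca1 : forall a, cm_fun (ca 1%g) a = a;
  caM : forall g h a, cm_fun (ca (g * h)%g) a = cm_fun (ca h) (cm_fun (ca g) a) }.

Record galois_cover (k : closedFieldType) (gT : finGroupType) (Y X : curve k) := GaloisCover {
  gc_mor :> curve_mor Y X;
  gc_cov : covering gc_mor;
  gc_act : curve_action gT Y;
  gc_over : forall g b, cm_fun (gc_act g) (cm_fun gc_mor b) = cm_fun gc_mor b;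
  gc_faithful : forall g, (forall a, cm_fun (gc_act g) a = a) -> g = 1%g;
  gc_quotient : forall a, (forall g, cm_fun (gc_act g) a = a) -> exists b, a = cm_fun gc_mor b }.

(* Linear algebra over a field L with bases indexed by finite types: M i is  *)
(* the image of the i-th basis vector under the linear map app M.            *)
Notation vec L I := {ffun I -> L^o}.
Notation mat L I J := {ffun I -> {ffun J -> L^o}}.

Section LinAlg.
Variable L : fieldType.
Implicit Types I J K : finType.

Definition app I J (M : mat L I J) (v : vec L I) : vec L J := \sum_i v i *: M i.
Definition bvec I (i : I) : vec L I := [ffun j => (i == j)%:R].
Definition mat1 I : mat L I I := [ffun i => bvec i].
Definition compm I J K (N : mat L J K) (M : mat L I J) : mat L I K :=
  [ffun i => app N (M i)].
Definition trm I J (M : mat L I J) : mat L J I := [ffun j => [ffun i => M i j]].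
Definition minv I J (M : mat L I J) (N : mat L J I) : Prop :=
  compm N M = mat1 I /\ compm M N = mat1 J.
Definition dotp I (xi v : vec L I) : L := \sum_i xi i * v i.
Definition vtens I J (v : vec L I) (w : vec L J) : vec L (I * J)%type :=
  [ffun p => v p.1 * w p.2].
Definition mtens I1 I2 J1 J2 (M : mat L I1 J1) (N : mat L I2 J2) :
    mat L (I1 * I2)%type (J1 * J2)%type :=
  [ffun p => vtens (M p.1) (N p.2)].
(* The map v |-> v \o h. *)
Definition pullm I J (h : J -> I) : mat L I J := [ffun i => [ffun j => (i == h j)%:R]].

Lemma appE I J (M : mat L I J) v j : app M v j = \sum_i v i * M i j.
Proof. by rewrite /app sum_ffunE; apply: eq_bigr => i _; rewrite ffunE. Qed.

Lemma appD I J (M : mat L I J) u v : app M (u + v) = app M u + app M v.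
Proof. by rewrite /app -big_split; apply: eq_bigr => i _; rewrite ffunE scalerDl. Qed.
Lemma appZ I J (M : mat L I J) (a : L) v : app M (a *: v) = a *: app M v.
Proof. by rewrite /app scaler_sumr; apply: eq_bigr => i _; rewrite ffunE scalerA. Qed.
Lemma app0 I J (M : mat L I J) : app M 0 = 0.
Proof. by rewrite -(scale0r 0) appZ scale0r. Qed.
Lemma app_sum I J K (M : mat L I J) (F : K -> vec L I) :
  app M (\sum_k F k) = \sum_k app M (F k).
Proof. by elim/big_rec2: _ => [|k u v _ <-]; rewrite ?app0 ?appD. Qed.
Lemma appDm I J (M N : mat L I J) v : app (M + N) v = app M v + app N v.
Proof. by rewrite /app -big_split; apply: eq_bigr => i _; rewrite ffunE scalerDr. Qed.
Lemma appNm I J (M : mat L I J) v : app (- M) v = - app M v.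
Proof. by rewrite /app -sumrN; apply: eq_bigr => i _; rewrite ffunE scalerN. Qed.
Lemma app0m I J v : app (0 : mat L I J) v = 0.
Proof. by rewrite /app big1 // => i _; rewrite ffunE scaler0. Qed.

Lemma app_bvec I J (M : mat L I J) i : app M (bvec i) = M i.
Proof.
rewrite /app (bigD1 i) //= ffunE eqxx scale1r big1 ?addr0 // => j ji.
by rewrite ffunE eq_sym (negbTE ji) scale0r.
Qed.

Lemma matP I J (M N : mat L I J) : (forall v, app M v = app N v) -> M = N.
Proof. by move=> h; apply/ffunP => i; rewrite -!app_bvec h. Qed.

Lemma app_comp I J K (N : mat L J K) (M : mat L I J) v :
  app (compm N M) v = app N (app M v).
Proof. by rewrite [app M v]/app app_sum; apply: eq_bigr => i _; rewrite appZ ffunE. Qed.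

Lemma app_id I (v : vec L I) : app (mat1 I) v = v.
Proof.
apply/ffunP => j; rewrite appE (bigD1 j) //= !ffunE eqxx mulr1 big1 ?addr0 // => i ij.
by rewrite !ffunE (negbTE ij) mulr0.
Qed.

Lemma minv_l I J (M : mat L I J) N v : minv M N -> app N (app M v) = v.
Proof. by case=> h _; rewrite -app_comp h app_id. Qed.
Lemma minv_r I J (M : mat L I J) N v : minv M N -> app M (app N v) = v.
Proof. by case=> _ h; rewrite -app_comp h app_id. Qed.
Lemma minvP I J (M : mat L I J) (N : mat L J I) :
  (forall v, app N (app M v) = v) -> (forall v, app M (app N v) = v) -> minv M N.
Proof. by move=> h1 h2; split; apply: matP => v; rewrite app_comp app_id. Qed.
Lemma minv_uniq I J (M : mat L I J) N N' : minv M N -> minv M N' -> N = N'.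
Proof.
by move=> h h'; apply: matP => v; rewrite -{2}(minv_r v h) (minv_l _ h').
Qed.

Lemma app_pull I J (h : J -> I) v : app (pullm h) v = [ffun j => v (h j)].
Proof.
apply/ffunP => j; rewrite appE ffunE (bigD1 (h j)) //= !ffunE eqxx mulr1.
by rewrite big1 ?addr0 // => i ij; rewrite !ffunE (negbTE ij) mulr0.
Qed.

Lemma app_trm I J (M : mat L I J) xi v : dotp (app (trm M) xi) v = dotp xi (app M v).
Proof.
rewrite /dotp; under eq_bigr do rewrite appE mulr_suml.
rewrite exchange_big; apply: eq_bigr => j _.
rewrite appE mulr_sumr; apply: eq_bigr => i _; rewrite !ffunE; ring.
Qed.

Lemma dotp_bvec I (xi : vec L I) i : dotp xi (bvec i) = xi i.
Proof.
rewrite /dotp (bigD1 i) //= ffunE eqxx mulr1 big1 ?addr0 // => j ji.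
by rewrite ffunE eq_sym (negbTE ji) mulr0.
Qed.
Lemma dotpP I (xi eta : vec L I) : (forall v, dotp xi v = dotp eta v) -> xi = eta.
Proof. by move=> h; apply/ffunP => i; rewrite -!dotp_bvec h. Qed.
Lemma dotpDr I (xi u v : vec L I) : dotp xi (u + v) = dotp xi u + dotp xi v.
Proof. by rewrite /dotp -big_split; apply: eq_bigr => i _; rewrite ffunE mulrDr. Qed.
Lemma dotpZr I (xi : vec L I) a v : dotp xi (a *: v) = a * dotp xi v.
Proof. by rewrite /dotp mulr_sumr; apply: eq_bigr => i _; rewrite ffunE [_ *: _]mulrC mulrA mulrC. Qed.
Lemma dotp0r I (xi : vec L I) : dotp xi 0 = 0.
Proof. by rewrite /dotp big1 // => i _; rewrite ffunE mulr0. Qed.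

Lemma trm_minv I J (M : mat L I J) N : minv M N -> minv (trm M) (trm N).
Proof.
move=> h; apply: minvP => xi; apply: dotpP => v; rewrite !app_trm.
  by rewrite (minv_r _ h).
by rewrite (minv_l _ h).
Qed.

Lemma app_tens I1 I2 J1 J2 (M : mat L I1 J1) (N : mat L I2 J2) v w :
  app (mtens M N) (vtens v w) = vtens (app M v) (app N w).
Proof.
apply/ffunP => -[j1 j2]; rewrite appE ffunE /= !appE mulr_suml.
under [RHS]eq_bigr do rewrite mulr_sumr.
rewrite pair_big /=; apply: eq_bigr => -[i1 i2] _.
by rewrite !ffunE /= mulrACA.
Qed.

Lemma bvec_tens I J (p : I * J) : bvec p = vtens (bvec p.1) (bvec p.2).
Proof.
case: p => i j; apply/ffunP => -[i' j']; rewrite !ffunE /= xpair_eqE.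
by rewrite -mulnb natrM.
Qed.

Lemma vtensDl I J (u v : vec L I) (w : vec L J) : vtens (u + v) w = vtens u w + vtens v w.
Proof. by apply/ffunP => p; rewrite !ffunE mulrDl. Qed.
Lemma vtensDr I J (u : vec L I) (v w : vec L J) : vtens u (v + w) = vtens u v + vtens u w.
Proof. by apply/ffunP => p; rewrite !ffunE mulrDr. Qed.
Lemma vtensZl I J a (v : vec L I) (w : vec L J) : vtens (a *: v) w = a *: vtens v w.
Proof. by apply/ffunP => p; rewrite !ffunE /GRing.scale /= mulrA. Qed.
Lemma vtensZr I J a (v : vec L I) (w : vec L J) : vtens v (a *: w) = a *: vtens v w.
Proof. by apply/ffunP => p; rewrite !ffunE /GRing.scale /= mulrCA. Qed.
Lemma vtens0l I J (w : vec L J) : vtens (0 : vec L I) w = 0.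
Proof. by apply/ffunP => p; rewrite !ffunE mul0r. Qed.
Lemma vtens0r I J (v : vec L I) : vtens v (0 : vec L J) = 0.
Proof. by apply/ffunP => p; rewrite !ffunE mulr0. Qed.
Lemma appZm I J a (M : mat L I J) v : app (a *: M) v = a *: app M v.
Proof.
rewrite /app scaler_sumr; apply: eq_bigr => i _.
by rewrite ffunE !scalerA mulrC.
Qed.

Lemma mat_tensP I J K (M N : mat L (I * J)%type K) :
  (forall v w, app M (vtens v w) = app N (vtens v w)) -> M = N.
Proof. by move=> h; apply/ffunP => p; rewrite -!app_bvec bvec_tens h. Qed.

Lemma mat_tens3P I J K (H : finType) (M N : mat L (I * J * K)%type H) :
  (forall u v w, app M (vtens (vtens u v) w) = app N (vtens (vtens u v) w)) -> M = N.
Proof.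
move=> h; apply/ffunP => -[p l].
by rewrite -!app_bvec (bvec_tens (p, l)) /= (bvec_tens p) h.
Qed.

Lemma mtens_comp I1 I2 J1 J2 K1 K2 (N1 : mat L J1 K1) (M1 : mat L I1 J1)
    (N2 : mat L J2 K2) (M2 : mat L I2 J2) :
  compm (mtens N1 N2) (mtens M1 M2) = mtens (compm N1 M1) (compm N2 M2).
Proof. by apply: mat_tensP => v w; rewrite app_comp !app_tens !app_comp. Qed.

Lemma mtens_id I J : mtens (mat1 I) (mat1 J) = mat1 (I * J)%type.
Proof. by apply: mat_tensP => v w; rewrite app_tens !app_id. Qed.

Lemma mtens_minv I1 I2 J1 J2 (M : mat L I1 J1) (N : mat L I2 J2) M' N' :
  minv M M' -> minv N N' -> minv (mtens M N) (mtens M' N').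
Proof. by case=> h1 h2 [h3 h4]; split; rewrite mtens_comp ?h1 ?h2 ?h3 ?h4 mtens_id. Qed.

Lemma compmA I J K (H : finType) (P : mat L K H) (N : mat L J K) (M : mat L I J) :
  compm P (compm N M) = compm (compm P N) M.
Proof. by apply: matP => v; rewrite !app_comp. Qed.
Lemma compm1 I J (M : mat L I J) : compm M (mat1 I) = M.
Proof. by apply: matP => v; rewrite app_comp app_id. Qed.
Lemma comp1m I J (M : mat L I J) : compm (mat1 J) M = M.
Proof. by apply: matP => v; rewrite app_comp app_id. Qed.

Definition msum I1 I2 J1 J2 (M : mat L I1 J1) (N : mat L I2 J2) :
    mat L (I1 + I2)%type (J1 + J2)%type :=
  [ffun p => [ffun q => match p, q with
     | inl i, inl j => M i j | inr i, inr j => N i j | _, _ => 0 end]].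
Definition lpart I J (v : vec L (I + J)%type) : vec L I := [ffun i => v (inl i)].
Definition rpart I J (v : vec L (I + J)%type) : vec L J := [ffun j => v (inr j)].

Lemma lpart_msum I1 I2 J1 J2 (M : mat L I1 J1) (N : mat L I2 J2) v :
  lpart (app (msum M N) v) = app M (lpart v).
Proof.
apply/ffunP => j; rewrite ffunE !appE big_sumType /= [X in _ + X]big1 ?addr0.
  by apply: eq_bigr => i _; rewrite !ffunE.
by move=> i _; rewrite !ffunE mulr0.
Qed.
Lemma rpart_msum I1 I2 J1 J2 (M : mat L I1 J1) (N : mat L I2 J2) v :
  rpart (app (msum M N) v) = app N (rpart v).
Proof.
apply/ffunP => j; rewrite ffunE !appE big_sumType /= big1 ?add0r.
  by apply: eq_bigr => i _; rewrite !ffunE.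
by move=> i _; rewrite !ffunE mulr0.
Qed.
Lemma partP I J (v w : vec L (I + J)%type) :
  lpart v = lpart w -> rpart v = rpart w -> v = w.
Proof.
move=> /ffunP h1 /ffunP h2; apply/ffunP => -[i|j].
  by have := h1 i; rewrite !ffunE.
by have := h2 j; rewrite !ffunE.
Qed.
Lemma msum_minv I1 I2 J1 J2 (M : mat L I1 J1) (N : mat L I2 J2) M' N' :
  minv M M' -> minv N N' -> minv (msum M N) (msum M' N').
Proof.
move=> h1 h2; apply: minvP => v; apply: partP; rewrite !(lpart_msum, rpart_msum).
- exact: minv_l h1.
- exact: minv_l h2.
- exact: minv_r h1.
- exact: minv_r h2.
Qed.

End LinAlg.
Arguments mat1 {L} I.

Section MapMat.
Variables (L L' : fieldType) (s : {rmorphism L -> L'}).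
Implicit Types I J K : finType.

Definition map_vec I (v : vec L I) : vec L' I := [ffun i => s (v i)].
Definition map_mat I J (M : mat L I J) : mat L' I J := [ffun i => map_vec (M i)].

Lemma map_vecD I (u v : vec L I) : map_vec (u + v) = map_vec u + map_vec v.
Proof. by apply/ffunP => i; rewrite !ffunE rmorphD. Qed.
Lemma map_vecZ I a (v : vec L I) : map_vec (a *: v) = s a *: map_vec v.
Proof. by apply/ffunP => i; rewrite !ffunE; exact: rmorphM. Qed.
Lemma map_vec0 I : map_vec (0 : vec L I) = 0.
Proof. by apply/ffunP => i; rewrite !ffunE rmorph0. Qed.
Lemma map_app I J (M : mat L I J) v : map_vec (app M v) = app (map_mat M) (map_vec v).
Proof.
apply/ffunP => j; rewrite ffunE !appE rmorph_sum; apply: eq_bigr => i _.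
by rewrite !ffunE rmorphM.
Qed.
Lemma map_bvec I (i : I) : map_vec (bvec L i) = bvec L' i.
Proof. by apply/ffunP => j; rewrite !ffunE rmorph_nat. Qed.
Lemma map_matP I J (M N : mat L' I J) :
  (forall v : vec L I, app M (map_vec v) = app N (map_vec v)) -> M = N.
Proof. by move=> h; apply/ffunP => i; rewrite -!app_bvec -map_bvec h. Qed.
Lemma map_compm I J K (N : mat L J K) (M : mat L I J) :
  map_mat (compm N M) = compm (map_mat N) (map_mat M).
Proof. by apply: map_matP => v; rewrite app_comp -!map_app app_comp. Qed.
Lemma map_mat1 I : map_mat (mat1 I) = mat1 I.
Proof. by apply: map_matP => v; rewrite -map_app !app_id. Qed.
Lemma map_minv I J (M : mat L I J) N : minv M N -> minv (map_mat M) (map_mat N).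
Proof. by case=> h1 h2; split; rewrite -map_compm ?h1 ?h2 map_mat1. Qed.
Lemma map_vtens I J (v : vec L I) (w : vec L J) :
  map_vec (vtens v w) = vtens (map_vec v) (map_vec w).
Proof. by apply/ffunP => p; rewrite !ffunE rmorphM. Qed.
Lemma map_mtens I1 I2 J1 J2 (M : mat L I1 J1) (N : mat L I2 J2) :
  map_mat (mtens M N) = mtens (map_mat M) (map_mat N).
Proof. by apply/ffunP => p; rewrite !ffunE map_vtens. Qed.
Lemma map_trm I J (M : mat L I J) : map_mat (trm M) = trm (map_mat M).
Proof. by apply/ffunP => i; apply/ffunP => j; rewrite !ffunE. Qed.
Lemma map_pullm I J (h : J -> I) : map_mat (pullm L h) = pullm L' h.
Proof. by apply/ffunP => i; apply/ffunP => j; rewrite !ffunE rmorph_nat. Qed.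
Lemma map_dotp I (xi v : vec L I) : s (dotp xi v) = dotp (map_vec xi) (map_vec v).
Proof.
by rewrite /dotp rmorph_sum; apply: eq_bigr => i _; rewrite !ffunE rmorphM.
Qed.

End MapMat.

(* Vector bundles. The stalk at the generic point is coordinatized as L^I,   *)
(* L the function field and I a finite set; a bundle is then the family of   *)
(* its stalks inside L^I, locally free for the Zariski topology. A morphism  *)
(* is an L-linear map carrying stalks into stalks.                           *)
Section Bundles.
Variables (k : closedFieldType) (Y : curve k).
Local Notation L := (ff Y).
Implicit Types (y : place Y) (I J : finType).

(* O_y-submodule generated by G. *)
Inductive ospan y I (G : set (vec L I)) : set (vec L I) :=
| ospan_nil : ospan y G 0
| ospan_cons c w v : in_ring y c -> G w -> ospan y G v -> ospan y G (c *: w + v).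

(* The vectors e i are an O_y-basis of S and an L-basis of L^I. *)
Definition frames y I (e : mat L I I) (S : set (vec L I)) : Prop :=
  (exists e', minv e e') /\
  forall c : vec L I, S (app e c) <-> forall i, in_ring y (c i).

Record bundle := Bundle {
  idx : finType;
  stalk : place Y -> set (vec L idx);
  loc_free : forall y, exists U : set (place Y), [/\ zopen U, U y &
    exists e : mat L idx idx, forall z, U z -> frames z e (stalk z)] }.

Arguments stalk : clear implicits.

Definition rank (V : bundle) : nat := #|idx V|.

Definition is_hom (V W : bundle) (M : mat L (idx V) (idx W)) : Prop :=
  forall y v, stalk V y v -> stalk W y (app M v).

Definition is_iso (V W : bundle) (M : mat L (idx V) (idx W)) (N : mat L (idx W) (idx V)) : Prop :=
  [/\ is_hom M, is_hom N & minv M N].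

Definition isomorphic (V W : bundle) : Prop := exists M N, @is_iso V W M N.

Lemma in_ring_sum y I (F : I -> L) :
  (forall i, in_ring y (F i)) -> in_ring y (\sum_i F i).
Proof.
move=> h; elim/big_rec: _ => [|i a _ ha]; first exact: in_pow0.
exact: in_powD (h i) ha.
Qed.

Lemma frames_ex (V : bundle) y : exists e, frames y e (stalk V y).
Proof. by have [U [_ Uy [e he]]] := loc_free V y; exists e; exact: he. Qed.

Lemma framesP y I (e e' : mat L I I) S v : frames y e S -> minv e e' ->
  S v <-> forall i, in_ring y (app e' v i).
Proof. by move=> [_ h] ee'; rewrite -{1}(minv_r v ee') h. Qed.

Lemma frames_lin y I (e : mat L I I) S c v w : frames y e S ->
  in_ring y c -> S v -> S w -> S (c *: v + w).
Proof.
move=> fe hc; have [[e' ee'] _] := fe.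
rewrite !(framesP _ fe ee') => hv hw i; rewrite appD appZ ffunE.
apply: in_powD; last exact: hw.
by rewrite ffunE; exact: in_ringM (hv i).
Qed.

Lemma stalk_lin (V : bundle) y c v w :
  in_ring y c -> stalk V y v -> stalk V y w -> stalk V y (c *: v + w).
Proof. have [e fe] := frames_ex V y; exact: frames_lin fe. Qed.

Lemma stalk_nil (V : bundle) y : stalk V y 0.
Proof.
have [e [_ fe]] := frames_ex V y; rewrite -(app0 e); apply/fe => i.
by rewrite ffunE; exact: in_pow0.
Qed.

Lemma stalk_span (V : bundle) y G :
  (forall w, G w -> stalk V y w) -> ospan y G `<=` stalk V y.
Proof.
move=> h v; elim=> [|c w u hc /h hw _ hu]; first exact: stalk_nil.
exact: stalk_lin.
Qed.

Lemma ospan_gen y I (G : set (vec L I)) w : G w -> ospan y G w.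
Proof.
move=> Gw; rewrite -[w]addr0 -[w in w + _]scale1r.
by apply: ospan_cons => //; [exact: in_ring1|exact: ospan_nil].
Qed.

Lemma ospan_add y I (G : set (vec L I)) v w : ospan y G v -> ospan y G w -> ospan y G (v + w).
Proof.
elim=> [|c u v' hc Gu _ IH] hw; first by rewrite add0r.
by rewrite -addrA; apply: ospan_cons => //; exact: IH.
Qed.

Lemma ospan_scale y I (G : set (vec L I)) c v : in_ring y c -> ospan y G v -> ospan y G (c *: v).
Proof.
move=> hc; elim=> [|d u v' hd Gu _ IH]; first by rewrite scaler0; exact: ospan_nil.
by rewrite scalerDr scalerA; apply: ospan_cons => //; exact: in_ringM.
Qed.

Lemma ospan_sum y I J (G : set (vec L I)) (F : J -> vec L I) :
  (forall j, ospan y G (F j)) -> ospan y G (\sum_j F j).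
Proof.
move=> h; elim/big_rec: _ => [|j v _ hv]; first exact: ospan_nil.
exact: ospan_add.
Qed.

Lemma ospan_map y I J (G : set (vec L I)) (G' : set (vec L J)) (M : mat L I J) v :
  (forall w, G w -> ospan y G' (app M w)) -> ospan y G v -> ospan y G' (app M v).
Proof.
move=> h; elim=> [|c w u hc /h hw _ hu]; first by rewrite app0; exact: ospan_nil.
by rewrite appD appZ; apply: ospan_add => //; exact: ospan_scale.
Qed.

Lemma ospan_stalk_map y I (G : set (vec L I)) (W : bundle) (M : mat L I (idx W)) v :
  (forall w, G w -> stalk W y (app M w)) -> ospan y G v -> stalk W y (app M v).
Proof.
move=> h; elim=> [|c w u hc /h hw _ hu]; first by rewrite app0; exact: stalk_nil.
by rewrite appD appZ; exact: stalk_lin.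
Qed.

Lemma ospan_frames y I (G : set (vec L I)) (e e' : mat L I I) : minv e e' ->
  (forall i, G (e i)) -> (forall w, G w -> forall i, in_ring y (app e' w i)) ->
  frames y e (ospan y G).
Proof.
move=> ee' h1 h2; split; first by exists e'.
move=> c; split=> [hc i|hc].
  rewrite -(minv_l c ee'); move: {c} (app e c) hc => v.
  elim=> [|d w u hd /h2 hw _ hu]; first by rewrite app0 ffunE; exact: in_pow0.
  rewrite appD appZ ffunE; apply: in_powD => //.
  by rewrite ffunE; exact: in_ringM (hw i).
apply: ospan_sum => i; apply: ospan_scale => //; exact/ospan_gen/h1.
Qed.

Lemma frames_mem y I (e : mat L I I) S i : frames y e S -> S (e i).
Proof.
case=> _ fe; rewrite -app_bvec; apply/fe => j; rewrite ffunE.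
by case: eqP => _; [exact: in_ring1|exact: in_pow0].
Qed.

(* Degree: -ord_y of the determinant of an O_y-basis of the stalk, summed    *)
(* over the closed points.                                                   *)
Definition frame_det I (e : mat L I I) : L :=
  \det (\matrix_(i < #|I|, j < #|I|) (e (enum_val i) (enum_val j) : L)).

Definition stalk_frame (V : bundle) y : mat L (idx V) (idx V) :=
  projT1 (cid (frames_ex V y)).

Definition degree (V : bundle) : int :=
  - \sum_(y \in [set: place Y]) vord y (frame_det (stalk_frame V y)).

Definition slope (V : bundle) : rat := (degree V)%:~R / (rank V)%:R.

(* M identifies V with a subbundle of W: the quotient is torsion-free. *)
Definition is_subbundle (V W : bundle) (M : mat L (idx V) (idx W)) : Prop :=
  [/\ is_hom M, injective (app M) & forall y v, stalk W y (app M v) -> stalk V y v].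

Definition is_surj (V W : bundle) (M : mat L (idx V) (idx W)) : Prop :=
  is_hom M /\ forall y w, stalk W y w -> exists2 v, stalk V y v & app M v = w.

Definition semistable (V : bundle) : Prop :=
  forall (W : bundle) M, @is_subbundle W V M -> (0 < rank W)%N -> slope W <= slope V.

Fact triv_loc_free I y : exists U : set (place Y), [/\ zopen U, U y &
  exists e : mat L I I, forall z, U z ->
    frames z e [set v | forall i, in_ring z (v i)]].
Proof.
exists setT; split=> //; first exact: zopenT.
exists (mat1 I) => z _; split; first by exists (mat1 I); apply: minvP => v; rewrite !app_id.
by move=> c; rewrite /= app_id.
Qed.
Definition triv I : bundle := Bundle (triv_loc_free I).

Section Operations.
Variables V W : bundle.

Definition tens_stalk y : set (vec L (idx V * idx W)%type) :=
  ospan y [set u | exists v w, [/\ stalk V y v, stalk W y w & u = vtens v w]].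
Fact tens_loc_free y : exists U : set (place Y), [/\ zopen U, U y &
  exists e : mat L (idx V * idx W)%type (idx V * idx W)%type,
    forall z, U z -> frames z e (tens_stalk z)].
Proof.
have [U [oU Uy [e he]]] := loc_free V y; have [U' [oU' U'y [f hf]]] := loc_free W y.
exists (U `&` U'); split=> //; first exact: zopenI.
have [[e' ee'] _] := he y Uy; have [[f' ff'] _] := hf y U'y.
exists (mtens e f) => z [Uz U'z]; apply: (ospan_frames (mtens_minv ee' ff')).
  move=> [i j]; exists (e i), (f j); split; last by rewrite ffunE.
    exact: frames_mem (he z Uz).
  exact: frames_mem (hf z U'z).
move=> _ [v [w [Vv Ww ->]]] [i j]; rewrite app_tens ffunE /=.
apply: in_ringM; last exact: (framesP _ (hf z U'z) ff').1.
exact: (framesP _ (he z Uz) ee').1.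
Qed.
Definition tens : bundle := Bundle tens_loc_free.

Definition dsum_stalk y : set (vec L (idx V + idx W)%type) :=
  [set v | stalk V y (lpart v) /\ stalk W y (rpart v)].
Fact dsum_loc_free y : exists U : set (place Y), [/\ zopen U, U y &
  exists e : mat L (idx V + idx W)%type (idx V + idx W)%type,
    forall z, U z -> frames z e (dsum_stalk z)].
Proof.
have [U [oU Uy [e he]]] := loc_free V y; have [U' [oU' U'y [f hf]]] := loc_free W y.
exists (U `&` U'); split=> //; first exact: zopenI.
have [[e' ee'] _] := he y Uy; have [[f' ff'] _] := hf y U'y.
exists (msum e f) => z [Uz U'z]; split; first by exists (msum e' f'); exact: msum_minv.
move=> c; rewrite /dsum_stalk /= lpart_msum rpart_msum (he z Uz).2 (hf z U'z).2.
split=> [[h1 h2] [i|j]|h]; first by have := h1 i; rewrite ffunE.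
  by have := h2 j; rewrite ffunE.
by split=> i; rewrite ffunE.
Qed.
Definition dsum : bundle := Bundle dsum_loc_free.

Definition dual_stalk y : set (vec L (idx V)) :=
  [set xi | forall v, stalk V y v -> in_ring y (dotp xi v)].

Lemma dual_frames y e e' : frames y e (stalk V y) -> minv e e' ->
  frames y (trm e') (dual_stalk y).
Proof.
move=> fe ee'; have e'e : minv e' e by case: ee'.
split; first by exists (trm e); exact: trm_minv.
move=> c; split=> [hc i|hc v /(framesP _ fe ee') hv]; last first.
  rewrite app_trm; apply: in_ring_sum => i; exact: in_ringM (hc i) (hv i).
have := hc (e i) (frames_mem i fe).
by rewrite app_trm -app_bvec (minv_l _ ee') dotp_bvec.
Qed.

Fact dual_loc_free y : exists U : set (place Y), [/\ zopen U, U y &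
  exists e : mat L (idx V) (idx V), forall z, U z -> frames z e (dual_stalk z)].
Proof.
have [U [oU Uy [e he]]] := loc_free V y; have [[e' ee'] _] := he y Uy.
exists U; split=> //; exists (trm e') => z Uz; exact: dual_frames (he z Uz) ee'.
Qed.
Definition bdual : bundle := Bundle dual_loc_free.

End Operations.

Lemma tens_hom (V V' W W' : bundle) M N : @is_hom V V' M -> @is_hom W W' N ->
  @is_hom (tens V W) (tens V' W') (mtens M N).
Proof.
move=> hM hN y u; apply: ospan_map => _ [v [w [Vv Ww ->]]].
rewrite app_tens; apply: ospan_gen; exists (app M v), (app N w).
by split=> //; [exact: hM|exact: hN].
Qed.

Fixpoint tens_pow (V : bundle) n : bundle :=
  if n is m.+1 then tens V (tens_pow V m) else triv unit.
Definition dsum_mul n (V : bundle) : bundle := iter n (dsum V) (triv void).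
Definition poly_bundle (f : {poly nat}) (V : bundle) : bundle :=
  foldr dsum (triv void) [seq dsum_mul (f`_i)%R (tens_pow V i) | i <- iota 0 (size f)].

Definition finite_bundle (V : bundle) : Prop :=
  exists f g : {poly nat}, f != g /\ isomorphic (poly_bundle f V) (poly_bundle g V).

Definition semistable0 (V : bundle) : Prop := semistable V /\ degree V = 0.

(* Subquotients, within the semistable bundles of degree 0, of finite ones. *)
Definition essentially_finite (V : bundle) : Prop :=
  exists (E W : bundle) M N,
    [/\ finite_bundle E, @is_subbundle W E M, @is_surj W V N,
        semistable0 W & semistable0 V].

End Bundles.
Arguments stalk {k Y} b y _.

Section PullBack.
Variables (k : closedFieldType) (Z Y : curve k) (f : curve_mor Z Y).

Definition pull_stalk (V : bundle Y) (z : place Z) : set (vec (ff Z) (idx V)) :=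
  ospan z [set map_vec (cm_fun f) v | v in stalk V (cm_pt f z)].

Arguments pull_stalk : clear implicits.

Lemma pull_frames (V : bundle Y) z e e' :
  frames (cm_pt f z) e (stalk V (cm_pt f z)) -> minv e e' ->
  frames z (map_mat (cm_fun f) e) (pull_stalk V z).
Proof.
move=> fe ee'; apply: (ospan_frames (map_minv (cm_fun f) ee')).
  by move=> i; exists (e i); [exact: frames_mem fe|rewrite ffunE].
move=> _ [v /(framesP _ fe ee') hv <-] i.
by rewrite -map_app ffunE -cm_loc.
Qed.

Fact pull_loc_free (V : bundle Y) z : exists U : set (place Z), [/\ zopen U, U z &
  exists e : mat (ff Z) (idx V) (idx V), forall t, U t -> frames t e (pull_stalk V t)].
Proof.
have [U [oU Uz [e he]]] := loc_free V (cm_pt f z); have [[e' ee'] _] := he _ Uz.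
exists (cm_pt f @^-1` U); split=> //; first exact: cm_cont.
exists (map_mat (cm_fun f) e) => t Ut; exact: pull_frames (he _ Ut) ee'.
Qed.
Definition pull (V : bundle Y) : bundle Z := Bundle (pull_loc_free V).

End PullBack.

Lemma pull_span_map k (Z Y : curve k) (f : curve_mor Z Y) z (I J : finType)
    (G : set (vec (ff Y) I)) (G' : set (vec (ff Z) J)) (M : mat (ff Z) I J) u :
  (forall w, G w -> ospan z G' (app M (map_vec (cm_fun f) w))) ->
  ospan (cm_pt f z) G u -> ospan z G' (app M (map_vec (cm_fun f) u)).
Proof.
move=> h; elim=> [|c w v hc /h hw _ hv]; first by rewrite map_vec0 app0; exact: ospan_nil.
rewrite map_vecD map_vecZ appD appZ; apply: ospan_add => //.
by apply: ospan_scale => //; rewrite -cm_loc.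
Qed.

Lemma ospan_tens k (Y : curve k) y (I J : finType) (G : set (vec (ff Y) I)) (H : set (vec (ff Y) J))
    (K : set (vec (ff Y) (I * J)%type)) v w :
  (forall v w, G v -> H w -> ospan y K (vtens v w)) ->
  ospan y G v -> ospan y H w -> ospan y K (vtens v w).
Proof.
move=> h; elim=> [|c g v' hc Gg _ IH] hw; first by rewrite vtens0l; exact: ospan_nil.
rewrite vtensDl vtensZl; apply: ospan_add; last exact: IH.
apply: ospan_scale => //; elim: hw {IH} => [|d t w' hd Ht _ IH].
  by rewrite vtens0r; exact: ospan_nil.
rewrite vtensDr vtensZr; apply: ospan_add => //; apply: ospan_scale => //; exact: h.
Qed.

Lemma ospan_tens_pull k (Z Y : curve k) (f : curve_mor Z Y) (V W : bundle Y) z v w :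
  stalk (pull f V) z v -> stalk (pull f W) z w -> stalk (pull f (tens V W)) z (vtens v w).
Proof.
apply: ospan_tens => _ _ [v' hv <-] [w' hw <-]; apply: ospan_gen.
exists (vtens v' w'); last by rewrite map_vtens.
by apply: ospan_gen; exists v', w'.
Qed.

(* Gamma-bundles: lambda_g : g^*V -> V, with lambda_{gh} = lambda_h o        *)
(* h^*lambda_g; glamV is the inverse of lambda.                              *)
Record gbundle (k : closedFieldType) (Y : curve k) (gT : finGroupType)
    (A : curve_action gT Y) := GBundle {
  gb :> bundle Y;
  glam : gT -> mat (ff Y) (idx gb) (idx gb);
  glamV : gT -> mat (ff Y) (idx gb) (idx gb);
  glamP : forall g, @is_iso k Y (pull (A g) gb) gb (glam g) (glamV g);
  glamM : forall g h,
    glam (g * h)%g = compm (glam h) (map_mat (cm_fun (A h)) (glam g)) }.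

Section GBundles.
Variables (k : closedFieldType) (Y : curve k) (gT : finGroupType).
Variable A : curve_action gT Y.
Local Notation L := (ff Y).
Local Notation gbundle := (gbundle A).
Implicit Types (V W U : gbundle) (g h : gT).

Definition equivariant V W (M : mat L (idx V) (idx W)) : Prop :=
  forall g, compm M (glam V g) = compm (glam W g) (map_mat (cm_fun (A g)) M).

Definition gdegree V : rat := (degree V)%:~R / #|gT|%:R.
Definition gslope V : rat := gdegree V / (rank V)%:R.

Definition gsemistable V : Prop :=
  forall W M, @is_subbundle k Y W V M -> equivariant M -> (0 < rank W)%N ->
    gslope W <= gslope V.

Definition ghomb V W : {pred mat L (idx V) (idx W)} :=
  fun M => `[< is_hom M /\ equivariant M >].

Fact ghomb_closed V W : zmod_closed (@ghomb V W).
Proof.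
split.
  apply/asboolP; split=> [y v _|g]; first by rewrite app0m; exact: stalk_nil.
  apply: (@map_matP _ _ (cm_fun (A g))) => v; rewrite !app_comp -map_app !app0m.
  by rewrite map_vec0 app0.
move=> M N /asboolP[hM eM] /asboolP[hN eN]; apply/asboolP; split=> [y v hv|g].
  rewrite appDm appNm addrC -scaleN1r; apply: stalk_lin; [|exact: hN|exact: hM].
  by rewrite /in_ring in_powN; exact: in_ring1.
apply: (@map_matP _ _ (cm_fun (A g))) => v; rewrite !app_comp -map_app.
rewrite !(appDm, appNm) -[- app N v]scaleN1r map_vecD map_vecZ appD appZ.
by rewrite rmorphN1 scaleN1r !map_app -!app_comp eM eN.
Qed.
HB.instance Definition _ V W := GRing.isZmodClosed.Build _ (@ghomb V W) (ghomb_closed V W).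

Record ghom V W := GHom { ghom_mat :> mat L (idx V) (idx W); ghomP : ghom_mat \in @ghomb V W }.
HB.instance Definition _ V W := [isSub for @ghom_mat V W].
HB.instance Definition _ V W := [Choice of ghom V W by <:].
HB.instance Definition _ V W := [SubChoice_isSubZmodule of ghom V W by <:].

Fact ghom_scaleP V W (c : k) (M : ghom V W) : kcst Y c *: (M : mat _ _ _) \in @ghomb V W.
Proof.
have /asboolP[hM eM] := ghomP M; apply/asboolP; split=> [y v hv|g].
  rewrite appZm -[_ *: _]addr0; apply: stalk_lin; [exact: in_pow_cst|exact: hM|exact: stalk_nil].
apply: (@map_matP _ _ (cm_fun (A g))) => v; rewrite !app_comp -map_app !appZm map_vecZ appZ.
by rewrite (ca_lin A) !map_app -!app_comp eM.
Qed.
Definition ghom_scale V W c (M : ghom V W) := GHom (ghom_scaleP c M).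

Fact ghom_scaleA V W a b (M : ghom V W) :
  ghom_scale a (ghom_scale b M) = ghom_scale (a * b) M.
Proof. by apply: val_inj; rewrite /= scalerA rmorphM. Qed.
Fact ghom_scale1 V W : left_id 1 (@ghom_scale V W).
Proof. by move=> M; apply: val_inj; rewrite /= rmorph1 scale1r. Qed.
Fact ghom_scaleDr V W : right_distributive (@ghom_scale V W) +%R.
Proof. by move=> c M N; apply: val_inj; rewrite /= scalerDr. Qed.
Fact ghom_scaleDl V W (M : ghom V W) : {morph (@ghom_scale V W)^~ M : a b / a + b}.
Proof. by move=> a b; apply: val_inj; rewrite /= rmorphD scalerDl. Qed.
HB.instance Definition _ V W := GRing.Zmodule_isLmodule.Build k (ghom V W)
  (@ghom_scaleA V W) (@ghom_scale1 V W) (@ghom_scaleDr V W) (@ghom_scaleDl V W).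

Fact gid_P V : mat1 (idx V) \in @ghomb V V.
Proof.
apply/asboolP; split=> [y v|g]; first by rewrite app_id.
by rewrite map_mat1 comp1m compm1.
Qed.
Definition gid V : ghom V V := GHom (gid_P V).

Fact gcomp_P V W U (N : ghom W U) (M : ghom V W) : compm N M \in @ghomb V U.
Proof.
have /asboolP[hM eM] := ghomP M; have /asboolP[hN eN] := ghomP N.
apply/asboolP; split=> [y v hv|g]; first by rewrite app_comp; exact/hN/hM.
by rewrite -compmA eM compmA eN -compmA map_compm.
Qed.
Definition gcomp V W U (N : ghom W U) (M : ghom V W) : ghom V U := GHom (gcomp_P N M).

Fact gone_iso g : @is_iso k Y (pull (A g) (triv Y unit)) (triv Y unit) (mat1 _) (mat1 _).
Proof.
split; last by apply: minvP => v; rewrite !app_id.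
- move=> y v; apply: ospan_stalk_map => _ [w hw <-] i.
  by rewrite app_id ffunE -cm_loc.
- move=> y v hv; rewrite app_id -[v]app_id; apply: ospan_sum => i; apply: ospan_scale => //.
  apply: ospan_gen; exists (bvec _ i); last by rewrite map_bvec ffunE.
  by move=> j; rewrite ffunE; case: eqP => _; [exact: in_ring1|exact: in_pow0].
Qed.
Fact gone_M g h : mat1 unit = compm (mat1 unit) (map_mat (cm_fun (A h)) (mat1 unit)).
Proof. by rewrite map_mat1 comp1m. Qed.
Definition gone : gbundle := GBundle gone_iso gone_M.

Fact gtens_iso V W g : @is_iso k Y (pull (A g) (tens V W)) (tens V W)
  (mtens (glam V g) (glam W g)) (mtens (glamV V g) (glamV W g)).
Proof.
have [hV hV' iV] := glamP V g; have [hW hW' iW] := glamP W g.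
split; last exact: mtens_minv.
- move=> y u; apply: ospan_stalk_map => _ [w + <-]; apply: pull_span_map.
  move=> _ [v1 [v2 [h1 h2 ->]]]; rewrite map_vtens app_tens; apply: ospan_gen.
  exists (app (glam V g) (map_vec (cm_fun (A g)) v1)).
  exists (app (glam W g) (map_vec (cm_fun (A g)) v2)).
  by split=> //; [apply: hV|apply: hW]; apply: ospan_gen; [exists v1|exists v2].
- move=> y u; apply: ospan_map => _ [v [w [hv hw ->]]]; rewrite app_tens.
  by apply: ospan_tens_pull; [exact: hV'|exact: hW'].
Qed.
Fact gtens_M V W g h : mtens (glam V (g * h)%g) (glam W (g * h)%g) =
  compm (mtens (glam V h) (glam W h))
        (map_mat (cm_fun (A h)) (mtens (glam V g) (glam W g))).
Proof. by rewrite map_mtens mtens_comp !glamM. Qed.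
Definition gtens V W : gbundle := GBundle (gtens_iso V W) (gtens_M V W).

Fact gdual_iso V g : @is_iso k Y (pull (A g) (bdual V)) (bdual V)
  (trm (glamV V g)) (trm (glam V g)).
Proof.
have [hM hN iM] := glamP V g; set s := cm_fun (A g).
split; last by apply: trm_minv; case: iM.
- move=> y u; apply: ospan_stalk_map => _ [xi hxi <-] v hv; rewrite app_trm.
  move: (hN y v hv); move: (app _ v) => {hv}v; elim=> [|c _ v' hc [w hw <-] _ hv'].
    by rewrite dotp0r; exact: in_pow0.
  rewrite dotpDr dotpZr -map_dotp; apply: in_powD => //.
  by apply: in_ringM => //; rewrite -[in_pow y 0 _]/(in_ring y _) -cm_loc; exact: hxi.
- move=> y xi hxi; have [e fe] := frames_ex V (cm_pt (A g) y).
  have [[e' ee'] _] := fe; have fd := dual_frames fe ee'.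
  have := @pull_frames k Y Y (A g) (bdual V) y (trm e') (trm e) fd
    (trm_minv (let: conj a b := ee' in conj b a)).
  move=> fp; apply/(framesP _ fp (map_minv _ (trm_minv (let: conj a b := ee' in conj b a)))).
  move=> i; rewrite -dotp_bvec map_trm !app_trm; apply: hxi; apply: hM.
  apply: ospan_gen; exists (e i); first exact: frames_mem fe.
  by rewrite app_bvec ffunE.
Qed.
Fact gdual_M V g h : trm (glamV V (g * h)%g) =
  compm (trm (glamV V h)) (map_mat (cm_fun (A h)) (trm (glamV V g))).
Proof.
have [_ _ ig] := glamP V g; have [_ _ ih] := glamP V h; have [_ _ igh] := glamP V (g * h)%g.
have {}igh : minv (compm (glam V h) (map_mat (cm_fun (A h)) (glam V g))) (glamV V (g * h)%g).
  by rewrite -glamM.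
have h1 := map_minv (cm_fun (A h)) ig.
have i2 : minv (compm (glam V h) (map_mat (cm_fun (A h)) (glam V g)))
  (compm (map_mat (cm_fun (A h)) (glamV V g)) (glamV V h)).
  apply: minvP => v; rewrite !app_comp.
    by rewrite (minv_l _ ih) (minv_l _ h1).
  by rewrite (minv_r _ h1) (minv_r _ ih).
rewrite (minv_uniq igh i2) map_trm; apply: matP => v; apply: dotpP => w.
by rewrite app_comp !app_trm app_comp.
Qed.
Definition gdual V : gbundle := GBundle (gdual_iso V) (gdual_M V).

Fact gtmor_P V V' W W' (M : ghom V V') (N : ghom W W') :
  mtens M N \in @ghomb (gtens V W) (gtens V' W').
Proof.
have /asboolP[hM eM] := ghomP M; have /asboolP[hN eN] := ghomP N.
apply/asboolP; split; first exact: tens_hom.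
by move=> g /=; rewrite map_mtens !mtens_comp eM eN.
Qed.
Definition gtmor V V' W W' (M : ghom V V') (N : ghom W W') :
  ghom (gtens V W) (gtens V' W') := GHom (gtmor_P M N).

Lemma app_assoc (I J K : finType) (u : vec L I) (v : vec L J) (w : vec L K) :
  app (pullm L (fun p => ((p.1, p.2.1), p.2.2))) (vtens (vtens u v) w) = vtens u (vtens v w).
Proof. by rewrite app_pull; apply/ffunP => p; rewrite !ffunE /= mulrA. Qed.

Fact gassoc_P V W U :
  pullm L (fun p => ((p.1, p.2.1), p.2.2)) \in @ghomb (gtens (gtens V W) U) (gtens V (gtens W U)).
Proof.
apply/asboolP; split.
  move=> y v; apply: ospan_map => _ [vw [u [hvw hu ->]]].
  move: hvw; elim=> [|c _ x hc [v1 [v2 [h1 h2 ->]]] _ IH].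
    by rewrite vtens0l app0; exact: ospan_nil.
  rewrite vtensDl vtensZl appD appZ; apply: ospan_add => //.
  apply: ospan_scale => //; apply: ospan_gen; exists v1, (vtens v2 u).
  by split; [|apply: ospan_gen; exists v2, u|exact: app_assoc].
move=> g; rewrite map_pullm; apply: mat_tens3P => u v w.
by rewrite !app_comp !(app_tens, app_assoc).
Qed.
Definition gassoc V W U : ghom (gtens (gtens V W) U) (gtens V (gtens W U)) :=
  GHom (gassoc_P V W U).

Fact glunit_P V : pullm L (fun i => (tt, i)) \in @ghomb (gtens gone V) V.
Proof.
apply/asboolP; split.
  move=> y v; apply: ospan_stalk_map => _ [u [w [hu hw ->]]].
  have -> : app (pullm L (fun i => (tt, i))) (vtens u w) = u tt *: w.
    by rewrite app_pull; apply/ffunP => i; rewrite !ffunE.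
  by rewrite -[_ *: _]addr0; apply: stalk_lin => //; exact: stalk_nil.
move=> g; rewrite map_pullm; apply: mat_tensP => u w; rewrite !app_comp app_tens app_id.
rewrite !app_pull; apply/ffunP => i; rewrite ffunE /= ffunE /= !appE mulr_sumr.
by apply: eq_bigr => j _; rewrite !ffunE /= mulrA.
Qed.
Definition glunit V : ghom (gtens gone V) V := GHom (glunit_P V).

Fact grunit_P V : pullm L (fun i => (i, tt)) \in @ghomb (gtens V gone) V.
Proof.
apply/asboolP; split.
  move=> y v; apply: ospan_stalk_map => _ [u [w [hu hw ->]]].
  have -> : app (pullm L (fun i => (i, tt))) (vtens u w) = w tt *: u.
    by rewrite app_pull; apply/ffunP => i; rewrite !ffunE /= mulrC.
  by rewrite -[_ *: _]addr0; apply: stalk_lin => //; exact: stalk_nil.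
move=> g; rewrite map_pullm; apply: mat_tensP => u w; rewrite !app_comp app_tens app_id.
rewrite !app_pull; apply/ffunP => i; rewrite ffunE /= ffunE /= !appE mulr_suml.
by apply: eq_bigr => j _; rewrite !ffunE /= mulrAC.
Qed.
Definition grunit V : ghom (gtens V gone) V := GHom (grunit_P V).

Fact gbraid_P V W : pullm L (fun p => (p.2, p.1)) \in @ghomb (gtens V W) (gtens W V).
Proof.
have sw (I J : finType) (u : vec L I) (w : vec L J) :
    app (pullm L (fun p => (p.2, p.1))) (vtens u w) = vtens w u.
  by rewrite app_pull; apply/ffunP => p; rewrite !ffunE /= mulrC.
apply/asboolP; split.
  move=> y v; apply: ospan_map => _ [u [w [hu hw ->]]].
  by rewrite sw; apply: ospan_gen; exists w, u.
by move=> g; rewrite map_pullm; apply: mat_tensP => u w; rewrite !app_comp !(app_tens, sw).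
Qed.
Definition gbraid V W : ghom (gtens V W) (gtens W V) := GHom (gbraid_P V W).

End GBundles.

Section Frobenius.
Variables (k : closedFieldType) (Y : curve k) (p : nat) (pk : p \in [pchar k]).

Fact pchar_ff : p \in [pchar (ff Y)].
Proof. by rewrite (fmorph_pchar (kcst Y)). Qed.
Let F : {rmorphism ff Y -> ff Y} := pFrobenius_aut pchar_ff.

Fact frob_loc y a : in_ring y a = in_ring y (F a).
Proof.
rewrite /in_ring /in_pow /= pFrobenius_autE expf_eq0.
have p0 : (0 < p)%N by apply: prime_gt0; case/andP: pk.
rewrite p0 /=; have [//|a0 /=] := eqVneq a 0.
have -> : forall n, vord y (a ^+ n) = vord y a *+ n.
  elim=> [|n IH]; first by rewrite expr0 vord1.
  by rewrite exprS vordM ?expf_neq0 // IH mulrS.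
by rewrite pmulrn_lge0.
Qed.
Fact frob_cont (U : set (place Y)) : zopen U -> zopen (id @^-1` U).
Proof. by []. Qed.

Definition frob : curve_mor Y Y := CurveMor frob_loc frob_cont.

Variables (gT : finGroupType) (A : curve_action gT Y) (V : gbundle A).

Lemma frob_comm (I : finType) g (v : vec (ff Y) I) :
  map_vec F (map_vec (cm_fun (A g)) v) = map_vec (cm_fun (A g)) (map_vec F v).
Proof. by apply/ffunP => i; rewrite !ffunE /= !pFrobenius_autE rmorphXn. Qed.

Fact gfrob_iso g : @is_iso k Y (pull (A g) (pull frob V)) (pull frob V)
  (map_mat F (glam V g)) (map_mat F (glamV V g)).
Proof.
have [hM hN iM] := glamP V g.
split; last exact: map_minv.
- move=> y u; apply: ospan_stalk_map => _ [w + <-]; apply: pull_span_map.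
  move=> _ [v hv <-]; rewrite -frob_comm -map_app; apply: ospan_gen.
  eexists; last by [].
  by apply: hM; apply: ospan_gen; exists v.
- move=> y u; apply: ospan_map => _ [v hv <-]; rewrite -map_app.
  rewrite -[map_vec _ _]app_id; apply: (@pull_span_map _ _ _ frob _ _ _ _ _ (mat1 _)) (hN _ _ hv).
  move=> _ [w hw <-]; rewrite app_id frob_comm; apply: ospan_gen.
  by eexists; last by []; apply: ospan_gen; exists w.
Qed.
Fact gfrob_M g h : map_mat F (glam V (g * h)%g) =
  compm (map_mat F (glam V h)) (map_mat (cm_fun (A h)) (map_mat F (glam V g))).
Proof.
rewrite glamM map_compm; congr (compm _ _); apply/ffunP => i; rewrite !ffunE.
exact: frob_comm.
Qed.
Definition gfrob : gbundle A := GBundle gfrob_iso gfrob_M.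

End Frobenius.

Definition strongly_semistable (k : closedFieldType) (Y : curve k) (gT : finGroupType)
    (A : curve_action gT Y) (V : gbundle A) : Prop :=
  gsemistable V /\
  forall p (pk : p \in [pchar k]) n, gsemistable (iter n (@gfrob k Y p pk gT A) V).

Section Fiber.
Variables (k : closedFieldType) (Y : curve k) (y : place Y) (V : bundle Y).

Definition stalkb : {pred vec (ff Y) (idx V)} := fun v => `[< stalk V y v >].
Fact stalkb_closed : zmod_closed stalkb.
Proof.
split; first by apply/asboolP; exact: stalk_nil.
move=> v w /asboolP hv /asboolP hw; apply/asboolP.
rewrite addrC -scaleN1r; apply: stalk_lin => //.
by rewrite /in_ring in_powN; exact: in_ring1.
Qed.
HB.instance Definition _ := GRing.isZmodClosed.Build _ stalkb stalkb_closed.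

Record stalk_type := Stalk { stalk_val :> vec (ff Y) (idx V); stalkP : stalk_val \in stalkb }.
HB.instance Definition _ := [isSub for stalk_val].
HB.instance Definition _ := [Choice of stalk_type by <:].
HB.instance Definition _ := [SubChoice_isSubZmodule of stalk_type by <:].

Definition mstalkb : {pred stalk_type} := fun v =>
  `[< ospan y [set w | exists c u, [/\ in_pow y 1 c, stalk V y u & w = c *: u]] (stalk_val v) >].
Fact mstalkb_closed : zmod_closed mstalkb.
Proof.
split; first by apply/asboolP; exact: ospan_nil.
move=> v w /asboolP hv /asboolP hw; apply/asboolP => /=.
apply: ospan_add => //; rewrite -scaleN1r; apply: ospan_scale => //.
by rewrite /in_ring in_powN; exact: in_ring1.
Qed.
HB.instance Definition _ := GRing.isZmodClosed.Build _ mstalkb mstalkb_closed.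

Definition fiber : Type := Quotient.quot mstalkb.
HB.instance Definition _ := GRing.Zmodule.on fiber.

Fact stalk_scaleP (c : k) (v : stalk_type) : kcst Y c *: (v : vec _ _) \in stalkb.
Proof.
apply/asboolP; rewrite -[_ *: _]addr0; apply: stalk_lin; last exact: stalk_nil.
  exact: in_pow_cst.
by have /asboolP := stalkP v.
Qed.
Definition stalk_scale c v := Stalk (stalk_scaleP c v).
Definition fiber_scale (c : k) (a : fiber) : fiber := \pi_fiber (stalk_scale c (repr a)).

Fact pi_fiber_scale c v : fiber_scale c (\pi_fiber v) = \pi_fiber (stalk_scale c v).
Proof.
apply/eqP; rewrite -Quotient.idealrBE; case: piP => w /eqP; rewrite -Quotient.idealrBE.
rewrite -opprB rpredN => /asboolP h; apply/asboolP => /=; rewrite -scalerBr.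
by apply: ospan_scale => //; exact: in_pow_cst.
Qed.

Fact fiber_scaleA c d a : fiber_scale c (fiber_scale d a) = fiber_scale (c * d) a.
Proof.
rewrite -[a]reprK; move: (repr a) => v.
rewrite (pi_fiber_scale d v) !pi_fiber_scale; congr (\pi_fiber _).
by apply: val_inj; rewrite /= scalerA rmorphM.
Qed.
Fact fiber_scale1 : left_id 1 fiber_scale.
Proof.
move=> a; rewrite -[a]reprK; move: (repr a) => v; rewrite pi_fiber_scale.
by congr (\pi_fiber _); apply: val_inj; rewrite /= rmorph1 scale1r.
Qed.
Fact fiber_scaleDr : right_distributive fiber_scale +%R.
Proof.
move=> c a b; rewrite -[a]reprK -[b]reprK; move: (repr a) (repr b) => v w.
rewrite !pi_fiber_scale -!raddfD pi_fiber_scale.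
by congr (\pi_fiber _); apply: val_inj; rewrite /= scalerDr.
Qed.
Fact fiber_scaleDl a : {morph fiber_scale^~ a : c d / c + d}.
Proof.
move=> c d; rewrite -[a]reprK; move: (repr a) => v; rewrite !pi_fiber_scale -raddfD.
by congr (\pi_fiber _); apply: val_inj; rewrite /= rmorphD scalerDl.
Qed.
HB.instance Definition _ := GRing.Zmodule_isLmodule.Build k fiber
  fiber_scaleA fiber_scale1 fiber_scaleDr fiber_scaleDl.

End Fiber.

Section FiberMaps.
Variables (k : closedFieldType) (Y : curve k) (y : place Y).

Fact fiber_mapP (V W : bundle Y) M (hM : @is_hom k Y V W M) (v : stalk_type y V) :
  app M v \in @stalkb k Y y W.
Proof. by apply/asboolP; apply: hM; have /asboolP := stalkP v. Qed.
Definition fiber_map V W M (hM : @is_hom k Y V W M) (a : fiber y V) : fiber y W :=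
  \pi_(fiber y W) (Stalk (fiber_mapP hM (repr a))).

Fact fiber_tensP (V W : bundle Y) (v : stalk_type y V) (w : stalk_type y W) :
  vtens v w \in @stalkb k Y y (tens V W).
Proof.
apply/asboolP; apply: ospan_gen; exists (v : vec _ _), (w : vec _ _).
by have /asboolP ? := stalkP v; have /asboolP ? := stalkP w.
Qed.
Definition fiber_tens V W (a : fiber y V) (b : fiber y W) : fiber y (tens V W) :=
  \pi_(fiber y (tens V W)) (Stalk (fiber_tensP (repr a) (repr b))).

Fact fiber_oneP : [ffun=> 1] \in @stalkb k Y y (triv Y unit).
Proof. by apply/asboolP => i; rewrite ffunE; exact: in_ring1. Qed.
Definition fiber_one : fiber y (triv Y unit) :=
  \pi_(fiber y (triv Y unit)) (Stalk fiber_oneP).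
End FiberMaps.

(* Neutral Tannakian categories (Deligne-Milne, Tannakian categories, 2.19)  *)
Record tensor_cat (k : fieldType) := TensorCat {
  tob :> Type;
  thom : tob -> tob -> lmodType k;
  tid : forall A, thom A A;
  tcomp : forall A B C, thom B C -> thom A B -> thom A C;
  tone : tob;
  tten : tob -> tob -> tob;
  tmor : forall A A' B B', thom A A' -> thom B B' -> thom (tten A B) (tten A' B');
  tassoc : forall A B C, thom (tten (tten A B) C) (tten A (tten B C));
  tlun : forall A, thom (tten tone A) A;
  trun : forall A, thom (tten A tone) A;
  tbraid : forall A B, thom (tten A B) (tten B A);
  tdual : tob -> tob }.

Section Tannakian.
Variables (k : fieldType) (C : tensor_cat k).
Local Notation "A ~> B" := (thom A B) (at level 90, no associativity).
Local Notation "g '\c' f" := (tcomp g f) (at level 39, left associativity).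
Local Notation "A ** B" := (tten A B) (at level 37, left associativity).
Local Notation "f '\t' g" := (tmor f g) (at level 37, left associativity).
Local Notation "1_ A" := (tid A) (at level 0, A at level 0, format "1_ A").
Local Notation one := (tone C).

Definition linear_category : Prop :=
  [/\ forall (A B : C) (f : A ~> B), 1_B \c f = f /\ f \c 1_A = f,
      forall (A B D E : C) (f : A ~> B) (g : B ~> D) (h : D ~> E),
        h \c (g \c f) = h \c g \c f,
      forall (A B D : C) (a : k) (f f' : A ~> B) (g : B ~> D),
        g \c (a *: f + f') = a *: (g \c f) + g \c f'
    & forall (A B D : C) (a : k) (f : A ~> B) (g g' : B ~> D),
        (a *: g + g') \c f = a *: (g \c f) + g' \c f].

Definition tmono (A B : C) (f : A ~> B) : Prop :=
  forall (T : C) (u v : T ~> A), f \c u = f \c v -> u = v.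
Definition tepi (A B : C) (f : A ~> B) : Prop :=
  forall (T : C) (u v : B ~> T), u \c f = v \c f -> u = v.
Definition inverses (A B : C) (f : A ~> B) (g : B ~> A) : Prop :=
  g \c f = 1_A /\ f \c g = 1_B.
Definition tiso (A B : C) (f : A ~> B) : Prop := exists g, inverses f g.
Definition is_kernel (A B K : C) (f : A ~> B) (i : K ~> A) : Prop :=
  f \c i = 0 /\ forall (T : C) (t : T ~> A), f \c t = 0 -> exists! u, i \c u = t.
Definition is_cokernel (A B Q : C) (f : A ~> B) (q : B ~> Q) : Prop :=
  q \c f = 0 /\ forall (T : C) (t : B ~> T), t \c f = 0 -> exists! u, u \c q = t.
Definition is_zero_object (Z : C) : Prop :=
  forall A : C, (forall f : A ~> Z, f = 0) /\ (forall f : Z ~> A, f = 0).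

Definition is_biproduct (A B P : C)
    (i1 : A ~> P) (i2 : B ~> P) (p1 : P ~> A) (p2 : P ~> B) : Prop :=
  [/\ p1 \c i1 = 1_A, p2 \c i2 = 1_B, p1 \c i2 = 0, p2 \c i1 = 0
    & i1 \c p1 + i2 \c p2 = 1_P].

Definition abelian_category : Prop :=
  (exists Z : C, is_zero_object Z) /\
  [/\ forall A B : C, exists P i1 i2 p1 p2, @is_biproduct A B P i1 i2 p1 p2,
      forall (A B : C) (f : A ~> B), exists K (i : K ~> A), is_kernel f i,
      forall (A B : C) (f : A ~> B), exists Q (q : B ~> Q), is_cokernel f q,
      forall (A B : C) (f : A ~> B), tmono f -> exists D (g : B ~> D), is_kernel g f
    & forall (A B : C) (f : A ~> B), tepi f -> exists D (g : D ~> A), is_cokernel g f].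

Definition bilinear_tensor : Prop :=
  [/\ forall A B : C, 1_A \t 1_B = 1_(A ** B),
      forall (A A' A'' B B' B'' : C) (f : A ~> A') (f' : A' ~> A'') (g : B ~> B') (g' : B' ~> B''),
        (f' \c f) \t (g' \c g) = (f' \t g') \c (f \t g),
      forall (A A' B B' : C) (a : k) (f f' : A ~> A') (g : B ~> B'),
        (a *: f + f') \t g = a *: (f \t g) + f' \t g
    & forall (A A' B B' : C) (a : k) (f : A ~> A') (g g' : B ~> B'),
        f \t (a *: g + g') = a *: (f \t g) + f \t g'].

Definition natural_constraints : Prop :=
  [/\ forall (A A' B B' D D' : C) (f : A ~> A') (g : B ~> B') (h : D ~> D'),
        tassoc A' B' D' \c (f \t g \t h) = f \t (g \t h) \c tassoc A B D,
      forall (A A' : C) (f : A ~> A'), tlun A' \c (1_one \t f) = f \c tlun A,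
      forall (A A' : C) (f : A ~> A'), trun A' \c (f \t 1_one) = f \c trun A
    & forall (A A' B B' : C) (f : A ~> A') (g : B ~> B'),
        tbraid A' B' \c (f \t g) = g \t f \c tbraid A B].

Definition invertible_constraints : Prop :=
  [/\ forall A B D : C, tiso (tassoc A B D), forall A : C, tiso (tlun A),
      forall A : C, tiso (trun A)
    & forall A B : C, inverses (tbraid A B) (tbraid B A)].

Definition coherent_constraints : Prop :=
  [/\ forall A B D E : C,
        tassoc A B (D ** E) \c tassoc (A ** B) D E =
        1_A \t tassoc B D E \c tassoc A (B ** D) E \c (tassoc A B D \t 1_E),
      forall A B : C, (1_A \t tlun B) \c tassoc A one B = trun A \t 1_B
    & forall A B D : C,
        tassoc B D A \c tbraid A (B ** D) \c tassoc A B D =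
        1_B \t tbraid A D \c tassoc B A D \c (tbraid A B \t 1_D)].

Definition symmetric_tensor_category : Prop :=
  [/\ bilinear_tensor, natural_constraints, invertible_constraints & coherent_constraints].

Definition rigid : Prop :=
  forall A : C, exists (ev : tdual A ** A ~> one) (coev : one ~> A ** tdual A),
    trun A \c (1_A \t ev) \c tassoc A (tdual A) A \c (coev \t 1_A) = tlun A /\
    forall assocV, inverses (tassoc (tdual A) A (tdual A)) assocV ->
      tlun (tdual A) \c (ev \t 1_(tdual A)) \c assocV \c (1_(tdual A) \t coev) = trun (tdual A).

Definition scalar_endomorphisms : Prop :=
  forall f : one ~> one, exists! a : k, f = a *: 1_one.

(* A functor to k-vector spaces with a candidate tensor structure, given by  *)
(* an element of the image of the unit object and by bilinear maps.          *)
Record vect_functor := VectFunctor {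
  fo : C -> lmodType k;
  fm : forall A B : C, A ~> B -> fo A -> fo B;
  fone : fo one;
  ften : forall A B : C, fo A -> fo B -> fo (A ** B) }.

Arguments fm v {A B} _ _.

Variable F : vect_functor.

Definition finite_dimensional (E : lmodType k) : Prop :=
  exists (n : nat) (e : 'I_n -> E), forall v, exists a : 'I_n -> k, v = \sum_i a i *: e i.

Definition is_linear (E E' : lmodType k) (u : E -> E') : Prop :=
  forall a v w, u (a *: v + w) = a *: u v + u w.
Definition is_bilinear (E E' D : lmodType k) (b : E -> E' -> D) : Prop :=
  (forall v', is_linear (b^~ v')) /\ (forall v, is_linear (b v)).
Definition is_tensor_product (E E' T : lmodType k) (t : E -> E' -> T) : Prop :=
  is_bilinear t /\
  forall (D : lmodType k) (b : E -> E' -> D), is_bilinear b ->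
    exists! u : T -> D, is_linear u /\ forall v v', u (t v v') = b v v'.

Definition linear_functor : Prop :=
  [/\ forall A : C, finite_dimensional (fo F A),
      forall (A B : C) (f : A ~> B), is_linear (fm F f),
      forall (A B : C) (a : k) (f g : A ~> B) v,
        fm F (a *: f + g) v = a *: fm F f v + fm F g v,
      forall (A : C) v, fm F 1_A v = v
    & forall (A B D : C) (f : A ~> B) (g : B ~> D) v, fm F (g \c f) v = fm F g (fm F f v)].

Definition tensor_functor : Prop :=
  [/\ forall v, exists! a : k, v = a *: fone F,
      forall A B : C, is_tensor_product (@ften F A B)
    & forall (A A' B B' : C) (f : A ~> A') (g : B ~> B') v w,
        fm F (f \t g) (ften v w) = ften (fm F f v) (fm F g w)] /\
  [/\ forall (A B D : C) (u : fo F A) (v : fo F B) (w : fo F D),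
        fm F (tassoc A B D) (ften (ften u v) w) = ften u (ften v w),
      forall (A : C) (v : fo F A), fm F (tlun A) (ften (fone F) v) = v,
      forall (A : C) (v : fo F A), fm F (trun A) (ften v (fone F)) = v
    & forall (A B : C) (v : fo F A) (w : fo F B), fm F (tbraid A B) (ften v w) = ften w v].

Definition exact_functor : Prop :=
  forall (A B D : C) (f : A ~> B) (g : B ~> D), is_kernel g f -> is_cokernel f g ->
    [/\ injective (fm F f), forall v, fm F g v = 0 <-> exists u, v = fm F f u
      & forall w, exists v, w = fm F g v].

Definition faithful_functor : Prop :=
  forall (A B : C) (f g : A ~> B), (forall v, fm F f v = fm F g v) -> f = g.

Definition neutral_tannakian : Prop :=
  [/\ linear_category, abelian_category, symmetric_tensor_category, rigid
    & scalar_endomorphisms] /\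
  [/\ linear_functor, tensor_functor, exact_functor & faithful_functor].

End Tannakian.
Arguments fm {k C} v {A B} _ _.

Section FullSubcategory.
Variables (k : fieldType) (C : tensor_cat k) (S : C -> Prop).

Definition tensor_closed : Prop :=
  [/\ S (tone C), forall A B, S A -> S B -> S (tten A B) & forall A, S A -> S (tdual A)].

Variable cl : tensor_closed.
Let c1 : S (tone C). Proof. by case: cl. Qed.
Let cM A B : S A -> S B -> S (tten A B). Proof. by case: cl => _ + _; exact. Qed.
Let cD A : S A -> S (tdual A). Proof. by case: cl => _ _; exact. Qed.
Let ob := {A : C | S A}.

Definition full_subcat : tensor_cat k := {|
  tob := ob;
  thom A B := thom (sval A) (sval B);
  tid A := tid (sval A);
  tcomp A B D g f := tcomp g f;
  tone := exist S (tone C) c1;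
  tten A B := exist S (tten (sval A) (sval B)) (cM (svalP A) (svalP B));
  tmor A A' B B' f g := tmor f g;
  tassoc A B D := tassoc (sval A) (sval B) (sval D);
  tlun A := tlun (sval A);
  trun A := trun (sval A);
  tbraid A B := tbraid (sval A) (sval B);
  tdual A := exist S (tdual (sval A)) (cD (svalP A)) |}.

Definition restrict_functor (F : vect_functor C) : vect_functor full_subcat := {|
  fo := fun A : full_subcat => fo F (sval A);
  fm := fun (A B : full_subcat) f => fm F (f : thom (sval A) (sval B));
  fone := fone F;
  ften := fun (A B : full_subcat) v w => @ften _ _ F (sval A) (sval B) v w |}.

End FullSubcategory.

(* The full subcategory of the objects satisfying S is stable under the      *)
(* unit object, tensor products and duals, and is neutral Tannakian.         *)
Definition neutral_tannakian_sub (k : fieldType) (C : tensor_cat k) (F : vect_functor C)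
    (S : C -> Prop) : Prop :=
  exists cl : tensor_closed S, neutral_tannakian (restrict_functor cl F).

Section Vect.
Variables (k : closedFieldType) (Y : curve k) (gT : finGroupType) (A : curve_action gT Y).

Definition Vect : tensor_cat k := {|
  tob := gbundle A;
  thom V W := ghom V W;
  tid := @gid k Y gT A;
  tcomp := @gcomp k Y gT A;
  tone := gone A;
  tten := @gtens k Y gT A;
  tmor := @gtmor k Y gT A;
  tassoc := @gassoc k Y gT A;
  tlun := @glunit k Y gT A;
  trun := @grunit k Y gT A;
  tbraid := @gbraid k Y gT A;
  tdual := @gdual k Y gT A |}.

Fact ghom_is_hom (V W : gbundle A) (f : ghom V W) : @is_hom k Y V W f.
Proof. by have /asboolP[] := ghomP f. Qed.

Definition fiber_functor (y : place Y) : vect_functor Vect := @VectFunctor k Vect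
  (fun V : gbundle A => fiber y V)
  (fun (V W : gbundle A) (f : ghom V W) => fiber_map (ghom_is_hom f))
  (fiber_one y)
  (fun V W : gbundle A => @fiber_tens k Y y V W).

End Vect.

Definition Vect0ss (k : closedFieldType) (Y : curve k) (gT : finGroupType)
    (A : curve_action gT Y) : Vect A -> Prop :=
  fun V => strongly_semistable V /\ gdegree V = 0.

Definition Nori (k : closedFieldType) (Y : curve k) (gT : finGroupType)
    (A : curve_action gT Y) : Vect A -> Prop :=
  fun V => essentially_finite (gb V).

Definition Etale (k : closedFieldType) (X : curve k) (P : branch_data X) (Y : curve k)
    (gT : finGroupType) (f : galois_cover gT Y X) : Vect (gc_act f) -> Prop :=
  fun V => exists (Y' : curve k) (gT' : finGroupType) (f' : galois_cover gT' Y' X)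
      (h : curve_mor Y' Y),
    [/\ orb_etale f' (trivial_branch Y') P,
        forall b, cm_fun h (cm_fun f b) = cm_fun f' b
      & exists I : finType, isomorphic (pull h (gb V)) (triv Y' I)].

(* Main.v *)
(* Homomorphisms of semistable bundles of degree 0 are strict: kernels, images and cokernels have   *)
(* degree 0, and a homomorphism vanishes as soon as it does in one fibre. So every class of such     *)
(* bundles closed under the tensor operations and degree 0 sub- and quotient bundles is Tannakian.   *)
(* Tensor products of strongly semistable bundles: in characteristic p, Frobenius pull-backs of a    *)
(* subbundle of positive degree would have too many sections; in characteristic 0, after a Galois    *)
(* cover a bundle contains lines of degree close to its slope, obtained by splitting a form of large *)
(* degree, whereas lines in a tensor product of degree 0 semistable bundles have degree at most 0.   *)
(* Finite bundles are the algebraic elements of the semiring of isomorphism classes, so they are     *)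
(* stable under sums and products up to subbundles; the slopes in their tensor powers are at most 0. *)
(* Covers etale over (X, P) have an etale compositum, as both local completions are given by P.      *)
From HB Require Import structures.
Require Import Defs.
From mathcomp Require Import all_boot all_order all_fingroup all_algebra all_field.
From mathcomp Require Import generic_quotient ring_quotient fraction.
From mathcomp Require Import boolp classical_sets functions cardinality fsbigop.
From mathcomp Require Import ring lra zify.
Set Implicit Arguments.
Unset Strict Implicit.
Unset Printing Implicit Defensive.
Import Order.TTheory GRing.Theory Num.Theory.
Local Open Scope classical_set_scope.
Local Open Scope ring_scope.
Local Open Scope quotient_scope.
Local Notation appM := app_comp.
Local Notation fdet := frame_det.

Implicit Types I J K : finType.

(** Everything is reduced to vector bundles on the one curve Y. The maximal destabilizing subspace
    of a Gamma-bundle is unique, hence invariant, so that equivariant semistability amounts to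
    semistability of the underlying bundle ([gss_ss0]). All three categories then consist of
    Gamma-bundles whose underlying bundle is semistable of degree 0 and satisfies a further
    condition.

    For a homomorphism of semistable bundles of degree 0, kernel and saturated image have degree at
    most 0, while the two degrees add up to at least 0. So both are 0 and the image is already
    saturated ([ss0_hom]). Kernels and cokernels are therefore computed on generic fibres, and a
    homomorphism vanishes as soon as its fibre at one point does ([ss0_rigid]). It follows
    ([tannakian_criterion]) that a class of such bundles is neutral Tannakian once it is stable
    under the tensor operations, direct sums and degree 0 sub- and quotient bundles. Scalars are the
    only endomorphisms of the unit because regular functions are constant ([regular_cst]). The
    geometry that enters, namely existence of zeros, weak approximation, the product formula
    ([tot_vord]), the inequality of Riemann ([riemann]) and the degree of a pull-back
    ([degree_cover]), is derived from the valuations.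

    For strongly semistable bundles the point is the tensor product. A section of the tensor product
    of A and B is a homomorphism from the dual of A to B, so by rigidity there are at most rank A
    times rank B independent sections. In characteristic p a subbundle of positive degree would
    acquire too many of them after Frobenius pull-backs ([tens_le_charp]). In characteristic 0 a
    bundle contains, after a cover, lines of degree close to its slope ([siegel2], [ach_slope]),
    whereas lines in the tensor product of two semistable bundles of degree 0 have degree at most 0
    ([tens_line]).

    For essentially finite bundles, isomorphism classes form a semiring in which finite bundles are
    the algebraic elements. Elimination without cancellation shows that (1 + x)(1 + y) is algebraic
    when x and y are ([sfinite_join]), and a comparison of maximal weights shows that finite bundles
    are semistable of degree 0 ([finite_sub_le]).

    For etale bundles, two trivializing covers are dominated by their compositum, which is etale
    over (X, P) because both completions at a point are given by P ([unramified_compositum]). Degree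
    0 sub- and quotient bundles of trivial bundles are trivial ([triv_subbundle],
    [triv_quotient]). *)

Lemma sum_enum (V : nmodType) I (F : I -> V) : \sum_i F i = \sum_(i < #|I|) F (enum_val i).
Proof.
rewrite (reindex (@enum_val _ predT)) //=.
by exists enum_rank => i _; [exact: enum_valK|exact: enum_rankK].
Qed.

(** * Linear dependence over a subfield *)

Section LinearDependence.
Variables (K R : fieldType) (s : {rmorphism K -> R}) (V : lmodType R).

(** [K] acts on the [R]-module through [s], so that the notion covers both functions over the
    constants and the extension of function fields given by a covering. *)
Definition free_over I (z : I -> V) : Prop :=
  forall c : I -> K, \sum_i s (c i) *: z i = 0 -> forall i, c i = 0.

Definition in_span J (b : J -> V) (v : V) : Prop := exists c : J -> K, v = \sum_j s (c j) *: b j.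

Lemma span_dependent I J (b : J -> V) (z : I -> V) : (forall i, in_span b (z i)) -> (#|J| < #|I|)%N ->
  exists2 c : I -> K, exists i, c i != 0 & \sum_i s (c i) *: z i = 0.
Proof.
move=> hz lt; have {hz} [C hC] := choice hz.
pose A := \matrix_(i < #|I|, j < #|J|) C (enum_val i) (enum_val j).
have : kermx A != 0.
  rewrite -mxrank_eq0 mxrank_ker -ltnNge.
  exact: leq_ltn_trans (rank_leq_col A) lt.
case/rowV0Pn => u /sub_kermxP uA u0; exists (fun i => u 0 (enum_rank i)).
  by have /rV0Pn[i hi] := u0; exists (enum_val i); rewrite enum_valK.
under eq_bigr do rewrite hC scaler_sumr.
rewrite exchange_big big1 // => j _.
transitivity (s ((u *m A) 0 (enum_rank j)) *: b j); last by rewrite uA mxE rmorph0 scale0r.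
rewrite mxE rmorph_sum scaler_suml sum_enum.
by apply: eq_bigr => i _; rewrite enum_valK mxE enum_rankK rmorphM scalerA.
Qed.

End LinearDependence.

Lemma ge_bound (T : eqType) (s : seq T) (F : T -> int) :
  exists N : nat, forall x, x \in s -> F x <= N%:Z.
Proof.
elim: s => [|x s [N hN]]; first by exists 0%N.
exists (N + `|F x|)%N => z; rewrite inE => /predU1P[->|/hN]; lia.
Qed.

Lemma free_ord (K R : fieldType) (s : {rmorphism K -> R}) (V : lmodType R) (H : finType) (z : H -> V) :
  free_over s z -> free_over s (fun i : 'I_#|H| => z (enum_val i)).
Proof.
move=> fz c e i; have := fz (fun h => c (enum_rank h)); rewrite sum_enum.
under eq_bigr do rewrite enum_valK.
by move=> /(_ e (enum_val i)); rewrite enum_valK.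
Qed.

Lemma free_inj (K R : fieldType) (s : {rmorphism K -> R}) (V : lmodType R) I J
    (z : I -> V) (h : J -> I) : free_over s z -> injective h -> free_over s (z \o h).
Proof.
move=> fz inj c e j; have := fz (fun i => \sum_(j | h j == i) c j) _ (h j).
rewrite (big_pred1 j) => [|j']; last by rewrite (inj_eq inj).
apply; apply: etrans e; under eq_bigr do rewrite rmorph_sum scaler_suml.
rewrite (exchange_big_dep xpredT) //=; apply: eq_bigr => j' _.
by rewrite (big_pred1 (h j')) // => i.
Qed.

Section PolyX.
Variable k : fieldType.

Lemma poly_decX (p : {poly k}) : exists q, p = q * 'X + (p`_0)%:P.
Proof.
elim/poly_ind: p => [|p c _]; first by exists 0; rewrite coef0 mul0r addr0.
by exists p; rewrite coefD coefMX coefC add0r.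
Qed.

(** The largest common power of ['X] is split off. Relations over k[a] are normalized in this way
    before being read at a zero of a, where a coefficient with nonzero constant term becomes a
    unit. *)
Lemma poly_divX I (p : I -> {poly k}) : (exists i, p i != 0) ->
  exists e (p' : I -> {poly k}), (forall i, p i = 'X^e * p' i) /\ exists i, (p' i)`_0 != 0.
Proof.
case=> i0; have [s] := ubnP (size (p i0)); elim: s p => // s IH p; rewrite ltnS => hs p0.
have [[i hi]|/forallNP h] := pselect (exists i, (p i)`_0 != 0).
  by exists 0%N, p; split=> [j|]; [rewrite mul1r|exists i].
have /choice[q E] i : exists q, p i = q * 'X.
  have [q e] := poly_decX (p i); exists q; rewrite {1}e.
  by have /negP/negPn/eqP -> := h i; rewrite addr0.
have q0 : q i0 != 0 by apply: contraNneq p0 => e; rewrite E e mul0r.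
have [|//|e [p' [hp' ex]]] := IH q; first by move: hs; rewrite E size_mulX.
by exists e.+1, p'; split=> // i; rewrite E hp' exprS mulrC mulrA.
Qed.

End PolyX.

(** * Sums of integer functions with finite support *)

Section Totals.
Variable T : choiceType.
Implicit Types (F G : T -> int) (s : seq T).

Definition fin_supp F := finite_set [set x | F x != 0].
(** Degrees of divisors will be such sums. The value is 0 when the support is infinite, a case
    handled by [tot_dflt]. *)
Definition tot F : int := \sum_(x \in [set: T]) F x.

Lemma tot_seq F s : uniq s -> (forall x, F x != 0 -> x \in s) -> tot F = \sum_(x <- s) F x.
Proof.
move=> us hs; rewrite (fsbig_seq _ _ us); symmetry; apply: fsbig_widen => // x [_ xs].
by apply/eqP; apply: contraT => /hs.
Qed.
Lemma fin_suppP F : fin_supp F -> exists2 s, uniq s & forall x, F x != 0 -> x \in s.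
Proof.
move=> /finite_seqP[s hs]; exists (undup s); first exact: undup_uniq.
by move=> x Fx; rewrite mem_undup; have : [set x | F x != 0] x by []; rewrite hs.
Qed.
Lemma fin_supp_eq F G : F =1 G -> fin_supp F -> fin_supp G.
Proof. by move=> /funext->. Qed.
Lemma tot_eq F G : F =1 G -> tot F = tot G.
Proof. by move=> /funext->. Qed.
Lemma fin_suppW F G : (forall x, G x != 0 -> F x != 0) -> fin_supp F -> fin_supp G.
Proof. by move=> h; apply: sub_finite_set => x; exact: h. Qed.
Lemma fin_suppU F G H : (forall x, H x != 0 -> F x != 0 \/ G x != 0) ->
  fin_supp F -> fin_supp G -> fin_supp H.
Proof.
move=> h hF hG; apply: (@sub_finite_set _ _ ([set x | F x != 0] `|` [set x | G x != 0])).
  by move=> x /h.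
by rewrite finite_setU.
Qed.
Lemma fin_suppD F G : fin_supp F -> fin_supp G -> fin_supp (fun x => F x + G x).
Proof. by apply: fin_suppU => x; have [->|] := eqVneq (F x) 0; [rewrite add0r; right|left]. Qed.
Lemma fin_suppN F : fin_supp F -> fin_supp (fun x => - F x).
Proof. by apply: fin_suppW => x; rewrite oppr_eq0. Qed.
Lemma fin_suppM F c : fin_supp F -> fin_supp (fun x => F x * c).
Proof. by apply: fin_suppW => x; rewrite mulf_eq0 => /norP[]. Qed.
Lemma tot0 : tot (fun=> 0) = 0.
Proof. by rewrite (@tot_seq _ [::]) ?big_nil // => x /eqP. Qed.
Lemma totD F G : fin_supp F -> fin_supp G -> tot (fun x => F x + G x) = tot F + tot G.
Proof.
move=> /fin_suppP[s us hs] /fin_suppP[r ur hr]; pose q := undup (s ++ r).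
have uq : uniq q := undup_uniq _.
have h H : (forall x, H x != 0 -> F x != 0 \/ G x != 0) -> tot H = \sum_(x <- q) H x.
  move=> h; apply: tot_seq => // x /h; rewrite mem_undup mem_cat.
  by case=> [/hs->//|/hr->]; rewrite orbT.
rewrite (h F (fun x hx => or_introl hx)) (h G (fun x hx => or_intror hx)) -big_split.
by apply: h => x; have [->|] := eqVneq (F x) 0; [rewrite add0r; right|left].
Qed.
Lemma tot_dflt F : ~ fin_supp F -> tot F = 0.
Proof.
move=> hF; rewrite /tot fsbig_dflt //; apply: contra_not hF.
by apply: sub_finite_set => x /eqP.
Qed.
Lemma totN F : tot (fun x => - F x) = - tot F.
Proof.
have [hF|hF] := pselect (fin_supp F).
  have [s us hs] := fin_suppP hF.
  by rewrite !(@tot_seq _ s) ?sumrN // => x; rewrite oppr_eq0; exact: hs.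
by rewrite !tot_dflt //; apply: contra_not hF; apply: fin_suppW => x; rewrite oppr_eq0.
Qed.
Lemma totM F c : tot (fun x => F x * c) = tot F * c.
Proof.
have [->|c0] := eqVneq c 0.
  by rewrite mulr0 -[RHS]tot0; apply: tot_eq => x; rewrite mulr0.
have [hF|hF] := pselect (fin_supp F).
  have [s us hs] := fin_suppP hF; rewrite !(@tot_seq _ s) ?mulr_suml // => x.
  by rewrite mulf_eq0 => /norP[/hs].
rewrite !tot_dflt ?mul0r //; apply: contra_not hF; apply: fin_suppW => x.
by rewrite mulf_eq0 (negbTE c0) orbF.
Qed.
Lemma tot_sum (I : Type) (r : seq I) (F : I -> T -> int) : (forall i, fin_supp (F i)) ->
  fin_supp (fun x => \sum_(i <- r) F i x) /\ tot (fun x => \sum_(i <- r) F i x) = \sum_(i <- r) tot (F i).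
Proof.
move=> h; elim: r => [|i r [IH1 IH2]].
  rewrite big_nil (@tot_eq _ (fun=> 0)) ?tot0 => [|x]; last by rewrite big_nil.
  split=> //; rewrite /fin_supp (_ : [set _ | _] = set0) //; apply/seteqP; split=> x //=.
  by rewrite big_nil.
rewrite big_cons -IH2 -totD // -(funext (fun x => big_cons _ _ _ _ xpredT (F^~ x))).
by split=> //; rewrite (funext (fun x => big_cons _ _ _ _ xpredT (F^~ x))); exact: fin_suppD.
Qed.
Lemma tot_ge0 F : (forall x, 0 <= F x) -> 0 <= tot F.
Proof.
move=> h; have [hF|hF] := pselect (fin_supp F).
  by have [s us hs] := fin_suppP hF; rewrite sumr_ge0.
by rewrite /tot fsbig_dflt //; apply: contra_not hF; apply: sub_finite_set => x /eqP.
Qed.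
Lemma tot_le F G : fin_supp F -> fin_supp G -> (forall x, F x <= G x) -> tot F <= tot G.
Proof.
move=> hF hG h; rewrite -subr_ge0 -totN -totD //; last exact: fin_suppN.
by apply: tot_ge0 => x; rewrite subr_ge0.
Qed.
Lemma tot_eq0 F : fin_supp F -> (forall x, 0 <= F x) -> tot F <= 0 -> forall x, F x = 0.
Proof.
move=> /fin_suppP[s us hs] h; rewrite (tot_seq us hs) => le x; apply/eqP; apply: contraT => Fx.
have /eqP : \sum_(x <- s) F x = 0 by apply/eqP; rewrite eq_le le sumr_ge0.
by rewrite psumr_eq0 // => /allP /(_ _ (hs _ Fx)) /eqP/eqP; rewrite (negbTE Fx).
Qed.
End Totals.

Section Curves.
Variable k : closedFieldType.

Section SingleCurve.
Variables (X : curve k).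
Local Notation L := (ff X).
Local Notation cst := (kcst X).
Implicit Types (y : place X) (a b : L) (V W : bundle X).

(** * Valuations at a place *)

Section Valuations.
Implicit Types (m : int).

(** Extends [in_pow] to negative exponents, so that poles of bounded order can be expressed; 0 is
    added by hand because its [vord] is the dummy value 0. *)
Definition vge y m a := (a == 0) || (m <= vord y a).

Lemma vge0 y m : vge y m 0. Proof. by rewrite /vge eqxx. Qed.
Lemma vgeE y m a : a != 0 -> vge y m a = (m <= vord y a).
Proof. by rewrite /vge => /negbTE->. Qed.
Lemma vge_vord y a : vge y (vord y a) a. Proof. by rewrite /vge lexx orbT. Qed.
Lemma vgeW y m m' a : m <= m' -> vge y m' a -> vge y m a.
Proof. by move=> h /orP[/eqP->|h']; rewrite ?vge0 // /vge (le_trans h h') orbT. Qed.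
Lemma vgeD y m a b : vge y m a -> vge y m b -> vge y m (a + b).
Proof.
rewrite /vge; have [->|a0] := eqVneq a 0; first by rewrite add0r.
have [->|b0] := eqVneq b 0; first by rewrite addr0 (negbTE a0).
have [//|ab0 /= ha hb] := eqVneq (a + b) 0.
by apply: le_trans (vordD y a0 b0 ab0); rewrite le_min ha.
Qed.
Lemma vgeN y m a : vge y m (- a) = vge y m a.
Proof. by rewrite /vge oppr_eq0 vordN. Qed.
Lemma vgeB y m a b : vge y m a -> vge y m b -> vge y m (a - b).
Proof. by move=> ha hb; apply: vgeD; rewrite ?vgeN. Qed.
Lemma vgeM y m m' a b : vge y m a -> vge y m' b -> vge y (m + m') (a * b).
Proof.
rewrite /vge; have [->|a0] := eqVneq a 0; first by rewrite mul0r eqxx.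
have [->|b0] := eqVneq b 0; first by rewrite mulr0 eqxx.
by rewrite /= => ha hb; rewrite vordM // mulf_eq0 (negbTE a0) (negbTE b0) lerD.
Qed.
Lemma vge_sum y m (I : Type) (r : seq I) (P : pred I) (F : I -> L) :
  (forall i, P i -> vge y m (F i)) -> vge y m (\sum_(i <- r | P i) F i).
Proof. by move=> h; elim/big_rec: _ => [|i a Pi]; [exact: vge0|exact/vgeD/h]. Qed.
Lemma in_ringE y a : in_ring y a = vge y 0 a. Proof. by []. Qed.
Lemma vge_cst y c : vge y 0 (kcst X c). Proof. exact: in_pow_cst. Qed.

Lemma vordV y a : vord y a^-1 = - vord y a.
Proof.
have [->|a0] := eqVneq a 0; first by rewrite invr0 vord0.
by apply/eqP; rewrite -addr_eq0 -vordM ?invr_eq0 // mulVf // vord1.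
Qed.
Lemma vordX y a n : vord y (a ^+ n) = vord y a *+ n.
Proof.
have [->|a0] := eqVneq a 0.
  by rewrite expr0n; case: n => [|n]; rewrite ?vord1 ?vord0 ?mul0rn.
elim: n => [|n IH]; first by rewrite vord1.
by rewrite exprS vordM ?expf_neq0 // IH mulrS.
Qed.
Lemma vordXz y a m : vord y (a ^ m) = vord y a * m.
Proof.
have pos (n : nat) : vord y (a ^ n) = vord y a * n by rewrite vordX -mulr_natr natz.
by case: m => n //; rewrite NegzE vordV pos mulrN.
Qed.
Lemma vgeX y a n : vge y 0 a -> vge y 0 (a ^+ n).
Proof.
by move=> h; elim: n => [|n IH]; rewrite ?exprS; [exact: in_ring1|exact: vgeM h IH].
Qed.
Lemma vord_prod y I (F : I -> L) : (forall i, F i != 0) -> vord y (\prod_i F i) = \sum_i vord y (F i).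
Proof.
move=> h; have [] : \prod_i F i != 0 /\ vord y (\prod_i F i) = \sum_i vord y (F i); last by [].
elim/big_rec2: _ => [|i x y' _ [y0 <-]]; first by rewrite oner_eq0 vord1.
by rewrite mulf_neq0 // vordM.
Qed.

Lemma unif_ex y : exists2 t, t != 0 & vord y t = 1.
Proof.
have [t ht] := vord_surj y; exists t => //; apply/eqP => t0.
by move/eqP: ht; rewrite t0 vord0.
Qed.

(** If the sum had a larger valuation, so would [a], being the difference of the sum and [b]. *)
Lemma vord_dom y a b : a != 0 -> vge y (vord y a + 1) b -> a + b != 0 /\ vord y (a + b) = vord y a.
Proof.
move=> a0 hb; have ab : a + b != 0.
  apply: contraL hb; rewrite addr_eq0 => /eqP ab.
  by rewrite -vgeN -ab vgeE; lia.
split=> //; apply/eqP; rewrite eq_le -[_ <= vord y a]negbK -ltNge -!vgeE //.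
apply/andP; split; last by apply: vgeD (vge_vord _ _) (vgeW _ hb); lia.
apply/negP => h; have : vge y (vord y a + 1) a.
  rewrite -[X in vge _ _ X](addrK b); apply: vgeB hb; rewrite vgeE //.
  by rewrite -lezD1 in h *.
by rewrite vgeE; lia.
Qed.

Lemma sum_dom y I (F : I -> L) j : F j != 0 ->
  (forall i, i != j -> vge y (vord y (F j) + 1) (F i)) -> \sum_i F i != 0.
Proof.
move=> Fj h; rewrite (bigD1 j) //=.
by have [] := @vord_dom y (F j) (\sum_(i | i != j) F i) Fj (vge_sum _ h).
Qed.

(* Discrete valuation rings are maximal subrings. *)
Lemma place_eq y z : (forall a, vge y 0 a -> vge z 0 a) -> y = z.
Proof.
move=> h; have [t t0 yt] := unif_ex y.
have u0 a : a != 0 -> vord y a = 0 -> vord z a = 0.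
  move=> a0 ya; have := h a; have := h a^-1.
  by rewrite !vgeE ?invr_eq0 // !vordV ya => /(_ isT) + /(_ isT); lia.
have E a : vord z a = vord z t * vord y a.
  have [->|a0] := eqVneq a 0; first by rewrite !vord0 mulr0.
  have t' m : t ^ m != 0 by rewrite expfz_neq0.
  have := u0 (a * t ^ (- vord y a)); rewrite mulf_neq0 // !vordM // !vordXz yt mul1r subrr.
  by move=> /(_ isT erefl); lia.
have [s zs] := vord_surj z.
(* [vord z] is [vord z t] times [vord y] and takes the value 1, so [vord z t] divides 1; it is
   nonnegative because [t] is integral at [y]. *)
have zt : vord z t = 1.
  have : 0 <= vord z t by rewrite -vgeE //; apply: h; rewrite vgeE // yt.
  move: (E s); rewrite zs => E1 ge; have : (`|vord z t| %| 1)%N.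
    by apply/dvdnP; exists `|vord y s|%N; rewrite mulnC -abszM -E1.
  by rewrite dvdn1; lia.
have {E zt} : vord y = vord z by apply/funext => a; rewrite E zt mul1r.
case: y z {h t0 yt u0 zs} => [v p1 p2 p3 p4 p5] [w q1 q2 q3 q4 q5] /= vw.
by case: _ / vw in q1 q2 q3 q4 q5 *; congr Place.
Qed.

End Valuations.

(** * The function field over its subfields k(a) *)

Section FunctionFields.
Implicit Types (t x : L) (p q : {poly k}).

Definition pev a p : L := (map_poly cst p).[a].
Lemma pevD a p q : pev a (p + q) = pev a p + pev a q.
Proof. by rewrite /pev rmorphD hornerD. Qed.
Lemma pevM a p q : pev a (p * q) = pev a p * pev a q.
Proof. by rewrite /pev rmorphM hornerM. Qed.
Lemma pev0 a : pev a 0 = 0. Proof. by rewrite /pev rmorph0 horner0. Qed.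
Lemma pev1 a : pev a 1 = 1. Proof. by rewrite /pev rmorph1 hornerC. Qed.
Lemma pevC a c : pev a c%:P = cst c. Proof. by rewrite /pev map_polyC hornerC. Qed.
Lemma pevX a : pev a 'X = a. Proof. by rewrite /pev map_polyX hornerX. Qed.
Lemma pevXn a n : pev a 'X^n = a ^+ n.
Proof. by rewrite /pev map_polyXn hornerXn. Qed.
Lemma pevZ a c p : pev a (c *: p) = cst c * pev a p.
Proof. by rewrite -mul_polyC pevM pevC. Qed.
Lemma pev_sum a (I : Type) (r : seq I) (P : pred I) (F : I -> {poly k}) :
  pev a (\sum_(i <- r | P i) F i) = \sum_(i <- r | P i) pev a (F i).
Proof. by rewrite /pev rmorph_sum horner_sum. Qed.
Lemma pevE a p n : (size p <= n)%N -> pev a p = \sum_(i < n) cst p`_i * a ^+ i.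
Proof.
move=> le; have {1}-> : p = \poly_(i < n) p`_i.
  apply/polyP => i; rewrite coef_poly; case: ltnP => // h.
  by rewrite nth_default // (leq_trans le).
by rewrite poly_def pev_sum; apply: eq_bigr => i _; rewrite pevZ pevXn.
Qed.

Definition transc a := forall p, p != 0 -> pev a p != 0.

Lemma pev_prod a (r : seq k) c :
  pev a (c *: \prod_(z <- r) ('X - z%:P)) = cst c * \prod_(z <- r) (a - cst z).
Proof.
rewrite pevZ; congr (_ * _); elim: r => [|z r IH]; first by rewrite !big_nil pev1.
by rewrite !big_cons pevM IH pevD -polyCN pevC pevX rmorphN.
Qed.

(** As k is algebraically closed, a polynomial vanishing at [a] is a product of linear factors, and
    one of these vanishes at [a]. *)
Lemma transcP a : transc a \/ exists c, a = cst c.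
Proof.
have [|/existsNP[p /not_implyP[p0 /negP/negPn/eqP]]] := pselect (transc a); first by left.
have [r ->] := closed_field_poly_normal p; rewrite pev_prod => /eqP.
rewrite mulf_eq0 fmorph_eq0 lead_coef_eq0 (negbTE p0) prodf_seq_eq0 => /hasP[z _].
by rewrite subr_eq0 => /eqP->; right; exists z.
Qed.

Lemma transc_neq0 a : transc a -> a != 0.
Proof. by move=> h; have := h 'X; rewrite polyX_eq0 pevX; apply. Qed.
Lemma transcV a : transc a -> transc a^-1.
Proof.
move=> ta; have [//|[c ac]] := transcP a^-1.
have := ta ('X - c^-1%:P); rewrite polyXsubC_eq0 => /(_ isT).
by rewrite pevD -polyCN pevC pevX rmorphN fmorphV -ac invrK subrr eqxx.
Qed.

(** Linear independence over k(a), with denominators cleared. *)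
Definition kfree I (z : I -> L) a : Prop :=
  forall p : I -> {poly k}, \sum_i pev a (p i) * z i = 0 -> forall i, p i = 0.

Section Counting.
Variables (t : L) (tt : transc t) (n : nat) (b : 'I_n -> L).
Hypothesis hb : forall x, exists2 q, q != 0 &
  exists r : 'I_n -> {poly k}, pev t q * x = \sum_j pev t (r j) * b j.

(** A filtration of the function field by spaces of dimension at most [l * n] over the constants, in
    which the counting takes place. *)
Let sp l x := exists2 r : 'I_n -> {poly k}, forall j, (size (r j) <= l)%N & x = \sum_j pev t (r j) * b j.

Let spW l l' x : (l <= l')%N -> sp l x -> sp l' x.
Proof. by move=> h [r hr ->]; exists r => // j; exact: leq_trans (hr j) h. Qed.

Let sp_sum l J (F : J -> L) : (forall j, sp l (F j)) -> sp l (\sum_j F j).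
Proof.
move=> h; elim/big_rec: _ => [|i x _ [r hr ->]].
  by exists (fun=> 0) => [j|]; rewrite ?size_poly0 // big1 // => j _; rewrite pev0 mul0r.
have [r' hr' ->] := h i; exists (fun j => r' j + r j) => [j|].
  by rewrite (leq_trans (size_polyD _ _)) // geq_max hr hr'.
by rewrite -big_split; apply: eq_bigr => j _; rewrite pevD mulrDl.
Qed.

Let spM l q x : sp l x -> sp (l + size q) (pev t q * x).
Proof.
case=> r hr ->; exists (fun j => q * r j) => [j|].
  rewrite (leq_trans (size_polyMleq _ _)) // (leq_trans (leq_pred _)) // addnC.
  by rewrite leq_add2r.
by rewrite mulr_sumr; apply: eq_bigr => j _; rewrite pevM mulrA.
Qed.

Let sp_clear J (x : J -> L) : exists2 q, q != 0 & exists l, forall j, sp l (pev t q * x j).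
Proof.
have /choice[Q /choice[r hr]] j : exists q, exists r : 'I_n -> {poly k},
    q != 0 /\ pev t q * x j = \sum_j pev t (r j) * b j.
  by have [q q0 [r hr]] := hb (x j); exists q, r.
exists (\prod_j Q j); first by apply/prodf_neq0 => j _; case: (hr j).
pose F j := \sum_i size (r j i) + size (\prod_(i | i != j) Q i).
exists (\sum_j F j)%N => j; apply: (@spW (F j)); first exact: leq_bigmax_sum || by rewrite (bigD1 j) //= leq_addr.
rewrite (bigD1 j) //= [Q j * _]mulrC pevM -mulrA (proj2 (hr j)); apply: spM.
by exists (r j) => // i; rewrite (bigD1 i) //= leq_addr.
Qed.

Let sp_dep l (H : finType) (x : H -> L) : (forall h, sp l (x h)) -> (l * n < #|H|)%N ->
  exists2 c : H -> k, exists h, c h != 0 & \sum_h cst (c h) * x h = 0.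
Proof.
move=> hx lt; have := @span_dependent k L cst L^o H ('I_l * 'I_n)%type (fun e => t ^+ e.1 * b e.2) x.
apply; last by rewrite card_prod !card_ord.
move=> h; have [r hr ->] := hx h; exists (fun e : 'I_l * 'I_n => (r e.2)`_e.1).
rewrite -(pair_bigA _ (fun (e : 'I_l) j => cst (r j)`_e * (t ^+ e * b j))) exchange_big.
apply: eq_bigr => j _; rewrite (pevE t (hr j)) mulr_suml.
by apply: eq_bigr => e _; rewrite mulrA.
Qed.

(** The elements q(t)^s a^i q1(t) z_h with i <= s are [(s + 1) * #|H|] in number and lie in a space
    of dimension at most [(l + s * l1) * n]. For large [s] they are dependent over the constants,
    and collecting the powers of [a] gives the relation. *)
Let count_dep a q l1 (H : finType) (z : H -> L) : q != 0 ->
  (forall l x, sp l x -> sp (l + l1) (pev t q * x)) ->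
  (forall l x, sp l x -> sp (l + l1) (pev t q * a * x)) -> (l1 * n < #|H|)%N ->
  exists2 p : H -> {poly k}, exists h, p h != 0 & \sum_h pev a (p h) * z h = 0.
Proof.
move=> q0 hq hqa lt; have [q1 q10 [l hl]] := sp_clear z; pose s := (l * n)%N.
have h1 i x l' : sp l' x -> sp (l' + i * l1) (pev t q ^+ i * x).
  elim: i => [|i IH] in x l' *; first by rewrite mul1r addn0.
  by rewrite exprS -mulrA mulSn [(l1 + _)%N]addnC addnA => /IH/hq.
have h2 i x l' : sp l' x -> sp (l' + i * l1) ((pev t q * a) ^+ i * x).
  elim: i => [|i IH] in x l' *; first by rewrite mul1r addn0.
  by rewrite exprS -mulrA mulSn [(l1 + _)%N]addnC addnA => /IH/hqa.
pose x (e : 'I_s.+1 * H) := pev t q ^+ s * a ^+ e.1 * (pev t q1 * z e.2).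
have hx e : sp (l + s * l1) (x e).
  have le : (e.1 <= s)%N by rewrite -ltnS.
  have := h1 (s - e.1)%N _ _ (h2 e.1 _ _ (hl e.2)).
  rewrite -addnA -mulnDl subnKC // exprMn -(mulrA (_ ^+ e.1)) (mulrA (_ ^+ (s - _))).
  by rewrite -exprD subnK // mulrA.
have [|c [[i0 h0] c0] e] := sp_dep hx.
  rewrite card_prod card_ord; nia.
exists (fun h => \poly_(i < s.+1) c (inord i, h)).
  exists h0; apply: contraNneq c0 => /polyP/(_ i0); rewrite coef_poly ltn_ord coef0.
  by rewrite inord_val => ->.
have u0 : pev t q ^+ s * pev t q1 != 0 by rewrite mulf_neq0 ?expf_neq0 ?tt.
apply: (mulfI u0); rewrite mulr0; apply: etrans e; rewrite mulr_sumr.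
transitivity (\sum_i \sum_h cst (c (i, h)) * x (i, h)); last first.
  by rewrite pair_bigA; apply: eq_bigr => -[].
rewrite exchange_big.
apply: eq_bigr => h _; rewrite (pevE a (size_poly _ _)) mulr_suml mulr_sumr.
apply: eq_bigr => i _; rewrite coef_poly ltn_ord inord_val /x; ring.
Qed.

(** One denominator [q] clears all the products [a * b j], so multiplication by [q] and by [q * a]
    raises the filtration by a constant, as [count_dep] requires. *)
Lemma bounded_dep a : exists D, forall (H : finType) (z : H -> L), (D < #|H|)%N ->
  exists2 p : H -> {poly k}, exists h, p h != 0 & \sum_h pev a (p h) * z h = 0.
Proof.
have [q q0 [l hl]] := sp_clear (fun j => a * b j).
exists ((l + size q) * n)%N => H z; apply: (@count_dep a q) => // l' x h.
  by apply: spW (spM q h); rewrite leq_add2l leq_addl.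
case: h => r hr ->; rewrite mulr_sumr; apply: sp_sum => j.
rewrite mulrCA -[_ * a * _]mulrA; apply: (@spW (l + size (r j))); last exact/spM.
by rewrite addnC leq_add ?leq_addr.
Qed.

End Counting.

Lemma ff_bounded_dep a : exists D, forall (H : finType) (z : H -> L), (D < #|H|)%N ->
  exists2 p : H -> {poly k}, exists h, p h != 0 & \sum_h pev a (p h) * z h = 0.
Proof.
have [t [ht [n [b hb]]]] := curveP X; apply: (@bounded_dep t _ n b) => // x.
have [c [hc ->]] := hb x.
have /choice[p /choice[q hpq]] j : exists p q : {poly k}, pev t q != 0 /\ c j = pev t p / pev t q.
  exact: hc.
exists (\prod_j q j).
  apply/prodf_neq0 => j _; apply: contraNneq (proj1 (hpq j)) => ->; by rewrite pev0.
exists (fun j => p j * \prod_(i | i != j) q i); rewrite mulr_sumr; apply: eq_bigr => j _.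
have [q0 ->] := hpq j; rewrite (bigD1 j) //= !pevM.
by field.
Qed.

(** A basis over k(a) expressed without fractions; for transcendental [a] the number [n] is the
    degree of the function field over k(a). *)
Definition kbasis a n (b : 'I_n -> L) : Prop :=
  kfree b a /\ forall (H : finType) (z : H -> L), (n < #|H|)%N -> ~ kfree z a.

Lemma not_kfree (H : finType) (z : H -> L) a :
  (exists2 p : H -> {poly k}, exists h, p h != 0 & \sum_h pev a (p h) * z h = 0) -> ~ kfree z a.
Proof. by case=> p [h ph] e /(_ p e h) /eqP; rewrite (negbTE ph). Qed.
Lemma kfree_ord (H : finType) (z : H -> L) a : kfree z a -> kfree (fun i : 'I_#|H| => z (enum_val i)) a.
Proof.
move=> fz p e i; have := fz (fun h => p (enum_rank h)); rewrite sum_enum.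
under eq_bigr do rewrite enum_valK.
by move=> /(_ e (enum_val i)); rewrite enum_valK.
Qed.

Lemma kbasis_ex a : transc a -> exists n (b : 'I_n -> L), kbasis a b.
Proof.
move=> ta; have [D hD] := ff_bounded_dep a.
pose P n := `[< exists z : 'I_n -> L, kfree z a >].
have P0 : exists n, P n by exists 0%N; apply/asboolP; exists (fun=> 0) => p _ [].
have PD n : P n -> (n <= D)%N.
  move/asboolP => [z fz]; rewrite leqNgt; apply/negP => lt.
  by apply: (not_kfree (hD _ z _) fz); rewrite card_ord.
case: (ex_maxnP P0 PD) => n /asboolP[b fb] max; exists n, b; split=> // H z lt /kfree_ord fz.
have /max : P #|H| by apply/asboolP; eexists; exact: fz.
by rewrite leqNgt lt.
Qed.

End FunctionFields.

(** * Residue fields *)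

Section ResidueField.
Implicit Types (t x : L) (p q : {poly k}).

(** Otherwise every [a - cst c] is a unit at [y], and so is every nonzero polynomial in [a], k being
    algebraically closed. Then the powers of a uniformizer are free over k[a], their terms having
    distinct valuations, against [ff_bounded_dep]. *)
Lemma residue_ex y a : vge y 0 a -> exists c, vge y 1 (a - cst c).
Proof.
move=> ha; apply: contrapT => /forallNP h.
have u p : p != 0 -> pev a p != 0 /\ vord y (pev a p) = 0.
  move=> p0; have [r ->] := closed_field_poly_normal p; rewrite pev_prod.
  have lc : cst (lead_coef p) != 0 by rewrite fmorph_eq0 lead_coef_eq0.
  have [] : \prod_(z <- r) (a - cst z) != 0 /\ vord y (\prod_(z <- r) (a - cst z)) = 0.
    elim: r => [|z r [IH1 IH2]]; first by rewrite big_nil oner_eq0 vord1.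
    have := h z; rewrite /vge => /negP; rewrite negb_or => /andP[n0 lt].
    have := vgeB ha (vge_cst y z); rewrite vgeE // => ge.
    by rewrite big_cons mulf_neq0 // vordM //; lia.
  by move=> n0 e; rewrite mulf_neq0 // vordM // vord_cst e.
have [D hD] := ff_bounded_dep a; have [t t0 yt] := unif_ex y.
have [|p [h0 ph0] e] := hD 'I_D.+1 (fun i => t ^+ i); first by rewrite card_ord.
case: (arg_minnP (fun i : 'I_D.+1 => i : nat) (P := fun i => p i != 0) ph0) => j pj min.
suff /eqP : \sum_i pev a (p i) * t ^+ i != 0 by rewrite e.
have [pj0 vj] := u _ pj.
apply: (@sum_dom y _ _ j); first by rewrite mulf_neq0 ?expf_neq0.
move=> i ij; have [->|pi] := eqVneq (p i) 0; first by rewrite pev0 mul0r vge0.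
have [pi0 vi] := u _ pi; rewrite vgeE ?mulf_neq0 ?expf_neq0 // !vordM ?expf_neq0 //.
rewrite !vordX; have := min i pi; rewrite leq_eqVlt eq_sym.
by rewrite val_eqE (negbTE ij); lia.
Qed.

Definition res y a : k := if pselect (exists c, vge y 1 (a - cst c)) is left h then projT1 (cid h) else 0.

Lemma resP y a : vge y 0 a -> vge y 1 (a - cst (res y a)).
Proof.
move=> ha; rewrite /res; case: pselect => [h|]; first exact: projT2 (cid h).
by case; exact: residue_ex.
Qed.
Lemma cst_vge1 y c : vge y 1 (cst c) -> c = 0.
Proof.
have [//|c0] := eqVneq c 0; by rewrite vgeE ?fmorph_eq0 // vord_cst.
Qed.
Lemma resE y a c : vge y 1 (a - cst c) -> res y a = c.
Proof.
move=> h; apply/eqP; rewrite -subr_eq0; apply/eqP/(@cst_vge1 y).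
have -> : cst (res y a - c) = (a - cst c) - (a - cst (res y a)) by rewrite rmorphB; ring.
apply: vgeB => //; apply: resP; rewrite -[a](subrK (cst c)).
by apply: vgeD (vge_cst _ _); apply: vgeW h.
Qed.
Lemma res_cst y c : res y (cst c) = c.
Proof. by apply: resE; rewrite subrr vge0. Qed.
Lemma resD y a b : vge y 0 a -> vge y 0 b -> res y (a + b) = res y a + res y b.
Proof.
move=> /resP ha /resP hb; apply: resE; rewrite rmorphD.
by rewrite opprD addrACA vgeD.
Qed.
Lemma resM y a b : vge y 0 a -> vge y 0 b -> res y (a * b) = res y a * res y b.
Proof.
move=> ha hb; apply: resE; rewrite rmorphM.
have -> : a * b - cst (res y a) * cst (res y b) =
  a * (b - cst (res y b)) + cst (res y b) * (a - cst (res y a)) by ring.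
apply: vgeD; first by rewrite -[1]add0r; apply: vgeM ha (resP hb).
by rewrite -[1]add0r; apply: vgeM (vge_cst _ _) (resP ha).
Qed.
Lemma res_eq0 y a : vge y 0 a -> (res y a = 0) <-> vge y 1 a.
Proof.
move=> ha; split=> [r0|h]; first by have := resP ha; rewrite r0 rmorph0 subr0.
by apply: resE; rewrite rmorph0 subr0.
Qed.
Lemma res_sum y I (F : I -> L) : (forall i, vge y 0 (F i)) -> res y (\sum_i F i) = \sum_i res y (F i).
Proof.
move=> h; have [] : vge y 0 (\sum_i F i) /\ res y (\sum_i F i) = \sum_i res y (F i); last by [].
elim/big_rec2: _ => [|i x z _ [h1 h2]]; first by rewrite vge0 -(rmorph0 cst) res_cst.
by rewrite vgeD // resD // h2.
Qed.

End ResidueField.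

(** * Zeros of nonconstant functions *)

(* Chevalley's extension of places: a subring of L which is maximal among    *)
(* those containing k and a but not the inverse of a is a discrete valuation *)
(* ring.                                                                     *)
Section PlaceExistence.
Variables (a : L) (ta : transc a).
Let a0 : a != 0 := transc_neq0 ta.

Definition good_ring (R : set L) : Prop :=
  [/\ forall c, R (cst c), R a, forall x z, R x -> R z -> R (x - z),
      forall x z, R x -> R z -> R (x * z) & ~ R a^-1].

(** Zorn's lemma, starting from k[a], which does not contain the inverse of [a] because [a] is
    transcendental. *)
Lemma max_good_ring : exists R, good_ring R /\ forall R', good_ring R' -> R `<=` R' -> R' = R.
pose R0 : set L := [set x | exists p, x = pev a p].
have g0 : good_ring R0.
  split=> [c||_ _ [p ->] [q ->]|_ _ [p ->] [q ->]|[p e]].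
  - by exists c%:P; rewrite pevC.
  - by exists 'X; rewrite pevX.
  - by exists (p + -1 *: q); rewrite pevD pevZ rmorphN1 mulN1r.
  - by exists (p * q); rewrite pevM.
  have n0 : 'X * p - 1 != 0.
    apply/eqP => /(congr1 (horner^~ 0)); rewrite hornerD hornerM hornerX mul0r add0r hornerN hornerC horner0.
    by move/eqP; rewrite oppr_eq0 oner_eq0.
  by have /eqP := ta n0; rewrite pevD pevM pevX -e divff // -polyCN pevC rmorphN1 subrr.
pose T := {R : set L | good_ring R}.
pose rel (A B : T) := `[< sval A `<=` sval B >].
have [] := @Zorn T rel.
- by move=> A; apply/asboolP.
- by move=> A B C /asboolP h1 /asboolP h2; apply/asboolP; exact: subset_trans h2.
- move=> [A gA] [B gB] /asboolP h1 /asboolP h2; apply: eq_exist.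
  by apply/seteqP.
- move=> C totC; have [[A CA]|C0] := pselect (exists A, C A); last first.
    by exists (exist _ R0 g0) => s Cs; case: C0; exists s.
  pose U : set L := [set x | exists2 B, C B & sval B x].
  have gU : good_ring U.
    split=> [c||x z|x z|].
    - by exists A => //; case: (svalP A).
    - by exists A => //; case: (svalP A).
    - move=> [B CB Bx] [D CD Dz]; have [/asboolP h|/asboolP h] := totC _ _ CB CD.
        by exists D => //; case: (svalP D) => _ _ + _ _; apply=> //; exact: h.
      by exists B => //; case: (svalP B) => _ _ + _ _; apply=> //; exact: h.
    - move=> [B CB Bx] [D CD Dz]; have [/asboolP h|/asboolP h] := totC _ _ CB CD.
        by exists D => //; case: (svalP D) => _ _ _ + _; apply=> //; exact: h.
      by exists B => //; case: (svalP B) => _ _ _ + _; apply=> //; exact: h.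
    - by case=> B CB Ba; case: (svalP B).
  by exists (exist _ U gU) => B CB; apply/asboolP => x Bx; exists B.
move=> [R gR] max; exists R; split=> // R' gR' sub.
by have /(congr1 sval) := max (exist _ R' gR') (asboolT sub).
Qed.

Variables (R : set L) (gR : good_ring R).
Hypothesis maxR : forall R', good_ring R' -> R `<=` R' -> R' = R.

Let Rc c : R (cst c). Proof. by case: gR. Qed.
Let Ra : R a. Proof. by case: gR. Qed.
Let RB x z : R x -> R z -> R (x - z). Proof. by case: gR => _ _ + _ _; exact. Qed.
Let RM x z : R x -> R z -> R (x * z). Proof. by case: gR => _ _ _ + _; exact. Qed.
Let Rna : ~ R a^-1. Proof. by case: gR. Qed.
Let R0 : R 0. Proof. by rewrite -(rmorph0 cst). Qed.
Let R1 : R 1. Proof. by rewrite -(rmorph1 cst). Qed.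
Let RN x : R x -> R (- x). Proof. by rewrite -sub0r; apply: RB. Qed.
Let RD x z : R x -> R z -> R (x + z). Proof. by move=> hx hz; rewrite -[z]opprK; apply/RB/RN. Qed.
Let RX x n : R x -> R (x ^+ n).
Proof. by move=> h; elim: n => [|n IH]; rewrite ?exprS //; exact: RM. Qed.
Let R_sum (I : Type) (r : seq I) (F : I -> L) : (forall i, R (F i)) -> R (\sum_(i <- r) F i).
Proof. by move=> h; elim/big_rec: _ => // i x _; exact/RD. Qed.

(** By maximality R[x] is not good, and the only condition that it can violate is the last one. *)
Let adjoin x (hx : ~ R x) : exists p : {poly L}, (forall i, R p`_i) /\ p.[x] = a^-1.
Proof.
pose R' : set L := [set z | exists p : {poly L}, (forall i, R p`_i) /\ p.[x] = z].
apply: contrapT => hn; have gR' : good_ring R'.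
  split=> [c||_ _ [p [hp <-]] [q [hq <-]]|_ _ [p [hp <-]] [q [hq <-]]|] //.
  - exists (cst c)%:P; split=> [i|]; last by rewrite hornerC.
    by rewrite coefC; case: eqP.
  - exists a%:P; split=> [i|]; last by rewrite hornerC.
    by rewrite coefC; case: eqP.
  - exists (p - q); split=> [i|]; last by rewrite hornerD hornerN.
    by rewrite coefB; apply: RB.
  - exists (p * q); split=> [i|]; last by rewrite hornerM.
    by rewrite coefM; apply: R_sum => j; apply: RM.
suff e : R' = R by apply: hx; rewrite -e; exists 'X; split=> [i|]; rewrite ?hornerX // coefX; case: eqP.
apply: maxR => // z hz; exists z%:P; split=> [i|]; last by rewrite hornerC.
by rewrite coefC; case: eqP.
Qed.

(** Otherwise 1/a is a polynomial in the inverse of [u = 1 - a * r], so some power of [u] lies in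
    aR. As all powers of [u] are 1 modulo aR, the element 1 would lie in aR. *)
Let unit1 r : R r -> R (1 - a * r)^-1.
Proof.
move=> hr; apply: contrapT => /adjoin[p [hp e]]; set u := 1 - a * r in e.
have hu : R u by apply: RB => //; apply: RM.
have u0 : u != 0.
  apply/eqP => u0; apply: Rna; move/eqP: u0; rewrite subr_eq0 => /eqP e1.
  by rewrite -[a^-1]mulr1 e1 mulKf.
have [s hs] : exists2 s, R s & u ^+ (size p) = a * s.
  exists (\sum_(i < size p) p`_i * u ^+ (size p - i)).
    by apply: R_sum => i; apply: RM => //; exact: RX.
  have {1}-> : u ^+ size p = a * (p.[u^-1] * u ^+ size p) by rewrite e mulVKf.
  congr (_ * _); rewrite horner_coef mulr_suml; apply: eq_bigr => i _.
  have -> : u ^+ size p = u ^+ (size p - i) * u ^+ i by rewrite -exprD subnK // ltnW.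
  by rewrite -mulrA exprVn (mulrC (u ^+ _)) mulKf ?expf_neq0.
have [s' hs' e'] : exists2 s', R s' & u ^+ (size p) = 1 - a * s'.
  elim: (size p) => [|n [s' hs' e']]; first by exists 0; rewrite ?mulr0 ?subr0.
  exists (r + s' - r * a * s'); last by rewrite exprS e' /u; ring.
  by apply: RB; [exact: RD|apply: RM => //; exact: RM].
move=> h; apply: Rna; have -> : a^-1 = s + s'; last exact: RD.
by apply: (mulfI a0); rewrite divff // mulrDr -h e' subrK.
Qed.

Let inv1 r : R r -> a * r = 1 -> False.
Proof. by move=> hr e; apply: Rna; rewrite -[a^-1]mulr1 -e mulKf. Qed.

Let rel1 x n := exists p : {poly L}, [/\ forall i, R p`_i, (size p <= n.+1)%N & a * p.[x] = 1].

(** If both were missing, 1 would be [a] times a polynomial in [x] and also [a] times a polynomial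
    in the inverse of [x]. The relation of larger degree can be shortened by means of the other,
    until degree 0 contradicts the absence of 1/a. *)
Let val_ring x : R x \/ R x^-1.
Proof.
apply: contrapT => /not_orP[hx hxi].
have x0 : x != 0 by apply/eqP => x0; apply: hx; rewrite x0.
have ex z : ~ R z -> exists n, rel1 z n.
  by move/adjoin=> [p [hp e]]; exists (size p), p; rewrite e divff.
suff H s z n m : (n + m <= s)%N -> (m <= n)%N -> z != 0 -> rel1 z n -> rel1 z^-1 m -> False.
  have [n hn] := ex _ hx; have [m hm] := ex _ hxi.
  have [le|lt] := leqP m n; first exact: (H _ _ _ _ (leqnn _) le x0 hn hm).
  by apply: (H _ x^-1 _ _ (leqnn _) (ltnW lt)); rewrite ?invr_eq0 ?invrK.
elim: s z n m => [|s IH] z n m lenm lemn z0 [p [hp sp ep]] [q [hq sq eq]].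
  move: lenm; rewrite leqn0 addn_eq0 => /andP[/eqP n0 _]; move: sp; rewrite n0 => /size1_polyC p0.
  by move: ep; rewrite p0 hornerC; exact: inv1.
case: n => [|n] in lenm lemn sp *.
  by move/size1_polyC: sp => p0; move: ep; rewrite p0 hornerC; exact: inv1.
have Ru := unit1 (hq 0%N); set u := 1 - a * q`_0 in Ru.
have eu : \sum_(j < m) a * q`_j.+1 * z^-1 ^+ j.+1 = u.
  rewrite /u -eq (horner_coef_wide _ sq) big_ord_recl mulr1 mulrDr addrAC subrr add0r.
  by rewrite mulr_sumr; apply: eq_bigr => j _; rewrite mulrA.
have u0 : u != 0.
  by apply/eqP => /eqP; rewrite subr_eq0 => /eqP e1; apply: (inv1 (hq 0%N)).
(* Multiplied by the power n + 1 of [z], the second relation expresses [u * z ^+ n.+1] through lower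
   powers; as [u] is invertible in R, this replaces the leading term of [p]. *)
pose p' := p - p`_n.+1 *: 'X^(n.+1) + \sum_(j < m) (a * p`_n.+1 * q`_j.+1 / u) *: 'X^(n - j).
suff hz : rel1 z n.
  have [le|lt] := leqP m n; first by apply: (IH z n m) => //; exists q.
  apply: (IH z^-1 m n); rewrite ?invr_eq0 ?invrK //; first by rewrite addnC.
    exact: ltnW.
  by exists q.
exists p'; split=> [i||].
- rewrite !coefD coefN coefZ coefXn coef_sum; apply: RD; first by apply: RB => //; apply: RM => //; case: eqP.
  apply: R_sum => j; rewrite coefZ; apply: RM; last by rewrite coefXn; case: eqP.
  by do 2 apply: RM => //; exact: RM.
- apply/leq_sizeP => i hi; rewrite !coefD coefN coefZ coefXn coef_sum big1 => [|j _].
    rewrite addr0; have [->|ni] := eqVneq i n.+1; first by rewrite mulr1 subrr.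
    by rewrite mulr0 subr0 nth_default // (leq_trans sp) // ltn_neqAle eq_sym ni.
  rewrite coefZ coefXn; case: eqP => [e|_]; last by rewrite mulr0.
  by move: hi; rewrite e ltnNge leq_subr.
rewrite -ep !hornerD hornerN hornerZ hornerXn horner_sum; congr (_ * _).
rewrite -[RHS]addr0 -addrA; congr (_ + _); rewrite addrC; apply/eqP; rewrite subr_eq0; apply/eqP.
transitivity (p`_n.+1 * z ^+ n.+1 / u * \sum_(j < m) a * q`_j.+1 * z^-1 ^+ j.+1); last first.
  by rewrite eu divfK.
rewrite mulr_sumr; apply: eq_bigr => j _; rewrite hornerZ hornerXn.
have lej : (j <= n)%N by rewrite -ltnS (leq_trans (ltn_ord j)).
have -> : z ^+ n.+1 = z ^+ (n - j) * z ^+ j.+1 by rewrite -exprD addnS subnK.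
by rewrite exprVn; field; rewrite expf_neq0.
Qed.

(** The maximal ideal of the valuation ring R. *)
Let mm x := x = 0 \/ ~ R x^-1.
Let mmR x : mm x -> R x.
Proof. by case=> [->//|h]; case: (val_ring x). Qed.
Let mmM r x : R r -> mm x -> mm (r * x).
Proof.
move=> hr hx; have [e|n0] := eqVneq (r * x) 0; [by left|right=> h].
case: hx => [x0|]; first by move: n0; rewrite x0 mulr0 eqxx.
apply; have -> : x^-1 = r * (r * x)^-1; last exact: RM.
by move: n0; rewrite mulf_eq0 => /norP[r0 x0]; rewrite invfM mulrA divff ?mul1r.
Qed.
Let mmD x z : mm x -> mm z -> mm (x + z).
Proof.
move=> hx hz; have [->|x0] := eqVneq x 0; first by rewrite add0r.
have [->|z0] := eqVneq z 0; first by rewrite addr0.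
have [h|h] := val_ring (x / z).
  have -> : x + z = (x / z + 1) * z by rewrite mulrDl divfK // mul1r.
  by apply: mmM => //; exact: RD.
have -> : x + z = (1 + z / x) * x by rewrite mulrDl divfK // mul1r.
by apply: mmM => //; apply: RD => //; rewrite -invf_div.
Qed.
Let mm_sum I (P : pred I) (F : I -> L) : (forall i, P i -> mm (F i)) -> mm (\sum_(i | P i) F i).
Proof. by move=> h; elim/big_rec: _ => [|i x Pi]; [left|apply/mmD/h]. Qed.
Let mma : mm a. Proof. by right. Qed.
Let mmc c : mm (cst c) -> c = 0.
Proof.
case=> [/eqP|]; first by rewrite fmorph_eq0 => /eqP.
by case; rewrite -fmorphV.
Qed.

Let pevR p : R (pev a p).
Proof. by rewrite (pevE _ (leqnn _)); apply: R_sum => i; apply: RM => //; exact: RX. Qed.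
Let pev_mm p : mm (pev a p) -> p`_0 = 0.
Proof.
move=> h; apply: mmc; have [q e] := poly_decX p.
have -> : cst p`_0 = pev a p + - pev a q * a by rewrite {2}e pevD pevM pevX pevC; ring.
by apply: mmD => //; apply: mmM mma; apply/RN/pevR.
Qed.

Let D := projT1 (cid (ff_bounded_dep a)).
Let hD := projT2 (cid (ff_bounded_dep a)).

(** The [D + 1] elements satisfy a relation over k[a]. After division by a power of [a], its first
    coefficient with nonzero constant term is a unit. Relative to the corresponding [x i] all other
    terms lie in the maximal ideal: the later ones by the second hypothesis, the earlier ones by the
    third, as their coefficients are multiples of [a]. *)
Let chainF (x : 'I_D.+1 -> L) : (forall i, x i != 0) ->
  (forall i j : 'I_D.+1, (i < j)%N -> mm (x j / x i)) -> (forall i j, mm (a * (x j / x i))) -> False.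
Proof.
move=> x0 h1 h2; have [|p p0 e] := @hD _ x; first by rewrite card_ord.
have [m [p' [hp' [i0 pi0]]]] := poly_divX p0.
case: (arg_minnP (fun i : 'I_D.+1 => i : nat) (P := fun i => (p' i)`_0 != 0) pi0) => i pi min.
suff /pev_mm/eqP : mm (pev a (p' i)) by rewrite (negbTE pi).
have -> : pev a (p' i) = \sum_(j | j != i) - pev a (p' j) * (x j / x i).
  apply: (mulIf (x0 i)); apply: (mulfI (expf_neq0 m a0)); apply/eqP; rewrite -subr_eq0; apply/eqP.
  apply: etrans e; rewrite [RHS](bigD1 i) //= hp' pevM pevXn mulrA; congr (_ + _).
  rewrite mulr_suml mulr_sumr -sumrN; apply: eq_bigr => j _.
  by rewrite hp' pevM pevXn; field.
apply: mm_sum => j ji; have [lt|] := ltnP i j; first by apply: mmM (h1 _ _ lt); apply/RN/pevR.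
rewrite leq_eqVlt val_eqE (negbTE ji) => lt.
have /eqP pj : (p' j)`_0 == 0 by apply: contraTT lt => /min; rewrite -leqNgt.
have [q e'] := poly_decX (p' j).
have -> : - pev a (p' j) * (x j / x i) = - pev a q * (a * (x j / x i)).
  by rewrite e' pj addr0 pevM pevX; ring.
by apply: mmM (h2 _ _); apply/RN/pevR.
Qed.

(** Otherwise there is an infinite sequence in the maximal ideal in which each element is a nonunit
    multiple of the next one; [D + 1] of its terms, in reverse order, contradict [chainF]. *)
Let t_ex : exists t, [/\ t != 0, mm t & forall x, mm x -> R (x / t)].
Proof.
apply: contrapT => /forallNP h.
have /choice[nxt hn] t : exists x, t != 0 -> mm t -> [/\ x != 0, mm x & mm (t / x)].
  have [[t0 ht]|hn] := pselect (t != 0 /\ mm t); last by exists 0 => t0 ht; case: hn.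
  have /existsNP[x /not_implyP[hx hr]] : ~ forall x, mm x -> R (x / t).
    by move=> H; apply: (h t).
  have x0 : x != 0 by apply/eqP => x0; apply: hr; rewrite x0 mul0r.
  by exists x => _ _; split=> //; right; rewrite invf_div.
(* The sequence starts at [a], so that [a / y n] is in the maximal ideal for n > 0; this provides
   the last hypothesis of [chainF]. *)
pose y n := iter n nxt a; have hy n : y n != 0 /\ mm (y n).
  by elim: n => [|n [n0 IH]] //=; have [] := hn _ n0 IH.
have hlt m n : mm (y n / y (n + m.+1)%N).
  elim: m => [|m IH]; first by rewrite addn1; have [n0 IH] := hy n; have [] := hn _ n0 IH.
  have [n0 _] := hy (n + m.+1)%N.
  have -> : y n / y (n + m.+2)%N = y n / y (n + m.+1)%N * (y (n + m.+1)%N / y (n + m.+2)%N).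
    by rewrite mulrA divfK.
  by apply: mmM; [exact: mmR|rewrite [in X in _ / X]addnS; have [z0 Hz] := hy (n + m.+1)%N; have [] := hn _ z0 Hz].
apply: (@chainF (fun i => y (D.+1 - i)%N)) => [i|i j lt|i j]; first by case: (hy (D.+1 - i)%N).
  have -> : (D.+1 - i = D.+1 - j + (j - i).-1.+1)%N by have := ltn_ord j; lia.
  exact: hlt.
rewrite mulrCA; apply: mmM; first by apply: mmR; case: (hy (D.+1 - j)%N).
have -> : (D.+1 - i = 0 + (D - i).+1)%N by have := ltn_ord i; lia.
exact: (hlt _ 0%N).
Qed.

Let t := projT1 (cid t_ex).
Let t0 : t != 0. Proof. by case: (projT2 (cid t_ex)). Qed.
Let mmt : mm t. Proof. by case: (projT2 (cid t_ex)). Qed.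
Let ht x : mm x -> R (x / t). Proof. by case: (projT2 (cid t_ex)) => _ _; exact. Qed.
Let mmtX n : mm (t ^+ n.+1).
Proof. by rewrite exprSr; apply: mmM mmt; apply/RX/mmR. Qed.

Let not_a : ~ R (a / t ^+ D.+1).
Proof.
move=> h; apply: (@chainF (fun i => t ^+ i)) => [i|i j lt|i j]; first exact: expf_neq0.
  by rewrite -expfB // -[(j - i)%N]prednK ?subn_gt0.
rewrite mulrCA; apply: mmM; first exact/RX/mmR.
have -> : a / t ^+ i = a / t ^+ D.+1 * t ^+ (D - i).+1; last exact: mmM.
have -> : t ^+ D.+1 = t ^+ i * t ^+ (D - i).+1.
  by rewrite -exprD; congr (_ ^+ _); have := ltn_ord i; lia.
by field; rewrite !expf_neq0.
Qed.

(** Otherwise [x] is divisible by all powers of [a], because [t ^+ D.+1] is a multiple of [a]. In a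
    relation over k[a] between powers of [x] the lowest coefficient is then divisible by [x]; being
    a power of [a] times a unit, it makes [a] invertible in R. *)
Let sep x : x != 0 -> exists n, ~ R (x / t ^+ n).
Proof.
move=> x0; apply: contrapT => /forallNP h'.
have {h'} h n : R (x / a ^+ n).
  have -> : x / a ^+ n = x / t ^+ (D.+1 * n) * (t ^+ D.+1 / a) ^+ n.
    by rewrite exprMn exprVn -exprM mulrA divfK ?expf_neq0.
  apply: RM; first by have /contrapT := h' (D.+1 * n)%N.
  by apply: RX; case: (val_ring (a / t ^+ D.+1)) => [/not_a//|]; rewrite invf_div.
have [|p [i0 p0] e] := @hD _ (fun i : 'I_D.+1 => x ^+ i); first by rewrite card_ord.
case: (arg_minnP (fun i : 'I_D.+1 => i : nat) (P := fun i => p i != 0) p0) => i pi min.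
have hR : R (pev a (p i) / x).
  have -> : pev a (p i) / x = \sum_(j | j != i) - pev a (p j) * (x ^+ j / x ^+ i.+1).
    apply: (mulIf (expf_neq0 i.+1 x0)); apply/eqP; rewrite -subr_eq0; apply/eqP.
    apply: etrans e; rewrite [RHS](bigD1 i) //= exprS; congr (_ + _); first by rewrite mulrA divfK.
    rewrite mulr_suml -sumrN; apply: eq_bigr => j _; rewrite -exprS mulNr mulNr opprK -mulrA.
    by rewrite divfK // expf_neq0.
  elim/big_rec: _ => // j z ji; apply: RD.
  have [->|pj] := eqVneq (p j) 0; first by rewrite pev0 oppr0 mul0r.
  have lt : (i < j)%N by have := min _ pj; rewrite leq_eqVlt eq_sym val_eqE (negbTE ji).
  have -> : x ^+ j / x ^+ i.+1 = x ^+ (j - i.+1).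
    by rewrite -{1}(subnK lt) exprD mulfK ?expf_neq0.
  apply: RM; first exact/RN/pevR.
  by apply: RX; have := h 0%N; rewrite divr1.
have [m [p' [hp' [[] pi0]]]] := @poly_divX k unit (fun=> p i) (ex_intro _ tt pi).
have hc : ~ mm (pev a (p' tt)) by move=> /pev_mm/eqP; rewrite (negbTE pi0).
have c0 : pev a (p' tt) != 0 by apply/eqP => c0; apply: hc; left.
have hci : R (pev a (p' tt))^-1 by apply: contrapT => H; apply: hc; right.
apply: Rna; have -> : a^-1 = (pev a (p' tt))^-1 * (pev a (p i) / x) * (x / a ^+ m.+1).
  rewrite (hp' tt) pevM pevXn exprS; field.
  by rewrite a0 x0 expf_neq0.
by apply: RM => //; apply: RM.
Qed.

Let unitz x : x != 0 -> exists m : int, R (x / t ^ m) /\ R (t ^ m / x).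
Proof.
suff H z : z != 0 -> R z -> exists m : int, R (z / t ^ m) /\ R (t ^ m / z).
  move=> x0; have [/H|/H] := val_ring x; first by apply.
  rewrite invr_eq0 => /(_ x0)[m [h1 h2]]; exists (- m).
  rewrite -invr_expz invrK mulrC -[x]invrK; split; first by [].
  by move: h1; rewrite invrK -invfM mulrC invfM.
move: z => {}x x0 hx; pose P n := `[< ~ R (x / t ^+ n) >]; have exP : exists n, P n.
  by have [n ?] := sep x0; exists n; apply/asboolP.
case: (ex_minnP exP) => -[|m] /asboolP hm min.
  by case: hm; rewrite divr1.
have hr : R (x / t ^+ m) by apply: contrapT => h; have := min m (asboolT h); rewrite ltnn.
exists m%:Z.
have /ht : mm (t ^+ m.+1 / x) by right; rewrite invf_div.
have -> // : t ^+ m.+1 / x / t = t ^+ m / x by rewrite exprS; field; rewrite ?x0.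
Qed.

Let ord x : int := if pselect (x != 0) is left h then projT1 (cid (unitz h)) else 0.
Let ordP x : x != 0 -> R (x / t ^ ord x) /\ R (t ^ ord x / x). by rewrite /ord; case: pselect => // h _; exact: projT2 (cid (unitz h)). Qed.
Let t_pos m : R (t ^ m) -> 0 <= m.
Proof.
case: m => // n h; exfalso; case: (mmtX n) => [/eqP|]; first by rewrite expf_eq0 (negbTE t0).
by apply.
Qed.
Let ord_ge x m : x != 0 -> R (x / t ^ m) -> m <= ord x.
Proof.
move=> x0 h; rewrite -subr_ge0; apply: t_pos; rewrite expfzDr // -invr_expz.
have -> : t ^ ord x / t ^ m = t ^ ord x / x * (x / t ^ m) by rewrite mulrA divfK.
by apply: RM => //; case: (ordP x0).
Qed.
Let ord_le x m : x != 0 -> R (t ^ m / x) -> ord x <= m.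
Proof.
move=> x0 h; rewrite -subr_ge0; apply: t_pos; rewrite expfzDr // -invr_expz.
have -> : t ^ m / t ^ ord x = t ^ m / x * (x / t ^ ord x) by rewrite mulrA divfK.
by apply: RM => //; case: (ordP x0).
Qed.
Let ordE x m : x != 0 -> R (x / t ^ m) -> R (t ^ m / x) -> ord x = m.
Proof. by move=> x0 h1 h2; apply/eqP; rewrite eq_le ord_le ?ord_ge. Qed.
(** The order counts powers of the generator [t] of the maximal ideal; an order of [a] that is at
    most 0 would put the inverse of [a] into R. *)
Lemma place_of_ring : exists y, 0 < vord y a.
Proof.
have o0 : ord 0 = 0 by rewrite /ord; case: pselect => h; have := h; rewrite eqxx.
have oM x z : x != 0 -> z != 0 -> ord (x * z) = ord x + ord z.
  move=> x0 z0; have [h1 h2] := ordP x0; have [h3 h4] := ordP z0.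
  apply: ordE; rewrite ?mulf_neq0 // expfzDr // ?invfM mulrACA; exact: RM.
have oD x z : x != 0 -> z != 0 -> x + z != 0 -> Num.min (ord x) (ord z) <= ord (x + z).
  move=> x0 z0 xz0; apply: ord_ge => //; rewrite mulrDl.
  have H w m : w != 0 -> m <= ord w -> R (w / t ^ m).
    move=> w0 le; have -> : w / t ^ m = w / t ^ ord w * t ^ (ord w - m).
      by rewrite expfzDr // -invr_expz mulrA divfK // expfz_neq0.
    apply: RM; first by case: (ordP w0).
    by case: (ord w - m) (subr_ge0 m (ord w)) => n; rewrite le => // _; exact/RX/mmR.
  by apply: RD; apply: H; rewrite // ge_min lexx ?orbT.
have oc c : ord (cst c) = 0.
  have [->|c0] := eqVneq c 0; first by rewrite rmorph0.
  by apply: ordE; rewrite ?fmorph_eq0 ?divr1 ?div1r -?fmorphV.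
have os : exists x, ord x = 1.
  by exists t; apply: ordE; rewrite // divff.
exists (Place o0 oM oD oc os) => /=; rewrite ltNge; apply/negP => le.
have [_ h] := ordP a0; apply: Rna.
have -> : a^-1 = t ^ ord a / a * t ^ (- ord a).
  by rewrite -invr_expz mulrAC divff ?mul1r // expfz_neq0.
apply: RM => //; case: (- ord a) (oppr_ge0 (ord a)) => n; rewrite le => // _; exact/RX/mmR.
Qed.

End PlaceExistence.

Lemma zero_ex (a : ff X) : transc a -> exists y : place X, 0 < vord y a.
Proof.
by move=> ta; have [R [gR mR]] := max_good_ring ta; exact: (@place_of_ring a ta R gR mR).
Qed.

(** A nonconstant function has a pole, at a zero of its inverse. *)
Lemma regular_cst (a : ff X) : (forall y : place X, vge y 0 a) -> exists c, a = kcst X c.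
Proof.
move=> h; have [ta|//] := transcP a; have [y] := zero_ex (transcV ta).
by have := h y; rewrite vgeE ?transc_neq0 // vordV; lia.
Qed.

(** * Weak approximation and finiteness of the set of zeros *)

Section Approximation.
Implicit Types (z : place X) (u w : L) (s : seq (place X)).

Lemma place_neq y z : y != z -> exists2 a, vge y 0 a & ~~ vge z 0 a.
Proof.
move=> yz; apply: contrapT => h; move/eqP: yz; apply; apply: place_eq => a ha.
by apply: contrapT => /negP ha'; apply: h; exists a.
Qed.

Lemma vordX_neg y a n : vord y a < 0 -> vord y (a ^+ n.+1) <= - n.+1%:Z.
Proof. by move=> h; rewrite vordX; elim: n => [|n]; lia. Qed.
Lemma vordX_pos y a n : 0 < vord y a -> n.+1%:Z <= vord y (a ^+ n.+1).
Proof. by move=> h; rewrite vordX; elim: n => [|n]; lia. Qed.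
Lemma vordX_ge0 y a n : 0 <= vord y a -> 0 <= vord y (a ^+ n).
Proof. by move=> h; rewrite vordX mulrn_wge0. Qed.
(** By induction on [s]: if [a] has no pole at the new point [z], a high power of a function with a
    zero at [y] and a pole at [z] is added to it. *)
Lemma approx_sep y s : y \notin s ->
  exists a, [/\ a != 0, 0 < vord y a & forall z, z \in s -> vord z a < 0].
Proof.
elim: s => [_|z s IH]; first by have [t t0 yt] := unif_ex y; exists t; rewrite yt.
rewrite inE negb_or => /andP[yz /IH[a [a0 ya sa]]].
have [lt|ge] := ltP (vord z a) 0.
  by exists a; split=> // v; rewrite inE => /predU1P[->|/sa].
have zy : z != y by rewrite eq_sym.
have [b yb zb] := place_neq yz; have [c zc yc] := place_neq zy.
have b0 : b != 0 by apply: contraNneq zb => ->; rewrite vge0.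
have c0 : c != 0 by apply: contraNneq yc => ->; rewrite vge0.
pose d := b / c; have d0 : d != 0 by rewrite mulf_neq0 ?invr_eq0.
have yd : 0 < vord y d.
  by rewrite vordM ?invr_eq0 // vordV; move: yb yc; rewrite !vgeE //; lia.
have zd : vord z d < 0.
  by rewrite vordM ?invr_eq0 // vordV; move: zb zc; rewrite !vgeE //; lia.
(* [r] bounds the poles of [a] on [s]. Where [d] has a pole, [f] dominates [a]; where it has none,
   the pole of [a] remains. *)
have [r hr] := ge_bound s (fun v => - vord v a); pose f := d ^+ r.+1.
have f0 : f != 0 by rewrite expf_neq0.
have [zf yf] := (vordX_neg r zd, vordX_pos r yd); rewrite -/f in zf yf.
have [|n0 zv] := @vord_dom z f a f0.
  by rewrite vgeE //; move: zf ge; clear; lia.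
exists (f + a); split=> //.
  have : vge y 1 (f + a).
    by apply: vgeD; rewrite vgeE //; move: yf; clear; lia.
  by rewrite vgeE.
move=> v; rewrite inE => /predU1P[->|vs]; first by rewrite zv; move: zf; clear; lia.
have := sa _ vs; have := hr _ vs => h1 h2; have [lt|ge'] := ltP (vord v d) 0.
  have vf := vordX_neg r lt; rewrite -/f in vf.
  have [|_ ->] := @vord_dom v f a f0; last by move: vf; clear; lia.
  by rewrite vgeE //; move: vf h1; clear; lia.
have vf := vordX_ge0 r.+1 ge'; rewrite -/f in vf.
rewrite addrC; have [|_ -> //] := @vord_dom v a f a0.
by rewrite vgeE //; move: vf h2; clear; lia.
Qed.

(** If [a] vanishes at [y] and has poles on [s], the function 1 / (1 + a^(N+1)) is close to 1 at [y]
    and close to 0 on [s]. *)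
Lemma approx_one (N : nat) y s : y \notin s ->
  exists2 w, vge y N%:Z (w - 1) & forall z, z \in s -> vge z N%:Z w.
Proof.
move=> /approx_sep[a [a0 ya sa]]; pose f := a ^+ N.+1.
have f0 : f != 0 by rewrite expf_neq0.
have yf := vordX_pos N ya; rewrite -/f in yf.
have [|n0 y0] := @vord_dom y 1 f (oner_neq0 _); first by rewrite vgeE // vord1; lia.
exists (1 + f)^-1.
  have -> : (1 + f)^-1 - 1 = - f / (1 + f) by field.
  rewrite vgeE ?mulf_neq0 ?invr_eq0 ?oppr_eq0 // vordM ?invr_eq0 ?oppr_eq0 //.
  by rewrite vordN vordV y0 vord1; lia.
move=> z /sa za; rewrite addrC in n0 *; have zf := vordX_neg N za; rewrite -/f in zf.
have [|_ h] := @vord_dom z f 1 f0; first by rewrite vgeE ?oner_neq0 // vord1; lia.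
by rewrite vgeE ?invr_eq0 // vordV h; lia.
Qed.

Section LocalBasis.
Variables (m : nat) (y_ : 'I_m -> place X) (e : 'I_m -> nat).
Local Notation H := {i : 'I_m & 'I_(e i)}.

Definition small_at c := forall i, vge (y_ i) (e i)%:Z c.
Definition unit_at c := forall i, c != 0 /\ vord (y_ i) c = 0.

(** The function of index (i, j) has order j at [y_ i] and large order at the other points. In a
    combination as described, the unit coefficient with least j contributes at its point a term of
    strictly least valuation. Upper bounds for numbers of zeros and for ramification rest on
    this. *)
Lemma local_basis : injective y_ -> exists u : H -> L, forall c : H -> L,
  (forall h, small_at (c h) \/ unit_at (c h)) -> (exists h, unit_at (c h)) -> \sum_h c h * u h != 0.
Proof.
move=> inj; have /choice[t ht] i : exists t, t != 0 /\ vord (y_ i) t = 1.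
  by have [t t0 t1] := unif_ex (y_ i); exists t.
have t0 i : t i != 0 by case: (ht i).
have /choice[w hw] i : exists w, vge (y_ i) 1 (w - 1) /\
    forall j, j != i -> forall n : 'I_(e i), vge (y_ j) (e j)%:Z (w * t i ^+ n).
  have [N hN] := ge_bound (enum 'I_m) (fun j => (e j)%:Z + `|vord (y_ j) (t i)| *+ e i).
  have [|w w1 w2] := @approx_one N.+1 (y_ i) [seq y_ j | j <- enum 'I_m & j != i].
    by apply/mapP => -[j]; rewrite mem_filter => /andP[ji _] /inj ij; rewrite ij eqxx in ji.
  exists w; split=> [|j ji n]; first by apply: vgeW w1.
  have jf : j \in [seq j <- enum 'I_m | j != i] by rewrite mem_filter ji mem_enum.
  have h := w2 _ (map_f y_ jf).
  apply: vgeW (vgeM h (vge_vord _ _)); rewrite vordX.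
  have := hN j; rewrite mem_enum => /(_ isT).
  have : - vord (y_ j) (t i) *+ n <= `|vord (y_ j) (t i)| *+ e i.
    apply: (@le_trans _ _ (`|vord (y_ j) (t i)| *+ n)).
      by apply: ler_wMn2r; rewrite ler_normr lexx orbT.
    by apply: ler_wpMn2l (ltnW (ltn_ord n)).
  by rewrite mulNrn; lia.
have wu i : w i != 0 /\ vord (y_ i) (w i) = 0.
  have [h _] := hw i; rewrite -[w i](subrK 1) addrC.
  by have [|? ->] := @vord_dom (y_ i) 1 (w i - 1) (oner_neq0 _); rewrite vord1.
pose Tg (i : 'I_m) (j : 'I_(e i)) : H := existT _ i j.
exists (fun h => w (tag h) * t (tag h) ^+ @nat_of_ord (e (tag h)) (tagged h)) => c hc [h0' hu'].
case: (arg_minnP (fun h : H => @nat_of_ord (e (tag h)) (tagged h)) (P := fun h => `[< unit_at (c h) >]) (asboolT hu')).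
move=> [i0 j0] /asboolP hu min; have [c0 v0] := hu i0; have [w0 wv] := wu i0.
have n0 : w i0 * t i0 ^+ j0 != 0 by rewrite mulf_neq0 ?expf_neq0.
have V : vord (y_ i0) (c (Tg _ j0) * (w i0 * t i0 ^+ j0)) = j0%:Z.
  have [_ t1] := ht i0.
  by rewrite vordM // vordM ?expf_neq0 // v0 wv vordX t1 natz.
apply: (@sum_dom (y_ i0) _ _ (Tg _ j0)); rewrite ?mulf_neq0 ?expf_neq0 // => -[i j] ne.
rewrite /=; have [ii|ii] := eqVneq i i0; last first.
  have [_ /(_ i0) h] := hw i; rewrite eq_sym ii in h; have {}h := h isT j.
  have h' : vge (y_ i0) 0 (c (Tg _ j)).
    case: (hc (Tg _ j)) => /(_ i0); first by apply: vgeW.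
    by case=> h1 h2; rewrite vgeE // h2.
  by apply: vgeW (vgeM h' h); have := ltn_ord j0; lia.
move: j ne; rewrite {}ii => j ne; have [_ t1] := ht i0.
have h2 : vge (y_ i0) j%:Z (w i0 * t i0 ^+ j).
  by rewrite vgeE ?mulf_neq0 ?expf_neq0 // vordM ?expf_neq0 // wv vordX t1 natz.
case: (hc (Tg _ j)) => [/(_ i0) h1|h1].
  by apply: vgeW (vgeM h1 h2); have := ltn_ord j0; lia.
have [h3 h4] := h1 i0; have h5 : vge (y_ i0) 0 (c (Tg _ j)) by rewrite vgeE // h4.
apply: vgeW (vgeM h5 h2); have /= := min _ (asboolT h1).
have : (j : nat) != j0 by apply: contraNneq ne => /val_inj ->.
by lia.
Qed.

End LocalBasis.

(** With the orders of [a] as multiplicities, a polynomial in [a] is a unit at the given zeros or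
    vanishes there to these orders, depending on its constant term. So the functions of
    [local_basis] are free over k[a]. *)
Lemma zeros_le a n (b : 'I_n -> L) m (y_ : 'I_m -> place X) : transc a -> kbasis a b ->
  injective y_ -> (forall i, 0 < vord (y_ i) a) -> (\sum_i `|vord (y_ i) a| <= n)%N.
Proof.
move=> ta [_ hb] inj pos; pose e i := `|vord (y_ i) a|%N; rewrite leqNgt; apply/negP => lt.
have [u hu] := local_basis e inj; have a0 := transc_neq0 ta.
apply: (hb _ u) => [|p e0]; first by rewrite card_tagged sumnE big_map big_enum; under eq_bigr do rewrite card_ord.
apply: contrapT => /existsNP[h /eqP ph].
have [l [p' [hp' [h1 ph1]]]] := poly_divX (ex_intro _ h ph).
have /eqP : \sum_h pev a (p' h) * u h = 0.
  apply: (mulfI (expf_neq0 l a0)); rewrite mulr0; apply: etrans e0.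
  by rewrite mulr_sumr; apply: eq_bigr => i _; rewrite hp' pevM pevXn mulrA.
have U h' : (p' h')`_0 != 0 -> unit_at y_ (pev a (p' h')).
  move=> c0 i; have [q eq] := poly_decX (p' h').
  rewrite eq pevD pevM pevX pevC addrC.
  have [||n0 ->] := @vord_dom (y_ i) (cst (p' h')`_0) (pev a q * a); last by rewrite vord_cst.
    by rewrite fmorph_eq0.
  rewrite vord_cst; apply: vgeM; last by rewrite vgeE //; exact: pos.
  rewrite (pevE _ (leqnn _)); apply: vge_sum => j _; apply: vgeM (vge_cst _ _) (vgeX _ _).
  by rewrite vgeE //; exact/ltW/pos.
apply/negP; apply: hu => [h'|]; last by exists h1; exact: U.
have [c0|/eqP/U] := pselect ((p' h')`_0 = 0); last by right.
left=> i; have [q eq] := poly_decX (p' h'); rewrite eq c0 addr0 pevM pevX.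
rewrite -[_%:Z]add0r; apply: vgeM; last by rewrite vgeE /e; have := pos i; lia.
rewrite (pevE _ (leqnn _)); apply: vge_sum => j _; apply: vgeM (vge_cst _ _) (vgeX _ _).
by rewrite vgeE //; exact/ltW/pos.
Qed.

Lemma zeros_finite a : transc a -> finite_set [set y : place X | 0 < vord y a].
Proof.
move=> ta; have [n [b hb]] := kbasis_ex ta; apply: contrapT => inf.
have [B sB leB] := infinite_set_fset n.+1 inf.
pose y_ := tnth (in_tuple (finmap.enum_fset B)).
have inj : injective y_ by apply/tuple_uniqP; exact: finmap.fset_uniq.
have pos i : 0 < vord (y_ i) a by apply: sB; exact: mem_tnth.
have := zeros_le ta hb inj pos; rewrite leqNgt => /negP; apply.
apply: (leq_trans leB); rewrite -[X in (X <= _)%N]card_ord -sum1_card.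
by apply: leq_sum => i _; have := pos i; lia.
Qed.

Lemma vord_finite a : finite_set [set y : place X | vord y a != 0].
Proof.
have [ta|[c ->]] := transcP a; last first.
  by rewrite (_ : [set _ | _] = set0) //; apply/seteqP; split=> y //=; rewrite vord_cst.
apply: (@sub_finite_set _ _ ([set y : place X | 0 < vord y a] `|` [set y : place X | 0 < vord y a^-1])).
  by move=> y /=; rewrite vordV; lia.
by rewrite finite_setU; split; apply: zeros_finite => //; exact: transcV.
Qed.

End Approximation.

(** * Codimension of spaces of functions *)

Section Codimension.
Variable V : lmodType (ff X).
Implicit Types (T : set V) (d m : nat).

Definition ksub T := T 0 /\ forall c v w, T v -> T w -> T (cst c *: v + w).

(** Codimension at most [d], expressed by free families because the spaces may have infinite
    dimension over k. *)
Definition codim T' T d := forall m n (z : 'I_n -> V), n = (m + d)%N ->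
  free_over cst z -> (forall i, T' (z i)) ->
  exists2 z' : 'I_m -> V, free_over cst z' & forall i, T (z' i).

Lemma codim0 T' T : (forall v, T' v -> T v) -> codim T' T 0.
Proof. by move=> h m n z; rewrite addn0 => e; case: m / e => fz hz; exists z => // i; exact: h. Qed.
Lemma codim_trans T1 T2 T3 d d' : codim T1 T2 d -> codim T2 T3 d' -> codim T1 T3 (d + d').
Proof.
move=> h1 h2 m n z e fz hz.
have [|z' fz' hz'] := h1 (m + d')%N n z _ fz hz; first by rewrite e; lia.
exact: h2 fz' hz'.
Qed.

(** Elimination: a vector with nonzero value of [phi] serves as pivot, and multiples of it correct
    the other vectors. *)
Lemma codim_functional T' T (phi : V -> k) : ksub T' ->
  (forall c v w, T' v -> T' w -> phi (cst c *: v + w) = c * phi v + phi w) ->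
  (forall v, T' v -> phi v = 0 -> T v) -> codim T' T 1.
Proof.
move=> [T0 TZ] lin hT m n z e fz hz.
rewrite addn1 in e; subst n.
have [i0 hi0] : exists i0, phi (z i0) = 0 -> forall j, phi (z j) = 0.
  have [[i hi]|/forallNP h] := pselect (exists i, phi (z i) <> 0); first by exists i.
  by exists ord0 => _ j; apply: contrapT.
pose q j := phi (z (lift i0 j)) / phi (z i0).
exists (fun j => cst (- q j) *: z i0 + z (lift i0 j)) => [c e j|j]; last first.
  apply: hT; [exact: TZ|rewrite lin // mulNr].
  have [p0|p0] := eqVneq (phi (z i0)) 0; first by rewrite p0 (hi0 p0) mulr0 oppr0 addr0.
  by rewrite divfK // addNr.
pose c' i := if unlift i0 i is Some j then c j else - \sum_j c j * q j.
have <- : c' (lift i0 j) = c j by rewrite /c' liftK.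
apply: fz; apply: etrans e; rewrite (bigD1_ord i0) //= {1}/c' unlift_none.
under [RHS]eq_bigr do rewrite scalerDr scalerA.
rewrite big_split -scaler_suml; congr (_ *: _ + _).
  rewrite rmorphN rmorph_sum -sumrN; apply: eq_bigr => i _.
  by rewrite rmorphM rmorphN mulrN.
by apply: eq_bigr => i _; rewrite /c' liftK.
Qed.

End Codimension.

(** * The product formula *)

Section ProductFormula.
Implicit Types (z : place X) (f x : L) (s : seq (place X)) (T : set L^o).

(** At a pole [z] of [x] where [a] is regular, the difference of [a] and its residue at [z]
    vanishes, so a high power of it cancels the pole. *)
Lemma kill_poles a x s : transc a -> (forall y, y \notin s -> vge y 0 a) ->
  exists2 q, q != 0 & forall y, y \notin s -> vge y 0 (pev a q * x).
Proof.
move=> ta ha; have [r ur hr] := fin_suppP (vord_finite x).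
have [N hN] := ge_bound r (fun y => - vord y x).
have V (l : seq (place X)) : pev a (\prod_(z <- l) ('X - (res z a)%:P) ^+ N) = \prod_(z <- l) (a - cst (res z a)) ^+ N.
  elim: l => [|z l IH]; first by rewrite !big_nil pev1.
  rewrite !big_cons pevM IH; congr (_ * _); elim: N {hN IH} => [|n IH]; first by rewrite pev1.
  by rewrite !exprS pevM IH pevD -polyCN pevC pevX rmorphN.
exists (\prod_(z <- r) ('X - (res z a)%:P) ^+ N).
  by rewrite prodf_seq_neq0; apply/allP => z _; rewrite expf_neq0 // polyXsubC_eq0.
move=> y ys; rewrite V.
have h0 (l : seq (place X)) : vge y 0 (\prod_(z <- l) (a - cst (res z a)) ^+ N).
  elim: l => [|z l IH]; first by rewrite big_nil; exact: in_ring1.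
  rewrite big_cons -[0]addr0; apply: vgeM => //; apply: vgeX.
  by apply: vgeB (ha _ ys) (vge_cst _ _).
have [h|] := boolP (vge y 0 x); first by rewrite -[0]addr0; exact: vgeM.
move=> /norP[x0]; rewrite -ltNge => lt.
have yr : y \in r by apply: hr; rewrite lt_eqF.
rewrite (big_rem _ yr) -mulrA mulrCA -[0]addr0; apply: vgeM => //.
have hy : vge y N%:Z ((a - cst (res y a)) ^+ N).
  have := resP (ha _ ys); elim: N {hN V h0} => [|n IH] hb; first exact: in_ring1.
  by rewrite exprS intS; apply: vgeM (IH hb).
by apply: vgeW (vgeM hy (vge_vord _ _)); have := hN _ yr; lia.
Qed.

Lemma ksub_vge T y m : ksub T -> ksub (T `&` [set f | vge y m f] : set L^o).
Proof.
move=> [T0 TZ]; split=> [|c v w [Tv hv] [Tw hw]]; first by split=> //; exact: vge0.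
split; first exact: TZ; apply: vgeD => //; rewrite -[m]add0r.
exact: vgeM (vge_cst _ _) hv.
Qed.

(** The coefficient of the leading polar term is a functional, so lowering the order of the pole by
    one costs one dimension. *)
Lemma pole_codim T y M : ksub T ->
  codim (T `&` [set f | vge y (- M%:Z) f] : set L^o) (T `&` [set f | vge y 0 f]) M.
Proof.
move=> kT; have [t t0 t1] := unif_ex y; elim: M => [|M IH]; first exact: codim0.
rewrite -[X in codim _ _ X]add1n; apply: codim_trans IH.
have V f : vge y (- M.+1%:Z) f -> vge y 0 (f * t ^+ M.+1).
  move=> h; have -> : 0 = - M.+1%:Z + vord y (t ^+ M.+1).
    by rewrite vordX t1 natz addNr.
  exact: vgeM h (vge_vord _ _).
apply: (@codim_functional L^o _ _ (fun f => res y (f * t ^+ M.+1))); first exact: ksub_vge.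
  move=> c v w [_ /V hv] [_ /V hw]; rewrite mulrDl resD //; last first.
    by rewrite -mulrA; apply: vgeM (vge_cst _ _) hv.
  by rewrite -mulrA resM ?vge_cst // res_cst.
move=> v [Tv hv]; move/V: (hv) => /res_eq0 h /h{}h; split=> //=.
rewrite -[v](mulfK (expf_neq0 M.+1 t0)).
have -> : - M%:Z = 1 + vord y (t ^+ M.+1)^-1 by rewrite vordV vordX; lia.
exact: vgeM h (vge_vord _ _).
Qed.

Lemma poles_codim T s (F : place X -> nat) : ksub T ->
  codim (T `&` [set f | forall y, y \in s -> vge y (- (F y)%:Z) f] : set L^o)
        (T `&` [set f | forall y, y \in s -> vge y 0 f]) (\sum_(y <- s) F y)%N.
Proof.
elim: s T => [|z s IH] T kT; first by rewrite big_nil; apply: codim0 => f [].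
rewrite big_cons; pose T' := T `&` [set f | vge z (- (F z)%:Z) f] : set L^o.
rewrite addnC; apply: (@codim_trans _ _ (T' `&` [set f | forall y, y \in s -> vge y 0 f])).
  have := IH T' (ksub_vge _ _ kT).
  rewrite (_ : T' `&` _ = T `&` [set f | forall y, y \in z :: s -> vge y (- (F y)%:Z) f]) //.
  apply/seteqP; split=> f; first by move=> [[Tf hz] hs]; split=> // y; rewrite inE => /predU1P[->|/hs].
  by move=> [Tf h]; split=> [|y ys]; [split=> //; apply: h|apply: h]; rewrite inE ?eqxx // ys orbT.
pose T2 := T `&` [set f | forall y, y \in s -> vge y 0 f] : set L^o.
have kT2 : ksub T2.
  case: kT => T0 TZ; split=> [|c v w [Tv hv] [Tw hw]]; first by split=> // y _; exact: vge0.
  split; first exact: TZ; move=> y ys; apply: vgeD; last exact: hw.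
  by rewrite -[0]addr0; apply: vgeM (vge_cst _ _) (hv _ ys).
have := @pole_codim T2 z (F z) kT2.
rewrite (_ : T2 `&` [set f | vge z (- (F z)%:Z) f] = T' `&` [set f | forall y, y \in s -> vge y 0 f]).
  rewrite (_ : T2 `&` [set f | vge z 0 f] = T `&` [set f | forall y, y \in z :: s -> vge y 0 f]) //.
  apply/seteqP; split=> f; first by move=> [[Tf hz] hs]; split=> // y; rewrite inE => /predU1P[->|/hz].
  by move=> [Tf h]; split=> [|]; [split=> // y ys; apply: h|apply: h]; rewrite inE ?eqxx // ys orbT.
by apply/seteqP; split=> f; move=> [[Tf h1] h2].
Qed.

Lemma poles_free a n (b : 'I_n -> L) : transc a -> kbasis a b -> exists (b' : 'I_n -> L) (c : nat),
    [/\ kfree b' a, forall y j, 0 <= vord y a -> vge y 0 (b' j) & forall y j, vge y (- c%:Z) (b' j)].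
Proof.
move=> ta [fb mb]; have a0 := transc_neq0 ta.
have [s us hs] := fin_suppP (vord_finite a).
have [p up hp] : exists2 p, uniq p & forall y, (y \in p) = (vord y a < 0).
  exists (filter (fun y => vord y a < 0) s); first exact: filter_uniq.
  move=> y; rewrite mem_filter; case: ltP => //= lt; apply: hs; by rewrite lt_eqF.
have ha y : y \notin p -> vge y 0 a by rewrite hp -leNgt vgeE.
have /choice[q hq] j : exists q, q != 0 /\ forall y, y \notin p -> vge y 0 (pev a q * b j).
  by have [q q0 hq] := kill_poles (b j) ta ha; exists q.
have /choice[N hN] j : exists N : nat, forall y, vge y (- N%:Z) (pev a (q j) * b j).
  have [N hN] := ge_bound p (fun y => - vord y (pev a (q j) * b j)); exists N => y.
  have [yp|/(proj2 (hq j))] := boolP (y \in p); last by apply: vgeW; lia.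
  by apply: vgeW (vge_vord _ _); have := hN _ yp; lia.
exists (fun j => pev a (q j) * b j), (\sum_j N j)%N; split.
- move=> r e j; have := fb (fun j => r j * q j); move=> /(_ _ j)/eqP.
  rewrite mulf_eq0 (negbTE (proj1 (hq j))) orbF => h; apply/eqP/h; apply: etrans e.
  by apply: eq_bigr => i _; rewrite pevM mulrA.
- by move=> y j ge; apply: (proj2 (hq j)); rewrite hp -leNgt.
- by move=> y j; apply: vgeW (hN j y); rewrite (bigD1 j) //=; lia.
Qed.

Lemma powers_free a n (b : 'I_n -> L) l : kfree b a ->
  free_over cst (fun h : 'I_l * 'I_n => a ^+ h.1 * b h.2 : L^o).
Proof.
move=> fb c e [i j]; have := fb (fun j => \poly_(i < l) (if insub i is Some i' then c (i', j) else 0)).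
move=> /(_ _ j)/polyP/(_ i); rewrite coef_poly ltn_ord coef0 valK; apply.
apply: etrans e; transitivity (\sum_i \sum_j cst (c (i, j)) * (a ^+ i * b j)); last first.
  by rewrite pair_bigA; apply: eq_bigr => -[].
rewrite exchange_big; apply: eq_bigr => j' _; rewrite (pevE a (size_poly _ _)) mulr_suml.
by apply: eq_bigr => i' _; rewrite coef_poly ltn_ord valK mulrA.
Qed.

(** The [l * n] functions a^i b_j with i < l are free, with poles bounded by l times those of [a]
    plus a constant. If [a] had fewer than [n] poles, two independent combinations would be regular
    everywhere for large [l], whereas regular functions are constant. *)
Lemma poles_ge a n (b : 'I_n -> L) : transc a -> kbasis a b ->
  n%:Z <= tot (fun y => Num.max 0 (- vord y a)).
Proof.
move=> ta hb; have [b' [c [fb rb cb]]] := poles_free ta hb; have a0 := transc_neq0 ta.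
have [s us hs] : exists2 s, uniq s & forall y, y \notin s -> 0 <= vord y a.
  by have [s us hs] := fin_suppP (vord_finite a); exists s => // y; apply: contraR => h; apply: hs; lia.
pose E y := absz (Num.max 0 (- vord y a)).
have -> : tot (fun y => Num.max 0 (- vord y a)) = (\sum_(y <- s) E y)%N.
  rewrite (@tot_seq _ _ s) // => [|y]; last by apply: contraNT => /hs; lia.
  rewrite -[RHS]natz natr_sum; apply: eq_bigr => y _; rewrite /E; lia.
rewrite lez_nat leqNgt; apply/negP => lt.
(* With this [l] two free functions remain after the [S] polar conditions are imposed:
   [S + 2 <= l * n]. *)
pose l := (c * size s).+2.
pose S := (\sum_(y <- s) (l * E y + c))%N.
have fz := free_ord (powers_free (l := l) fb).
have cardE : #|{: 'I_l * 'I_n}| = (l * n)%N by rewrite card_prod !card_ord.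
have leS : (S.+2 <= l * n)%N.
  rewrite /S big_split -big_distrr big_const_seq iter_addn_0.
  have El (x : nat) : (l * x + c * size s).+2 = (l + l * x)%N by rewrite addnC.
  by apply: leq_trans (leq_mul (leqnn l) lt); rewrite mulnS -El.
pose T : set L^o := [set f | forall y, y \notin s -> vge y 0 f].
have kT : ksub T.
  split=> [y _|c' v w hv hw y ys]; first exact: vge0.
  apply: vgeD; last exact: hw.
  by rewrite -[0]addr0; apply: vgeM (vge_cst _ _) (hv _ ys).
have [||z' fz' hz'] := @poles_codim T s (fun y => l * E y + c)%N kT (l * n - S)%N _ _ _ fz.
- by rewrite subnK //; lia.
- move=> h; case: (enum_val h) => i j; split=> [y ys|y ys].
    by rewrite -[0]addr0; apply: vgeM (rb _ _ (hs _ ys)); apply: vgeX; rewrite vgeE //; exact: hs.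
  have -> : - (l * E y + c)%N%:Z = - (l * E y)%N%:Z + - c%:Z by lia.
  apply: vgeM (cb _ _); apply: (vgeW _ (vge_vord _ _)); rewrite vordX.
  apply: (@le_trans _ _ ((- (E y)%:Z) *+ i)); last by apply: ler_wMn2r; rewrite /E; lia.
  rewrite mulNrn lerN2 -mulr_natr natz lez_nat mulnC leq_mul2r.
  by rewrite (ltnW (ltn_ord i)) orbT.
have [||d [i0 di0] e] := @span_dependent _ _ cst L^o 'I_(l * n - S) 'I_1 (fun=> 1) z'.
- move=> i; have [y|w ->] := @regular_cst (z' i).
    by have [h1 h2] := hz' i; have [/h2|/h1] := boolP (y \in s).
  by exists (fun=> w); rewrite big_ord1 [_ *: _]mulr1.
- by rewrite !card_ord; lia.
by move/eqP: di0; apply; exact: fz'.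
Qed.

Lemma totmax_le a n (b : 'I_n -> L) : transc a -> kbasis a b ->
  tot (fun y : place X => Num.max 0 (vord y a)) <= n%:Z.
Proof.
move=> ta hb; have [s us hs] : exists2 s, uniq s & forall y, (y \in s) = (0 < vord y a).
  have [s us hs] := fin_suppP (vord_finite a); exists (filter (fun y => 0 < vord y a) s).
    exact: filter_uniq.
  by move=> y; rewrite mem_filter; case: ltP => //= lt; apply: hs; rewrite gt_eqF.
rewrite (@tot_seq _ _ s) // => [|y]; last by rewrite hs; lia.
pose y_ := tnth (in_tuple s).
have inj : injective y_ by apply/tuple_uniqP.
have pos i : 0 < vord (y_ i) a by rewrite -hs; exact: mem_tnth.
have := zeros_le ta hb inj pos; rewrite -lez_nat; apply: le_trans.
rewrite -[X in _ <= X]natz natr_sum (big_tnth _ _ s); apply: ler_sum => i _.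
by rewrite natz; rewrite /y_; lia.
Qed.

Lemma fin_supp_vord a : fin_supp (fun y : place X => vord y a).
Proof. exact: vord_finite. Qed.
Lemma tot_vord_split a : tot (fun y : place X => vord y a) =
  tot (fun y : place X => Num.max 0 (vord y a)) - tot (fun y : place X => Num.max 0 (- vord y a)).
Proof.
have fp : fin_supp (fun y : place X => Num.max 0 (vord y a)).
  by apply: fin_suppW (fin_supp_vord a) => y; lia.
have fn : fin_supp (fun y : place X => Num.max 0 (- vord y a)).
  by apply: fin_suppW (fin_supp_vord a) => y; lia.
by rewrite -totN -totD //; [apply: tot_eq => y; lia|exact: fin_suppN].
Qed.

(** The number of zeros of [a] is at most the degree over k(a), the number of poles at least that
    degree. The same inequalities for the inverse of [a] close the circle. *)
Lemma tot_vord a : tot (fun y : place X => vord y a) = 0.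
Proof.
have [ta|[c ->]] := transcP a; last first.
  by rewrite -[RHS](tot0 (place X)); apply: tot_eq => y; rewrite vord_cst.
rewrite tot_vord_split.
have [n [b hb]] := kbasis_ex ta; have [n' [b' hb']] := kbasis_ex (transcV ta).
have := poles_ge ta hb; have := totmax_le ta hb.
have := poles_ge (transcV ta) hb'; have := totmax_le (transcV ta) hb'.
have -> : tot (fun y : place X => Num.max 0 (vord y a^-1)) = tot (fun y : place X => Num.max 0 (- vord y a)).
  by apply: tot_eq => y; rewrite vordV.
have -> : tot (fun y : place X => Num.max 0 (- vord y a^-1)) = tot (fun y : place X => Num.max 0 (vord y a)).
  by apply: tot_eq => y; rewrite vordV opprK.
clear; lia.
Qed.

Lemma tot_zeros a n (b : 'I_n -> L) : transc a -> kbasis a b ->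
  tot (fun y : place X => Num.max 0 (vord y a)) = n%:Z.
Proof.
move=> ta hb; have := totmax_le ta hb; have := poles_ge ta hb; have := tot_vord_split a.
by rewrite tot_vord; clear; lia.
Qed.

End ProductFormula.

Lemma codimW (V : lmodType (ff X)) (T' T : set V) d d' : (d <= d')%N -> codim T' T d -> codim T' T d'.
Proof.
move=> le h m n z e fz hz.
have [|z' fz' hz'] := h (m + (d' - d))%N n z _ fz hz; first by rewrite e; lia.
exists (z' \o @lshift m (d' - d)) => [|i]; last exact: hz'.
exact: (@free_inj _ _ _ V _ 'I_m z' (@lshift m (d' - d)) fz' (@lshift_inj _ _)).
Qed.

(** * Frames as matrices and their determinants *)

Definition mxof I J (M : mat L I J) : 'M[L]_(#|I|, #|J|) :=
  \matrix_(i < #|I|, j < #|J|) (M (enum_val i) (enum_val j) : L).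

Definition ofmx I J (A : 'M[L]_(#|I|, #|J|)) : mat L I J :=
  [ffun i => [ffun j => A (enum_rank i) (enum_rank j)]].

Lemma mxofK I J : cancel (@mxof I J) (@ofmx I J).
Proof. by move=> M; apply/ffunP => i; apply/ffunP => j; rewrite !ffunE mxE !enum_rankK. Qed.
Lemma ofmxK I J : cancel (@ofmx I J) (@mxof I J).
Proof. by move=> A; apply/matrixP => i j; rewrite mxE !ffunE !enum_valK. Qed.
Lemma mxof_comp I J K (N : mat L J K) (M : mat L I J) : mxof (compm N M) = mxof M *m mxof N.
Proof.
apply/matrixP => i j; rewrite !mxE ffunE appE sum_enum.
by apply: eq_bigr => l _; rewrite !mxE.
Qed.
Lemma mxof1 I : mxof (mat1 I) = 1%:M.
Proof. by apply/matrixP => i j; rewrite !mxE !ffunE (inj_eq enum_val_inj). Qed.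
Lemma frame_detE I (e : mat L I I) : fdet e = \det (mxof e).
Proof. by []. Qed.
Lemma frame_det_comp I (N M : mat L I I) : fdet (compm N M) = fdet M * fdet N.
Proof. by rewrite !frame_detE mxof_comp det_mulmx. Qed.
Lemma frame_det1 I : fdet (mat1 I : mat L I I) = 1.
Proof. by rewrite frame_detE mxof1 det1. Qed.
Lemma minv_det I (e e' : mat L I I) : minv e e' -> fdet e != 0 /\ fdet e' = (fdet e)^-1.
Proof.
case=> h _; have : fdet e * fdet e' = 1 by rewrite -frame_det_comp h frame_det1.
move=> E; have n0 : fdet e != 0.
  by apply/eqP => e0; move/eqP: E; rewrite e0 mul0r eq_sym oner_eq0.
by split=> //; apply: (mulfI n0); rewrite divff.
Qed.
Lemma det_minv I (e : mat L I I) : fdet e != 0 -> minv e (ofmx (invmx (mxof e))).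
Proof.
rewrite -unitfE => u; split; rewrite -[LHS]mxofK mxof_comp ofmxK.
  by rewrite mulmxV // -mxof1 mxofK.
by rewrite mulVmx // -mxof1 mxofK.
Qed.
Lemma minv_sym I J (M : mat L I J) N : minv M N -> minv N M.
Proof. by case. Qed.
Lemma scalar_det I a : a != 0 -> fdet ([ffun j => a *: bvec L j] : mat L I I) != 0.
Proof.
move=> a0; rewrite frame_detE (_ : mxof _ = a%:M) ?det_scalar ?expf_neq0 //.
by apply/matrixP => i j; rewrite !mxE !ffunE (inj_eq enum_val_inj); exact: mulr_natr.
Qed.

Lemma frame_det_enum I n (h : 'I_n -> I) (e : mat L I I) : bijective h ->
  fdet e = \det (\matrix_(i, j) (e (h i) (h j) : L)).
Proof.
move=> [g hK gK]; have cE : #|I| = n.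
  by rewrite -[RHS](card_ord n); apply: (@bij_eq_card _ _ g); exists h.
case: n / cE h g hK gK => h g hK gK.
pose f i := enum_rank (h i); have fK : injective f.
  by move=> i j /enum_rank_inj /(can_inj hK).
pose s := perm fK.
have -> : (\matrix_(i, j) (e (h i) (h j) : L)) = row_perm s (col_perm s (mxof e)).
  by apply/matrixP => i j; rewrite !mxE !permE !enum_rankK.
by rewrite row_permE col_permE !det_mulmx !det_perm odd_permV mulrCA -signr_addb addbb mulr1.
Qed.

Lemma frame_det_sum I J (e : mat L (I + J)%type (I + J)%type) (eI : mat L I I) (eJ : mat L J J) :
  (forall i i', e (inl i) (inl i') = eI i i') -> (forall j j', e (inr j) (inr j') = eJ j j') ->
  (forall i j, e (inl i) (inr j) = 0) -> fdet e = fdet eI * fdet eJ.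
Proof.
move=> h1 h2 h3.
pose h (i : 'I_(#|I| + #|J|)) : (I + J)%type :=
  match fintype.split i with inl a => inl (enum_val a) | inr b => inr (enum_val b) end.
have bh : bijective h.
  exists (fun x => match x with inl i => lshift _ (enum_rank i) | inr j => rshift _ (enum_rank j) end).
    by move=> i; rewrite /h; case: splitP => j e0; apply: val_inj; rewrite enum_valK.
  by move=> [i|j]; rewrite /h ?(unsplitK (inl _)) ?(unsplitK (inr _)) enum_rankK.
rewrite (frame_det_enum e bh) -(det_lblock _ (\matrix_(j, i) (e (inr (enum_val j)) (inl (enum_val i)) : L)))
  -[X in \det X]submxK; congr (\det (block_mx _ _ _ _)); apply/matrixP => i j.
all: by rewrite !mxE /h ?(unsplitK (inl _)) ?(unsplitK (inr _)).
Qed.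

Lemma frame_det_reindex I J (h : I -> J) (e : mat L J J) (e' : mat L I I) : bijective h ->
  (forall i i', e' i i' = e (h i) (h i')) -> fdet e' = fdet e.
Proof.
move=> bh E; rewrite (@frame_det_enum J #|I| (h \o enum_val)).
  by rewrite frame_detE; congr (\det _); apply/matrixP => i j; rewrite !mxE.
by apply: bij_comp => //.
Qed.

(** The matrix is block diagonal with [#|J|] copies of [e]; with [J] replaced by an ordinal, the
    blocks are split off one at a time. *)
Lemma frame_det_mtens1 I J (e : mat L I I) : fdet (mtens e (mat1 J)) = fdet e ^+ #|J|.
Proof.
pose h (p : I * 'I_#|J|) := (p.1, enum_val p.2).
have bh : bijective h.
  by exists (fun p => (p.1, enum_rank p.2)) => -[i j]; rewrite /h ?enum_valK ?enum_rankK.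
rewrite -(frame_det_reindex bh (e' := mtens e (mat1 'I_#|J|))) => [|p p']; last first.
  by rewrite !ffunE (inj_eq enum_val_inj).
elim: #|J| {h bh} => [|n IH].
  rewrite frame_detE; have cIJ : #|{: I * 'I_0}| = 0%N by rewrite card_prod card_ord muln0.
  by move: (mxof _); rewrite cIJ => A; rewrite det_mx00.
pose g (x : I + I * 'I_n) : I * 'I_n.+1 :=
  match x with inl i => (i, ord0) | inr p => (p.1, lift ord0 p.2) end.
have bg : bijective g.
  exists (fun p => if unlift ord0 p.2 is Some j then inr (p.1, j) else inl p.1).
    by move=> [i|[i j]]; rewrite ?unlift_none ?liftK.
  by move=> [i j] /=; case: unliftP => [j'|] ->.
pose e2 : mat L (I + I * 'I_n)%type (I + I * 'I_n)%type :=
  [ffun x => [ffun x' => mtens e (mat1 'I_n.+1) (g x) (g x')]].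
rewrite -(frame_det_reindex bg (e' := e2)) => [|x x']; last by rewrite !ffunE.
rewrite exprS -IH; apply: frame_det_sum => [i i'|p p'|i p].
- by rewrite !ffunE mulr1.
- by rewrite !ffunE.
- by rewrite !ffunE; exact: mulr0.
Qed.

Lemma frame_det_mtens I J (e : mat L I I) (f : mat L J J) :
  fdet (mtens e f) = fdet e ^+ #|J| * fdet f ^+ #|I|.
Proof.
have -> : mtens e f = compm (mtens (mat1 I) f) (mtens e (mat1 J)).
  by rewrite mtens_comp comp1m compm1.
rewrite frame_det_comp frame_det_mtens1; congr (_ * _); rewrite -frame_det_mtens1.
apply: (@frame_det_reindex _ _ (fun p => (p.2, p.1))); first by exists (fun p => (p.2, p.1)) => -[].
by move=> [i j] [i' j']; rewrite !ffunE mulrC.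
Qed.

Lemma res0 y : res y 0 = 0. Proof. by rewrite -(rmorph0 (kcst X)) res_cst. Qed.
Lemma det_ge y n (A : 'M[L]_n) : (forall i j, vge y 0 (A i j)) -> vge y 0 (\det A).
Proof.
move=> h; apply: vge_sum => s _; rewrite -[0]addr0; apply: vgeM.
  by apply: vgeX; rewrite vgeN; exact: in_ring1.
by elim/big_rec: _ => [|i x _ hx]; [exact: in_ring1|rewrite -[0]addr0; apply: vgeM].
Qed.

Lemma inv_ge y I (e e' : mat L I I) : minv e e' -> (forall i j, vge y 0 (e i j)) ->
  vord y (fdet e) = 0 -> forall i j, vge y 0 (e' i j).
Proof.
move=> ee' he v0 i j; have [n0 _] := minv_det ee'.
have -> : e' = ofmx (invmx (mxof e)) by exact: minv_uniq ee' (det_minv n0).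
rewrite !ffunE /invmx unitmxE unitfE n0 mxE -[0]addr0; apply: vgeM.
  by rewrite vgeE ?invr_eq0 // vordV v0.
rewrite mxE -[0]addr0; apply: vgeM; first by apply: vgeX; rewrite vgeN; exact: in_ring1.
by apply: det_ge => a b; rewrite !mxE.
Qed.

Lemma app_ge y I J (M : mat L I J) (v : vec L I) : (forall i j, vge y 0 (M i j)) ->
  (forall i, vge y 0 (v i)) -> forall j, vge y 0 (app M v j).
Proof.
move=> hM hv j; rewrite appE; apply: vge_sum => i _.
by rewrite -[0]addr0; apply: vgeM.
Qed.

(** * Lattices at a place *)

Definition omod y I (S : set (vec L I)) :=
  S 0 /\ forall c v w, vge y 0 c -> S v -> S w -> S (c *: v + w).

Lemma omod_sum y I J (S : set (vec L I)) (c : J -> L) (v : J -> vec L I) : omod y S ->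
  (forall j, vge y 0 (c j)) -> (forall j, S (v j)) -> S (\sum_j c j *: v j).
Proof. by move=> [S0 SZ] hc hv; elim/big_rec: _ => // j w _; exact: SZ. Qed.
Lemma stalk_omod (V : bundle X) y : omod y (stalk V y).
Proof. by split; [exact: stalk_nil|move=> c v w; exact: stalk_lin]. Qed.
Lemma frames_omod y I (e : mat L I I) S : frames y e S -> omod y S.
Proof.
move=> fe; split=> [|c v w]; last exact: frames_lin fe.
by case: fe => _ fe; rewrite -(app0 e); apply/fe => i; rewrite ffunE; exact: vge0.
Qed.

Section Index.
Variables (y : place X) (I : finType).
Implicit Types (e f : mat L I I) (S : set (vec L I)).

Lemma frames_rows e S : frames y e S -> forall i, S (e i).
Proof. by move=> fe i; exact: frame_mem fe || exact: (frames_mem i fe). Qed.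
(** The matrix of [e] in terms of [f] is integral, and the valuation of its determinant is the
    difference of the two sides. If that is 0, the inverse matrix is integral as well, by Cramer's
    rule. *)
Lemma frames_sub e f S T : frames y e S -> frames y f T -> S `<=` T ->
  vord y (fdet f) <= vord y (fdet e) /\
  (vord y (fdet e) <= vord y (fdet f) -> S = T).
Proof.
move=> fe ff ST; have [[e' ee'] _] := fe; have [[f' ff'] _] := ff.
pose g := compm f' e; pose g' := compm e' f.
have gg : minv g g' by apply: minvP => v; rewrite !appM ?(minv_r _ ff') ?(minv_l _ ee') // (minv_r _ ee') (minv_l _ ff').
have hg i j : vge y 0 (g i j).
  by rewrite ffunE; apply: (framesP _ ff ff').1; apply: ST; exact: frames_rows.
have [e0 _] := minv_det ee'; have [f0 ef'] := minv_det ff'; have [g0 _] := minv_det gg.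
have vg : vord y (fdet g) = vord y (fdet e) - vord y (fdet f).
  by rewrite frame_det_comp ef' vordM ?invr_eq0 // vordV.
have : vge y 0 (fdet g) by rewrite frame_detE; apply: det_ge => i j; rewrite mxE.
rewrite vgeE // vg subr_ge0 => le; split=> // le'; apply/seteqP; split=> // v Tv.
have hg' := inv_ge gg hg ltac:(rewrite vg; lia).
rewrite (framesP _ fe ee') => i.
have -> : app e' v = app g' (app f' v) by rewrite appM (minv_r _ ff').
by apply: app_ge => //; apply/(framesP _ ff ff').
Qed.

Lemma frames_eq e f S : frames y e S -> frames y f S -> vord y (fdet e) = vord y (fdet f).
Proof.
move=> fe ff; apply/eqP; rewrite eq_le.
by rewrite (frames_sub fe ff (@subset_refl _ S)).1 (frames_sub ff fe (@subset_refl _ S)).1.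
Qed.

(* The elements of S whose determinant has the least valuation form a frame. *)
Lemma lattice_frame S f (N : nat) : omod y S -> fdet f != 0 -> (forall i, S (f i)) ->
  (forall v i, S v -> vge y (- N%:Z) (v i)) -> exists e, frames y e S.
Proof.
move=> mS f0 Sf bS.
have [t t0 t1] := unif_ex y.
have lb e : (forall i, S (e i)) -> fdet e != 0 -> - (N * #|I|)%:Z <= vord y (fdet e).
  move=> Se e0; pose A := t ^+ N *: mxof e.
  have : vge y 0 (\det A).
    apply: det_ge => i j; rewrite !mxE.
    have -> : 0 = vord y (t ^+ N) + - N%:Z by rewrite vordX t1 natz subrr.
    exact: vgeM (vge_vord _ _) (bS _ _ (Se _)).
  rewrite detZ -frame_detE vgeE ?mulf_neq0 ?expf_neq0 // vordM ?expf_neq0 //.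
  by rewrite !vordX t1 natz; lia.
pose P n := `[< exists e, [/\ forall i, S (e i), fdet e != 0 &
  vord y (fdet e) + (N * #|I|)%:Z = n%:Z] >].
have exP : exists n, P n.
  have := lb _ Sf f0; exists (absz (vord y (fdet f) + (N * #|I|)%:Z)).
  by apply/asboolP; exists f; split=> //; lia.
case: (ex_minnP exP) => n /asboolP[e [Se e0 en]] min; exists e.
have ee' := det_minv e0; split; first by exists (ofmx (invmx (mxof e))).
move=> c; split=> [Sc i|hc]; last exact: (omod_sum mS hc Se).
rewrite -[in_ring y _]negbK; apply/negP; rewrite /vge => /norP[c0].
(* If [c i] had a pole, replacing [e i] by [app e c] would lower the valuation of the
   determinant. *)
pose e2 : mat L I I := [ffun j => if j == i then app e c else e j].
pose g : mat L I I := [ffun j => if j == i then c else bvec L j].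
have ge : compm e g = e2.
  by apply/ffunP => j; rewrite !ffunE; case: eqP => // _; rewrite app_bvec.
have dg : fdet g = c i.
  rewrite frame_detE (expand_det_col _ (enum_rank i)) (bigD1 (enum_rank i)) //= big1 ?addr0.
    rewrite mxE !ffunE enum_rankK eqxx /cofactor addnn -signr_odd odd_double.
    rewrite [X in \det X](_ : _ = 1%:M) ?det1 ?mulr1 //; apply/matrixP => a b; rewrite !mxE !ffunE.
    have -> : enum_val (lift (enum_rank i) a) == i = false.
      by apply/eqP => /(congr1 enum_rank); rewrite enum_valK => /eqP; rewrite eq_sym (negbTE (neq_lift _ _)).
    by rewrite ffunE (inj_eq enum_val_inj) (inj_eq lift_inj).
  move=> j ji; rewrite mxE !ffunE; case: eqP => [E|_].
    by move: ji; rewrite -E enum_valK eqxx.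
  rewrite ffunE enum_rankK; case: eqP => [E|_]; last by rewrite mul0r.
  by move: ji; rewrite -E enum_valK eqxx.
have d2 : fdet e2 = c i * fdet e by rewrite -ge frame_det_comp dg.
have e20 : fdet e2 != 0 by rewrite d2 mulf_neq0.
have Se2 j : S (e2 j) by rewrite ffunE; case: eqP => _.
have := lb _ Se2 e20; rewrite d2 vordM // => lb2.
have /min : P (absz (vord y (fdet e2) + (N * #|I|)%:Z)).
  by apply/asboolP; exists e2; split=> //; rewrite d2 vordM //; lia.
by rewrite d2 vordM //; lia.
Qed.

Lemma frames_bounded f T : frames y f T -> exists N : nat, forall v i, T v -> vge y (- N%:Z) (v i).
Proof.
move=> ff; have [[f' ff'] _] := ff.
have [N hN] := ge_bound (enum {: I * I}) (fun p => - vord y (f p.1 p.2)).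
exists N => v i /(framesP _ ff ff') Tv; rewrite -(minv_r v ff') appE; apply: vge_sum => j _.
rewrite -[- N%:Z]add0r; apply: vgeM (Tv j) _; apply: vgeW (vge_vord _ _).
by have := hN (j, i); rewrite mem_enum => /(_ isT) /=; lia.
Qed.

(** Induction on the difference of the determinants. When [S] is smaller than [T], the matrix from
    [S] to [T] is singular modulo the maximal ideal; a vector of its kernel defines a functional on
    [T] with values in k that vanishes on [S], and the kernel of this functional is a lattice
    containing [S] and strictly smaller than [T]. *)
Lemma lattice_codim e f S T (W : set (vec L I)) : frames y e S -> frames y f T -> S `<=` T ->
  ksub (V := {ffun I -> L^o}) W -> codim (V := {ffun I -> L^o}) (W `&` T) (W `&` S)
    `|vord y (fdet e) - vord y (fdet f)|.
Proof.
move=> fe ff0 ST0 kW.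
suff H d f' T' : (absz (vord y (fdet e) - vord y (fdet f')) <= d)%N ->
    frames y f' T' -> S `<=` T' -> codim (V := {ffun I -> L^o}) (W `&` T') (W `&` S) d.
  exact: H ff0 ST0.
elim: d f' T' {f T ff0 ST0} => [|d IH] f T led ff ST.
  have [le eq] := frames_sub fe ff ST; rewrite eq; first exact: codim0.
  by move: led le; lia.
have [le eq] := frames_sub fe ff ST.
have [Ef|nE] := eqVneq (vord y (fdet e)) (vord y (fdet f)).
  by rewrite -eq ?Ef //; apply: (codimW (leq0n _)); exact: codim0.
have [[f' ff'] _] := ff; have [[e' ee'] _] := fe.
pose g := compm f' e; pose r : 'M[k]_#|I| := \matrix_(i, j) res y (mxof g i j).
have hg i j : vge y 0 (g i j).
  by rewrite ffunE; apply: (framesP _ ff ff').1; apply: ST; exact: frames_rows.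
have res_det n (A : 'M[L]_n) : (forall i j, vge y 0 (A i j)) ->
    res y (\det A) = \det (\matrix_(i, j) res y (A i j)).
  move=> hA; rewrite res_sum => [|s].
    apply: eq_bigr => s _; rewrite resM; last first.
    - by elim/big_rec: _ => [|i x _ hx]; [exact: in_ring1|rewrite -[0]addr0; apply: vgeM].
    - by apply: vgeX; rewrite vgeN; exact: in_ring1.
    congr (_ * _).
      by rewrite -(rmorphN1 (kcst X)) -rmorphXn res_cst.
    have [] : vge y 0 (\prod_i A i (s i)) /\
      res y (\prod_i A i (s i)) = \prod_i (\matrix_(i, j) res y (A i j)) i (s i); last by [].
    elim/big_rec2: _ => [|i x z _ [h1 h2]].
      by rewrite -(rmorph1 (kcst X)) res_cst vge_cst.
    by rewrite mxE resM // h2; split=> //; rewrite -[0]addr0; exact: vgeM.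
  rewrite -[0]addr0; apply: vgeM; first by apply: vgeX; rewrite vgeN; exact: in_ring1.
  by elim/big_rec: _ => [|i x _ hx]; [exact: in_ring1|rewrite -[0]addr0; apply: vgeM].
have vg : vord y (fdet g) = vord y (fdet e) - vord y (fdet f).
  have [e0 _] := minv_det ee'; have [f0 ef'] := minv_det ff'.
  by rewrite frame_det_comp ef' vordM ?invr_eq0 // vordV.
have r0 : \det r = 0.
  rewrite -res_det => [|i j]; last by rewrite mxE.
  apply/res_eq0; rewrite -frame_detE.
    by rewrite /vge; lia.
  by rewrite /vge; lia.
have /rowV0Pn[a /sub_kermxP ra a0] : kermx r^T != 0.
  by rewrite kermx_eq0 row_free_unit unitmxE det_tr r0 unitr0.
pose phi (v : vec L I) := \sum_i a 0 (enum_rank i) * res y (app f' v i).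
have hT v : T v -> forall i, vge y 0 (app f' v i) by move/(framesP _ ff ff').
have lin c v w : T v -> T w -> phi (kcst X c *: v + w) = c * phi v + phi w.
  move=> Tv Tw; rewrite mulr_sumr -big_split; apply: eq_bigr => i _.
  rewrite appD appZ ffunE [X in X + _]ffunE resD ?hT //; last first.
    by rewrite -[0]addr0; apply: vgeM (vge_cst _ _) _; exact: hT.
  by rewrite resM ?hT ?vge_cst // res_cst mulrDr mulrCA.
pose T2 := T `&` [set v | phi v = 0].
have phiS v : S v -> phi v = 0.
  move=> /(framesP _ fe ee') hv; have -> : v = app e (app e' v) by rewrite (minv_r _ ee').
  have E i : res y (app g (app e' v) i) = \sum_j res y (app e' v j) * res y (g j i).
    rewrite appE res_sum; last by move=> j; rewrite -[0]addr0; apply: vgeM; [exact: hv|exact: hg].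
    by apply: eq_bigr => j _; rewrite resM; [|exact: hv|exact: hg].
  rewrite /phi -appM; under eq_bigr do rewrite E.
  under eq_bigr do rewrite mulr_sumr; rewrite exchange_big big1 //= => j _.
  under eq_bigr do rewrite mulrCA; rewrite -mulr_sumr.
  suff -> : \sum_i a 0 (enum_rank i) * res y (g j i) = 0 by rewrite mulr0.
  transitivity ((a *m r^T) 0 (enum_rank j)); last by rewrite ra mxE.
  by rewrite mxE sum_enum; apply: eq_bigr => i _; rewrite enum_valK !mxE enum_rankK.
have ST2 : S `<=` T2 by move=> v Sv; split; [exact: ST|exact: phiS].
have mT2 : omod y T2.
  have [T0 TZ] := frames_omod ff; have phi0 : phi 0 = 0.
    by rewrite /phi big1 // => i _; rewrite app0 ffunE -(rmorph0 (kcst X)) res_cst mulr0.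
  split=> [|c v w hc [Tv pv] [Tw pw]]; first by split.
  split; first exact: TZ.
  have -> : c *: v + w = kcst X (res y c) *: v + ((c - kcst X (res y c)) *: v + w).
    by rewrite addrA -scalerDl (addrC (kcst X _)) subrK.
  have Tz : T ((c - kcst X (res y c)) *: v + w) by apply: TZ => //; apply: vgeB (vge_cst _ _).
  rewrite /= lin // pv mulr0 add0r -[RHS]pw; apply: eq_bigr => i _.
  rewrite appD appZ ffunE [X in X + _]ffunE resD ?hT //; last first.
    by apply: vgeW (vgeM (resP hc) (hT _ Tv i)).
  have v1 : vge y 1 ((c - kcst X (res y c)) * app f' v i).
    by rewrite -[1]addr0; apply: vgeM (resP hc) (hT _ Tv i).
  by rewrite (res_eq0 (vgeW _ v1)).2 ?add0r.
have [N bN] := frames_bounded ff; have [e0 _] := minv_det ee'.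
have [f2 ff2] := lattice_frame mT2 e0 (fun i => ST2 _ (frames_rows fe i)) (fun v i h => bN v i h.1).
have [le2 eq2] := frames_sub ff2 ff (fun v h => h.1).
have [le3 _] := frames_sub fe ff2 ST2.
have neq : vord y (fdet f2) != vord y (fdet f).
  apply/eqP => E2; have TT : T2 = T by apply: eq2; rewrite E2.
  have /rV0Pn[i ai] := a0.
  have : T2 (f (enum_val i)) by rewrite TT; exact: frames_rows.
  case=> _ /eqP; rewrite /phi (bigD1 (enum_val i)) //= enum_valK -app_bvec (minv_l _ ff').
  rewrite ffunE eqxx -(rmorph1 (kcst X)) res_cst mulr1 big1 ?addr0 ?(negbTE ai) // => j ji.
  by rewrite ffunE eq_sym (negbTE ji) res0 mulr0.
have kWT : ksub (V := {ffun I -> L^o}) (W `&` T).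
  have [T0 TZ] := frames_omod ff; have [W0 WZ] := kW; split=> // c v w [h1 h2] [h3 h4].
  by split; [exact: WZ|apply: TZ => //; exact: vge_cst].
rewrite -[X in codim _ _ X]add1n; apply: (@codim_trans _ _ (W `&` T2)).
  apply: (@codim_functional _ _ _ phi kWT) => [c v w [_ Tv] [_ Tw]|v [Wv Tv] pv]; first exact: lin.
  by split.
apply: IH ff2 ST2; lia.
Qed.

End Index.

(** * Bundles as families of lattices *)

Section Adelic.
Implicit Types (z : place X).

Definition std y I : set (vec L I) := [set v | forall i, vge y 0 (v i)].

Lemma bad_finite J (F : J -> L) : finite_set [set y : place X | ~ forall j, vge y 0 (F j)].
Proof.
apply: (@sub_finite_set _ _ (\bigcup_(j in [set: J]) [set y : place X | vord y (F j) != 0])).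
  move=> y /existsNP[j hj]; exists j => //=; apply/eqP => e; apply: hj.
  by apply: vgeW (vge_vord _ _); rewrite e.
by apply: bigcup_finite => [|j _]; [exact: finite_finset|exact: vord_finite].
Qed.

Lemma bad_finite2 I J (M : mat L I J) : finite_set [set y : place X | ~ forall i j, vge y 0 (M i j)].
Proof.
apply: sub_finite_set (bad_finite (fun p : I * J => M p.1 p.2)) => y h1 h2.
by apply: h1 => i j; exact: (h2 (i, j)).
Qed.

Lemma nonintegral_finite I J I' J' (M : mat L I J) (N : mat L I' J') (S T : set (place X)) :
  finite_set S -> (forall z, ~ S z -> (forall i j, vge z 0 (M i j)) ->
  (forall i j, vge z 0 (N i j)) -> ~ T z) -> finite_set T.
Proof.
move=> fS h; apply: (@sub_finite_set _ _ (S `|` ([set z | ~ forall i j, vge z 0 (M i j)] `|`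
  [set z | ~ forall i j, vge z 0 (N i j)]))); last first.
  by rewrite !finite_setU; split=> //; split; exact: bad_finite2.
by move=> z Tz; apply: contrapT => /not_orP[h1 /not_orP[/contrapT h2 /contrapT h3]]; exact: (h z).
Qed.

Lemma std_frame y I (e e' : mat L I I) : minv e e' -> (forall i j, vge y 0 (e i j)) ->
  (forall i j, vge y 0 (e' i j)) -> frames y e (std y (I := I)).
Proof.
move=> ee' he he'; split; first by exists e'.
move=> c; split=> [hc i|hc]; last exact: app_ge.
by rewrite -(minv_l c ee'); exact: app_ge.
Qed.

(** Lattices that are standard at almost all places. By [adelic_loc_free] and [bundle_adelic] such
    families are the vector bundles, and these conditions are easier to verify than local
    freeness. *)
Definition adelic I (S : place X -> set (vec L I)) : Prop := [/\ forall y, omod y (S y),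
      forall y, exists N : nat, forall v i, S y v -> vge y (- N%:Z) (v i),
      forall y, exists2 f : mat L I I, fdet f != 0 & forall i, S y (f i)
    & finite_set [set y | S y <> std y (I := I)]].

Lemma adelic_frame I (S : place X -> set (vec L I)) y : adelic S -> exists e, frames y e (S y).
Proof.
case=> h1 h2 h3 _; have [N hN] := h2 y; have [f f0 hf] := h3 y.
exact: lattice_frame (h1 y) f0 hf hN.
Qed.

Lemma adelic_loc_free I (S : place X -> set (vec L I)) : adelic S ->
  forall y, exists U : set (place X), [/\ zopen U, U y &
    exists e : mat L I I, forall z, U z -> frames z e (S z)].
Proof.
move=> aS y; have [e fe] := adelic_frame y aS; have [[e' ee'] _] := fe.
have [_ _ _ fS] := aS.
pose G : set (place X) := [set z | [/\ S z = std z (I := I), forall i j, vge z 0 (e i j)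
  & forall i j, vge z 0 (e' i j)]].
exists (G `|` [set y]); split; [right|by right|exists e => z [[-> h1 h2]|->] //]; last exact: std_frame h1 h2.
by apply: (nonintegral_finite (M := e) (N := e') fS) => z /contrapT ? ? ?; apply; left.
Qed.

Definition mkb I (S : place X -> set (vec L I)) (aS : adelic S) : bundle X :=
  Bundle (adelic_loc_free aS).

Lemma frames_inv V y : exists2 e, frames y e (stalk V y) & exists e', minv e e'.
Proof. by have [e fe] := frames_ex V y; exists e; case: fe. Qed.
Lemma bundle_adelic V : adelic (stalk V).
Proof.
split.
- by move=> y; exact: stalk_omod.
- by move=> y; have [e fe] := frames_ex V y; exact: frames_bounded fe.
- move=> y; have [e fe [e' ee']] := frames_inv V y.
  by exists e; [case: (minv_det ee')|exact: (frames_rows fe)].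
have [[y0 _]|n0] := pselect (exists y0 : place X, True); last first.
  by rewrite (_ : [set _ | _] = set0) //; apply/seteqP; split=> y; case: n0.
have [U [oU Uy [e he]]] := loc_free V y0; have [[e' ee'] _] := he _ Uy.
case: oU => [U0|fU]; first by move: Uy; rewrite U0.
apply: (nonintegral_finite (M := e) (N := e') fU) => z /contrapT h1 h2 h3 h.
apply: h; have fs := std_frame ee' h2 h3; apply/seteqP; split=> v.
  by move=> hv; apply/(framesP _ fs ee'); apply/(framesP _ (he _ h1) ee').
by move=> /(framesP _ fs ee') hv; apply/(framesP _ (he _ h1) ee').
Qed.

Definition ldeg V y : int := vord y (fdet (stalk_frame V y)).

Lemma ldegE V y e : frames y e (stalk V y) -> ldeg V y = vord y (fdet e).
Proof. by move=> fe; apply: frames_eq fe; exact: projT2 (cid (frames_ex V y)). Qed.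
Lemma degreeE V : degree V = - tot (ldeg V).
Proof. by []. Qed.
Lemma frames_std y I : frames y (mat1 I) (std y (I := I)).
Proof.
split; first by exists (mat1 I); apply: minvP => v; rewrite !app_id.
by move=> c; rewrite app_id.
Qed.

Lemma fin_supp_ldeg V : fin_supp (ldeg V).
Proof.
have [_ _ _ fS] := bundle_adelic V; apply: sub_finite_set fS => y h e.
by move/eqP: h; rewrite (@ldegE _ _ (mat1 _)) ?frame_det1 ?vord1 // e; exact: frames_std.
Qed.

Section Transport.
Variables (V : bundle X) (I : finType) (M : mat L I (idx V)) (N : mat L (idx V) I).
Hypothesis MN : minv M N.

Lemma minv_card : #|I| = #|idx V|.
Proof.
have [h1 h2] := MN; apply/eqP; rewrite eqn_leq.
have := congr1 (@mxof _ _) h1; have := congr1 (@mxof _ _) h2.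
by rewrite !mxof_comp !mxof1 => /mulmx1_min -> /mulmx1_min ->.
Qed.

Let b (i : I) : idx V := enum_val (cast_ord minv_card (enum_rank i)).
Let b' (j : idx V) : I := enum_val (cast_ord (esym minv_card) (enum_rank j)).
Let bK : cancel b b'. by move=> i; rewrite /b' enum_valK cast_ordK enum_rankK. Qed.
Let b'K : cancel b' b. Proof. by move=> i; rewrite /b enum_valK cast_ordKV enum_rankK. Qed.
Let bb : bijective b. Proof. by exists b'. Qed.

Definition tr_frame (e : mat L (idx V) (idx V)) : mat L I I := [ffun i => app N (e (b i))].
Let Nb : mat L I I := [ffun i => N (b i)].

Lemma tr_frame_det e : fdet (tr_frame e) = fdet e * fdet Nb.
pose eb : mat L I I := [ffun i => [ffun i' => e (b i) (b i')]].
have -> : tr_frame e = compm Nb eb.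
  apply/ffunP => i; rewrite !ffunE; apply/ffunP => i'; rewrite !appE (reindex b); last exact: onW_bij.
  by apply: eq_bigr => i'' _; rewrite !ffunE.
by rewrite frame_det_comp; congr (_ * _); apply: frame_det_reindex bb _ => i i'; rewrite !ffunE.
Qed.

Lemma app_tr_frame e c : app (tr_frame e) c = app N (app e [ffun j => c (b' j)]).
Proof.
rewrite app_sum [LHS]/app (reindex b'); last by apply: onW_bij; exists b.
by apply: eq_bigr => j _; rewrite appZ !ffunE b'K.
Qed.

Lemma tr_frames y e : frames y e (stalk V y) -> frames y (tr_frame e) [set v | stalk V y (app M v)].
Proof.
move=> fe; have [[e' ee'] _] := fe; split.
  pose f : mat L I I := compm (compm (pullm L b) e') M.
  exists f; apply: minvP => v; rewrite !appM ?app_tr_frame.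
    rewrite (minv_r _ MN) (minv_l _ ee') app_pull; apply/ffunP => i; rewrite !ffunE bK //.
  rewrite app_pull -[RHS](minv_l _ MN); congr (app N _).
  rewrite -[RHS](minv_r _ ee'); congr (app e _); apply/ffunP => j; rewrite !ffunE b'K //.
move=> c /=; rewrite app_tr_frame (minv_r _ MN) (proj2 fe); split=> h i.
  by have := h (b i); rewrite ffunE bK.
by rewrite ffunE.
Qed.

Lemma transport_adelic : adelic (fun y => [set v | stalk V y (app M v)]).
Proof.
have [aO aB aF fS] := bundle_adelic V.
have fr y : exists e, frames y e [set v | stalk V y (app M v)].
  by have [e fe] := frames_ex V y; exists (tr_frame e); exact: tr_frames.
split.
- by move=> y; have [e fe] := fr y; exact: frames_omod fe.
- by move=> y; have [e fe] := fr y; exact: frames_bounded fe.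
- move=> y; have [e fe] := fr y; have [[e' ee'] _] := fe.
  by exists e; [case: (minv_det ee')|exact: (frames_rows fe)].
apply: (nonintegral_finite (M := M) (N := N) fS) => z /contrapT h1 h2 h3 h.
apply: h; apply/seteqP; split=> v; rewrite h1 => hv; last exact: app_ge.
by rewrite -(minv_l v MN); exact: app_ge.
Qed.

Definition transport := mkb transport_adelic.

(** The determinants of all frames are multiplied by one and the same function, whose divisor has
    degree 0. *)
Lemma transport_degree : degree transport = degree V.
Proof.
rewrite !degreeE.
rewrite (@tot_eq _ _ (fun y => ldeg V y + vord y (fdet Nb))) => [|y]; last first.
  have [e fe] := frames_ex V y; rewrite (ldegE fe) (@ldegE transport _ (tr_frame e)); last exact: tr_frames.
  have [[e' ee'] _] := fe; have [e0 _] := minv_det ee'.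
  have [[f ff'] _] := tr_frames fe; have [f0 _] := minv_det ff'.
  rewrite tr_frame_det vordM //; apply: contraNneq f0 => n0.
  by rewrite tr_frame_det n0 mulr0.
by rewrite totD ?tot_vord ?addr0 //; [exact: fin_supp_ldeg|exact: vord_finite].
Qed.

End Transport.

(** The stalks of [V] become sublattices of those of [W], so [frames_sub] compares the local
    degrees; equality of the totals forces equality at every place. *)
Lemma degree_hom V W (M : mat L (idx V) (idx W)) N : minv M N -> is_hom M ->
  degree V <= degree W /\ (degree W <= degree V -> @is_iso k X V W M N).
Proof.
move=> MN hM; rewrite -(transport_degree MN) !lerN2.
have sub y : ldeg (transport MN) y <= ldeg V y /\ (ldeg V y <= ldeg (transport MN) y ->
    stalk V y = [set v | stalk W y (app M v)]).
  have [e fe] := frames_ex V y; have [f ff'] := frames_ex (transport MN) y.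
  rewrite (ldegE fe) (ldegE ff'); apply: frames_sub fe ff' _ => v; exact: hM.
split; first by apply: tot_le => [||y]; [exact: fin_supp_ldeg|exact: fin_supp_ldeg|case: (sub y)].
move=> le; split=> // y w hw; have [le1] := sub y.
have fD : fin_supp (fun y => ldeg V y - ldeg (transport MN) y).
  by apply: fin_suppD; [|apply: fin_suppN]; exact: fin_supp_ldeg.
have ge z : 0 <= ldeg V z - ldeg (transport MN) z by rewrite subr_ge0; case: (sub z).
have t0 : tot (fun y => ldeg V y - ldeg (transport MN) y) <= 0.
  by rewrite totD ?totN ?subr_le0 //; [exact: fin_supp_ldeg|apply: fin_suppN; exact: fin_supp_ldeg].
have /eqP := tot_eq0 fD ge t0 y; rewrite subr_eq0 => /eqP -> /(_ (lexx _)) ->.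
by rewrite /= (minv_r _ MN).
Qed.

Lemma degree_iso V W M N : @is_iso k X V W M N -> degree V = degree W.
Proof.
case=> hM hN MN; apply/eqP; rewrite eq_le (degree_hom MN hM).1.
by rewrite (degree_hom (minv_sym MN) hN).1.
Qed.

End Adelic.

(** * Subspaces and split exact sequences *)

Section Splittings.
Variable R : fieldType.

(* J -> I -> K is a split short exact sequence with retraction B' and        *)
(* section s.                                                                *)
Definition splitting I J K (B : mat R J I) (B' : mat R I J) (N : mat R I K) (s : mat R K I) : Prop :=
  [/\ compm B' B = mat1 J, compm N s = mat1 K, compm N B = 0, compm B' s = 0
    & compm B B' + compm s N = mat1 I].

Section Lemmas.
Variables (I J K : finType) (B : mat R J I) (B' : mat R I J) (N : mat R I K) (s : mat R K I).
Hypothesis sp : splitting B B' N s.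
Lemma sp_BK c : app B' (app B c) = c.
Proof. by have [h _ _ _ _] := sp; rewrite -appM h app_id. Qed.
Lemma sp_sK c : app N (app s c) = c.
Proof. by have [_ h _ _ _] := sp; rewrite -appM h app_id. Qed.
Lemma sp_NB c : app N (app B c) = 0.
Proof. by have [_ _ h _ _] := sp; rewrite -appM h app0m. Qed.
Lemma sp_Bs c : app B' (app s c) = 0.
Proof. by have [_ _ _ h _] := sp; rewrite -appM h app0m. Qed.
Lemma sp_dec v : app B (app B' v) + app s (app N v) = v.
Proof. by have [_ _ _ _ h] := sp; rewrite -!appM -appDm h app_id. Qed.
Lemma sp_ker v : app N v = 0 -> v = app B (app B' v).
Proof. by move=> h; rewrite -{1}(sp_dec v) h app0 addr0. Qed.
Lemma sp_kerP v : app N v = 0 <-> exists c, v = app B c.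
Proof. by split=> [/sp_ker h|[c ->]]; [exists (app B' v)|exact: sp_NB]. Qed.
End Lemmas.

Lemma splittingP I J K (B : mat R J I) (B' : mat R I J) (N : mat R I K) (s : mat R K I) :
  (forall c, app B' (app B c) = c) -> (forall c, app N (app s c) = c) ->
  (forall c, app N (app B c) = 0) -> (forall c, app B' (app s c) = 0) ->
  (forall v, app B (app B' v) + app s (app N v) = v) -> splitting B B' N s.
Proof.
move=> h1 h2 h3 h4 h5; split; apply: matP => v; by rewrite ?appDm ?appM ?app_id ?app0m.
Qed.

Definition lsub I (U : set (vec R I)) : Prop := U 0 /\ forall (a : R) v w, U v -> U w -> U (a *: v + w).

Lemma lsub_sum I (U : set (vec R I)) J (c : J -> R) (v : J -> vec R I) :
  lsub U -> (forall j, U (v j)) -> U (\sum_j c j *: v j).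
Proof. by move=> [U0 UZ] hv; elim/big_rec: _ => // j w _; exact: UZ. Qed.
(** A free family of maximal size [r] spans the subspace. The first [r] rows of the invertible
    matrix [row_ebase A] span the same subspace and index [J]; the remaining rows index [K]. *)
Lemma lsub_split I (U : set (vec R I)) : lsub U ->
  exists J K (B : mat R J I) (B' : mat R I J) (N : mat R I K) (s : mat R K I),
    splitting B B' N s /\ forall v, U v <-> app N v = 0.
Proof.
move=> lU; set n := #|I|.
pose vec_of (u : 'rV[R]_n) : vec R I := [ffun i => u 0 (enum_rank i)].
pose row_of (v : vec R I) : 'rV[R]_n := \row_i (v (enum_val i) : R).
have rowK v : vec_of (row_of v) = v by apply/ffunP => i; rewrite !ffunE mxE enum_rankK.
pose P r := `[< exists A : 'M[R]_(r, n), row_free A /\ forall i, U (vec_of (row i A)) >].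
have exP : exists r, P r.
  by exists 0%N; apply/asboolP; exists 0; split=> [|[]//]; rewrite /row_free mxrank0.
have leP r : P r -> (r <= n)%N.
  by move=> /asboolP[A [/eqP fA _]]; rewrite -fA rank_leq_col.
case: (ex_maxnP exP leP) => r /asboolP[A [fA UA]] maxr {exP leP}.
have UP v : U v <-> (row_of v <= A)%MS.
  split=> [Uv|/submxP[c e]].
    apply: contraT => nA; have : P (r + 1)%N.
      apply/asboolP; exists (col_mx A (row_of v)); split.
        have : (\rank A < \rank (col_mx A (row_of v)))%N.
          apply: rank_ltmx; rewrite /ltmx -addsmxE addsmxSl.
          by apply: contra nA; rewrite -addsmxE => h; apply: submx_trans h; exact: addsmxSr.
        rewrite (eqP fA) => lt; rewrite /row_free eqn_leq rank_leq_row.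
        exact: leq_trans (eq_leq (addn1 r)) lt.
      move=> i; case: (splitP i) => j ij.
        have -> : i = lshift 1 j by apply: val_inj.
        by rewrite rowKu.
      have -> : i = rshift r j by apply: val_inj.
      by rewrite rowKd row_id rowK.
    by move/maxr; rewrite addn1 ltnn.
  have -> : v = \sum_i c 0 i *: vec_of (row i A).
    rewrite -[LHS]rowK e; apply/ffunP => i; rewrite ffunE mxE sum_ffunE.
    by apply: eq_bigr => j _; rewrite !ffunE mxE.
  exact: lsub_sum.
pose G := row_ebase A; have uG : G \in unitmx := row_ebase_unit A.
have rA : \rank A = r by apply/eqP.
have AP v : (row_of v <= A)%MS <-> forall i : 'I_n, (r <= i)%N -> (row_of v *m invmx G) 0 i = 0.
  rewrite -(eq_row_base A); split=> [/submxP[c ->] i le|h].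
    rewrite mulmxA mulmxK // mxE big1 // => j _; rewrite mxE.
    have lt : (j < i)%N by apply: leq_trans (ltn_ord j) _; rewrite rA.
    by rewrite (ltn_eqF lt) mulr0.
  apply/submxP; exists (\row_(j < \rank A) (row_of v *m invmx G) 0 (widen_ord (rank_leq_col A) j)).
  rewrite mulmxA -[LHS](mulmxKV uG); congr (_ *m _); apply/rowP => i; rewrite [RHS]mxE.
  have [lt|le] := ltnP i (\rank A).
    rewrite (bigD1 (Ordinal lt)) //= !mxE eqxx lt mulr1 [X in _ + X]big1 ?addr0 => [|j ji].
      by rewrite (_ : widen_ord _ _ = i) //; exact: val_inj.
    by rewrite !mxE; case: eqP => [E|_]; rewrite ?mulr0 //; move: ji; rewrite -val_eqE /= E eqxx.
  rewrite h -?rA // big1 // => j _; rewrite !mxE.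
  case: eqP => [E|_]; rewrite ?mulr0 //.
  by move: le; rewrite -E leqNgt ltn_ord.
pose Q : {pred 'I_n} := fun i => (i < r)%N.
pose g : mat R 'I_n I := [ffun i => vec_of (row i G)].
pose g' : mat R I 'I_n := [ffun i => [ffun j => invmx G (enum_rank i) j]].
have appg c : row_of (app g c) = (\row_i (c i : R)) *m G.
  apply/rowP => i; rewrite !mxE appE; apply: eq_bigr => j _.
  by rewrite !ffunE !mxE enum_valK.
have appg' v i : app g' v i = (row_of v *m invmx G) 0 i.
  by rewrite appE mxE sum_enum; apply: eq_bigr => j _; rewrite mxE !ffunE enum_valK.
have g'g c : app g' (app g c) = c.
  by apply/ffunP => i; rewrite appg' appg mulmxK // mxE.
have gg' v : app g (app g' v) = v.
  rewrite -[LHS]rowK -[RHS]rowK appg; congr vec_of.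
  rewrite -[RHS](mulmxKV uG); congr (_ *m _); apply/rowP => i; by rewrite mxE.
pose J := {i | i \in Q}; pose K := {i | i \in [predC Q]}.
pose ext (A : {pred 'I_n}) (c : vec R {i | i \in A}) : vec R 'I_n :=
  [ffun i => if insub i is Some j then c j else 0].
have appx (D : {pred 'I_n}) (c : vec R {i | i \in D}) : app [ffun j => g (val j)] c = app g (ext D c).
  rewrite [RHS](bigID (mem D)) [X in _ = _ + X]big1 ?addr0 => [|i iD]; last first.
    by rewrite ffunE insubF ?scale0r //; exact: negbTE.
  by rewrite [RHS]big_sub; apply: eq_bigr => j _; rewrite !ffunE valK.
have appr (D : {pred 'I_n}) v (j : {i | i \in D}) :
    app ([ffun i => [ffun j => g' i (val j)]] : mat R I {i | i \in D}) v j = app g' v (val j).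
  by rewrite !appE; apply: eq_bigr => i _; rewrite !ffunE.
exists J, K, [ffun j => g (val j)], [ffun i => [ffun j => g' i (val j)]],
  [ffun i => [ffun j => g' i (val j)]], [ffun j => g (val j)]; split.
  apply: splittingP => [c|c|c|c|v]; rewrite ?appx.
  - by apply/ffunP => j; rewrite appr g'g ffunE valK.
  - by apply/ffunP => j; rewrite appr g'g ffunE valK.
  - by apply/ffunP => j; rewrite appr g'g !ffunE insubF //; apply/negbTE/(valP j).
  - by apply/ffunP => j; rewrite appr g'g !ffunE insubF // inE (valP j).
  rewrite -appD -[RHS]gg'; congr (app g _); apply/ffunP => i; rewrite !ffunE.
  case: insubP => [j _ <-|iQ].
    by rewrite insubF ?addr0 // inE (valP j).
  by rewrite add0r; case: insubP => [j _ <-|]; rewrite // inE iQ.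
move=> v; rewrite UP AP; split=> [h|/ffunP h i le].
  apply/ffunP => j; rewrite appr ffunE appg' h //; have := valP j.
  by rewrite inE -leqNgt.
have iK : i \in [predC Q] by rewrite inE -leqNgt.
by have := h (exist _ i iK); rewrite appr ffunE -appg'.
Qed.

End Splittings.

(** * Subbundles, quotient bundles and additivity of the degree *)

Section SubQuotients.
Implicit Types (z : place X).

Lemma scale_in (V : bundle X) y J (v : J -> vec L (idx V)) :
  exists2 a, a != 0 & forall j, stalk V y (a *: v j).
Proof.
have [e fe [e' ee']] := frames_inv V y; have [t t0 t1] := unif_ex y.
have [N hN] := ge_bound (enum {: J * idx V}) (fun p => - vord y (app e' (v p.1) p.2)).
exists (t ^+ N); first exact: expf_neq0.
move=> j; apply/(framesP _ fe ee') => i; rewrite appZ ffunE.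
have -> : in_ring y (t ^+ N *: app e' (v j) i) = vge y (N%:Z + - N%:Z) (t ^+ N * app e' (v j) i).
  by rewrite subrr.
apply: vgeM; first by rewrite vgeE ?expf_neq0 // vordX t1 natz.
apply: vgeW (vge_vord _ _); have := hN (j, i); rewrite mem_enum => /(_ isT) /=; lia.
Qed.

Lemma app_bounded y I J (M : mat L I J) (N : nat) : exists N' : nat, forall v : vec L I,
  (forall i, vge y (- N%:Z) (v i)) -> forall j, vge y (- N'%:Z) (app M v j).
Proof.
have [P hP] := ge_bound (enum {: I * J}) (fun p => - vord y (M p.1 p.2)).
exists (N + P)%N => v hv j; rewrite appE; apply: vge_sum => i _.
have -> : - (N + P)%N%:Z = - N%:Z + - P%:Z by lia.
apply: vgeM (hv i) _; apply: vgeW (vge_vord _ _).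
have := hP (i, j); rewrite mem_enum => /(_ isT) /=; lia.
Qed.

Variables (V : bundle X) (J K : finType).
Local Notation I := (idx V).
Variables (B : mat L J I) (B' : mat L I J) (N : mat L I K) (s : mat L K I).
Hypothesis sp : splitting B B' N s.

Lemma bsub_adelic : adelic (fun y => [set c | stalk V y (app B c)]).
Proof.
have [aO aB aF fS] := bundle_adelic V; split.
- move=> y; have [V0 VZ] := aO y; split=> [|c v w hc hv hw] /=; first by rewrite app0.
  by rewrite appD appZ; exact: VZ.
- move=> y; have [n hn] := aB y; have [n' hn'] := app_bounded y B' n.
  by exists n' => c j hc; rewrite -(sp_BK sp c); apply: hn' => i; exact: hn.
- move=> y; have [a a0 ha] := @scale_in V y _ (fun j => B j).
  by exists [ffun j => a *: bvec L j] => [|j]; [exact: scalar_det|rewrite ffunE /= appZ app_bvec].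
apply: (nonintegral_finite (M := B) (N := B') fS) => z /contrapT h1 h2 h3 h.
apply: h; apply/seteqP; split=> v; rewrite h1 => hv; last exact: app_ge.
by rewrite -(sp_BK sp v); exact: app_ge.
Qed.
Definition bsub := mkb bsub_adelic.

Lemma bquot_adelic : adelic (fun y => [set w | exists2 v, stalk V y v & app N v = w]).
Proof.
have [aO aB aF fS] := bundle_adelic V; split.
- move=> y; have [V0 VZ] := aO y; split=> [|c _ _ hc [v hv <-] [w hw <-]].
    by exists 0; rewrite ?app0.
  by exists (c *: v + w); [exact: VZ|rewrite appD appZ].
- move=> y; have [n hn] := aB y; have [n' hn'] := app_bounded y N n.
  by exists n' => _ j [v hv <-]; apply: hn' => i; exact: hn.
- move=> y; have [a a0 ha] := @scale_in V y _ (fun j => s j).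
  exists [ffun j => a *: bvec L j] => [|j]; first exact: scalar_det.
  by exists (a *: s j); rewrite // ffunE appZ -[s j]app_bvec (sp_sK sp).
apply: (nonintegral_finite (M := N) (N := s) fS) => z /contrapT h1 h2 h3 h.
apply: h; apply/seteqP; split=> v; rewrite h1.
  by move=> [w hw <-]; exact: app_ge.
by move=> hv; exists (app s v); [exact: app_ge|exact: (sp_sK sp)].
Qed.
Definition bquot := mkb bquot_adelic.

Let T : mat L (J + K)%type I := [ffun x => match x with inl j => B j | inr l => s l end].
Let T' : mat L I (J + K)%type :=
  [ffun i => [ffun x => match x with inl j => B' i j | inr l => N i l end]].
Let appT x : app T x = app B (lpart x) + app s (rpart x).
rewrite {1}/app big_sumType; congr (_ + _); apply: eq_bigr => j _; by rewrite !ffunE.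
Qed.
Let lT' v : lpart (app T' v) = app B' v.
Proof. by apply/ffunP => j; rewrite ffunE !appE; apply: eq_bigr => i _; rewrite !ffunE. Qed.
Let rT' v : rpart (app T' v) = app N v.
Proof. by apply/ffunP => j; rewrite ffunE !appE; apply: eq_bigr => i _; rewrite !ffunE. Qed.
Let TT' : minv T T'.
Proof.
apply: minvP => v; last by rewrite appT lT' rT' (sp_dec sp).
by apply: partP; rewrite ?lT' ?rT' appT appD ?(sp_BK sp) ?(sp_Bs sp) ?(sp_NB sp) ?(sp_sK sp) ?addr0 ?add0r.
Qed.

(** A frame of the subbundle together with lifts of a frame of the quotient is a frame of [V], with
    block triangular matrix. *)
Lemma degree_ses : degree V = degree bsub + degree bquot.
Proof.
rewrite -(transport_degree TT') !degreeE -opprD -totD; try exact: fin_supp_ldeg.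
congr (- _); apply: tot_eq => y.
have [eS fS] := frames_ex bsub y; have [eQ fQ] := frames_ex bquot y.
have [[eS' iS] _] := fS; have [[eQ' iQ] _] := fQ.
have /choice[v hv] l : exists v, stalk V y v /\ app N v = eQ l.
  by have [v h1 h2] := frames_rows fQ l; exists v.
pose f : mat L (J + K)%type (J + K)%type := [ffun x => [ffun x' =>
  match x, x' with inl j, inl j' => eS j j' | inl _, inr _ => 0
                 | inr l, inl j => app B' (v l) j | inr l, inr l' => eQ l l' end]].
have df : fdet f = fdet eS * fdet eQ.
  by apply: frame_det_sum => [j j'|l l'|j l]; rewrite !ffunE.
have [S0 _] := minv_det iS; have [Q0 _] := minv_det iQ.
have f0 : fdet f != 0 by rewrite df mulf_neq0.
suff ff' : frames y f (stalk (transport TT') y).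
  by rewrite (@ldegE (transport TT') y f ff') (ldegE fS) (ldegE fQ) df vordM.
split; first by exists (ofmx (invmx (mxof f))); exact: det_minv.
move=> c; pose w := \sum_l rpart c l *: v l.
have rf : rpart (app f c) = app eQ (rpart c).
  apply/ffunP => l; rewrite ffunE !appE big_sumType /= big1 ?add0r => [|j _]; last by rewrite !ffunE mulr0.
  by apply: eq_bigr => l' _; rewrite !ffunE.
have lf : lpart (app f c) = app eS (lpart c) + app B' w.
  apply/ffunP => j; rewrite ffunE appE big_sumType [RHS]ffunE; congr (_ + _).
    by rewrite appE; apply: eq_bigr => j' _; rewrite !ffunE.
  by rewrite app_sum sum_ffunE; apply: eq_bigr => l _; rewrite appZ !ffunE.
have Nw : app N w = app eQ (rpart c).
  by rewrite app_sum; apply: eq_bigr => l _; rewrite appZ (proj2 (hv l)).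
have E : app T (app f c) = app B (app eS (lpart c)) + w.
  by rewrite appT lf rf appD -addrA -Nw (sp_dec sp).
rewrite /= E; split=> [h|h]; last first.
  rewrite -[app B _]scale1r; apply: stalk_lin; first exact: in_ring1.
    by have := (proj2 fS (lpart c)).2; apply=> j; rewrite ffunE.
  rewrite /w; apply: (omod_sum (stalk_omod V y)) => l; last by case: (hv l).
  by rewrite ffunE; exact: h.
have hQ : forall l, in_ring y (rpart c l).
  by apply/(proj2 fQ); exists (app B (app eS (lpart c)) + w); rewrite // appD (sp_NB sp) add0r.
have hw : stalk V y w.
  by rewrite /w; apply: (omod_sum (stalk_omod V y)) => [l|l]; [exact: hQ|case: (hv l)].
have hS : forall j, in_ring y (lpart c j).
  apply/(proj2 fS) => /=; rewrite -[app B _](addrK w) addrC -scaleN1r.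
  by apply: stalk_lin => //; rewrite /in_ring in_powN; exact: in_ring1.
by case=> [j|l]; [have := hS j|have := hQ l]; rewrite ffunE.
Qed.

End SubQuotients.

(** * Sections, retractions and subspaces attached to linear maps *)

Section LinearMaps.
Variable R : fieldType.

Lemma app_lsum I J K (M : mat R I J) (c : K -> R) (w : K -> vec R I) :
  app M (\sum_j c j *: w j) = \sum_j c j *: app M (w j).
Proof. by rewrite app_sum; apply: eq_bigr => j _; rewrite appZ. Qed.
Lemma surj_section I K (N : mat R I K) : (forall w, exists v, app N v = w) ->
  exists s : mat R K I, forall w, app N (app s w) = w.
Proof.
move=> h; have /choice[s hs] l := h (bvec R l); exists (finfun s) => w.
rewrite -[RHS]app_id app_sum; apply: eq_bigr => l _.
by rewrite appZ !ffunE hs.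
Qed.

Lemma inj_ker I J (M : mat R I J) : (forall v, app M v = 0 -> v = 0) -> injective (app M).
Proof.
move=> h v w e; apply/eqP; rewrite -subr_eq0; apply/eqP/h.
by rewrite appD -scaleN1r appZ scaleN1r e subrr.
Qed.

Lemma bij_minv I J (M : mat R I J) : injective (app M) -> (forall w, exists v, app M v = w) ->
  exists N, minv M N.
Proof.
move=> inj /surj_section[N hN]; exists N; apply: minvP => v; last exact: hN.
by apply: inj.
Qed.

Lemma lsub_range I J (M : mat R I J) : lsub [set w | exists v, w = app M v].
Proof.
split=> [|a _ _ [v ->] [w ->]]; first by exists 0; rewrite app0.
by exists (a *: v + w); rewrite appD appZ.
Qed.
Lemma lsub_ker I J (M : mat R I J) : lsub [set v | app M v = 0].
Proof.
split=> [|a v w hv hw]; first exact: app0.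
by rewrite /= appD appZ hv hw scaler0 addr0.
Qed.
Lemma lsub0 I : lsub ([set 0] : set (vec R I)).
Proof. by split=> // a v w -> ->; rewrite scaler0 addr0. Qed.
Lemma lsubT I : lsub (setT : set (vec R I)). Proof. by split. Qed.
Lemma lsubI I (U W : set (vec R I)) : lsub U -> lsub W -> lsub (U `&` W).
Proof. by move=> [U0 UZ] [W0 WZ]; split=> // a v w [? ?] [? ?]; split; [exact: UZ|exact: WZ]. Qed.
Lemma lsub_preim I J (M : mat R I J) (U : set (vec R J)) : lsub U -> lsub [set v | U (app M v)].
Proof.
move=> [U0 UZ]; split=> [|a v w hv hw]; first by rewrite /= app0.
by rewrite /= appD appZ; exact: UZ.
Qed.
Lemma lsub_im I J (M : mat R I J) (U : set (vec R I)) : lsub U ->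
  lsub [set w | exists2 v, U v & w = app M v].
Proof.
move=> [U0 UZ]; split=> [|a _ _ [v hv ->] [w hw ->]]; first by exists 0; rewrite ?app0.
by exists (a *: v + w); [exact: UZ|rewrite appD appZ].
Qed.
Definition lsum I (U W : set (vec R I)) : set (vec R I) :=
  [set v | exists u w, [/\ U u, W w & v = u + w]].
Lemma lsubD I (U W : set (vec R I)) : lsub U -> lsub W -> lsub (lsum U W).
Proof.
move=> [U0 UZ] [W0 WZ]; split=> [|a _ _ [u [w [hu hw ->]]] [u' [w' [hu' hw' ->]]]].
  by exists 0, 0; rewrite addr0.
exists (a *: u + u'), (a *: w + w'); split; [exact: UZ|exact: WZ|].
by rewrite scalerDr addrACA.
Qed.
Lemma lsub_opp I (U : set (vec R I)) v : lsub U -> U v -> U (- v).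
Proof. by move=> [U0 UZ] h; rewrite -[- v]addr0 -scaleN1r; exact: UZ. Qed.
Lemma lsub_add I (U : set (vec R I)) v w : lsub U -> U v -> U w -> U (v + w).
Proof. by move=> [U0 UZ] h1 h2; rewrite -[v]scale1r; exact: UZ. Qed.
Lemma inj_retract I J (M : mat R I J) : injective (app M) -> exists M', compm M' M = mat1 I.
Proof.
move=> inj; have [J1 [K [B [B' [N [s [sp hU]]]]]]] := lsub_split (lsub_range M).
have /choice[h hh] j : exists v, B j = app M v.
  by apply/(hU (B j)).2; rewrite -app_bvec (sp_NB sp).
have E x : app M (app (finfun h) x) = app B x.
  by rewrite app_sum; apply: eq_bigr => j _; rewrite appZ ffunE hh.
exists (compm (finfun h) B'); apply: matP => c; rewrite !appM app_id; apply: inj.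
by rewrite E -(sp_ker sp) //; apply/hU; exists c.
Qed.

End LinearMaps.

(** * Degrees of subspaces of the generic fibre *)

Section SubDegrees.
Implicit Types (z : place X) (S : bundle X).

Lemma card_compm I J (M' : mat L J I) (M : mat L I J) : compm M' M = mat1 I -> (#|I| <= #|J|)%N.
Proof. by move/(congr1 (@mxof _ _)); rewrite mxof_comp mxof1 => /mulmx1_min. Qed.

(** A subbundle with torsion-free quotient is determined by its generic fibre, so that subbundles
    can be handled as subspaces [U]. *)
Definition sub_of V (U : set (vec L (idx V))) S (M : mat L (idx S) (idx V)) : Prop :=
  is_subbundle M /\ forall v, U v <-> exists c, v = app M c.

Lemma sub_of_mem V U S M c : @sub_of V U S M -> U (app M c).
Proof. by case=> _ h; apply/h; exists c. Qed.
Lemma sub_of_stalk V U S M y c : @sub_of V U S M -> stalk S y c <-> stalk V y (app M c).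
Proof. by case=> -[h1 h2 h3] _; split; [exact: h1|exact: h3]. Qed.
Lemma sub_of_lsub V U S M : @sub_of V U S M -> lsub U.
Proof.
case=> _ h; have -> : U = [set w | exists v, w = app M v] by apply/seteqP; split=> v /h.
exact: lsub_range.
Qed.

Lemma bsub_sub_of V J K (B : mat L J (idx V)) B' (N : mat L (idx V) K) s
    (sp : splitting B B' N s) : @sub_of V [set v | app N v = 0] (bsub sp) B.
Proof.
split; last by move=> v; exact: (sp_kerP sp v).
by split=> // v w e; rewrite -(sp_BK sp v) e (sp_BK sp).
Qed.

Lemma sub_of_ex V U : lsub U -> exists S M, @sub_of V U S M.
Proof.
move=> /lsub_split[J [K [B [B' [N [s [sp hU]]]]]]]; exists (bsub sp), B.
by rewrite (_ : U = [set v | app N v = 0]); [exact: bsub_sub_of|apply/seteqP; split=> v /hU].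
Qed.

Lemma sub_of_le V (U W : set (vec L (idx V))) S M T P : @sub_of V U S M -> @sub_of V W T P -> U `<=` W ->
  (rank S <= rank T)%N /\ (W `<=` U -> degree S = degree T /\ rank S = rank T).
Proof.
move=> hS hT UW; have [[hM iM rM] SU] := hS; have [[hP iP rP] TU] := hT.
have [M' h'] := inj_retract iM; have [P' p'] := inj_retract iP.
have PP v : W v -> app P (app P' v) = v by move=> /TU[c ->]; rewrite -(appM P' P) p' app_id.
have MM v : U v -> app M (app M' v) = v by move=> /SU[c ->]; rewrite -(appM M' M) h' app_id.
have MK v : app M' (app M v) = v by rewrite -appM h' app_id.
have PK v : app P' (app P v) = v by rewrite -appM p' app_id.
have sU c : U (app M c) := sub_of_mem c hS.
have sW c : W (app P c) := sub_of_mem c hT.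
split=> [|WU].
  apply: (@card_compm _ _ (compm M' P) (compm P' M)); apply: matP => v.
  by rewrite !appM app_id PP //; exact: UW.
have g : @is_iso k X S T (compm P' M) (compm M' P).
  split; last by apply: minvP => v; rewrite !appM ?PP ?MM //; [exact: UW|exact: WU].
    by move=> y v hv; rewrite appM; apply: rP; rewrite PP; [exact: hM|exact: UW].
  by move=> y v hv; rewrite appM; apply: rM; rewrite MM; [exact: hP|exact: WU].
split; first exact: degree_iso g.
by have [_ _ /minv_card] := g.
Qed.

(** The choice of the subbundle does not matter, by [sub_of_le]; the value is 0 when [U] is not a
    subspace. *)
Definition sdeg V U : int :=
  if pselect (exists p : {S : bundle X & mat L (idx S) (idx V)}, sub_of U (tagged p)) is left h
  then degree (tag (projT1 (cid h))) else 0.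
Definition srk V (U : set (vec L (idx V))) : nat :=
  if pselect (exists p : {S : bundle X & mat L (idx S) (idx V)}, sub_of U (tagged p)) is left h
  then rank (tag (projT1 (cid h))) else 0.

Lemma sdegE V U S M : @sub_of V U S M -> sdeg U = degree S /\ srk U = rank S.
Proof.
move=> hS; rewrite /sdeg /srk; case: pselect => [h|[]]; last by exists (existT _ S M).
case: (cid h) => -[T P] hT; have [_] := sub_of_le hT hS (@subset_refl _ U).
by apply.
Qed.

Lemma srk_le V (U W : set (vec L (idx V))) : lsub U -> lsub W -> U `<=` W -> (srk U <= srk W)%N.
Proof.
move=> /sub_of_ex[S [M hS]] /sub_of_ex[T [P hT]] UW.
by rewrite (sdegE hS).2 (sdegE hT).2 (sub_of_le hS hT UW).1.
Qed.

Lemma sdegT V : sdeg [set: vec L (idx V)] = degree V /\ srk [set: vec L (idx V)] = rank V.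
Proof.
apply: (@sdegE V setT V (mat1 _)); split; last by move=> v; split=> // _; exists v; rewrite app_id.
by split=> [y v|v w|y v]; rewrite ?app_id.
Qed.

Lemma degree_rank0 V : rank V = 0%N -> degree V = 0.
Proof.
move=> r0; rewrite degreeE (tot_eq (G := fun=> 0)) ?tot0 // => y; rewrite /ldeg frame_detE.
by move: (mxof _); rewrite -/(rank V) r0 => B; rewrite det_mx00 vord1.
Qed.

Lemma sdeg0 V : sdeg ([set 0] : set (vec L (idx V))) = 0.
Proof.
have [S [M hS]] := sub_of_ex (@lsub0 L (idx V)); have [[_ inj _] hU] := hS.
rewrite (sdegE hS).1; apply: degree_rank0; apply/eqP; rewrite -leqn0 leqNgt.
apply/negP => /card_gt0P[i _]; have : app M (bvec L i) = 0 by apply: (hU _).2; exists (bvec L i).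
by rewrite -(app0 M) => /inj/ffunP/(_ i)/eqP; rewrite !ffunE eqxx oner_eq0.
Qed.

(** [f] induces a generic isomorphism between the quotient bundles with generic fibres U2/U1 and
    U2'/U1', to which [degree_hom] applies. Submodularity and the behaviour of degrees under
    homomorphisms are instances. *)
Lemma sdeg_compare V V' (f : mat L (idx V) (idx V')) U1 U2 U1' U2' :
  is_hom f -> lsub U1 -> lsub U2 -> lsub U1' -> lsub U2' -> U1 `<=` U2 -> U1' `<=` U2' ->
  (forall v, U1 v -> U1' (app f v)) -> (forall v, U2 v -> U2' (app f v)) ->
  (forall v, U2 v -> U1' (app f v) -> U1 v) ->
  (forall w, U2' w -> exists2 v, U2 v & U1' (w - app f v)) ->
  sdeg U2 - sdeg U1 <= sdeg U2' - sdeg U1' /\ (sdeg U2' - sdeg U1' <= sdeg U2 - sdeg U1 ->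
   forall y w, stalk V' y w -> U2' w -> exists v, [/\ stalk V y v, U2 v & U1' (w - app f v)]).
Proof.
move=> hf l1 l2 l1' l2' s12 s12' f1 f2 inj surj.
have quot (W : bundle X) (A1 A2 : set (vec L (idx W))) : lsub A1 -> lsub A2 -> A1 `<=` A2 ->
    exists (Q : bundle X) (p : mat L (idx W) (idx Q)),
      [/\ degree Q = sdeg A2 - sdeg A1, forall y w, stalk Q y w <-> exists v, [/\ stalk W y v, A2 v & app p v = w],
          forall v, A2 v -> app p v = 0 <-> A1 v & forall w, exists2 v, A2 v & app p v = w].
  move=> k1 k2 k12; have [S [M hS]] := sub_of_ex k2.
  have [[hM iM rM] SU] := hS; have [M' /(congr1 (@app _ _ _)) h'] := inj_retract iM.
  have MK c : app M' (app M c) = c by rewrite -appM h' app_id.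
  have MM v : A2 v -> app M (app M' v) = v by move=> /SU[c ->]; rewrite MK.
  have [J [K [B [B' [N [s [sp hN]]]]]]] := lsub_split (lsub_preim M k1).
  have hB : @sub_of W A1 (bsub sp) (compm M B).
    split; last first.
      move=> v; split=> [A1v|[c ->]]; last by rewrite appM; apply/(hN _).2; rewrite (sp_NB sp).
      have A2v := k12 _ A1v; have : app N (app M' v) = 0 by apply/hN; rewrite /= MM.
      by move=> /(sp_ker sp) e; exists (app B' (app M' v)); rewrite appM -e MM.
    split=> [y v|v w|y v]; rewrite !appM; first exact: hM.
      by move=> /iM e; rewrite -(sp_BK sp v) e (sp_BK sp).
    exact: rM.
  exists (bquot sp), (compm N M'); split.
  - by rewrite (sdegE hS).1 (sdegE hB).1 (degree_ses sp) addrC addKr.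
  - move=> y w; split=> [[c hc <-]|[v [h1 h2 <-]]].
      by exists (app M c); split; [exact: hM|exact: sub_of_mem hS|rewrite appM MK].
    by rewrite appM; exists (app M' v) => //; apply: rM; rewrite MM.
  - by move=> v A2v; rewrite appM -hN /= MM.
  - move=> w; exists (app M (app s w)); first exact: sub_of_mem hS.
    by rewrite appM MK (sp_sK sp).
have [Q [p [dQ sQ kQ eQ]]] := quot V U1 U2 l1 l2 s12.
have [Q' [p' [dQ' sQ' kQ' eQ']]] := quot V' U1' U2' l1' l2' s12'.
rewrite -dQ -dQ'; have /choice[s hs] w : exists v, U2 v /\ app p v = w by have [v] := eQ w; exists v.
pose g : mat L (idx Q) (idx Q') := [ffun i => app p' (app f (s (bvec L i)))].
have appB (W : bundle X) I (h : mat L (idx W) I) v w : app h (v - w) = app h v - app h w.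
  by rewrite appD -scaleN1r appZ scaleN1r.
have E v : U2 v -> app g (app p v) = app p' (app f v).
  (* [v'] combines the chosen lifts with the coordinates of [v] in the quotient; it differs from [v]
     by an element of [U1], which [f] sends into [U1']. *)
  move=> U2v; pose v' : vec L (idx V) := \sum_i app p v i *: (s (bvec L i) : vec L (idx V)).
  have U2v' : U2 v' by apply: lsub_sum => // i; case: (hs (bvec L i)).
  have -> : app g (app p v) = app p' (app f v').
    rewrite (app_lsum f (app p v)) (app_lsum p' (app p v)).
    by apply: eq_bigr => i _; rewrite ffunE.
  have U2d : U2 (v' - v) by apply: lsub_add => //; exact: lsub_opp.
  apply/eqP; rewrite -subr_eq0 -2!appB; apply/eqP/(kQ' _ (f2 _ U2d)).2/f1/(kQ _ U2d).1.
  rewrite appB (app_lsum p (app p v)); apply/eqP; rewrite subr_eq0; apply/eqP.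
  by rewrite -[RHS]app_id; apply: eq_bigr => i _; rewrite (proj2 (hs _)) ffunE.
have gi : injective (app g).
  apply: inj_ker => w; have [v U2v <-] := eQ w; rewrite E // => /(kQ' _ (f2 _ U2v)).1 h.
  exact/(kQ _ U2v).2/inj.
have gs w : exists v, app g v = w.
  have [v' U2v' <-] := eQ' w; have [v U2v h] := surj _ U2v'; exists (app p v); rewrite E //.
  apply/eqP; rewrite eq_sym -subr_eq0 -appB; apply/eqP/(kQ' _ _).2 => //.
  by apply: lsub_add => //; apply: lsub_opp => //; exact: f2.
have [g' gg] := bij_minv gi gs.
have hg : @is_hom k X Q Q' g.
  move=> y w /sQ[v [h1 h2 <-]]; rewrite E //; apply/sQ'; exists (app f v).
  by split=> //; [exact: hf|exact: f2].
have [le eq] := degree_hom gg hg; split=> // /eq[_ hg' _] y w hw U2w.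
have /hg'/sQ[v [h1 h2 e]] : stalk Q' y (app p' w) by apply/sQ'; exists w.
exists v; split=> //; apply/(kQ' _ _).1; first by apply: lsub_add => //; apply: lsub_opp => //; exact: f2.
by rewrite appB -E // e (minv_r _ gg) subrr.
Qed.

Lemma is_hom1 V : @is_hom k X V V (mat1 _).
Proof. by move=> y v; rewrite app_id. Qed.
(** The map from B/(A meet B) to (A + B)/A is an isomorphism on generic fibres. *)
Lemma sdeg_submod V (A B : set (vec L (idx V))) : lsub A -> lsub B ->
  sdeg A + sdeg B <= sdeg (A `&` B) + sdeg (lsum A B).
Proof.
move=> lA lB; have [A0 AZ] := lA; have [B0 BZ] := lB.
have := @sdeg_compare V V (mat1 _) (A `&` B) B A (lsum A B) (@is_hom1 V) (lsubI lA lB) lB lA (lsubD lA lB).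
case=> [||||||le _]; last by lia.
- by move=> v [].
- by move=> v Av; exists v, 0; rewrite addr0.
- by move=> v []; rewrite app_id.
- by move=> v Bv; rewrite app_id; exists 0, v; rewrite add0r.
- by move=> v Bv; rewrite app_id.
- by move=> _ [a [b [Aa Bb ->]]]; exists b; rewrite ?app_id ?addrK.
Qed.

Lemma sdeg_hom V W (f : mat L (idx V) (idx W)) (U : set (vec L (idx V))) : is_hom f -> lsub U ->
  sdeg U - sdeg (U `&` [set v | app f v = 0]) <= sdeg [set w | exists2 v, U v & w = app f v] /\
  (sdeg [set w | exists2 v, U v & w = app f v] <= sdeg U - sdeg (U `&` [set v | app f v = 0]) ->
   forall y v, U v -> stalk W y (app f v) -> exists v', [/\ stalk V y v', U v' & app f v' = app f v]).
Proof.
move=> hf lU; have := @sdeg_compare V W f (U `&` [set v | app f v = 0]) U [set 0]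
  [set w | exists2 v, U v & w = app f v] hf (lsubI lU (lsub_ker f)) lU (@lsub0 _ _) (lsub_im f lU).
rewrite sdeg0 subr0; case=> [||||||le eq].
- by move=> v [].
- by move=> _ ->; exists 0; [case: lU|rewrite app0].
- by move=> v [].
- by move=> v Uv; exists v.
- by [].
- by move=> _ [v Uv ->]; exists v; rewrite //= subrr.
split=> // /eq h y v Uv hv; have [|v' [h1 h2 /eqP]] := h y _ hv; first by exists v.
by rewrite subr_eq0 => /eqP e; exists v'.
Qed.

Definition ss0 V : Prop := degree V = 0 /\ forall U : set (vec L (idx V)), lsub U -> sdeg U <= 0.

Lemma semistable0P V : semistable0 V <-> ss0 V.
Proof.
split=> [[ss d0]|[d0 h]]; split=> //.
  move=> U lU; have [S [M hS]] := sub_of_ex lU; rewrite (sdegE hS).1.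
  have [/degree_rank0 -> //|r0] := posnP (rank S).
  have := ss S M hS.1 r0; rewrite /slope d0 mul0r pmulr_lle0 ?invr_gt0 ?ltr0n //.
  by rewrite -[0 : rat]/(0%:~R) ler_int.
move=> S M hS r0; rewrite /slope d0 mul0r pmulr_lle0 ?invr_gt0 ?ltr0n //.
rewrite -[0 : rat]/(0%:~R) ler_int.
have hU : sub_of [set w | exists v, w = app M v] M by split.
by rewrite -(sdegE hU).1; apply: h; exact: lsub_range.
Qed.

End SubDegrees.

(** * Twists by divisors and spaces of global sections *)

Section Twist.
Implicit Types (z : place X).

Lemma frame_detZ I a (e : mat L I I) : fdet (a *: e) = a ^+ #|I| * fdet e.
Proof.
rewrite -detZ; congr (\det _); apply/matrixP => i j; by rewrite !mxE !ffunE.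
Qed.

Lemma frames_scale y I (a : L) (e : mat L I I) S : a != 0 -> frames y e S ->
  frames y (a *: e) [set v | S (a^-1 *: v)].
Proof.
move=> a0 [[e' ee'] fe]; split=> [|c]; last by rewrite /= appZm scalerA mulVf // scale1r.
exists (a^-1 *: e'); apply: minvP => v; rewrite !appZm appZ scalerA ?divff ?mulVf // scale1r.
  exact: minv_l ee'.
exact: minv_r ee'.
Qed.

Lemma adelic_frames V (S : place X -> set (vec L (idx V))) :
  (forall y, exists e, frames y e (S y)) -> finite_set [set y | S y <> stalk V y] -> adelic S.
Proof.
move=> hf fin; have [_ _ _ fV] := bundle_adelic V; split=> [y|y|y|].
- by have [e /frames_omod] := hf y.
- by have [e /frames_bounded] := hf y.
- have [e fe] := hf y; exists e; last exact: (frames_rows fe).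
  by have [[e' /minv_det[]]] := fe.
- apply: (@sub_finite_set _ _ ([set y | S y <> stalk V y] `|` [set y | stalk V y <> std y (I := _)])).
    by move=> y /= h; have [e|e] := pselect (S y = stalk V y); [right; rewrite -e|left].
  by rewrite finite_setU.
Qed.

Lemma degree_mkb V (aV : adelic (stalk V)) : degree (mkb aV) = degree V.
Proof.
apply: (@degree_iso (mkb aV) V (mat1 _) (mat1 _)); split; try by move=> y v; rewrite app_id.
by apply: minvP => v; rewrite !app_id.
Qed.

Lemma ldeg_triv y I : ldeg (triv X I) y = 0.
Proof. by rewrite (ldegE (V := triv X I) (@frames_std y I)) frame_det1 vord1. Qed.
Lemma degree_triv I : degree (triv X I) = 0.
Proof. by rewrite degreeE (tot_eq (ldeg_triv ^~ I)) tot0. Qed.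

Definition unif y : L := projT1 (cid2 (unif_ex y)).
Lemma unif_neq0 y : unif y != 0. Proof. by rewrite /unif; case: cid2. Qed.
Lemma vord_unif y m : vord y (unif y ^ m) = m.
Proof. by rewrite vordXz /unif; case: cid2 => t _ ->; rewrite mul1r. Qed.
Lemma vord_unif1 y : vord y (unif y) = 1.
Proof. by rewrite -[unif y]expr1z vord_unif. Qed.

Section Def.
Variables (V : bundle X) (m : place X -> int) (fm : fin_supp m).

Let S y := [set v | stalk V y (unif y ^ m y *: v)].
Lemma twist_frames y e : frames y e (stalk V y) -> frames y (unif y ^ (- m y) *: e) (S y).
Proof.
move=> fe; have := frames_scale (expfz_neq0 (- m y) (unif_neq0 y)) fe.
by rewrite invr_expz opprK.
Qed.
Lemma twist_adelic : adelic S.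
Proof.
apply: adelic_frames => [y|]; first by have [e /twist_frames] := frames_ex V y; exists (unif y ^ (- m y) *: e).
apply: sub_finite_set fm => y h; apply/eqP => m0; apply: h.
by apply/seteqP; split=> v; rewrite /S /= m0 scale1r.
Qed.
(** V(D) for the divisor D with multiplicities [m]; by [stalk_twist] the choice of uniformizers is
    immaterial. *)
Definition twist := mkb twist_adelic.
Lemma stalk_twist y v : stalk twist y v <-> forall c, vge y (m y) c -> stalk V y (c *: v).
Proof.
split=> [h c hc|]; last by apply; rewrite vgeE ?expfz_neq0 ?unif_neq0 // vord_unif.
have u0 := unif_neq0 y.
have -> : c *: v = (c * unif y ^ (- m y)) *: (unif y ^ m y *: v) + 0.
  by rewrite addr0 scalerA -mulrA -expfzDr // addNr mulr1.
apply: (stalk_omod V y).2 => //; last exact: stalk_nil.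
rewrite -(subrr (m y)); apply: vgeM => //.
by rewrite vgeE ?expfz_neq0 // vord_unif.
Qed.
Lemma ldeg_twist y : ldeg twist y = ldeg V y - m y * (rank V)%:Z.
Proof.
have [e fe] := frames_ex V y; rewrite (ldegE (V := twist) (twist_frames fe)) (ldegE fe) frame_detZ.
have [[e' /minv_det[d0 _]] _] := fe.
rewrite vordM ?expf_neq0 ?expfz_neq0 ?unif_neq0 // vordX vord_unif mulNrn addrC -mulr_natr.
by rewrite natz.
Qed.
Lemma degree_twist : degree twist = degree V + tot m * (rank V)%:Z.
Proof.
rewrite !degreeE (tot_eq ldeg_twist) totD ?totN ?totM ?opprD ?opprK //.
  exact: fin_supp_ldeg.
exact/fin_suppN/fin_suppM.
Qed.
End Def.

Lemma vge1 y : vge y 0 1. Proof. exact: in_ring1. Qed.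

Lemma vge_prod y (T : eqType) (s : seq T) (m : T -> int) (F : T -> L) :
  (forall i, i \in s -> vge y (m i) (F i)) -> vge y (\sum_(i <- s) m i) (\prod_(i <- s) F i).
Proof.
elim: s => [|i s IH] h; first by rewrite !big_nil vge1.
rewrite !big_cons; apply: vgeM; first by apply: h; exact: mem_head.
by apply: IH => j js; apply: h; rewrite inE js orbT.
Qed.

(** The lattices are shrunk from [T] to [S] one place after the other, at a cost bounded by
    [lattice_codim]. *)
Lemma sections_codim I (S T : place X -> set (vec L I)) (aS : adelic S) (aT : adelic T) :
  (forall y, S y `<=` T y) ->
  codim (V := {ffun I -> L^o}) [set v | forall y, T y v] [set v | forall y, S y v]
    `|degree (mkb aT) - degree (mkb aS)|%N.
Proof.
move=> ST; set d := fun y => ldeg (mkb aS) y - ldeg (mkb aT) y.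
have dy y : exists e f, [/\ frames y e (S y), frames y f (T y) &
    d y = vord y (fdet e) - vord y (fdet f)].
  have [e fe] := frames_ex (mkb aS) y; have [f ff] := frames_ex (mkb aT) y.
  by exists e, f; rewrite /d (ldegE fe) (ldegE ff).
have d0 y : 0 <= d y.
  by have [e [f [fe ff ->]]] := dy y; rewrite subr_ge0; have [] := frames_sub fe ff (ST y).
have fd : fin_supp d by apply: fin_suppD; [|apply: fin_suppN]; exact: fin_supp_ldeg.
have -> : degree (mkb aT) - degree (mkb aS) = tot d.
  by rewrite totD ?totN; [rewrite opprK addrC|exact: fin_supp_ldeg|apply: fin_suppN; exact: fin_supp_ldeg].
have [s us hs] := fin_suppP fd; rewrite (tot_seq us hs).
have Seq y : y \notin s -> S y = T y.
  move=> ys; have [e [f [fe ff e0]]] := dy y; have [_] := frames_sub fe ff (ST y); apply.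
  rewrite -subr_le0 -e0; have := hs y; rewrite (negbTE ys); case: eqP => [-> //|_].
  by move=> /(_ isT).
pose W (s' : seq (place X)) : set (vec L I) := [set v | forall y, T y v /\ (y \in s' -> S y v)].
have : codim (V := {ffun I -> L^o}) (W [::]) (W s) (absz (\sum_(y <- s) d y)).
  elim: s {us hs Seq} => [|y s IH]; first by rewrite big_nil; exact: codim0.
  rewrite big_cons.
  have -> : absz (d y + \sum_(j <- s) d j) = (absz (\sum_(j <- s) d j)%R + absz (d y))%N.
    have : 0 <= \sum_(j <- s) d j by apply: sumr_ge0.
    by move: (d0 y); lia.
  apply: codim_trans IH _; have [e [f [fe ff ->]]] := dy y.
  have kW : ksub (V := {ffun I -> L^o}) (W s).
    have ok z : omod z (S z) by have [+ _ _ _] := aS.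
    have ok' z : omod z (T z) by have [+ _ _ _] := aT.
    split=> [z|c v w hv hw z]; first by split=> [|_]; [case: (ok' z)|case: (ok z)].
    have [v1 v2] := hv z; have [w1 w2] := hw z.
    split=> [|zs]; [apply: (ok' z).2|apply: (ok z).2] => //; try exact: vge_cst.
      exact: v2.
    exact: w2.
  have E1 : W s = W s `&` T y by apply/seteqP; split=> v; [split=> //; case: (H y)|case].
  have E2 : W (y :: s) = W s `&` S y.
    apply/seteqP; split=> v => [h|[h1 h2] z].
      split=> [z|]; last by have [_] := h y; apply; exact: mem_head.
      by have [h1 h2] := h z; split=> // zs; apply: h2; rewrite inE zs orbT.
    by have [? hz] := h1 z; split=> //; rewrite inE => /predU1P[->|].
  by rewrite E1 E2; exact: lattice_codim.
have -> : W [::] = [set v | forall y, T y v].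
  by apply/seteqP; split=> v h y; [case: (h y)|split].
have -> // : W s = [set v | forall y, S y v].
apply/seteqP; split=> v h y.
  by have [h1 h2] := h y; case: (boolP (y \in s)) => [/h2|/Seq ->].
by split=> [|_]; [apply: ST|].
Qed.

End Twist.

(** * Riemann's inequality *)

Section Riemann.
Implicit Types (z : place X).

Lemma transc_ex : exists t : L, transc t.
Proof. by have [t [tt _]] := curveP X; exists t. Qed.

(** [V] is embedded in a bundle [T] of degree [l * n0 * rank V] that has [M * n0 * rank V] explicit
    independent sections t^p b_j / Q. By [sections_codim] all but deg T - deg V of them survive in
    [V]. Since [l = M + c], the loss against deg V is the constant [c * n0] for each unit of
    rank. *)
Theorem riemann : exists C : nat, forall V n, n%:Z <= degree V - C%:Z * (rank V)%:Z ->
  exists z : 'I_n -> vec L (idx V), free_over cst (z : 'I_n -> {ffun idx V -> L^o}) /\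
    forall i y, stalk V y (z i).
Proof.
have [t tt] := transc_ex; have [n0 [b0 kb0]] := kbasis_ex tt.
have [b [c [fb b1 b2]]] := poles_free tt kb0.
pose D y : int := Num.max 0 (- vord y t).
have D0 y : 0 <= D y by rewrite le_max.
have fD : fin_supp D.
  apply: fin_suppW (fin_supp_vord t) => y; rewrite /D; apply: contraNneq => ->.
  by rewrite maxxx.
have totD' : tot D = n0%:Z.
  rewrite -(tot_zeros tt kb0); have fD' : fin_supp (fun y => Num.max 0 (vord y t)).
    by apply: fin_suppW (fin_supp_vord t) => y; apply: contraNneq => ->.
  apply/eqP; rewrite -subr_eq0 -totN -totD //; last exact: fin_suppN.
  rewrite (tot_eq (G := fun y => - vord y t)) ?totN ?tot_vord // => y.
  by rewrite /D; lia.
exists (c * n0)%N => V n hn; set I := idx V.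
have [_ bV _ /finite_seqP[s0 hs0]] := bundle_adelic V.
have [N hN] : exists N : nat, forall y v i, stalk V y v -> vge y (- N%:Z) (v i) /\ (y \notin s0 -> vge y 0 (v i)).
  have /choice[B hB] := bV; have [N hN] := ge_bound s0 (fun y => (B y)%:Z).
  exists N => y v i hv; case: (boolP (y \in s0)) => ys.
    by split=> //; apply: vgeW (hB y v i hv); have := hN y ys; lia.
  have e : stalk V y = std y (I := idx V).
    by apply: contrapT => h; move: ys; have : [set` s0] y by [rewrite -hs0]; move=> ->.
  by move: hv; rewrite e => /(_ i) h; split=> //; apply: vgeW h; lia.
(* [F y] vanishes to order at least [N] at [y] if [t] is regular there, so [Q] absorbs the poles of
   [V] away from the poles of [t]. *)
pose F y := (t - cst (res y t)) ^+ N.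
have F0 y : F y != 0.
  rewrite expf_neq0 //; have := tt ('X - (res y t)%:P).
  by rewrite -size_poly_eq0 size_XsubC /pev rmorphB /= map_polyX map_polyC !hornerE; apply.
pose Q := \prod_(y <- s0) F y.
have Q0 : Q != 0 by rewrite prodf_seq_neq0; apply/allP => y _; rewrite F0.
(* At a pole of [t], the product of [Q] with a vector of [V] has a pole of order at most [M] times
   that of [t]; the additional [c] makes room for the poles of the [b j]. *)
pose M := (size s0 * N + N)%N; pose l := (M + c)%N.
have QD z : vge z (- (size s0 * N)%N%:Z * D z) Q.
  have -> : - (size s0 * N)%N%:Z * D z = \sum_(y <- s0) (- N%:Z * D z).
    by rewrite big_const_seq iter_addr_0; ring.
  apply: vge_prod => y _; have : vge z (- D z) (t - cst (res y t)).
    apply: vgeB; first by apply: vgeW (vge_vord z t); rewrite /D; lia.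
    by apply: vgeW (vge_cst z _); move: (D0 z); lia.
  rewrite /F => h; elim: (N) => [|m IH]; first by rewrite mul0r vge1.
  rewrite exprS (_ : - m.+1%:Z * D z = - D z + - m%:Z * D z); first exact: vgeM.
  by rewrite intS opprD mulrDl mulN1r.
have QS y : 0 <= vord y t -> y \in s0 -> vge y N%:Z Q.
  move=> ty ys; rewrite /Q (perm_big _ (perm_to_rem ys)) big_cons -[N%:Z]addr0; apply: vgeM.
    have /resP : vge y 0 t by apply: vgeW ty (vge_vord y t).
    rewrite /F => h; elim: (N) => [|m IH]; first by rewrite vge1.
    by rewrite exprS intS; exact: vgeM.
  have := @vge_prod y _ (rem y s0) (fun=> 0) F; rewrite big1_eq; apply=> z _.
  by apply: vgeX; apply: vgeB; [exact: vgeW ty (vge_vord y t)|exact: vge_cst].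
pose m y := l%:Z * D y + vord y Q.
have fm : fin_supp m.
  apply: fin_suppD (fin_supp_vord Q).
  by apply: fin_supp_eq (fin_suppM l%:Z fD) => y; rewrite mulrC.
pose T := twist (triv X I) fm.
have TP y v : stalk T y v <-> forall i, vge y (- (l%:Z * D y)) (Q * v i).
  split=> [/stalk_twist h i|h].
    have u0 : unif y ^ m y != 0 by rewrite expfz_neq0 ?unif_neq0.
    have := h (unif y ^ m y); rewrite vgeE // vord_unif => /(_ (lexx _))/(_ i).
    rewrite ffunE => hi.
    have [->|v0] := eqVneq (v i) 0; first by rewrite mulr0 vge0.
    have {}hi : vge y 0 (unif y ^ m y * v i) := hi.
    move: hi; rewrite vgeE ?mulf_neq0 // vgeE ?mulf_neq0 // (vordM y u0 v0) (vordM y Q0 v0) vord_unif /m.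
    by clear; lia.
  apply/stalk_twist => a ha i; rewrite ffunE; change (vge y 0 (a * v i)).
  have [->|v0] := eqVneq (v i) 0; first by rewrite mulr0 vge0.
  have [->|a0] := eqVneq a 0; first by rewrite mul0r vge0.
  have := h i; move: ha; rewrite (vgeE _ _ a0) (vgeE _ _ (mulf_neq0 Q0 v0)) (vgeE _ _ (mulf_neq0 a0 v0)).
  by rewrite (vordM y a0 v0) (vordM y Q0 v0) /m; lia.
have VT y : stalk V y `<=` stalk T y.
  move=> v hv; apply/TP => i; have [h1 h2] := hN y v i hv.
  have [ty|ty] := leP 0 (vord y t).
    have -> : - (l%:Z * D y) = 0 by rewrite /D max_l ?mulr0 ?oppr_le0.
    case: (boolP (y \in s0)) => ys; first by rewrite -(subrr N%:Z); apply: vgeM => //; exact: QS.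
    rewrite -(addr0 0); apply: vgeM (h2 ys); apply: vgeW (QD y).
    by rewrite /D max_l ?mulr0 ?oppr_le0.
  have Dy : 1 <= D y by rewrite /D; lia.
  apply: vgeW (vgeM (QD y) h1); rewrite /l /M; move: (size s0 * N)%N Dy (D0 y).
  move: (D y) => d a h _; have := mulr_ge0 (_ : 0 <= N%:Z) (_ : 0 <= d - 1).
  rewrite mulNr; lia.
have aT : adelic (I := I) (stalk T) := bundle_adelic T.
have := @sections_codim I (stalk V) (stalk T) (bundle_adelic V) aT VT.
rewrite (degree_mkb (bundle_adelic V)) (degree_mkb (V := T) aT).
have dT : degree T = l%:Z * n0%:Z * (rank V)%:Z.
  rewrite degree_twist degree_triv.
  rewrite (totD (F := fun y => l%:Z * D y)) ?tot_vord ?addr0; last exact: fin_supp_vord.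
    by rewrite (tot_eq (G := fun y => D y * l%:Z)) ?totM ?totD' ?[l%:Z * _]mulrC // => y; rewrite mulrC.
  by apply: fin_supp_eq (fin_suppM l%:Z fD) => y; rewrite mulrC.
have degle : degree V <= degree T.
  have hh : @is_hom k X V T (mat1 I) by move=> y v; rewrite app_id; exact: VT.
  have mm : minv (mat1 I : mat L I I) (mat1 I) by apply: minvP => v; rewrite !app_id.
  by have [] := degree_hom (V := V) (W := T) mm hh.
pose H := ('I_M * 'I_n0 * I)%type.
pose z (h : H) : {ffun I -> L^o} := (t ^+ h.1.1 * b h.1.2 / Q) *: bvec L h.2.
have fz : free_over cst z.
  move=> a /ffunP h0; have key i : \sum_(p : 'I_M * 'I_n0) cst (a (p, i)) * (t ^+ p.1 * b p.2) = 0.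
    have := h0 i; rewrite sum_ffunE [RHS]ffunE => /(congr1 (fun x => x * Q)); rewrite mul0r => e.
    apply: etrans e; rewrite mulr_suml.
    rewrite [RHS](eq_bigr (fun h : H => (cst (a (h.1, h.2)) *: z (h.1, h.2)) i * Q)); last by case.
    rewrite -(pair_bigA _ (fun p j => (cst (a (p, j)) *: z (p, j)) i * Q)).
    apply: eq_bigr => p _; rewrite (bigD1 i) //= !ffunE eqxx [X in _ + X]big1 ?addr0 => [|j ji].
      by rewrite -[RHS]/(cst (a (p, i)) * ((t ^+ p.1 * b p.2 / Q) * 1) * Q) mulr1 -[RHS]mulrA divfK.
    by rewrite !ffunE (negbTE ji) !scaler0 mul0r.
  move=> [p i]; exact: (powers_free (l := M) fb (key i)).
have zT h y : stalk T y (z h).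
  apply/TP => i; rewrite !ffunE; case: eqP => _; last by rewrite scaler0 mulr0 vge0.
  change (vge y (- (l%:Z * D y)) (Q * ((t ^+ h.1.1 * b h.1.2 / Q) * 1))); rewrite mulr1 [Q * _]mulrC divfK //; case: h => -[[p lp] j] _ /=.
  have [ty|ty] := leP 0 (vord y t).
    have -> : - (l%:Z * D y) = 0 by rewrite /D max_l ?mulr0 ?oppr_le0.
    by rewrite -(addr0 0); apply: vgeM (b1 _ _ ty); apply: vgeX; exact: vgeW ty (vge_vord y t).
  have Dy : vord y t = - D y by rewrite /D; lia.
  have Dy1 : 1 <= D y by rewrite /D; lia.
  have h1 : vge y (- (p%:Z * D y)) (t ^+ p).
    by apply: vgeW (vge_vord y _); rewrite vordX Dy mulNrn -mulr_natl natz.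
  apply: vgeW (vgeM h1 (b2 y j)).
  rewrite /l; have := mulr_ge0 (_ : 0 <= M%:Z - p%:Z) (D0 y).
  have := mulr_ge0 (_ : 0 <= c%:Z) (_ : 0 <= D y - 1).
  rewrite subr_ge0 => /(_ isT) g1.
  have {}g1 := g1 Dy1; have : p%:Z <= M%:Z by lia.
  rewrite -subr_ge0 => g2 g3; lia.
move=> /codimW; set d := absz _ => cd.
have cd' : (d <= #|{: H}| - n)%N.
  rewrite !card_prod !card_ord /d; move: hn degle; rewrite dT /rank -/I.
  by rewrite -!PoszM; lia.
have nH : (n <= #|{: H}|)%N.
  rewrite !card_prod !card_ord; move: hn degle; rewrite dT /rank -/I.
  by rewrite -!PoszM; lia.
have [|i|z' fz' hz'] := cd _ cd' n #|{: H}| (fun i => z (enum_val i)) _ (free_ord fz).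
- by rewrite subnKC.
- by move=> y.
by exists z'.
Qed.

End Riemann.

End SingleCurve.

(** * Ramification and degrees of pull-backs *)

Section Ramification.
Variables (Z Y : curve k) (h : curve_mor Z Y).
Local Notation s := (cm_fun h).
Implicit Types (z : place Z) (y : place Y).

Definition ram z : int := vord z (s (unif (cm_pt h z))).

Lemma vge_pull z a : vge z 0 (s a) = vge (cm_pt h z) 0 a.
Proof. by rewrite -!in_ringE cm_loc. Qed.
Lemma ram_gt0 z : 0 < ram z.
Proof.
have u0 := unif_neq0 (cm_pt h z); have := vge_pull z (unif (cm_pt h z))^-1.
have v1 := vord_unif1 (cm_pt h z).
rewrite !vgeE ?fmorph_eq0 ?invr_eq0 // fmorphV !vordV v1.
by move=> /negbT; rewrite -ltNge oppr_lt0.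
Qed.

Lemma vord_pull z a : vord z (s a) = ram z * vord (cm_pt h z) a.
Proof.
have [->|a0] := eqVneq a 0; first by rewrite rmorph0 !vord0 mulr0.
set y := cm_pt h z; set m := vord y a; set u := unif y ^ m.
have u0 : u != 0 by rewrite expfz_neq0 ?unif_neq0.
have w0 : a / u != 0 by rewrite mulf_neq0 ?invr_eq0.
have vw : vord y (a / u) = 0 by rewrite vordM ?invr_eq0 // vordV vord_unif subrr.
have sw : vord z (s (a / u)) = 0.
  apply/eqP; rewrite eq_le; apply/andP; split; last first.
    by have := vge_pull z (a / u); rewrite !vgeE ?fmorph_eq0 // vw.
  have := vge_pull z (a / u)^-1; rewrite !vgeE ?fmorph_eq0 ?invr_eq0 // vordV vw.
  by rewrite fmorphV vordV oppr_ge0.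
have -> : s a = s (a / u) * s u by rewrite -rmorphM divfK.
rewrite vordM ?fmorph_eq0 // sw add0r.
by rewrite fmorphXz vordXz.
Qed.

Lemma frame_det_map I (e : mat (ff Y) I I) : fdet (map_mat s e) = s (fdet e).
Proof.
rewrite -det_map_mx; congr (\det _); apply/matrixP => i j; by rewrite !mxE !ffunE.
Qed.

Lemma ldeg_pull V z : ldeg (pull h V) z = ram z * ldeg V (cm_pt h z).
Proof.
have [e fe [e' ee']] := frames_inv V (cm_pt h z).
by rewrite (ldegE fe) (ldegE (V := pull h V) (pull_frames fe ee')) frame_det_map vord_pull.
Qed.

Lemma degree_pull V : degree (pull h V) = - tot (fun z => ram z * ldeg V (cm_pt h z)).
Proof. by rewrite degreeE; congr (- _); apply: tot_eq => z; exact: ldeg_pull. Qed.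

Section Finite.
Hypothesis lin : k_linear h.
Variables (N : nat) (w : 'I_N -> (ff Z)^o).
Hypothesis fw : free_over s w.
Hypothesis sw : forall a, in_span s w a.

(** With the ramification indices as multiplicities, the functions of [local_basis] are free over
    [ff Y]: after division by the coefficient of least valuation at [y], each coefficient is a unit
    along the fibre or vanishes there to the order of ramification. *)
Lemma fiber_le y r : uniq r -> (forall z, z \in r -> cm_pt h z = y) -> \sum_(z <- r) ram z <= N%:Z.
Proof.
move=> ur hr; pose y_ (i : 'I_(size r)) := tnth (in_tuple r) i.
have iy : injective y_.
  move=> i j; rewrite /y_ !(tnth_nth (y_ i)) => /eqP; rewrite nth_uniq //.
  by move=> /eqP/val_inj.
have hy i : cm_pt h (y_ i) = y by apply: hr; exact: mem_tnth.
pose e i := absz (ram (y_ i)).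
have ee i : (e i)%:Z = ram (y_ i) by rewrite gez0_abs // ltW // ram_gt0.
pose H : finType := {i : 'I_(size r) & 'I_(e i)}; have [u hu] := local_basis e iy.
have -> : \sum_(z <- r) ram z = #|{: H}|%:Z.
  rewrite big_tnth card_tagged sumnE big_map big_enum (big_morph Posz PoszD erefl).
  by apply: eq_bigr => i _; rewrite card_ord.
rewrite lez_nat leqNgt; apply/negP => lt.
have [|c [i1 ci1] c0] := span_dependent (s := s) (V := (ff Z)^o) (I := H) (z := u) (fun i => sw (u i)).
  by rewrite card_ord.
have [i0 c00 hmin] := @arg_minP _ _ H i1 (fun i => c i != 0) (fun i => vord y (c i)) ci1.
pose c' i := c i / c i0.
have c'E i : c i != 0 -> vord y (c' i) = vord y (c i) - vord y (c i0).
  by move=> ci; rewrite vordM ?invr_eq0 // vordV.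
have : \sum_i s (c' i) * u i != 0.
  apply: hu => [i|]; last first.
    exists i0 => i; rewrite /c' divff // rmorph1; split; [exact: oner_neq0|exact: vord1].
  have [ci|ci] := eqVneq (c i) 0.
    by left=> j; rewrite /c' ci mul0r rmorph0 vge0.
  have c'0 : c' i != 0 by rewrite mulf_neq0 ?invr_eq0.
  have [v0|v0] := eqVneq (vord y (c' i)) 0.
    by right=> j; rewrite fmorph_eq0 vord_pull hy v0 mulr0.
  left=> j; rewrite vgeE ?fmorph_eq0 // vord_pull hy ee ler_peMr ?(ltW (ram_gt0 _)) //.
  have := hmin i ci; move: v0; rewrite c'E; lia.
move/eqP; apply; have := c0 => /(congr1 ( *%R (s (c i0))^-1)); rewrite mulr0 => e0.
apply: etrans e0; rewrite mulr_sumr; apply: eq_bigr => i _.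
by rewrite rmorphM fmorphV [s (c i) * _]mulrC -mulrA.
Qed.

(** A function with a simple zero at [y] has on Z at least [N] times as many zeros as on Y, by
    comparison of degrees over k(a). As [fiber_le] bounds the contribution of every fibre, the bound
    is attained over the zeros, in particular over [y]. *)
Lemma fiber_ex y : exists r, [/\ uniq r, forall z, (z \in r) = (cm_pt h z == y)
  & \sum_(z <- r) ram z = N%:Z].
Proof.
pose a := unif y; have v1 : vord y a = 1 := vord_unif1 y.
have ta : transc a.
  by have [//|[c ac]] := transcP a; move: v1; rewrite ac vord_cst.
have tsa : transc (s a).
  have [//|[c ac]] := transcP (s a); move: ac; rewrite -lin => /fmorph_inj ac.
  by move: v1; rewrite ac vord_cst.
have [n [b kb]] := kbasis_ex ta; have [n' [b' kb']] := kbasis_ex tsa.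
have Nn : (N * n <= n')%N.
  rewrite leqNgt; apply/negP => lt.
  apply: (kb'.2 ('I_N * 'I_n)%type (fun p => w p.1 * s (b p.2))); first by rewrite card_prod !card_ord.
  move=> p p0; have pevs q : pev (s a) q = s (pev a q).
    rewrite -horner_map -map_poly_comp; congr (_.[_]); apply: eq_map_poly => c /=.
    by rewrite lin.
  have /fw/(_ _) e : \sum_j s (\sum_i pev a (p (j, i)) * b i) *: w j = 0.
    apply: etrans p0.
    rewrite [RHS](eq_bigr (fun q => pev (s a) (p (q.1, q.2)) * (w q.1 * s (b q.2)))); last by case.
    rewrite -(pair_bigA _ (fun j i => pev (s a) (p (j, i)) * (w j * s (b i)))).
    apply: eq_bigr => j _; rewrite rmorph_sum [_ *: _]mulr_suml; apply: eq_bigr => i _.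
    by rewrite pevs; ring.
  by move=> [j i]; exact: (kb.1 _ (e j) i).
pose D y' : int := Num.max 0 (vord y' a).
have D0 y' : 0 <= D y' by rewrite le_max.
have DZ z : Num.max 0 (vord z (s a)) = ram z * D (cm_pt h z).
  by rewrite vord_pull maxr_pMr ?mulr0 // ltW // ram_gt0.
have fDY : fin_supp D.
  by apply: fin_suppW (fin_supp_vord a) => y'; apply: contraNneq; rewrite /D => ->.
have fDZ : fin_supp (fun z => ram z * D (cm_pt h z)).
  apply: fin_suppW (fin_supp_vord (s a)) => z; rewrite -DZ; apply: contraNneq => ->.
  by rewrite maxxx.
have tY := tot_zeros ta kb; have tZ := tot_zeros tsa kb'; rewrite (tot_eq DZ) in tZ.
have [sY uY hY] := fin_suppP fDY; have [sZ uZ hZ] := fin_suppP fDZ.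
have hZY z : D (cm_pt h z) != 0 -> z \in sZ.
  by move=> Dz; apply: hZ; rewrite mulf_neq0 // gt_eqF // ram_gt0.
rewrite (tot_seq uZ hZ) in tZ; rewrite (tot_seq uY hY) in tY.
pose f y' := [seq z <- sZ | cm_pt h z == y'].
have tZ' : \sum_(z <- sZ) ram z * D (cm_pt h z) = \sum_(y' <- sY) D y' * \sum_(z <- f y') ram z.
  transitivity (\sum_(y' <- sY) \sum_(z <- sZ | cm_pt h z == y') D y' * ram z); last first.
    by apply: eq_bigr => y' _; rewrite mulr_sumr big_filter.
  rewrite [RHS](exchange_big_dep predT) //=; apply: eq_bigr => z _.
  have [D00|Dz] := eqVneq (D (cm_pt h z)) 0.
    by rewrite D00 mulr0 big1 // => y' /eqP <-; rewrite D00 mul0r.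
  rewrite (eq_bigl (pred1 (cm_pt h z))) => [|y']; last by rewrite eq_sym.
  by rewrite -big_filter filter_pred1_uniq ?hY // big_seq1 mulrC.
have fle y' : \sum_(z <- f y') ram z <= N%:Z.
  apply: (@fiber_le y') => [|z]; first exact: filter_uniq.
  by rewrite mem_filter => /andP[/eqP].
have ys : y \in sY by apply: hY; rewrite /D v1.
exists (f y); split; first exact: filter_uniq.
  move=> z; rewrite mem_filter; case: eqP => //= zy; apply: hZY.
  by rewrite zy /D v1.
apply/eqP; rewrite eq_le fle.
have : \sum_(y' <- sY) D y' * (N%:Z - \sum_(z <- f y') ram z) <= 0.
  under eq_bigr do rewrite mulrBr; rewrite sumrB -tZ' tZ -mulr_suml tY subr_le0.
  by rewrite mulrC.
rewrite (bigD1_seq y) //= /D v1 mul1r => le0.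
rewrite -subr_le0; apply: le_trans le0; rewrite lerDl; apply: sumr_ge0 => y' _.
by apply: mulr_ge0; [exact: D0|rewrite subr_ge0; exact: fle].
Qed.

Lemma tot_pull F : fin_supp F -> tot (fun z => ram z * F (cm_pt h z)) = N%:Z * tot F.
Proof.
move=> fF; have [sY uY hY] := fin_suppP fF; rewrite (tot_seq uY hY).
have /choice[r hr] := fiber_ex.
pose sZ := flatten [seq r y | y <- sY].
have inZ z : (z \in sZ) = (cm_pt h z \in sY).
  apply/flattenP/idP => [[_ /mapP[y ys ->]]|zs]; first by have [_ -> _] := hr y => /eqP ->.
  exists (r (cm_pt h z)); first exact: map_f.
  by have [_ -> _] := hr (cm_pt h z).
have uZ : uniq sZ.
  rewrite /sZ; elim: (sY) uY => //= y l IH /andP[yl ul]; rewrite cat_uniq IH //.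
  have [-> rE _] := hr y; rewrite andbT; apply/hasPn => z /flattenP[_ /mapP[y' ys' ->]].
  have [_ -> _] := hr y'; rewrite rE => /eqP ->; apply/eqP => e; by rewrite -e ys' in yl.
rewrite (tot_seq uZ) => [|z]; last first.
  by rewrite inZ => h0; apply: hY; apply: contraNneq h0 => ->; rewrite mulr0.
rewrite big_flatten big_map mulr_sumr; apply: eq_bigr => y _.
have [_ rE <-] := hr y; rewrite mulr_suml; apply: eq_big_seq => z.
by rewrite rE => /eqP ->.
Qed.

Lemma degree_cover V : degree (pull h V) = N%:Z * degree V.
Proof. by rewrite degree_pull tot_pull ?mulrN //; exact: fin_supp_ldeg. Qed.

End Finite.

Lemma finite_basis (n : nat) (b : 'I_n -> (ff Z)^o) : (forall a, in_span s b a) ->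
  exists (N : nat) (w : 'I_N -> (ff Z)^o), [/\ (0 < N)%N, free_over s w & forall a, in_span s w a].
Proof.
elim: n b => [|n IH] b sb.
  have [c e] := sb 1; move: e; rewrite big_ord0 => /eqP; by rewrite oner_eq0.
have [fb|nb] := pselect (free_over s b); first by exists n.+1, b.
have [c [c0 [i ci]]] : exists c, \sum_i s (c i) *: b i = 0 /\ exists i, c i != 0.
  move: nb => /existsNP[c /not_implyP[c0 /existsNP[i /eqP ci]]]; exists c; split=> //.
  by exists i.
apply: (IH (fun j => b (lift i j))) => a; have [d ->] := sb a.
exists (fun j => d (lift i j) - d i * c (lift i j) / c i).
have bi : b i = \sum_j s (- c (lift i j) / c i) *: b (lift i j).
  move: c0; rewrite (bigD1_ord i) //= => /eqP; rewrite addrC addr_eq0 => /eqP c0.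
  have -> : b i = s (- (c i)^-1) *: - (s (c i) *: b i).
    by rewrite -scaleNr scalerA -rmorphN -rmorphM mulrNN mulVf // rmorph1 scale1r.
  rewrite -c0 scaler_sumr; apply: eq_bigr => j _; rewrite scalerA -rmorphM.
  by rewrite mulNr mulrC mulNr.
rewrite (bigD1_ord i) //= {1}bi scaler_sumr -big_split /=; apply: eq_bigr => j _.
rewrite scalerA -scalerDl -rmorphM -rmorphD.
by rewrite addrC mulrA mulrN mulNr.
Qed.

Lemma covering_basis : covering h ->
  exists (N : nat) (w : 'I_N -> (ff Z)^o), [/\ (0 < N)%N, free_over s w & forall a, in_span s w a].
Proof. by case=> _ [n [b hb]] _; apply: (@finite_basis n b). Qed.

End Ramification.

(** * Pull-back of homomorphisms and subbundles *)

Section Pulls.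
Variables (Z Y : curve k) (h : curve_mor Z Y).
Local Notation s := (cm_fun h).
Implicit Types (V W S : bundle Y) (z : place Z) (y : place Y).

Lemma pull_gen V z v : stalk V (cm_pt h z) v -> stalk (pull h V) z (map_vec s v).
Proof. by move=> hv; apply: ospan_gen; exists v. Qed.
Lemma pull_local V I (T : set (vec (ff Z) I)) z (M : mat (ff Y) (idx V) I) :
  omod z T -> (forall v, stalk V (cm_pt h z) v -> T (map_vec s (app M v))) ->
  forall v, stalk (pull h V) z v -> T (app (map_mat s M) v).
Proof.
move=> [T0 TZ] hM v; elim=> [|c _ u hc [w hw <-] _ hu]; first by rewrite app0.
by rewrite appD appZ -map_app; apply: TZ => //; exact: hM.
Qed.

Lemma pull_hom V W M : @is_hom k Y V W M -> @is_hom k Z (pull h V) (pull h W) (map_mat s M).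
Proof.
move=> hM z; apply: pull_local; first exact: stalk_omod.
by move=> v hv; apply: pull_gen; exact: hM.
Qed.

Lemma pull_iso V W M N : @is_iso k Y V W M N ->
  @is_iso k Z (pull h V) (pull h W) (map_mat s M) (map_mat s N).
Proof. by case=> hM hN MN; split; [exact: pull_hom|exact: pull_hom|exact: map_minv]. Qed.
Lemma pull_surj V W M : @is_surj k Y V W M -> @is_surj k Z (pull h V) (pull h W) (map_mat s M).
Proof.
case=> hM sM; split; first exact: pull_hom.
move=> z w; elim=> [|c _ u hc [w' /sM[v hv <-] <-] _ [v' hv' <-]].
  by exists 0; [exact: stalk_nil|rewrite app0].
exists (c *: map_vec s v + v'); last by rewrite appD appZ map_app.
by apply: stalk_lin => //; exact: pull_gen.
Qed.
End Pulls.

Section LocalRetract.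
Variables (Y : curve k).
Implicit Types (V W S : bundle Y) (y : place Y).

Lemma is_hom_comp V W S (N : mat (ff Y) (idx W) (idx S)) (M : mat (ff Y) (idx V) (idx W)) :
  is_hom N -> is_hom M -> @is_hom k Y V S (compm N M).
Proof. by move=> hN hM y v hv; rewrite appM; exact/hN/hM. Qed.
(** The quotient by a subbundle is locally free, so lifting a frame of it splits the inclusion near
    [y]. *)
Lemma local_retract V U S M y : @sub_of Y V U S M ->
  exists R, compm R M = mat1 (idx S) /\ forall v, stalk V y v -> stalk S y (app R v).
Proof.
move=> hS; have [J [K [B [B' [N [t [sp hU]]]]]]] := lsub_split (sub_of_lsub hS).
have [f ff [f' ff']] := frames_inv (bquot sp) y.
have /choice[v0 hv0] j : exists v, stalk V y v /\ app N v = f j.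
  by have [v hv e] := frames_rows ff j; exists v.
pose sy := compm (finfun v0) f' : mat _ K (idx V).
have Ns w : app N (app sy w) = w.
  rewrite appM -[RHS](minv_r _ ff') app_lsum.
  by apply: eq_bigr => j _; rewrite ffunE (proj2 (hv0 j)).
have sV w : stalk (bquot sp) y w -> stalk V y (app sy w).
  move=> /(framesP _ ff ff') hw; rewrite appM.
  apply: (omod_sum (stalk_omod V y)) => [j|j]; first exact: hw.
  by rewrite ffunE; case: (hv0 j).
have [M' M'M] := inj_retract (let: conj (And3 _ i _) _ := hS in i).
exists (compm M' (mat1 _ - compm sy N)); split.
  rewrite -M'M; apply: matP => c; rewrite !appM.
  have Nc : app N (app M c) = 0 by apply/hU; exact: sub_of_mem hS.
  by rewrite appDm appNm app_id appM Nc app0 subr0.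
move=> v hv; apply/(sub_of_stalk y _ hS); rewrite appM appDm appNm app_id appM.
set u := v - _; have [c uc] : exists c, u = app M c.
  apply/(proj2 hS)/hU; rewrite appD -scaleN1r appZ scaleN1r Ns subrr //.
rewrite uc -(appM M') M'M app_id -uc /u -scaleN1r addrC.
apply: (stalk_omod V y).2 => //; first by rewrite vgeN vge1.
by apply: sV; exists v.
Qed.

End LocalRetract.

Section PullSub.
Variables (Z Y : curve k) (h : curve_mor Z Y).
Local Notation s := (cm_fun h).
Implicit Types (V W S : bundle Y) (z : place Z) (y : place Y).

Lemma sub_of_range V S M : @is_subbundle k Y S V M -> sub_of [set w | exists v, w = app M v] M.
Proof. by move=> hM. Qed.
(** Local retractions carry over to the pull-back, and they imply saturation. *)
Lemma pull_sub V S M : @is_subbundle k Y S V M -> @is_subbundle k Z (pull h S) (pull h V) (map_mat s M).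
Proof.
move=> hM; have hS := sub_of_range hM; have [hh /inj_retract[M' M'M] _] := hM.
split; first exact: pull_hom.
  move=> v w e; rewrite -[v]app_id -[w]app_id -(map_mat1 s) -M'M map_compm !appM.
  by rewrite [app (map_mat s M) v]e.
move=> z c; have [R [RM hR]] := local_retract (cm_pt h z) hS.
have E : app (map_mat s R) (app (map_mat s M) c) = c.
  by rewrite -appM -map_compm RM map_mat1 app_id.
move=> hc; rewrite -E; apply: pull_local hc; first exact: stalk_omod.
by move=> v hv; apply: pull_gen; exact: hR.
Qed.

Lemma ss0_sub V S M : ss0 V -> @is_subbundle k Y S V M -> degree S <= 0.
Proof.
move=> [_ h0] hM; have hS := sub_of_range hM; rewrite -(sdegE hS).1.
exact/h0/(sub_of_lsub hS).
Qed.

Lemma ss0I V : degree V = 0 -> (forall S M, @is_subbundle k Y S V M -> degree S <= 0) -> ss0 V.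
Proof.
move=> d0 hS; split=> // U /sub_of_ex[S [M hM]].
by rewrite (sdegE hM).1; apply: (hS S M); case: hM.
Qed.
End PullSub.

(** A subbundle of positive degree in [V] would pull back to one in [pull h V]. *)
Lemma ss0_pull (Z Y : curve k) (h : curve_mor Z Y) (V : bundle Y) (N : int) : 0 < N ->
  (forall W : bundle Y, degree (pull h W) = N * degree W) -> ss0 (pull h V) -> ss0 V.
Proof.
move=> N0 hN hV; have [d0 _] := hV; apply: ss0I.
  by move: d0; rewrite hN => /eqP; rewrite mulf_eq0 gt_eqF // => /eqP.
move=> S M /(pull_sub h) /(ss0_sub hV); rewrite hN pmulr_rle0 //.
Qed.

Section PullTens.
Variables (Z Y : curve k) (h : curve_mor Z Y).

Lemma isom_pull (V W : bundle Y) : isomorphic V W -> isomorphic (pull h V) (pull h W).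
Proof. by case=> M [N /(pull_iso h) i]; exists (map_mat (cm_fun h) M), (map_mat (cm_fun h) N). Qed.
Lemma pull_tens_iso (V W : bundle Y) :
  @is_iso k Z (pull h (tens V W)) (tens (pull h V) (pull h W)) (mat1 _) (mat1 _).
Proof.
split; last by apply: minvP => v; rewrite !app_id.
  move=> z v; apply: ospan_stalk_map => _ [w + <-]; apply: pull_span_map.
  move=> _ [v1 [v2 [h1 h2 ->]]]; rewrite app_id map_vtens; apply: ospan_gen.
  by exists (map_vec (cm_fun h) v1), (map_vec (cm_fun h) v2); split=> //; exact: pull_gen.
move=> z v; rewrite app_id; elim=> [|c _ u hc [v1 [v2 [h1 h2 ->]]] _ hu]; first exact: stalk_nil.
by apply: stalk_lin => //; exact: ospan_tens_pull.
Qed.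

Lemma isom_pull_tens (V W : bundle Y) : isomorphic (pull h (tens V W)) (tens (pull h V) (pull h W)).
Proof. by exists (mat1 _), (mat1 _); exact: pull_tens_iso. Qed.

End PullTens.

(** * Maximal destabilizing subspaces *)

Section Semistability.
Variables (Y : curve k).
Local Notation L := (ff Y).
Implicit Types (A B V W S : bundle Y) (y : place Y).

(** Along the filtration by coordinate subspaces, a step that enlarges the trace of [U] raises its
    degree by at most the degree of the corresponding graded line of [V]. *)
Lemma sdeg_bounded V : exists B : nat, forall U : set (vec L (idx V)), lsub U -> sdeg U <= B%:Z.
Proof.
set I := idx V; pose F i : set (vec L I) := [set v | forall j, (i <= enum_rank j)%N -> v j = 0].
have lF i : lsub (F i).
  split=> [j _|a v w hv hw j ij]; first by rewrite ffunE.
  by rewrite !ffunE (hv j ij) (hw j ij) scaler0 addr0.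
have FS i : F i `<=` F i.+1 by move=> v hv j ij; apply: hv; exact: ltnW.
pose d i := Num.max 0 (sdeg (V := V) (F i.+1) - sdeg (V := V) (F i)).
have key U i : lsub U -> (i <= #|I|)%N -> sdeg (V := V) (U `&` F i) <= \sum_(j < i) d j.
  move=> lU; elim: i => [_|i IH lt].
    rewrite big_ord0 (_ : U `&` F 0%N = [set 0]) ?sdeg0 //; apply/seteqP; split=> [v [_ h]|_ ->].
      by apply/ffunP => j; rewrite h // ffunE.
    by split; [case: lU|case: (lF 0%N)].
  rewrite big_ord_recr; apply: le_trans (_ : sdeg (V := V) (U `&` F i) + d i <= _); last first.
    by rewrite lerD2r IH // ltnW.
  pose j0 : I := enum_val (Ordinal lt).
  have j0E j : (i <= enum_rank j)%N -> j != j0 -> (i < enum_rank j)%N.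
    move=> ij jj; rewrite ltn_neqAle ij andbT; apply: contraNneq jj => e.
    by rewrite -[j]enum_rankK; apply/eqP; congr enum_val; exact: val_inj.
  have [[u [[Uu Fu] u0]]|nu] := pselect (exists u, (U `&` F i.+1) u /\ u j0 != 0); last first.
    rewrite (_ : U `&` F i.+1 = U `&` F i) ?lerDl ?le_max //.
    apply/seteqP; split=> [v [Uv Fv]|v [Uv Fv]]; split=> //; last exact: FS.
    move=> j ij; have [->|jj] := eqVneq j j0; last by apply: Fv; exact: j0E.
    by apply/eqP; apply: contra_notT nu => h; exists v.
  rewrite -lerBlDl le_max; apply/orP; right.
  have [] := @sdeg_compare Y V V (mat1 _) (U `&` F i) (U `&` F i.+1) (F i) (F i.+1)
    (@is_hom1 _ V) (lsubI lU (lF i)) (lsubI lU (lF i.+1)) (lF i) (lF i.+1).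
  - by move=> v [? ?]; split=> //; exact: FS.
  - exact: FS.
  - by move=> v []; rewrite app_id.
  - by move=> v []; rewrite app_id.
  - by move=> v [Uv _]; rewrite app_id.
  - move=> w Fw; exists ((w j0 / u j0) *: u).
      have [U0 UZ] := lsubI lU (lF i.+1); rewrite -[_ *: _]addr0; apply: UZ => //.
    move=> j ij; rewrite app_id !ffunE; have [->|jj] := eqVneq j j0.
      by change (w j0 - w j0 / u j0 * u j0 = 0); rewrite divfK // subrr.
    by rewrite (Fw j (j0E j ij jj)) (Fu j (j0E j ij jj)) scaler0 subr0.
  by [].
exists (absz (\sum_(j < #|I|) d j)) => U lU; have := key U #|I| lU (leqnn _).
rewrite (_ : U `&` F #|I| = U); last first.
  by apply/seteqP; split=> [v []|v Uv] //; split=> // j; rewrite leqNgt ltn_ord.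
by move/le_trans; apply; exact: lez_abs.
Qed.

Lemma compm1C I J (N : mat L J I) (M : mat L I J) :
  compm N M = mat1 I -> (#|J| <= #|I|)%N -> compm M N = mat1 J.
Proof.
move=> NM le; have rk : #|I| = #|J| by apply/eqP; rewrite eqn_leq (card_compm NM).
have sq m n (A : 'M[L]_(m, n)) (B : 'M_(n, m)) : m = n -> A *m B = 1%:M -> B *m A = 1%:M.
  by move=> e; case: n / e in A B *; exact: mulmx1C.
apply: (can_inj (@mxofK _ _ _)); rewrite mxof_comp mxof1; apply: sq => //.
by rewrite -mxof_comp NM mxof1.
Qed.

Lemma srk_eq V (U W : set (vec L (idx V))) : lsub U -> lsub W -> U `<=` W ->
  (srk W <= srk U)%N -> W `<=` U.
Proof.
move=> /sub_of_ex[S [M hS]] /sub_of_ex[T [P hT]] UW.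
rewrite (sdegE hS).2 (sdegE hT).2 => le.
have [[_ iM _] SU] := hS; have [[_ iP _] TU] := hT; have [P' P'P] := inj_retract iP.
have PP v : W v -> app P (app P' v) = v.
  by move=> /TU[c ->]; rewrite -(appM P' P) P'P app_id.
have MW c : W (app M c) := UW _ (sub_of_mem c hS).
have [M' M'M] := inj_retract iM.
have c1 : compm (compm M' P) (compm P' M) = mat1 (idx S).
  by rewrite -M'M; apply: matP => c; rewrite !appM PP.
have c2 := compm1C c1 le.
move=> w Ww; apply/SU; exists (app (compm M' P) (app P' w)).
by rewrite -{1}(PP _ Ww) -{1}[app P' w]app_id -{1}c2 [in LHS]appM [in LHS](appM P') PP.
Qed.

(** Among the subspaces of maximal degree one of maximal rank is taken. For a second one,
    submodularity gives the sum the same degree; its rank cannot be larger, so it coincides with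
    both. *)
Lemma max_destab V : (exists2 U : set (vec L (idx V)), lsub U & 0 < sdeg U) ->
  exists U : set (vec L (idx V)), [/\ lsub U, 0 < sdeg U &
    forall W : set (vec L (idx V)), lsub W -> sdeg W = sdeg U -> srk W = srk U -> W = U].
Proof.
move=> [U0 l0 d0]; have [B hB] := sdeg_bounded V.
pose P m := `[< exists2 U : set (vec L (idx V)), lsub U & sdeg U = (m%:Z) >].
have exP : exists m, P m.
  exists (absz (sdeg U0)); apply/asboolP; exists U0 => //; rewrite gez0_abs //; exact: ltW.
have bdP m : P m -> (m <= B)%N by move=> /asboolP[U /hB + e]; rewrite e.
case: (ex_maxnP exP bdP) => m /asboolP[U1 l1 d1] maxm.
have maxd (U : set (vec L (idx V))) : lsub U -> sdeg U <= m%:Z.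
  move=> lU; have [h|/ltW h] := leP 0 (sdeg U); last by apply: le_trans h _.
  rewrite -(gez0_abs h); apply: maxm; apply/asboolP; exists U => //.
  by rewrite gez0_abs.
pose Q r := `[< exists U : set (vec L (idx V)), [/\ lsub U, sdeg U = m%:Z & srk U = r] >].
have exQ : exists r, Q r by exists (srk U1); apply/asboolP; exists U1.
have leQ r : Q r -> (r <= rank V)%N.
  by move=> /asboolP[U [lU _ <-]]; rewrite -(sdegT V).2; apply: srk_le => //.
case: (ex_maxnP exQ leQ) => r /asboolP[U [lU dU rU]] maxr.
have m0 : 0 < m%:Z by apply: lt_le_trans d0 (maxd _ l0).
exists U; split=> //; first by rewrite dU.
move=> W lW dW rW; have := sdeg_submod lU lW; rewrite dU => sm.
have lS := lsubD lU lW; have h1 := maxd _ (lsubI lU lW); have h2 := maxd _ lS.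
have dS : sdeg (lsum U W) = m%:Z by move: sm h1 h2; lia.
have rS : (srk (lsum U W) <= r)%N by apply: maxr; apply/asboolP; exists (lsum U W).
have US : U `<=` lsum U W by move=> v; exists v, 0; rewrite addr0; case: lW.
have WS : W `<=` lsum U W by move=> v; exists 0, v; rewrite add0r; case: lU.
have SU := srk_eq lU lS US (leq_trans rS (_ : r <= srk U)%N).
have SW := srk_eq lW lS WS (leq_trans rS (_ : r <= srk W)%N).
apply/seteqP; split=> v.
  by move=> /WS; apply: SU; rewrite rU.
by move=> /US; apply: SW; rewrite rW rU.
Qed.

(** * Invariant subbundles of equivariant bundles *)

Section SemilinearDestabilization.
Variables (gT : finGroupType) (A : curve_action gT Y).
Implicit Types g : gT.

Lemma ca_surj g a : cm_fun (A g) (cm_fun (A g^-1%g) a) = a.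
Proof. by rewrite -caM mulVg ca1. Qed.
Lemma degree_act g (V : bundle Y) : degree (pull (A g) V) = degree V.
Proof.
rewrite (@degree_cover _ _ (A g) (ca_lin A g) 1 (fun=> 1)) ?mul1r //.
  move=> c; rewrite big_ord1 => /eqP; rewrite [_ *: _]mulr1 fmorph_eq0 => /eqP c0 i.
  by rewrite (ord1 i).
move=> a; exists (fun=> cm_fun (A g^-1%g) a); rewrite big_ord1 ca_surj.
by rewrite [_ *: _]mulr1.
Qed.

Lemma act_sub (V : gbundle A) (U : set (vec L (idx V))) S M g : @sub_of _ V U S M ->
  @sub_of _ V [set w | exists2 u, U u & w = app (glam V g) (map_vec (cm_fun (A g)) u)]
    (pull (A g) S) (compm (glam V g) (map_mat (cm_fun (A g)) M)).
Proof.
move=> [hM hU]; have [h1 h2 h3] := pull_sub (A g) hM; have [gh gh' gg] := glamP V g.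
split.
  split; first exact: is_hom_comp gh h1.
    move=> v w; rewrite !appM => e; apply: h2.
    by rewrite -(minv_l (app _ v) gg) e (minv_l _ gg).
  move=> y v; rewrite appM => hv; apply: h3.
  by rewrite -(minv_l (app _ v) gg); exact: gh'.
move=> w; split=> [[u /hU[c ->] ->]|[c ->]].
  by exists (map_vec (cm_fun (A g)) c); rewrite appM map_app.
pose c' := map_vec (cm_fun (A g^-1%g)) c.
have cc : map_vec (cm_fun (A g)) c' = c by apply/ffunP => i; rewrite !ffunE ca_surj.
exists (app M c'); first by apply/hU; exists c'.
by rewrite map_app cc appM.
Qed.

(** The translate of [U] under the semilinear action of [g] on the generic fibre. *)
Definition tw_im (V : gbundle A) g (U : set (vec L (idx V))) : set (vec L (idx V)) :=
  [set w | exists2 u, U u & w = app (glam V g) (map_vec (cm_fun (A g)) u)].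

Lemma gsub_ex (V : gbundle A) (U : set (vec L (idx V))) : lsub U -> (forall g, tw_im g U = U) ->
  exists (S : gbundle A) (M : mat L (idx S) (idx V)), @sub_of _ V U S M /\ equivariant M.
Proof.
move=> lU Ug; have [S [M hS]] := sub_of_ex lU; have [sM hU] := hS; have [hM iM rM] := sM.
have [M' M'M] := inj_retract iM.
have MM v : U v -> app M (app M' v) = v by move=> /hU[c ->]; rewrite -(appM M') M'M app_id.
have MK c : app M' (app M c) = c by rewrite -(appM M') M'M app_id.
pose gm g := compm (glam V g) (map_mat (cm_fun (A g)) M).
have gmS g : @sub_of _ V U (pull (A g) S) (gm g) by rewrite -{1}(Ug g); exact: act_sub.
have /choice[gm' hgm'] g : exists m, compm m (gm g) = mat1 (idx S).
  by have [[_ i _] _] := gmS g; exact: inj_retract.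
have GG g v : U v -> app (gm g) (app (gm' g) v) = v.
  by move=> /(proj2 (gmS g))[c ->]; rewrite -(appM (gm' g)) hgm' app_id.
have Ugm g c : U (app (gm g) c) by apply: sub_of_mem (gmS g).
pose lam g := compm M' (gm g); pose lamV g := compm (gm' g) M.
have isoS g : @is_iso k Y (pull (A g) S) S (lam g) (lamV g).
  have [[gh _ gr] _] := gmS g; split.
  - move=> y v hv; apply: rM; rewrite (appM M') MM //; exact: gh.
  - move=> y v hv; apply: gr; rewrite (appM (gm' g)) GG; [exact: hM|exact: sub_of_mem hS].
  - apply: minvP => v; rewrite (appM M') (appM (gm' g)).
      by rewrite MM // -(appM (gm' g)) hgm' app_id.
    by rewrite GG //; exact: sub_of_mem hS.
have Mlam g : compm M (lam g) = gm g by apply: matP => v; rewrite (appM M) (appM M') MM.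
have lamM g h : lam (g * h)%g = compm (lam h) (map_mat (cm_fun (A h)) (lam g)).
  have -> : lam (g * h)%g = compm M' (compm M (compm (lam h) (map_mat (cm_fun (A h)) (lam g)))).
    rewrite (compmA M) Mlam -[compm (gm h) _](compmA (glam V h)) -map_compm Mlam.
    rewrite map_compm (compmA (glam V h)) -glamM.
    congr (compm _ (compm _ _)); apply/ffunP => i; apply/ffunP => j.
    by rewrite !ffunE caM.
  by rewrite compmA M'M comp1m.
by exists (GBundle isoS lamM), M.
Qed.

(* The maximal destabilizing subspace is unique, hence invariant. *)
Lemma gss_ss0 (V : gbundle A) : gsemistable V -> gdegree V = 0 -> ss0 V.
Proof.
move=> ssV dV; have d0 : degree V = 0.
  move: dV; rewrite /gdegree => /eqP; rewrite mulf_eq0 invr_eq0 pnatr_eq0.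
  by rewrite (cardD1 1%g) orbF intr_eq0 => /eqP.
split=> // U0 l0; rewrite leNgt; apply/negP => d1.
have [U [lU dU uU]] := max_destab (ex_intro2 _ _ U0 l0 d1).
have [|S [M [hS eM]]] := @gsub_ex V U lU.
  move=> g; have [S [M hS]] := sub_of_ex lU; have hg := act_sub g hS.
  apply: uU; first exact: sub_of_lsub hg.
    by rewrite (sdegE hg).1 (sdegE hS).1 degree_act.
  by rewrite (sdegE hg).2 (sdegE hS).2.
have r0 : (0 < rank S)%N.
  by rewrite lt0n; apply: contraTneq dU => /degree_rank0 r0; rewrite (sdegE hS).1 r0.
have c0 : (0 < #|gT|)%N by rewrite (cardD1 1%g).
have := ssV S M hS.1 eM r0; rewrite /gslope /gdegree d0 !mul0r.
rewrite !pmulr_lle0 ?invr_gt0 ?ltr0n // -[0]/(0%:~R) ler_int leNgt.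
by rewrite -(sdegE hS).1 dU.
Qed.

Lemma ss0_gss (V : gbundle A) : ss0 V -> gsemistable V /\ gdegree V = 0.
Proof.
move=> hV; have [d0 _] := hV; split; last by rewrite /gdegree d0 mul0r.
move=> W M hM _ r0; rewrite /gslope /gdegree d0 !mul0r -mulrA pmulr_lle0.
  by rewrite -[0]/(0%:~R) ler_int; exact: ss0_sub hM.
by rewrite mulr_gt0 // invr_gt0 ltr0n // (cardD1 1%g).
Qed.

End SemilinearDestabilization.

(** * Strong semistability and Frobenius pull-backs *)

Section StrongSemistability.

Definition frobn p (pk : p \in [pchar k]) n V : bundle Y := iter n (pull (frob Y pk)) V.

Definition sss0 V : Prop := ss0 V /\ forall p (pk : p \in [pchar k]) n, ss0 (frobn pk n V).

Lemma ram_frob p (pk : p \in [pchar k]) y : ram (frob Y pk) y = p%:Z.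
Proof.
rewrite /ram vordX vord_unif1 -mulr_natr mul1r.
by rewrite natz.
Qed.

Lemma degree_frob p (pk : p \in [pchar k]) V : degree (pull (frob Y pk) V) = p%:Z * degree V.
Proof.
rewrite degree_pull mulrN; congr (- _); rewrite mulrC -totM; apply: tot_eq => y.
by rewrite ram_frob mulrC.
Qed.

Lemma degree_frobn p (pk : p \in [pchar k]) n V : degree (frobn pk n V) = p%:Z ^+ n * degree V.
Proof. by elim: n => [|n IH]; rewrite ?mul1r //= degree_frob IH exprS mulrA. Qed.
Lemma rank_frobn p (pk : p \in [pchar k]) n V : rank (frobn pk n V) = rank V.
Proof. by elim: n => [|n IH]. Qed.

Variables (gT : finGroupType) (A : curve_action gT Y).

(** Equivariant and plain Frobenius pull-backs have the same underlying bundle, and [gss_ss0] and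
    [ss0_gss] pass between the two notions of semistability. *)
Lemma Vect0ssP (V : gbundle A) : @Vect0ss k Y gT A V <-> sss0 V.
Proof.
have E p (pk : p \in [pchar k]) n : iter n (@gfrob k Y p pk gT A) V = frobn pk n V :> bundle Y.
  by elim: n => [|n IH] //=; rewrite IH.
split=> [[[h1 h2] d0]|[h1 h2]].
  have s0 : ss0 V by exact: gss_ss0.
  split=> // p pk n; rewrite -E; apply: gss_ss0; first exact: h2.
  by rewrite /gdegree E degree_frobn (proj1 s0) mulr0 mul0r.
have [g0 d0] := ss0_gss h1; split=> //; split=> // p pk n.
by have := h2 p pk n; rewrite -E => /ss0_gss[].
Qed.

End StrongSemistability.

(** * Semistability under tensor operations, subbundles and quotients *)

Lemma tens_frames V W y e f : frames y e (stalk V y) -> frames y f (stalk W y) ->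
  frames y (mtens e f) (stalk (tens V W) y).
Proof.
move=> fe ff; have [[e' ee'] _] := fe; have [[f' ff'] _] := ff.
apply: (ospan_frames (mtens_minv ee' ff')).
  move=> [i j]; exists (e i), (f j); split; last by rewrite ffunE.
    exact: frames_mem fe.
  exact: frames_mem ff.
move=> _ [v [w [Vv Ww ->]]] [i j]; rewrite app_tens ffunE.
by apply: in_ringM; [exact: (framesP _ fe ee').1|exact: (framesP _ ff ff').1].
Qed.

Lemma dsum_frames V W y e f : frames y e (stalk V y) -> frames y f (stalk W y) ->
  frames y (msum e f) (stalk (dsum V W) y).
Proof.
move=> fe ff; have [[e' ee'] he] := fe; have [[f' ff'] hf] := ff.
split; first by exists (msum e' f'); exact: msum_minv.
move=> c; rewrite /= /dsum_stalk /= lpart_msum rpart_msum he hf.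
split=> [[h1 h2] [i|j]|h]; first by have := h1 i; rewrite ffunE.
  by have := h2 j; rewrite ffunE.
by split=> i; rewrite ffunE.
Qed.

Lemma frame_neq0 y I (e : mat L I I) (S : set (vec L I)) : frames y e S -> fdet e != 0.
Proof. by case=> -[e' /minv_det[]]. Qed.
Lemma degree_tens V W : degree (tens V W) = degree V * (rank W)%:Z + degree W * (rank V)%:Z.
Proof.
have E y : ldeg (tens V W) y = ldeg V y * (rank W)%:Z + ldeg W y * (rank V)%:Z.
  have [e fe] := frames_ex V y; have [f ff] := frames_ex W y.
  rewrite (ldegE fe) (ldegE ff) (ldegE (V := tens V W) (tens_frames fe ff)) frame_det_mtens.
  have := frame_neq0 ff; have := frame_neq0 fe; move: (fdet e) (fdet f) => a b a0 b0.
  rewrite vordM ?expf_neq0 // 2!vordX.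
  by rewrite 2!pmulrn 2!mulrzz.
rewrite !degreeE (tot_eq E) totD ?totM ?opprD ?mulNr //; apply: fin_suppM; exact: fin_supp_ldeg.
Qed.

Lemma degree_dsum V W : degree (dsum V W) = degree V + degree W.
Proof.
have E y : ldeg (dsum V W) y = ldeg V y + ldeg W y.
  have [e fe] := frames_ex V y; have [f ff] := frames_ex W y.
  rewrite (ldegE fe) (ldegE ff) (ldegE (V := dsum V W) (dsum_frames fe ff)).
  rewrite (@frame_det_sum _ _ _ _ e f) => [|i i'|j j'|i j]; rewrite ?ffunE //.
  by apply: vordM; [exact: frame_neq0 fe|exact: frame_neq0 ff].
by rewrite !degreeE (tot_eq E) totD ?opprD //; exact: fin_supp_ldeg.
Qed.

Lemma frame_det_trm I (e : mat L I I) : fdet (trm e) = fdet e.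
Proof.
rewrite -[RHS]det_tr; congr (\det _); apply/matrixP => i j; by rewrite !mxE !ffunE.
Qed.

Lemma degree_bdual V : degree (bdual V) = - degree V.
Proof.
have E y : ldeg (bdual V) y = - ldeg V y.
  have [e fe [e' ee']] := frames_inv V y.
  rewrite (ldegE fe) (ldegE (V := bdual V) (dual_frames fe ee')) frame_det_trm.
  by rewrite (minv_det ee').2 vordV.
by rewrite !degreeE (tot_eq E) totN.
Qed.

Lemma rank_tens V W : rank (tens V W) = (rank V * rank W)%N.
Proof. exact: card_prod. Qed.

Lemma place_ex : inhabited (place Y).
Proof. by have [t /zero_ex[y _]] := transc_ex Y. Qed.

Definition kerf V W (f : mat L (idx V) (idx W)) : set (vec L (idx V)) := [set v | app f v = 0].
Definition imf V W (f : mat L (idx V) (idx W)) : set (vec L (idx W)) := [set w | exists2 v, setT v & w = app f v].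

Lemma lsub_imf V W (f : mat L (idx V) (idx W)) : lsub (imf f).
Proof. exact/lsub_im/lsubT. Qed.
(** Kernel and image have degree at most 0, and by [sdeg_hom] the sum of the degrees is at least deg
    V = 0. Both are therefore 0, and the case of equality says that the image is saturated. *)
Lemma ss0_hom V W (f : mat L (idx V) (idx W)) : ss0 V -> ss0 W -> is_hom f ->
  [/\ sdeg (kerf f) = 0, sdeg (imf f) = 0 &
    forall y v, stalk W y (app f v) -> exists2 v', stalk V y v' & app f v' = app f v].
Proof.
move=> [dV hV] [dW hW] hf; have [le eq] := sdeg_hom hf (@lsubT _ _).
have hk := hV _ (lsub_ker f); have hi := hW _ (lsub_imf f).
move: le eq; rewrite setTI (sdegT V).1 dV -/(imf f) => le eq.
have k0 : sdeg (kerf f) = 0 by move: hk hi le; rewrite -/(kerf f); lia.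
have i0 : sdeg (imf f) = 0 by move: hi le; lia.
split=> // y v hv; have [|v' [h1 _ h2]] := eq _ y v I hv; last by exists v'.
by rewrite k0.
Qed.

Lemma ss0_iso V W M N : @is_iso k Y V W M N -> ss0 V -> ss0 W.
Proof.
move=> MN hV; have [hM hN mn] := MN; apply: ss0I; first by rewrite -(degree_iso MN); case: hV.
move=> S P [hP iP rP]; apply: (ss0_sub (M := compm N P)) hV _; split.
- exact: is_hom_comp.
- by move=> v w; rewrite !appM => e; apply: iP; rewrite -(minv_r (app P v) mn) e (minv_r _ mn).
- by move=> y v; rewrite appM => /hM; rewrite (minv_r _ mn); exact: rP.
Qed.

Lemma ss0_subbundle V S M : ss0 V -> @is_subbundle k Y S V M -> degree S = 0 -> ss0 S.
Proof.
move=> hV [hM iM rM] d0; apply: ss0I => // T P [hP iP rP].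
apply: (ss0_sub (M := compm M P)) hV _; split.
- exact: is_hom_comp.
- by move=> v w; rewrite !appM => /iM/iP.
- by move=> y v; rewrite appM => /rM/rP.
Qed.

(** By [sdeg_compare] a subspace of [W] has at most the degree of its preimage in [V]. *)
Lemma ss0_surj V W N : ss0 V -> @is_surj k Y V W N -> degree W = 0 -> ss0 W.
Proof.
move=> [dV hV] [hN sN] dW; split=> // U lU.
have [y0] := place_ex.
have [||sur _] := @sdeg_compare Y V W N [set v | U (app N v)] setT U setT hN
  (lsub_preim N lU) (@lsubT _ _) lU (@lsubT _ _) (@subsetT _ _) (@subsetT _ _)
  (fun v h => h) (fun v h => h).
- by [].
- move=> w _; have [a a0 /(_ tt)/sN[v _ e]] := scale_in y0 (fun _ : unit => w).
  exists (a^-1 *: v) => //; rewrite appZ e scalerA mulVf // scale1r subrr; by case: lU.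
move: sur; rewrite (sdegT V).1 (sdegT W).1; have := hV _ (lsub_preim N lU); lia.
Qed.

(** A subspace is filtered by its image in [W] and its intersection with [V], both contributing
    degree at most 0. *)
Lemma ss0_dsum V W : ss0 V -> ss0 W -> ss0 (dsum V W).
Proof.
move=> [dV hV] [dW hW]; split=> [|U lU]; first by rewrite degree_dsum dV dW.
pose pl : mat L (idx V + idx W)%type (idx V) := pullm L inl.
pose pr : mat L (idx V + idx W)%type (idx W) := pullm L inr.
have plE v : app pl v = lpart v by exact: app_pull.
have prE v : app pr v = rpart v by exact: app_pull.
have hl : @is_hom k Y (dsum V W) V pl by move=> y v []; rewrite plE.
have hr : @is_hom k Y (dsum V W) W pr by move=> y v []; rewrite prE.
have [le1 _] := sdeg_hom hr lU; set K := U `&` _ in le1.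
have lK : lsub K := lsubI lU (lsub_ker pr).
have [le2 _] := sdeg_hom hl lK.
have K0 : K `&` [set v | app pl v = 0] = [set 0].
  apply/seteqP; split=> [v [[_ h1] h2]|_ ->]; last first.
    by split; [case: lK|exact: app0].
  apply: partP; first by rewrite -plE -[RHS]plE app0.
  by rewrite -prE -[RHS]prE app0.
rewrite K0 sdeg0 in le2.
have h1 := le_trans le2 (hV _ (lsub_im pl lK)); have h2 := le_trans le1 (hW _ (lsub_im pr lU)).
by move: h1 h2; lia.
Qed.

(** The transpose of the inclusion of a subbundle S of the dual maps [V] generically onto the dual
    of S, which therefore has degree at least 0. *)
Lemma ss0_bdual V : ss0 V -> ss0 (bdual V).
Proof.
move=> [dV hV]; apply: ss0I; first by rewrite degree_bdual dV.
move=> S M [hM iM rM]; pose f : mat L (idx V) (idx (bdual S)) := trm M.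
have fE v c : dotp (app f v) c = dotp v (app M c) by exact: app_trm.
have hf : @is_hom k Y V (bdual S) f.
  move=> y v hv c hc; rewrite fE; have := hM y c hc v hv.
  by rewrite /dotp; under eq_bigr do rewrite mulrC.
have [le _] := sdeg_hom hf (@lsubT _ _); rewrite setTI (sdegT V).1 in le.
have iT : [set w | exists2 v : vec L (idx V), setT v & w = app f v] = setT.
  apply/seteqP; split=> // w _; have [M' M'M] := inj_retract iM.
  exists (app (trm M') w) => //; apply: dotpP => c.
  by rewrite fE app_trm -appM M'M app_id.
rewrite iT (sdegT (bdual S)).1 degree_bdual in le.
have := hV _ (lsub_ker f); lia.
Qed.

Lemma lsub_unit (U : set (vec L unit)) : lsub U -> U = [set 0] \/ U = setT.
Proof.
move=> [U0 UZ]; have [[u Uu u0]|h] := pselect (exists2 u, U u & u tt != 0).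
  right; apply/seteqP; split=> // v _.
  rewrite (_ : v = (v tt / u tt) *: u + 0); first exact: UZ.
  by apply/ffunP => -[]; rewrite addr0 ffunE; apply/esym/divfK.
left; apply/seteqP; split=> [v Uv|_ ->] //; apply/ffunP => -[]; rewrite ffunE.
by apply/eqP; apply: contra_notT h => h; exists v.
Qed.

(** Induction on the rank by projection to one coordinate; a line has no subspaces but 0 and
    itself. *)
Lemma ss0_triv I : ss0 (triv Y I).
Proof.
split=> [|U lU]; first exact: degree_triv.
have [n] := ubnP #|I|; elim: n => // n IH in I U lU *; rewrite ltnS => nI.
have [I0|/card_gt0P[i0 _]] := posnP #|I|.
  rewrite (_ : U = [set 0]) ?sdeg0 //; apply/seteqP; split=> [v Uv|_ ->]; last by case: lU.
  by apply/ffunP => i; move/card0_eq: I0 => /(_ i).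
pose p : mat L I unit := pullm L (fun=> i0).
pose q : mat L I {i | i != i0} := pullm L val.
have hp : @is_hom k Y (triv Y I) (triv Y unit) p.
  by move=> y v hv i; rewrite app_pull ffunE.
have hq : @is_hom k Y (triv Y I) (triv Y {i | i != i0}) q.
  by move=> y v hv i; rewrite app_pull ffunE.
have [le1 _] := sdeg_hom hp lU; set K := U `&` _ in le1.
have lK : lsub K := lsubI lU (lsub_ker p).
have [le2 _] := sdeg_hom hq lK.
have K0 : K `&` [set v | app q v = 0] = [set 0].
  apply/seteqP; split=> [v [[_ h1] h2]|_ ->]; last first.
    by split; [case: lK|exact: app0].
  apply/ffunP => i; have [->|ii] := eqVneq i i0.
    by move: h1 => /ffunP/(_ tt); rewrite app_pull !ffunE.
  by move: h2 => /ffunP/(_ (Sub i ii)); rewrite app_pull !ffunE.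
rewrite K0 sdeg0 in le2.
have h2 : sdeg (V := triv Y {i | i != i0}) [set w | exists2 v, K v & w = app q v] <= 0.
  apply: IH; first exact: (lsub_im q lK).
  have I1 : (0 < #|I|)%N by apply/card_gt0P; exists i0.
  by rewrite card_sig cardC1; move: #|I| I1 nI => [].
have h1 : sdeg (V := triv Y unit) [set w | exists2 v, U v & w = app p v] <= 0.
  have [->|->] := lsub_unit (lsub_im p lU); first by rewrite sdeg0.
  by rewrite (sdegT (triv Y unit)).1 degree_triv.
move: (le_trans le1 h1) (le_trans le2 h2); lia.
Qed.

Lemma isom_refl V : isomorphic V V.
Proof.
exists (mat1 _), (mat1 _); split; [exact: is_hom1|exact: is_hom1|].
by apply: minvP => v; rewrite !app_id.
Qed.
Lemma isom_sym V W : isomorphic V W -> isomorphic W V.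
Proof. by case=> M [N [hM hN MN]]; exists N, M; split=> //; exact: minv_sym. Qed.
Lemma isom_trans V W S : isomorphic V W -> isomorphic W S -> isomorphic V S.
Proof.
case=> M [N [hM hN MN]] [M1 [N1 [hM1 hN1 MN1]]]; exists (compm M1 M), (compm N N1).
split; [exact: is_hom_comp|exact: is_hom_comp|].
by apply: minvP => v; rewrite !appM; rewrite ?(minv_l _ MN1) ?(minv_l _ MN) ?(minv_r _ MN) ?(minv_r _ MN1).
Qed.
Lemma isom_tens V V' W W' : isomorphic V V' -> isomorphic W W' -> isomorphic (tens V W) (tens V' W').
Proof.
case=> M [N [hM hN MN]] [M1 [N1 [hM1 hN1 MN1]]]; exists (mtens M M1), (mtens N N1).
by split; [exact: tens_hom|exact: tens_hom|exact: mtens_minv].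
Qed.
Lemma isom_ss0 V W : isomorphic V W -> ss0 V -> ss0 W.
Proof. by case=> M [N /ss0_iso h] /h. Qed.
Lemma sub_iso V W S (M : mat L (idx S) (idx V)) P Q : @is_iso k Y V W P Q -> is_subbundle M ->
  is_subbundle (compm P M).
Proof.
move=> [hP hQ PQ] [hM iM rM]; split; first exact: is_hom_comp.
  by move=> v w; rewrite !appM => e; apply: iM; rewrite -(minv_l (app M v) PQ) e (minv_l _ PQ).
by move=> y v; rewrite appM => /hQ; rewrite (minv_l _ PQ); exact: rM.
Qed.

(** * Tensors as homomorphisms *)

Section Contraction.
Local Notation cst := (kcst Y).

(** The homomorphism from the dual of the first factor to the second factor that corresponds to a
    tensor. *)
Definition ctr I J (s : vec L (I * J)%type) : mat L I J := [ffun i => [ffun j => s (i, j)]].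

Lemma ctrE I J (s : vec L (I * J)%type) i j : app (ctr s) (bvec L i) j = s (i, j).
Proof. by rewrite app_bvec !ffunE. Qed.
Lemma ctr_tens I J (v : vec L I) (w : vec L J) xi : app (ctr (vtens v w)) xi = dotp xi v *: w.
Proof.
apply/ffunP => j; rewrite appE ffunE; transitivity (dotp xi v * w j); last by [].
rewrite mulr_suml.
by apply: eq_bigr => i _; rewrite !ffunE mulrA.
Qed.
Lemma ctr_lin I J a (s t : vec L (I * J)%type) xi :
  app (ctr (a *: s + t)) xi = a *: app (ctr s) xi + app (ctr t) xi.
Proof.
rewrite -appZm -appDm; congr app; apply/ffunP => i; apply/ffunP => j; by rewrite !ffunE.
Qed.
Lemma ctr0 I J xi : app (ctr (0 : vec L (I * J)%type)) xi = 0.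
Proof.
rewrite (_ : ctr _ = 0) ?app0m //; apply/ffunP => i; apply/ffunP => j; by rewrite !ffunE.
Qed.

Lemma ctr_stalk A B y s xi : stalk (tens A B) y s -> stalk (bdual A) y xi -> stalk B y (app (ctr s) xi).
Proof.
move=> + hxi; elim=> [|c _ u hc [v [w [hv hw ->]]] _ hu]; first by rewrite ctr0; exact: stalk_nil.
rewrite ctr_lin ctr_tens; apply: stalk_lin => //.
by rewrite -[_ *: w]addr0; apply: stalk_lin => //; [exact: hxi|exact: stalk_nil].
Qed.

(* A homomorphism of semistable bundles of degree 0 is strict, so that it    *)
(* vanishes as soon as its fibre at one point does.                          *)
Lemma ss0_rigid A B (f : mat L (idx A) (idx B)) y : ss0 A -> ss0 B -> is_hom f ->
  (forall v, stalk A y v -> stalk B y ((unif y)^-1 *: app f v)) -> forall v, app f v = 0.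
Proof.
move=> sA sB hf hy; have [_ _ strict] := ss0_hom sA sB hf.
have u0 := unif_neq0 y; have u1 := vord_unif1 y.
(* By strictness f(v) divided by the n-th power of the uniformizer is f(v') for some v' in the
   stalk, and the assumption on f allows one more division. *)
have key n v : stalk A y v -> stalk B y ((unif y)^-1 ^+ n *: app f v).
  elim: n v => [|n IH] v hv; first by rewrite scale1r; exact: hf.
  have := IH v hv; rewrite -appZ => /strict[v' hv' e].
  by rewrite exprS -scalerA -appZ -e; exact: hy.
have f0 v : stalk A y v -> app f v = 0.
  move=> hv; have [e fe [e' ee']] := frames_inv B y.
  rewrite -[LHS](minv_r _ ee'); rewrite (_ : app e' _ = 0) ?app0 //; apply/ffunP => j.
  rewrite ffunE; apply/eqP; apply: contraT => a0; set a := app e' _ j in a0.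
  have := key (absz (vord y a)).+1 v hv => /(framesP _ fe ee')/(_ j).
  rewrite appZ ffunE -[in_ring y _]/(vge y 0 ((unif y)^-1 ^+ (absz (vord y a)).+1 * a)).
  rewrite vgeE ?mulf_neq0 ?expf_neq0 ?invr_eq0 // vordM ?expf_neq0 ?invr_eq0 // vordX vordV.
  by move: (vord y a) => m; lia.
move=> v; have [a a0 /(_ tt) h] := scale_in (V := A) y (fun _ : unit => v).
by have := f0 _ h; rewrite appZ => /eqP; rewrite scaler_eq0 (negbTE a0) => /eqP.
Qed.

(** Evaluation at one point is injective on global sections: a section vanishing at [y] is a
    homomorphism from the dual of [A] to [B] with zero fibre at [y], hence zero by [ss0_rigid]. *)
Lemma tens_sections_le A B n (z : 'I_n -> vec L (idx A * idx B)%type) : ss0 A -> ss0 B ->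
  free_over cst (z : 'I_n -> {ffun (idx A * idx B)%type -> L^o}) ->
  (forall i y, stalk (tens A B) y (z i)) -> (n <= rank A * rank B)%N.
Proof.
move=> sA sB fz hz; rewrite leqNgt; apply/negP => lt; have [y] := place_ex.
set T := tens A B in hz; have [g fg [g' gg']] := frames_inv T y.
have hc i p : vge y 0 (app g' (z i) p) by exact: (framesP _ fg gg').1.
pose rs i : {ffun idx T -> k^o} := [ffun p => res y (app g' (z i) p)].
pose b (p : idx T) : {ffun idx T -> k^o} := [ffun q => (p == q)%:R].
have [||c [i ci] c0] := @span_dependent k k idfun {ffun idx T -> k^o} 'I_n (idx T) b rs.
- move=> i; exists (rs i); apply/ffunP => q; rewrite sum_ffunE (bigD1 q) //= !ffunE eqxx.
  rewrite [_ *: _]mulr1 big1 ?addr0 // => p pq; rewrite !ffunE (negbTE pq).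
  exact: mulr0.
- by rewrite card_ord card_prod.
pose s := \sum_i cst (c i) *: z i.
have sE p : app g' s p = \sum_i cst (c i) * app g' (z i) p.
  rewrite (app_lsum g' (fun i => cst (c i)) z) sum_ffunE; apply: eq_bigr => j _.
  by rewrite ffunE.
have s1 p : vge y 1 (app g' s p).
  apply/res_eq0; rewrite sE.
    apply: vge_sum => j _; rewrite -(addr0 0); apply: vgeM; [exact: vge_cst|exact: hc].
  rewrite res_sum => [|j]; last by rewrite -(addr0 0); apply: vgeM; [exact: vge_cst|exact: hc].
  move/ffunP: c0 => /(_ p); rewrite sum_ffunE [RHS]ffunE => c0; apply: etrans c0.
  apply: eq_bigr => j _; rewrite resM ?vge_cst // res_cst !ffunE.
  by [].
have hs : stalk T y ((unif y)^-1 *: s).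
  apply/(framesP _ fg gg') => p; rewrite appZ ffunE.
  change (vge y 0 ((unif y)^-1 * app g' s p)); rewrite -(subrr 1) addrC; apply: vgeM => //.
  by rewrite vgeE ?invr_eq0 ?unif_neq0 // vordV vord_unif1.
have f0 := @ss0_rigid (bdual A) B (ctr s) y (ss0_bdual sA) sB.
have s0 : s = 0.
  apply/ffunP => -[i1 j1]; rewrite -ctrE f0 ?ffunE // => [y1 v hv|v hv].
    apply: ctr_stalk hv; apply: (omod_sum (stalk_omod T y1)) => j; [exact: vge_cst|exact: hz].
  by have := ctr_stalk hs hv; rewrite -[_ *: s]addr0 ctr_lin ctr0 addr0.
by move: ci; rewrite (fz c s0 i) eqxx.
Qed.

End Contraction.

(** * Tensor products in characteristic p *)

Section TensorCharp.
Variables (p : nat) (pk : p \in [pchar k]).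

Lemma frobn_sub n S V M : @is_subbundle k Y S V M ->
  exists M', @is_subbundle k Y (frobn pk n S) (frobn pk n V) M'.
Proof.
move=> hM; elim: n => [|n [M' hM']]; first by exists M.
by exists (map_mat (cm_fun (frob Y pk)) M'); exact: (pull_sub (frob Y pk) hM').
Qed.

Lemma frobn_tens n V W : isomorphic (frobn pk n (tens V W)) (tens (frobn pk n V) (frobn pk n W)).
Proof.
elim: n => [|n IH]; first exact: isom_refl.
exact: isom_trans (isom_pull (frob Y pk) IH) (isom_pull_tens _ _ _).
Qed.

(** If deg W were positive, the degrees of its Frobenius pull-backs would grow like p^n, and
    [riemann] would give them more sections than [tens_sections_le] allows in the tensor product of
    the pull-backs of [E] and [F]. *)
Lemma tens_le_charp E F W M : (forall n, ss0 (frobn pk n E)) -> (forall n, ss0 (frobn pk n F)) ->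
  @is_subbundle k Y W (tens E F) M -> degree W <= 0.
Proof.
move=> sE sF hM; rewrite leNgt; apply/negP => d0; have [C hC] := riemann Y.
(* Since p^n > n, the pull-back has degree larger than [rank E * rank F + C * rank W]. *)
pose N := (rank E * rank F + C * rank W)%N; pose n := N.+1.
have [M' hM'] := frobn_sub n hM; have [P [Q PQ]] := frobn_tens n E F.
have hM'' := sub_iso PQ hM'.
have [|z [fz hz]] := hC (frobn pk n W) (rank E * rank F).+1.
  rewrite degree_frobn rank_frobn; have : (N.+1 <= p ^ n)%N.
    apply: leq_trans (ltn_expl n _) => //; exact: prime_gt1 (pcharf_prime pk).
  have -> : p%:Z ^+ n = (p ^ n)%N%:Z by rewrite -!natz natrX.
  move: (p ^ n)%N d0 => q; rewrite /N; move: (degree W) (rank E * rank F)%N => d r d0.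
  rewrite -PoszM; move: (C * rank W)%N => s sq; have : q%:Z <= q%:Z * d by rewrite ler_peMr.
  by move: sq; lia.
have := @tens_sections_le (frobn pk n E) (frobn pk n F) _
  (fun i => app (compm P M') (z i)) (sE n) (sF n).
have [hh hi _] := hM''; rewrite (rank_frobn pk n E) (rank_frobn pk n F) ltnn => absurd.
suff : false by []; apply: absurd => [c c0|i y]; last exact: hh.
apply: fz; apply: hi; rewrite app0.
by rewrite (app_lsum (compm P M') (fun i => kcst Y (c i)) z).
Qed.

End TensorCharp.

End Semistability.

(** * Curves of finite field extensions *)

Section RestrictPlaces.
Variables (Z Y : curve k) (s : {rmorphism ff Y -> ff Z}).
Hypothesis lin : forall c, s (kcst Y c) = kcst Z c.
Variables (n : nat) (b : 'I_n -> (ff Z)^o).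
Hypothesis hb : forall a, in_span s b a.
Implicit Types (z : place Z) (y : place Y).

(** If the valuation were trivial on [ff Y], all powers of a uniformizer would be free over [ff Y],
    which is impossible in a finite extension. *)
Lemma restr_nontrivial z : exists a, 0 < vord z (s a).
Proof.
suff [a ha] : exists a, vord z (s a) != 0.
  have [h|h] := ltP 0 (vord z (s a)); first by exists a.
  by exists a^-1; rewrite fmorphV vordV oppr_gt0 lt_neqAle ha.
have [t t0 t1] := unif_ex z; apply: contrapT => h0.
have v0 a : vord z (s a) = 0 by apply/eqP; apply: contra_notT h0 => h; exists a.
have [|c [i0 ci0] c0] := @span_dependent _ _ s (ff Z)^o 'I_n.+1 'I_n b (fun i => t ^+ i) (fun i => hb _).
  by rewrite !card_ord.
have [i1 ci1 hmin] := @arg_minnP _ i0 (fun i => c i != 0) (fun i => val i) ci0.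
have := @sum_dom Z z 'I_n.+1 (fun i => s (c i) * t ^+ i) i1; rewrite c0 eqxx => h.
suff : false by []; apply: h => [|i ii]; first by rewrite mulf_neq0 ?fmorph_eq0 ?expf_neq0.
have [->|ci] := eqVneq (c i) 0; first by rewrite rmorph0 mul0r vge0.
rewrite vgeE ?mulf_neq0 ?fmorph_eq0 ?expf_neq0 // !vordM ?fmorph_eq0 ?expf_neq0 //.
rewrite !v0 !vordX t1 !natz lez_nat addn1 ltn_neqAle (hmin i ci) andbT.
by apply: contraNneq ii => e; apply/eqP/val_inj/esym.
Qed.

(** The values of [vord z] on [ff Y] are the multiples of the least positive one, and division by it
    normalizes the restricted valuation. *)
Lemma restr_ex z : exists y, forall a, in_ring y a = in_ring z (s a).
Proof.
pose P m := (0 < m)%N && `[< exists a, vord z (s a) = m%:Z >].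
have exP : exists m, P m.
  have [a ha] := restr_nontrivial z; exists (absz (vord z (s a))).
  by rewrite /P absz_gt0 gt_eqF //; apply/asboolP; exists a; rewrite gtz0_abs.
case: (ex_minnP exP) => e /andP[e0 /asboolP[u ue]] mine.
have ez0 : (e%:Z : int) != 0 by rewrite -lt0n.
have u0 : u != 0 by apply: contraTneq e0 => u0; move: ue; rewrite u0 rmorph0 vord0 => -[<-].
have div a : (vord z (s a) = (vord z (s a) %/ e)%Z * e%:Z).
  have [->|a0] := eqVneq a 0; first by rewrite rmorph0 vord0 div0z.
  set q := (_ %/ _)%Z; have r0 : vord z (s (a / u ^ q)) = (vord z (s a) %% e)%Z.
    rewrite rmorphM fmorphV vordM ?invr_eq0 ?fmorph_eq0 ?expfz_neq0 // vordV fmorphXz vordXz ue.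
    by rewrite [in LHS](divz_eq (vord z (s a)) e); ring.
  rewrite {1}(divz_eq (vord z (s a)) e); suff -> : (vord z (s a) %% e)%Z = 0 by rewrite addr0.
  have := modz_ge0 (vord z (s a)) ez0; have := ltz_pmod (vord z (s a)) (_ : 0 < e%:Z).
  move: r0; case: (vord z (s a) %% e)%Z => // -[//|m] r0 /(_ e0) lt _.
  have /mine : P m.+1 by apply/andP; split=> //; apply/asboolP; exists (a / u ^ q).
  by rewrite leqNgt -ltz_nat lt.
pose v a := (vord z (s a) %/ e)%Z.
have vE a : vord z (s a) = v a * e%:Z by exact: div.
have e1 : 0 < e%:Z by [].
have v_0 : v 0 = 0 by rewrite /v rmorph0 vord0 div0z.
have v_M a c : a != 0 -> c != 0 -> v (a * c) = v a + v c.
  move=> a0 c0; apply: (mulIf ez0); rewrite -vE rmorphM vordM ?fmorph_eq0 // mulrDl.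
  by rewrite -!vE.
have v_D a c : a != 0 -> c != 0 -> a + c != 0 -> Num.min (v a) (v c) <= v (a + c).
  move=> a0 c0 ac; rewrite -(ler_pM2r e1) minr_pMl // -!vE rmorphD.
  by apply: vordD; rewrite -?rmorphD fmorph_eq0.
have v_c c : v (kcst Y c) = 0 by rewrite /v lin vord_cst div0z.
have v_s : exists t, v t = 1 by exists u; apply: (mulIf ez0); rewrite -vE mul1r.
exists (Place v_0 v_M v_D v_c v_s) => a.
by rewrite /in_ring /in_pow fmorph_eq0 vE pmulr_lge0.
Qed.

Definition restr z : place Y := projT1 (cid (restr_ex z)).
Lemma restrP z a : in_ring (restr z) a = in_ring z (s a).
Proof. by rewrite /restr; case: cid. Qed.
Lemma restr_cont U : zopen U -> zopen (restr @^-1` U).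
Proof.
case=> [->|fU]; first by left.
right; have [r hr] := proj1 (finite_seqP _) fU.
have -> : ~` (restr @^-1` U) = \bigcup_(y in [set` r]) [set z | restr z = y].
  apply/seteqP; split=> [z h|z [y yr zy] h]; first by exists (restr z) => //; rewrite -hr.
  by move: yr; rewrite -hr -zy.
apply: bigcup_finite => [|y _]; first exact: finite_seq.
pose a := unif y; have v1 : vord y a = 1 := vord_unif1 y.
have ta : transc (s a).
  have [//|[c ac]] := transcP (s a); move: ac; rewrite -lin => /fmorph_inj ac.
  by move: v1; rewrite ac vord_cst.
apply: sub_finite_set (zeros_finite ta) => z zy.
have := restrP z a^-1; rewrite zy fmorphV !in_ringE !vgeE ?invr_eq0 ?fmorph_eq0 ?unif_neq0 //.
by rewrite !vordV v1 => /esym/negbT; rewrite -ltNge oppr_lt0.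
Qed.

Definition mor_of : curve_mor Z Y := CurveMor restrP restr_cont.

End RestrictPlaces.

Section ExtensionCurve.
Variables (Y : curve k) (K : fieldType) (s : {rmorphism ff Y -> K}).
Variables (n : nat) (b : 'I_n -> K^o).
Hypothesis hb : forall a, in_span s b a.

Lemma ext_function_field : function_field (s \o kcst Y).
Proof.
have [t [tt [m [c hc]]]] := curveP Y.
have mp p : (map_poly (s \o kcst Y) p).[s t] = s (map_poly (kcst Y) p).[t].
  by rewrite -horner_map -map_poly_comp.
exists (s t); split=> [p /tt|]; first by rewrite mp fmorph_eq0.
exists #|{: 'I_n * 'I_m}|, (fun h => b (enum_val h).1 * s (c (enum_val h).2)) => a.
have [d ->] := hb a; have /choice[f hf] j := hc (d j).
exists (fun h => s (f (enum_val h).1 (enum_val h).2)); split.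
  move=> h; have [h1 _] := hf (enum_val h).1; have [p [q [q0 ->]]] := h1 (enum_val h).2.
  by exists p, q; rewrite !mp fmorph_eq0 fmorph_div.
rewrite [RHS](reindex (@enum_rank _)); last exact/onW_bij/enum_rank_bij.
rewrite [RHS](eq_bigr (fun h => s (f h.1 h.2) * (b h.1 * s (c h.2)))) => [|h _]; last by rewrite enum_rankK.
rewrite -(pair_bigA _ (fun i j => s (f i j) * (b i * s (c j)))); apply: eq_bigr => i _.
have [_ ->] := hf i; rewrite rmorph_sum [_ *: _]mulr_suml; apply: eq_bigr => j _.
by rewrite rmorphM; ring.
Qed.

Definition ext_curve : curve k := Curve ext_function_field.
Definition ext_mor : curve_mor ext_curve Y := @mor_of ext_curve Y s (fun=> erefl) n b hb.

End ExtensionCurve.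

(** * The Galois cover defined by a Galois extension *)

Section GaloisCurve.
Variables (Y : curve k) (L : splittingFieldType (ff Y)).
Hypothesis galL : galois 1 {:L}.

Lemma vect_span (a : (L : fieldType)^o) :
  in_span (in_alg L) (fun i : 'I_(\dim {:L}) => (vbasis {:L})`_i : (L : fieldType)^o) a.
Proof.
have e : a = \sum_i in_alg L (coord (vbasis {:L}) i a) * (vbasis {:L})`_i :> L.
  rewrite {1}(coord_vbasis (memvf (a : L))).
  by apply: eq_bigr => i _; rewrite mulr_algl.
by exists (fun i => coord (vbasis {:L}) i a).
Qed.

Definition gal_curve : curve k := ext_curve vect_span.
Definition gal_mor : curve_mor gal_curve Y := ext_mor vect_span.

Definition gal_fun (g : gal_of {:L}) : {rmorphism ff gal_curve -> ff gal_curve} :=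
  GRing.RMorphism.clone L L (fun_of_lfun (gal_repr g)) _.

Lemma gal_fun_alg g c : gal_fun g (in_alg L c) = in_alg L c.
Proof. exact: rmorph_alg. Qed.
Lemma gal_span g (a : (ff gal_curve)^o) : in_span (gal_fun g) (fun _ : 'I_1 => 1 : (ff gal_curve)^o) a.
Proof.
exists (fun=> gal_fun g^-1%g a); rewrite big_ord1 [_ *: _]mulr1.
by rewrite -[RHS]galM ?memvf // mulVg gal_id.
Qed.

Definition gal_act_mor g : curve_mor gal_curve gal_curve :=
  mor_of (s := gal_fun g) (fun c => gal_fun_alg g _) (gal_span g).

Lemma gal_action1 a : cm_fun (gal_act_mor 1%g) a = a.
Proof. exact: gal_id. Qed.
Lemma gal_actionM g h a :
  cm_fun (gal_act_mor (g * h)%g) a = cm_fun (gal_act_mor h) (cm_fun (gal_act_mor g) a).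
Proof. exact/galM/memvf. Qed.
Definition gal_action : curve_action (gal_of {:L}) gal_curve :=
  CurveAction (ca := gal_act_mor) (fun g c => gal_fun_alg g _) gal_action1 gal_actionM.

Lemma gal_covering : covering gal_mor.
Proof.
split=> [c|| a] //; first by exists (\dim {:L}), (fun i : 'I_(\dim {:L}) => (vbasis {:L})`_i); exact: vect_span.
have /and3P[_ /separableP/(_ a (memvf _)) sep _] := galL.
have /polyOver1P[q qE] := minPolyOver 1 a.
exists q; rewrite -(separable_map (in_alg L)) -qE; split; first exact: sep.
exact: root_minPoly.
Qed.

Lemma gal_faithful g : (forall a, cm_fun (gal_action g) a = a) -> g = 1%g.
Proof. by move=> h; apply/eqP/gal_eqP => a _; rewrite gal_id; exact: h. Qed.
Lemma gal_quotient a : (forall g, cm_fun (gal_action g) a = a) -> exists b, a = cm_fun gal_mor b.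
Proof.
move=> h; have : a \in fixedField 'Gal({:L} / 1)%g.
  by apply/fixedFieldP; [exact: memvf|move=> g _; exact: h].
by rewrite (galois_fixedField galL) => /vlineP[b ->]; exists b.
Qed.

Definition gal_cover : galois_cover (gal_of {:L}) gal_curve Y :=
  @GaloisCover k (gal_of {:L}) gal_curve Y gal_mor gal_covering gal_action
    gal_fun_alg gal_faithful gal_quotient.

End GaloisCurve.

(** * Splitting fields of polynomials *)

Lemma irr_factor (F : fieldType) (p : {poly F}) : (1 < size p)%N ->
  exists2 r, r %| p & irreducible_poly r.
Proof.
have [n] := ubnP (size p); elim: n p => // n IH p; rewrite ltnS => pn p1.
have [irr|nirr] := pselect (irreducible_poly p); first by exists p.
have [q [q1 qp nqp]] : exists q : {poly F}, [/\ size q != 1%N, q %| p & ~~ (q %= p)].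
  apply: contra_notP nirr => h; split=> // q q1 qp; apply: contraT => nqp.
  by case: h; exists q.
have p0 : p != 0 by rewrite -size_poly_gt0 ltnW.
have qs : (size q < size p)%N by rewrite ltn_neqAle dvdp_leq // andbT dvdp_size_eqp.
have [||r rq ir] := IH q; first exact: leq_trans qs pn.
  by rewrite ltn_neqAle eq_sym q1 size_poly_gt0 (dvdpN0 qp).
by exists r => //; exact: dvdp_trans rq qp.
Qed.

Definition splits (F : fieldType) (q : {poly F}) := exists zs, q %= \prod_(z <- zs) ('X - z%:P).

(** Roots are adjoined one at a time, by induction on the degree. *)
Lemma split_ext (F : fieldType) (p : {poly F}) : p != 0 ->
  exists L : fieldExtType F, splits (map_poly (in_alg L) p).
Proof.
have [n] := ubnP (size p); elim: n F p => // n IH F p; rewrite ltnS => pn p0.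
have [Cp|C'p] := leqP (size p) 1.
  exists F^o, [::]; rewrite big_nil -size_poly_eq1 size_map_poly eqn_leq Cp.
  by rewrite size_poly_gt0.
have [r r_dv_p irr_r] := irr_factor C'p.
have [K _ [x rx0 _]] := irredp_FAdjoin irr_r.
have [q Dp] : exists q, map_poly (in_alg K) p = q * ('X - x%:P).
  by apply/factor_theorem; rewrite -(divpK r_dv_p) rmorphM rootM rx0 orbT.
have Dszp : size p = size (q * ('X - x%:P)) by rewrite -Dp size_map_poly.
have nz_q : q != 0.
  by move: p0; rewrite -size_poly_eq0 Dszp size_poly_eq0 mulf_eq0 => /norP[].
have [|L [zs Dq]] := IH K q _ nz_q.
  by move: pn; rewrite Dszp size_mul ?polyXsubC_eq0 ?size_XsubC ?addn2.
exists (baseFieldType L), ((in_alg L x : L) :: zs).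
have -> : map_poly (in_alg (baseFieldType L)) p = map_poly (in_alg L) (map_poly (in_alg K) p).
  by rewrite -map_poly_comp.
by rewrite Dp big_cons mulrC rmorphM rmorphB /= map_polyX map_polyC eqp_mull.
Qed.

(** Inside an extension in which [p] splits, the subfield generated by the roots is taken. *)
Lemma splitting_ex (F : fieldType) (p : {poly F}) : p != 0 ->
  exists L : splittingFieldType F, splittingFieldFor 1 (map_poly (in_alg L) p) {:L}.
Proof.
move=> p0.
suff [L splitLp] : exists L : fieldExtType F, splittingFieldFor 1 (map_poly (in_alg L) p) {:L}.
  have ax : splitting_field_axiom L.
    by exists (map_poly (in_alg L) p) => //; apply/polyOver1P; exists p.
  pose mx := FieldExt_isSplittingField.Build F L ax.
  pose L' : splittingFieldType F := HB.pack_for (splittingFieldType F) (FieldExt.sort L) mx.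
  by exists L'.
have [L [ys Dp]] := split_ext p0.
pose Lp := subvs_of <<1 & ys>>; pose toL := linfun (vsval : Lp -> L).
have [zs Dys] : exists zs, map toL zs = ys.
  exists (map (vsproj _) ys); rewrite -map_comp map_id_in // => y ys_y.
  by rewrite /= lfunE /= vsprojK ?seqv_sub_adjoin.
exists Lp, zs.
  set lhs := (lhs in lhs %= _); set rhs := (rhs in _ %= rhs).
  suff : map_poly toL lhs %= map_poly toL rhs by rewrite eqp_map.
  rewrite -Dys big_map in Dp; apply: etrans Dp; apply: congr2.
    by rewrite -map_poly_comp; apply/eq_map_poly => x; apply: rmorph_alg.
  rewrite rmorph_prod; apply/eq_bigr => z _.
  by rewrite rmorphB /= map_polyX map_polyC.
set Lzs := LHS; pose Lys := (toL @: Lzs)%VS; apply/vspaceP => u.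
have : val u \in Lys by rewrite /Lys aimg_adjoin_seq aimg1 Dys (valP u).
by case/memv_imgP => v Lzs_v; rewrite memvf lfunE => /val_inj->.
Qed.

(** * Comparison and composition of morphisms *)

Section CompareMorphisms.

Lemma cm_pt_eq (Z Y : curve k) (f g : curve_mor Z Y) : cm_fun f =1 cm_fun g -> cm_pt f =1 cm_pt g.
Proof. by move=> e z; apply: place_eq => a; rewrite -!in_ringE !cm_loc e. Qed.
Lemma pull_eq_iso (Z Y : curve k) (f g : curve_mor Z Y) (V : bundle Y) : cm_fun f =1 cm_fun g ->
  @is_iso k Z (pull f V) (pull g V) (mat1 _) (mat1 _).
Proof.
have key (f1 g1 : curve_mor Z Y) : cm_fun f1 =1 cm_fun g1 -> @is_hom k Z (pull f1 V) (pull g1 V) (mat1 _).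
  move=> e z v; apply: ospan_stalk_map => _ [w + <-]; rewrite app_id (cm_pt_eq e).
  have -> : map_vec (cm_fun f1) w = map_vec (cm_fun g1) w by apply/ffunP => i; rewrite !ffunE.
  exact: pull_gen.
move=> e; split; [exact: key|by apply: key|].
by apply: minvP => v; rewrite !app_id.
Qed.

Lemma pull_id_iso (Y : curve k) (f : curve_mor Y Y) (V : bundle Y) : cm_fun f =1 id ->
  @is_iso k Y (pull f V) V (mat1 _) (mat1 _).
Proof.
move=> e; have ept y : cm_pt f y = y by apply: place_eq => a; rewrite -!in_ringE cm_loc e.
have ev (w : vec (ff Y) (idx V)) : map_vec (cm_fun f) w = w by apply/ffunP => i; rewrite !ffunE.
split; last by apply: minvP => v; rewrite !app_id.
- by move=> y v; apply: ospan_stalk_map => _ [w + <-]; rewrite app_id ept ev.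
- by move=> y v hv; rewrite app_id -[v]ev; apply: pull_gen; rewrite ept.
Qed.

Section Comp.
Variables (Z Y X : curve k) (h : curve_mor Z Y) (g : curve_mor Y X).
Fact comp_loc z a : in_ring (cm_pt g (cm_pt h z)) a = in_ring z (cm_fun h (cm_fun g a)).
Proof. by rewrite !cm_loc. Qed.
Fact comp_cont U : zopen U -> zopen ((fun z => cm_pt g (cm_pt h z)) @^-1` U).
Proof. by move=> /(cm_cont g)/(cm_cont h). Qed.
Definition comp_mor : curve_mor Z X := @CurveMor k Z X (cm_fun h \o cm_fun g) _ comp_loc comp_cont.

Lemma pull_comp_iso (V : bundle X) : @is_iso k Z (pull comp_mor V) (pull h (pull g V)) (mat1 _) (mat1 _).
Proof.
split; last by apply: minvP => v; rewrite !app_id.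
  move=> z v; apply: ospan_stalk_map => _ [w hw <-]; rewrite app_id.
  have -> : map_vec (cm_fun comp_mor) w = map_vec (cm_fun h) (map_vec (cm_fun g) w).
    by apply/ffunP => i; rewrite !ffunE.
  by apply: pull_gen; exact: pull_gen.
move=> z v; apply: ospan_stalk_map => _ [w + <-]; rewrite app_id -[map_vec _ w]app_id -(map_mat1 (cm_fun h)) -map_app.
elim=> [|c _ u hc [u' hu' <-] _ IH]; first by rewrite app0 map_vec0; exact: stalk_nil.
rewrite appD appZ map_vecD map_vecZ; apply: stalk_lin => //; first by rewrite -cm_loc.
rewrite app_id; have <- : map_vec (cm_fun comp_mor) u' = map_vec (cm_fun h) (map_vec (cm_fun g) u').
  by apply/ffunP => i; rewrite !ffunE.
exact: pull_gen.
Qed.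
End Comp.

End CompareMorphisms.

(** * Galois descent *)

Section Descent.
Variables (gT : finGroupType) (Z Y : curve k) (f : galois_cover gT Z Y).
Local Notation s := (cm_fun f).
Local Notation sg g := (cm_fun (gc_act f g)).

(** A nonzero vector of [U] of minimal support inside that of [u], with one coordinate normalized to
    1, is fixed by the group, since its difference with a conjugate has smaller support. It comes
    from [ff Y] and so lies in [T]; subtracting a multiple of it from [u] lowers the support. *)
Lemma descent I (U T : set (vec (ff Z) I)) : lsub U -> lsub T ->
  (forall g u, U u -> U (map_vec (sg g) u)) ->
  (forall w : vec (ff Y) I, U (map_vec s w) -> T (map_vec s w)) -> U `<=` T.
Proof.
move=> lU lT invU UT.
pose supp (u : vec (ff Z) I) := [set i | u i != 0]%SET.
have suppS (u v : vec (ff Z) I) : (forall i, u i = 0 -> v i = 0) -> supp v \subset supp u.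
  by move=> h; apply/fintype.subsetP => i; rewrite !inE; apply: contraNneq => /h ->.
suff key n u : U u -> (#|supp u| <= n)%N -> T u by move=> u /key; apply.
elim: n u => [|n IH] u Uu.
  rewrite leqn0 cards_eq0 => /eqP s0; rewrite (_ : u = 0); first by case: lT.
  apply/ffunP => i; apply/eqP; rewrite ffunE; apply: contraT => ui.
  by have : i \in supp u by [rewrite inE]; rewrite s0 inE.
move=> un; have [u0|u0] := eqVneq u 0; first by rewrite u0; case: lT.
pose P m := `[< exists w, [/\ U w, w <> 0, supp w \subset supp u & #|supp w| = m] >].
have exP : exists m, P m by exists #|supp u|; apply/asboolP; exists u; split=> //; apply/eqP.
case: (ex_minnP exP) => m /asboolP[w [Uw w0 wu wm]] minm.
have [j wj] : exists j, w j != 0.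
  by apply: contra_notP w0 => h; apply/ffunP => i; rewrite ffunE; apply/eqP; apply: contra_notT h => h; exists i.
pose w' := (w j)^-1 *: w.
have w'j : w' j = 1 by rewrite ffunE; exact: mulVf.
have Uw' : U w' by rewrite /w' -[_ *: _]addr0; apply: lU.2 => //; case: lU.
have inv g : map_vec (sg g) w' = w'.
  apply/eqP; rewrite -subr_eq0; apply: contraT => d0.
  have /minm : P #|supp (map_vec (sg g) w' - w')|.
    apply/asboolP; exists (map_vec (sg g) w' - w'); split=> //.
    - by apply: lsub_add => //; [exact: invU|exact: lsub_opp].
    - exact/eqP.
    - by apply: fintype.subset_trans wu; apply: suppS => i wi; rewrite !ffunE wi scaler0 rmorph0 subr0.
  rewrite -wm leqNgt => /negP[]; apply: proper_card; apply/properP; split.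
    by apply: suppS => i wi; rewrite !ffunE wi scaler0 rmorph0 subr0.
  exists j; first by rewrite inE.
  have e : (map_vec (sg g) w' - w') j = sg g (w' j) - w' j.
    by rewrite ffunE; congr (_ + _); rewrite ffunE.
  by rewrite inE negbK e w'j rmorph1 subrr.
have /choice[w0' hw0] i : exists b, w' i = s b.
  by apply: gc_quotient => g; have /ffunP/(_ i) := inv g; rewrite ffunE.
have Tw' : T w'.
  have e : w' = map_vec s (finfun w0') by apply/ffunP => i; rewrite !ffunE -hw0 ffunE.
  by rewrite e; apply: UT; rewrite -e.
rewrite -[u](subrK (u j *: w')); apply: lsub_add => //; last first.
  by rewrite -[_ *: w']addr0; apply: lT.2 => //; case: lT.
apply: IH; first by apply: lsub_add => //; apply: lsub_opp => //; rewrite -[_ *: w']addr0; apply: lU.2 => //; case: lU.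
rewrite -ltnS; apply: leq_trans un; apply: proper_card; apply/properP; split.
  apply: suppS => i ui; have wi : w i = 0.
    apply/eqP; apply: contraT => wi; have : i \in supp w by rewrite inE.
    by move/(fintype.subsetP wu); rewrite inE ui eqxx.
  by rewrite !ffunE wi !scaler0 subr0.
exists j; last first.
  have e : (u - u j *: w') j = u j - u j * w' j.
    by rewrite ffunE; rewrite ffunE; rewrite ffunE.
  by rewrite inE negbK e w'j mulr1 subrr.
by apply: (fintype.subsetP wu); rewrite inE.
Qed.

(** The pull-back is equivariant through identity matrices, so by [gss_ss0] it suffices to consider
    invariant subbundles, and these are pull-backs of subbundles of [V] by [descent]. *)
Lemma galois_ss0 (V : bundle Y) : ss0 V -> ss0 (pull f V).
Proof.
move=> hV; have [N [w [N0 fw sw]]] := covering_basis (gc_cov f).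
have dN W : degree (pull f W) = N%:Z * degree W.
  by apply: (@degree_cover _ _ f _ N w) => //; case: (gc_cov f).
have isoA g : @is_iso k Z (pull (gc_act f g) (pull f V)) (pull f V) (mat1 _) (mat1 _).
  have [h1 h2 h3] := pull_comp_iso (gc_act f g) f V.
  have [h4 h5 _] := @pull_eq_iso Z Y (comp_mor (gc_act f g) f) f V (gc_over f g).
  split=> //; first by rewrite -[mat1 _]compm1; exact: (is_hom_comp h4 h2).
  by rewrite -[mat1 _]compm1; exact: (is_hom_comp h1 h5).
pose G := @GBundle k Z gT (gc_act f) (pull f V) (fun=> mat1 _) (fun=> mat1 _) isoA
  (fun g h => esym (etrans (comp1m _) (map_mat1 _ _))).
apply: (@gss_ss0 Z gT (gc_act f) G); last first.
  by rewrite /gdegree dN (proj1 hV) mulr0 mul0r.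
have d0 : degree G = 0 by rewrite dN (proj1 hV) mulr0.
move=> W M hM eM r0; rewrite /gslope /gdegree d0 !mul0r -mulrA pmulr_lle0; last first.
  by rewrite mulr_gt0 // invr_gt0 ltr0n // (cardD1 1%g).
rewrite -[0]/(0%:~R) ler_int.
have hU := sub_of_range hM; set U := [set w | _] in hU.
have lU := sub_of_lsub hU.
pose U0 : set (vec (ff Y) (idx V)) := [set v | U (map_vec s v)].
have lU0 : lsub U0.
  split=> [|a v w' hv hw]; first by rewrite /U0 /= map_vec0; case: lU.
  by rewrite /U0 /= map_vecD map_vecZ; exact: lU.2.
have [S0 [M0 hS0]] := sub_of_ex lU0.
have hP := pull_sub f hS0.1.
have hP' : @sub_of Z (pull f V) U (pull f S0) (map_mat s M0).
  split=> // v; split=> [Uv|[c ->]]; last first.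
    rewrite [app _ c]/app; apply: lsub_sum => // i.
    rewrite ffunE -app_bvec.
    exact: sub_of_mem hS0.
  apply: (descent lU (lsub_range (map_mat s M0))) Uv => [g _ [c ->]|u hu].
    exists (app (glam W g) (map_vec (sg g) c)); rewrite -appM eM comp1m.
    exact: map_app.
  have [c ->] := (hS0.2 u).1 hu; by exists (map_vec s c); rewrite map_app.
rewrite -(sdegE hU).1 (sdegE hP').1 dN pmulr_rle0 //.
exact: (ss0_sub hV hS0.1).
Qed.

End Descent.

(** * Covers that preserve semistability *)

Section GoodCovers.

(** The properties of compositions of Galois covers on which the argument in characteristic 0
    relies. *)
Definition good (Z Y : curve k) (h : curve_mor Z Y) (N : nat) : Prop :=
  [/\ (0 < N)%N, forall W, degree (pull h W) = N%:Z * degree W & forall V, ss0 V -> ss0 (pull h V)].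

Lemma good_comp (Z Y X : curve k) (h : curve_mor Z Y) (g : curve_mor Y X) M N :
  good h M -> good g N -> good (comp_mor h g) (M * N).
Proof.
move=> [M0 hM sM] [N0 hN sN]; split=> [|W|V /sN/sM]; first by rewrite muln_gt0 M0.
  by rewrite (degree_iso (pull_comp_iso h g W)) hM hN mulrA.
apply: ss0_iso; have [h1 h2 h3] := pull_comp_iso h g V; split; [exact: h2|exact: h1|exact: minv_sym].
Qed.

Lemma id_loc (Y : curve k) (y : place Y) a : in_ring (id y) a = in_ring y (idfun a).
Proof. by []. Qed.
Lemma id_cont (Y : curve k) (U : set (place Y)) : zopen U -> zopen (id @^-1` U).
Proof. by []. Qed.
Definition id_mor (Y : curve k) : curve_mor Y Y := CurveMor (@id_loc Y) (@id_cont Y).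

Lemma good_id (Y : curve k) : good (id_mor Y) 1.
Proof.
have i V : @is_iso k Y (pull (id_mor Y) V) V (mat1 _) (mat1 _) by exact: pull_id_iso.
split=> // [W|V]; first by rewrite mul1r (degree_iso (i W)).
by apply: ss0_iso; have [h1 h2 h3] := i V; split; [exact: h2|exact: h1|exact: minv_sym].
Qed.

End GoodCovers.

(** * Gauss' lemma *)

Section GaussLemma.
Variables (Z : curve k).
Local Notation L := (ff Z).
Implicit Types (z : place Z) (p q : {poly L}) (m : int).

Definition pge z m p := forall i, vge z m p`_i.
(** The Gauss valuation of [p] at [z] is [m]. *)
Definition pexact z m p := pge z m p /\ exists2 i, p`_i != 0 & vord z p`_i = m.

Lemma pexact_top z m p : pexact z m p ->
  exists i, [/\ p`_i != 0, vord z p`_i = m & forall j, (i < j)%N -> vge z (m + 1) p`_j].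
Proof.
move=> [hp [i0 pi0 vi0]]; pose P i := (p`_i != 0) && (vord z p`_i == m).
have exP : exists i, P i by exists i0; rewrite /P pi0 vi0 eqxx.
have bP i : P i -> (i <= size p)%N.
  by move=> /andP[pi _]; apply: contraNT pi; rewrite -ltnNge => /ltnW/leq_sizeP ->.
case: (ex_maxnP exP bP) => i /andP[pi /eqP vi] maxi; exists i; split=> // j ij.
have [->|pj] := eqVneq p`_j 0; first exact: vge0.
have := hp j; rewrite !vgeE // le_eqVlt => /orP[/eqP e|]; last by rewrite -lezD1.
by have := maxi j; rewrite /P pj -e eqxx leqNgt ij => /(_ isT).
Qed.

(** In each factor the coefficient of least valuation with the highest index is taken; their product
    strictly dominates the other terms of the same coefficient of [p * q]. *)
Lemma pexactM z m n p q : pexact z m p -> pexact z n q -> pexact z (m + n) (p * q).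
Proof.
move=> ep eq; have [[hp _] [hq _]] := (ep, eq); split.
  by move=> i; rewrite coefM; apply: vge_sum => j _; exact: vgeM.
have [i [pi vi ti]] := pexact_top ep; have [j [qj vj tj]] := pexact_top eq.
have lt : (i < (i + j).+1)%N by rewrite leq_addr.
have [|h1 h2] := @vord_dom _ z (p`_i * q`_j)
  (\sum_(a < (i + j).+1 | a != Ordinal lt) p`_a * q`_(i + j - a)) (mulf_neq0 pi qj).
  rewrite vordM // vi vj; apply: vge_sum => a ai.
  have [la|ga|e] := ltngtP a i; last by rewrite -val_eqE /= e eqxx in ai.
    rewrite -addrA; apply: vgeM; first exact: hp.
    by apply: tj; lia.
  by rewrite addrAC; apply: vgeM; [exact: ti|exact: hq].
exists (i + j)%N; rewrite coefM (bigD1 (Ordinal lt)) //= addKn //.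
by rewrite h2 vordM // vi vj.
Qed.

Lemma pexactC z c : c != 0 -> pexact z (vord z c) c%:P.
Proof.
move=> c0; split=> [i|]; last by exists 0%N; rewrite coefC.
by rewrite coefC; case: eqP => _; [exact: vge_vord|exact: vge0].
Qed.

Lemma pexact_prod z I (m : I -> int) (P : I -> {poly L}) :
  (forall i, pexact z (m i) (P i)) -> pexact z (\sum_i m i) (\prod_i P i).
Proof.
move=> h; elim/big_rec2: _ => [|i p n _ hp]; last exact: pexactM.
by rewrite -(vord1 z); apply: pexactC; exact: oner_neq0.
Qed.

Lemma pexact_le z m r p : pexact z m p -> pge z r p -> r <= m.
Proof. by move=> [_ [i pi <-]] /(_ i); rewrite vgeE. Qed.

End GaussLemma.

Section LinearPowers.
Variable F : comNzRingType.
Definition linp (a b : F) : {poly F} := a *: 'X + b%:P.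
Lemma coef_linp a b : [/\ (linp a b)`_0 = b, (linp a b)`_1 = a & forall i, (1 < i)%N -> (linp a b)`_i = 0].
Proof.
by split=> [||[|[|i]]]; rewrite coefD coefZ coefX coefC ?mulr0 ?mulr1 ?add0r ?addr0.
Qed.
Lemma coef_linpM a b (q : {poly F}) i :
  (linp a b * q)`_i = a * (if i == 0%N then 0 else q`_i.-1) + b * q`_i.
Proof. by rewrite mulrDl -scalerAl coefD coefZ coefXM mul_polyC coefZ. Qed.
Lemma linp_exp a b j : (linp a b ^+ j)`_j = a ^+ j /\ forall i, (j < i)%N -> (linp a b ^+ j)`_i = 0.
Proof.
elim: j => [|j [IH1 IH2]]; first by split=> [|[|i]]; rewrite coefC.
split=> [|[|i] ij]; rewrite exprS coef_linpM ?IH1 ?IH2 ?mulr0 ?addr0 //; first by rewrite exprS.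
exact: leqW.
Qed.
End LinearPowers.

(** * Binary forms on a bundle of rank 2 *)

Section Rank2.
Variables (Y : curve k).
Local Notation L := (ff Y).
Implicit Types (y : place Y).

Lemma frame_det_unit (e : mat L unit unit) : fdet e = e tt tt.
Proof.
have b : bijective (fun _ : 'I_1 => tt) by exists (fun=> ord0) => [i|[]] //; rewrite (ord1 i).
by rewrite (frame_det_enum e b) det_mx11 mxE.
Qed.

Section Frames.
Variables (V : bundle Y) (B : mat L unit (idx V)) (B' : mat L (idx V) unit).
Variables (N : mat L (idx V) unit) (s : mat L unit (idx V)).
Hypothesis sp : splitting B B' N s.

(** A generator of the subline is completed by a lift of a generator of the quotient line. *)
Lemma rank2_frame y : exists e1 e2 : vec L (idx V), [/\ stalk V y e1, stalk V y e2, app N e1 = 0 &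
      forall v, stalk V y v -> exists x1 x2, [/\ vge y 0 x1, vge y 0 x2 & v = x1 *: e1 + x2 *: e2]] /\
  [/\ app B' e1 tt != 0, vord y (app B' e1 tt) = ldeg (bsub sp) y,
      app N e2 tt != 0 & vord y (app N e2 tt) = ldeg (bquot sp) y].
Proof.
have [g fg] := frames_ex (bsub sp) y; have [[g' gg'] hg] := fg.
have [f ff] := frames_ex (bquot sp) y; have [[f' ff'] hf] := ff.
have uE (w : vec L unit) (e : mat L unit unit) : app e w = w tt *: e tt.
  by rewrite /app (bigD1 tt) //= big1 ?addr0 // => -[].
have [v0 hv0 e0] := frames_rows ff tt.
exists (app B (g tt)), v0; split; split.
- exact: (frames_rows fg tt).
- exact: hv0.
- exact: sp_NB sp _.
- move=> v hv; have : stalk (bquot sp) y (app N v) by exists v.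
  rewrite -(minv_r (app N v) ff') hf => /(_ tt) h2; set x2 := app f' _ tt in h2.
  have Nv : app N v = x2 *: f tt by rewrite -[LHS](minv_r _ ff').
  have hd : stalk V y (v - x2 *: v0).
    rewrite addrC -scaleNr; apply: stalk_lin => //.
    by rewrite in_ringE vgeN.
  have dk : app N (v - x2 *: v0) = 0 by rewrite appD -scaleNr appZ Nv e0 scaleNr subrr.
  have dB := sp_ker sp dk; set c := app B' _ in dB.
  have : stalk (bsub sp) y c by rewrite /= -dB.
  rewrite -(minv_r c gg') hg => /(_ tt) h1; set x1 := app g' _ tt in h1.
  exists x1, x2; split; [exact: h1|exact: h2|].
  by rewrite -[LHS](subrK (x2 *: v0)) dB -{1}(minv_r c gg') uE appZ.
- by rewrite (sp_BK sp) -frame_det_unit; exact: frame_neq0 fg.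
- by rewrite (sp_BK sp) -frame_det_unit (ldegE (V := bsub sp) fg).
- by rewrite e0 -frame_det_unit; exact: frame_neq0 ff.
- by rewrite e0 -frame_det_unit (ldegE (V := bquot sp) ff).
Qed.

(** The option type is the projective line of linear forms up to scalars: [Some zeta] stands for
    [B' - zeta *: N], and [None], the point at infinity, for [N]. *)
Lemma splitting_line (o : option L) : exists (B1 : mat L unit (idx V)) (B1' : mat L (idx V) unit)
  (s1 : mat L unit (idx V)), splitting B1 B1' (if o is Some zeta then B' - zeta *: N else N) s1.
Proof.
case: o => [zeta|]; last by exists B, B', s.
exists (zeta *: B + s), N, B; apply: splittingP => v.
- by rewrite appDm appZm appD appZ (sp_NB sp) (sp_sK sp) scaler0 add0r.
- by rewrite appDm appNm appZm (sp_BK sp) (sp_NB sp) scaler0 subr0.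
- rewrite !(appDm, appNm, appZm, appD, appZ) (sp_BK sp) (sp_Bs sp) (sp_NB sp) (sp_sK sp).
  by rewrite !scaler0 oppr0 scaler0 addr0 add0r subrr.
- exact: sp_NB sp v.
- rewrite !(appDm, appNm, appZm, appD) -scaleN1r !appZ scaleN1r.
  rewrite -[RHS](sp_dec sp v).
  by rewrite addrC addrA subrK.
Qed.

End Frames.

Section Forms.
Variables (n : nat) (al be ga : place Y -> L).
Hypothesis al0 : forall y, al y != 0.
Hypothesis ga0 : forall y, ga y != 0.
Hypothesis fin : finite_set [set y | ~ [/\ vord y (al y) = 0, vord y (ga y) = 0 & vge y 0 (be y)]].

Definition form y (a : vec L 'I_n.+1) : {poly L} :=
  \sum_j a j *: (ga y ^+ (n - j) *: linp (al y) (be y) ^+ j).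
Let T y : mat L 'I_n.+1 'I_n.+1 :=
  [ffun j : 'I_n.+1 => [ffun i : 'I_n.+1 => (ga y ^+ (n - j) *: linp (al y) (be y) ^+ j)`_i]].

Lemma app_T y a i : app (T y) a i = (form y a)`_i. by rewrite appE coef_sum; apply: eq_bigr => j _; rewrite !ffunE [RHS]coefZ. Qed.

Lemma det_T y : fdet (T y) = \prod_(j < n.+1) (ga y ^+ (n - j) * al y ^+ j).
Proof.
have b : bijective (id : 'I_n.+1 -> 'I_n.+1) by exists id.
rewrite (frame_det_enum (T y) b) det_trig.
  by apply: eq_bigr => j _; rewrite mxE !ffunE coefZ (linp_exp _ _ _).1.
apply/is_trig_mxP => i j ij; rewrite mxE !ffunE coefZ.
by rewrite ((linp_exp (al y) (be y) i).2 j ij) mulr0.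
Qed.

Lemma det_T_neq0 y : fdet (T y) != 0.
Proof. by rewrite det_T; apply/prodf_neq0 => j _; rewrite mulf_neq0 ?expf_neq0. Qed.
Lemma vord_det_T y : vord y (fdet (T y)) =
  \sum_(j < n.+1) ((n - j)%N%:Z * vord y (ga y) + j%:Z * vord y (al y)).
Proof.
rewrite det_T vord_prod => [|j]; last by rewrite mulf_neq0 ?expf_neq0.
apply: eq_bigr => j _; rewrite vordM ?expf_neq0 // !vordX 2!pmulrn 2!mulrzz.
by rewrite mulrC [_ * j%:Z]mulrC.
Qed.

Definition form_stalk y : set (vec L 'I_n.+1) := [set a | pge y 0 (form y a)].

Lemma form_stalkP y a : form_stalk y a <-> forall i, vge y 0 (app (T y) a i).
Proof.
split=> [h i|h i]; first by rewrite app_T.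
have [le|lt] := leqP i n; first by have := h (Ordinal (le : i < n.+1)%N); rewrite app_T.
rewrite coef_sum big1 ?vge0 // => j _.
by rewrite !coefZ (linp_exp _ _ _).2 ?mulr0 //; apply: leq_trans lt.
Qed.

Lemma form_frames y : exists T', [/\ minv (T y) T' & frames y T' (form_stalk y)].
Proof.
have TT := det_minv (det_T_neq0 y); eexists; split; first exact: TT.
split; first by exists (T y); exact: minv_sym.
by move=> c; rewrite form_stalkP (minv_r c TT).
Qed.

Lemma form_adelic : adelic form_stalk.
Proof.
apply: (@adelic_frames Y (triv Y 'I_n.+1) form_stalk).
  by move=> y; have [T' [_ fT]] := form_frames y; exists T'.
apply: sub_finite_set fin => y h; apply: contra_not h => -[a0 g0 b0].
have [T' [TT fT]] := form_frames y.
have le : stalk (triv Y 'I_n.+1) y `<=` form_stalk y.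
  move=> a ha; apply/form_stalkP => i; apply: app_ge => [i' j|j]; last exact: ha.
  rewrite !ffunE coefZ.
  rewrite -(addr0 0); apply: vgeM; first by apply: vgeX; rewrite vgeE // g0.
  elim: (val i') (val j) => [|m IH] j'; first by rewrite coefC; case: eqP => _; [exact: vge1|exact: vge0].
  rewrite exprS coef_linpM; apply: vgeD.
    case: ifP => _; first by rewrite mulr0 vge0.
    by rewrite -(addr0 0); apply: vgeM; [rewrite vgeE // a0|exact: IH].
  by rewrite -(addr0 0); exact: vgeM.
have [_ eq] := frames_sub (@frames_std Y y 'I_n.+1) fT le.
apply/esym/eq; rewrite frame_det1 vord1 (minv_det TT).2 vordV vord_det_T big1 // => j _.
by rewrite a0 g0 !mulr0.
Qed.

Definition forms := mkb form_adelic.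

Lemma ldeg_forms y : ldeg forms y =
  - \sum_(j < n.+1) ((n - j)%N%:Z * vord y (ga y) + j%:Z * vord y (al y)).
Proof.
have [T' [TT fT]] := form_frames y.
by rewrite (ldegE (V := forms) fT) (minv_det TT).2 vordV vord_det_T.
Qed.

End Forms.
End Rank2.

(** * Lines in bundles of rank 2 in characteristic 0 *)

Section CharZeroCovers.
Hypothesis ch0 : [pchar k] =i pred0.

Lemma fin_supp_pull (Z Y : curve k) (h : curve_mor Z Y) (N : nat) (w : 'I_N -> (ff Z)^o) F :
  k_linear h -> free_over (cm_fun h) w -> (forall a, in_span (cm_fun h) w a) ->
  fin_supp F -> fin_supp (fun z => ram h z * F (cm_pt h z)).
Proof.
move=> lin fw sw /fin_suppP[s _ hs].
have /choice[r hr] := fiber_ex lin fw sw.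
have fin : finite_set [set` flatten [seq r y | y <- s]] by exact: finite_seq.
apply: sub_finite_set fin => z Fz; apply/flattenP; exists (r (cm_pt h z)).
  by apply: map_f; apply: hs; apply: contraNneq Fz => ->; rewrite mulr0.
by have [_ -> _] := hr (cm_pt h z).
Qed.

(** In characteristic 0 a splitting field is Galois, so [galois_ss0] applies to the cover that it
    defines. *)
Lemma split_cover (Y : curve k) (p : {poly ff Y}) : p != 0 ->
  exists (Z : curve k) (h : curve_mor Z Y) (N : nat) c zs,
  [/\ good h N, forall F, fin_supp F -> fin_supp (fun z => ram h z * F (cm_pt h z)) /\
        tot (fun z => ram h z * F (cm_pt h z)) = N%:Z * tot F, c != 0
    & map_poly (cm_fun h) p = c *: \prod_(z <- zs) ('X - z%:P)].
Proof.
move=> p0; have [L [zs hz _]] := splitting_ex p0.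
have galL : galois 1 {:L}.
  apply/and3P; split; [exact: sub1v| |exact: normalFieldf].
  apply/separableP => a _; apply: pcharf0_separable => q.
  by rewrite pchar_lalg (fmorph_pchar (kcst Y)).
have cov := gc_cov (gal_cover galL).
have [N [w [N0 fw sw]]] := covering_basis cov; have [lin _ _] := cov.
have /eqpP[[c1 c2] /andP[c10 c20] e] := hz.
exists (gal_curve L), (gal_cover galL), N, (c2 / c1), zs; split.
- split=> // [W|V]; last exact: galois_ss0.
  exact: (degree_cover lin fw sw).
- by move=> F fF; split; [exact: (fin_supp_pull lin fw sw fF)|exact: (tot_pull lin fw sw fF)].
- by rewrite mulf_neq0 ?invr_eq0.
- move/(congr1 (fun q => c1^-1 *: q)): e; rewrite !scalerA mulVf // scale1r mulrC => e.
  exact: e.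
Qed.

Lemma splitting_map (Z Y : curve k) (h : curve_mor Z Y) I J K
    (B : mat (ff Y) J I) (B' : mat (ff Y) I J) (N : mat (ff Y) I K) (s : mat (ff Y) K I) :
  splitting B B' N s ->
  splitting (map_mat (cm_fun h) B) (map_mat (cm_fun h) B') (map_mat (cm_fun h) N) (map_mat (cm_fun h) s).
Proof.
have m0 (I1 J1 : finType) : map_mat (cm_fun h) (0 : mat (ff Y) I1 J1) = 0.
  by apply/ffunP => i; apply/ffunP => j; rewrite !ffunE rmorph0.
case=> h1 h2 h3 h4 h5; split; rewrite -?map_compm ?h1 ?h2 ?h3 ?h4 ?map_mat1 //.
by rewrite -(map_mat1 (cm_fun h)) -h5; apply/ffunP => i; apply/ffunP => j; rewrite !ffunE rmorphD.
Qed.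

(** The left side is the n-th power of g times the polynomial evaluated at lx / g. It factors
    through the roots, and the missing degree [n - size zs] appears as a power of g, that is, as
    roots at infinity. *)
Lemma homogenize (F : fieldType) (g : F) (lx : {poly F}) n c (zs : seq F) : g != 0 -> (size zs <= n)%N ->
  \sum_(j < n.+1) (c *: \prod_(z <- zs) ('X - z%:P))`_j *: (g ^+ (n - j) *: lx ^+ j) =
  c *: (\prod_(z <- zs) (lx - (z * g)%:P) * g%:P ^+ (n - size zs)).
Proof.
move=> g0 le; set q := c *: _; pose x := g^-1 *: lx.
have sq : (size (map_poly polyC q) <= n.+1)%N.
  rewrite size_map_polyC; apply: leq_trans (size_scale_leq _ _) _.
  by rewrite size_prod_XsubC.
transitivity (g ^+ n *: (q \Po x)).
  rewrite /comp_poly (horner_coef_wide _ sq) scaler_sumr; apply: eq_bigr => j _.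
  rewrite coef_map mul_polyC !scalerA exprZn scalerA.
  rewrite [g ^+ n * _]mulrC -mulrA.
  have -> : g ^+ n = g ^+ (n - j) * g ^+ j by rewrite -exprD subnK // -ltnS.
  by rewrite exprVn mulfK ?expf_neq0.
rewrite comp_polyZ scalerA mulrC -scalerA; congr (_ *: _).
rewrite (rmorph_prod (comp_poly x)) /=.
rewrite (eq_bigr (fun z => g^-1 *: (lx - (z * g)%:P))) => [|z _]; last first.
  by rewrite comp_polyB comp_polyX comp_polyC scalerBr -[g^-1 *: (_)%:P]mul_polyC -polyCM mulrCA mulVf ?mulr1.
have -> (G : F -> {poly F}) : \prod_(z <- zs) (g^-1 *: G z) = g^-1 ^+ size zs *: \prod_(z <- zs) G z.
  elim: (zs) => [|z l IH]; first by rewrite !big_nil scale1r.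
  by rewrite !big_cons IH -scalerAl -scalerAr scalerA exprS.
rewrite mulrC -polyC_exp mul_polyC scalerA -[in LHS](subnK le) exprD exprVn mulfK ?expf_neq0 //.
Qed.

(** The degree n of the forms is taken even, so that the factor n (n + 1) / 2 is visibly the integer
    [n2 * n2.*2.+1]. *)
Lemma sum_weights n2 (g a : int) :
  \sum_(j < n2.*2.+1) ((n2.*2 - j)%N%:Z * g + j%:Z * a) = (a + g) * (n2 * n2.*2.+1)%N%:Z.
Proof.
have e : \sum_(j < n2.*2.+1) j%:Z = (n2 * n2.*2.+1)%N%:Z.
  rewrite -(big_morph Posz PoszD erefl) -(big_mkord xpredT id) bin2_sum bin2.
  by rewrite -doubleMr doubleK mulnC.
transitivity (\sum_(j < n2.*2.+1) ((n2.*2)%:Z * g + j%:Z * (a - g))).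
  apply: eq_bigr => j _; rewrite -subzn; last by rewrite -ltnS.
  by ring.
rewrite big_split /= -[X in _ + X]mulr_suml e sumr_const card_ord -muln2.
by ring.
Qed.

(* A form of large degree n with controlled poles exists by Riemann's        *)
(* inequality; over the splitting field of this form it is a product of n    *)
(* linear forms, by Gauss' lemma one of them has few poles, and its kernel   *)
(* is a line of large degree.                                                *)
Lemma siegel2 (Y : curve k) (V : bundle Y) (B : mat (ff Y) unit (idx V)) B'
    (N : mat (ff Y) (idx V) unit) s (sp : splitting B B' N s) : exists C : nat, forall n2 : nat, (0 < n2)%N ->
  exists (Z : curve k) (h : curve_mor Z Y) (M : nat) (K : bundle Z) P,
  [/\ good h M, @is_subbundle k Z K (pull h V) P, rank K = 1%N &
     M%:Z * (n2%:Z * degree V - C.+1%:Z) <= (n2.*2)%:Z * degree K].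
Proof.
have [C hC] := riemann Y; exists C => n2 n20; set n := n2.*2; set d := degree V.
have [y0] := place_ex Y.
have /choice[e1 /choice[e2 he]] := rank2_frame sp.
pose al y := app B' (e1 y) tt; pose be y := app B' (e2 y) tt; pose ga y := app N (e2 y) tt.
have al0 y : al y != 0 by have [_ []] := he y.
have ga0 y : ga y != 0 by have [_ []] := he y.
have val_ y : vord y (al y) = ldeg (bsub sp) y by have [_ []] := he y.
have vga y : vord y (ga y) = ldeg (bquot sp) y by have [_ []] := he y.
have fin : finite_set [set y | ~ [/\ vord y (al y) = 0, vord y (ga y) = 0 & vge y 0 (be y)]].
  have [_ _ _ fV] := bundle_adelic V.
  have := bad_finite2 B'; have := fin_supp_ldeg (bsub sp); have := fin_supp_ldeg (bquot sp).
  rewrite /fin_supp => f1 f2 f3.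
  apply: (@sub_finite_set _ _ (([set y | stalk V y <> std y (I := idx V)] `|` [set y | ~ forall i j, vge y 0 (B' i j)])
    `|` ([set y | ldeg (bquot sp) y != 0] `|` [set y | ldeg (bsub sp) y != 0]))); last first.
    by rewrite !finite_setU.
  move=> y /= h; apply: contrapT => /not_orP[/not_orP[/contrapT Vs /contrapT B0] /not_orP[q0 b0]].
  apply: h; rewrite val_ vga; split; [by apply: contrapT => /eqP|by apply: contrapT => /eqP|].
  apply: app_ge => // i; have [[_ h2 _ _] _] := he y.
  by move: h2; rewrite Vs; apply.
pose Fm := @forms Y n al be ga al0 ga0 fin.
have dV : degree V = - tot (ldeg (bsub sp)) - tot (ldeg (bquot sp)).
  by rewrite (degree_ses sp) !degreeE.
have dF : degree Fm = - d * (n2 * n.+1)%N%:Z.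
  rewrite degreeE (tot_eq (@ldeg_forms Y n al be ga al0 ga0 fin)) totN opprK.
  rewrite (tot_eq (G := fun y => (ldeg (bsub sp) y + ldeg (bquot sp) y) * (n2 * n.+1)%N%:Z)).
    by rewrite totM totD; [rewrite /d dV opprD !opprK|exact: fin_supp_ldeg|exact: fin_supp_ldeg].
  by move=> y; rewrite sum_weights val_ vga.
(* Poles of order [m0] at the auxiliary point [y0] raise the degree of [Fm] just above the bound of
   [riemann], so that a nonzero form exists. *)
pose m0 : int := C%:Z + d * n2%:Z + 1; pose mf y : int := if y == y0 then m0 else 0.
have fm : fin_supp mf.
  apply: (@sub_finite_set _ _ [set y0]); last exact: finite_set1.
  by move=> y; have [->|ne] := eqVneq y y0 => //=; rewrite /mf (negbTE ne) eqxx.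
have tm : tot mf = m0.
  rewrite (@tot_seq _ mf [:: y0]) // => [|y]; first by rewrite big_seq1 /mf eqxx.
  by rewrite inE /mf; have [//|ne] := eqVneq y y0; rewrite eqxx.
have [|zz [fz hz]] := hC (twist Fm fm) 1%N.
  rewrite degree_twist tm dF -[rank Fm]/#|'I_n.+1| card_ord -[rank _]/#|'I_n.+1| card_ord.
  have -> : - d * (n2 * n.+1)%N%:Z + m0 * n.+1%:Z - C%:Z * n.+1%:Z = n.+1%:Z.
    by rewrite /m0 PoszM; ring.
  by [].
pose a := zz ord0.
have a0 : a != 0.
  apply/eqP => a0; have := fz (fun=> 1); rewrite big_ord1 -/a a0 scaler0 => /(_ erefl ord0)/eqP.
  by rewrite oner_eq0.
have ha y i : vge y (- mf y) (@form Y n al be ga y a)`_i.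
  have u0 : unif y ^ mf y != 0 by rewrite expfz_neq0 ?unif_neq0.
  have /stalk_twist/(_ (unif y ^ mf y)) := hz ord0 y.
  rewrite vgeE // vord_unif lexx => /(_ isT i); rewrite -/a.
  have -> : @form Y n al be ga y (unif y ^ mf y *: a) = unif y ^ mf y *: @form Y n al be ga y a.
    by rewrite /form scaler_sumr; apply: eq_bigr => j _; rewrite ffunE -scalerA.
  rewrite coefZ => h; have [->|b0] := eqVneq (@form Y n al be ga y a)`_i 0; first exact: vge0.
  by move: h; rewrite !vgeE ?mulf_neq0 // vordM // vord_unif; clear; lia.
pose p : {poly ff Y} := \poly_(j < n.+1) a (inord j).
have pE (j : 'I_n.+1) : p`_j = a j by rewrite coef_poly ltn_ord inord_val.
have p0 : p != 0.
  apply: contraNneq a0 => p0; apply/eqP/ffunP => j; by rewrite -pE p0 coef0 ffunE.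
have [Z [h [M [c [zs [gh htot c0 e]]]]]] := split_cover p0.
exists Z, h, M.
have szs : (size zs <= n)%N.
  have := size_poly n.+1 (fun j => a (inord j)); rewrite -/p -(size_map_poly (cm_fun h)) e.
  by rewrite size_scale // size_prod_XsubC ltnS.
(* The roots of [p], completed by roots at infinity up to the degree [n]. *)
pose os := map Some zs ++ nseq (n - size zs) None.
have sos : size os = n by rewrite size_cat size_map size_nseq subnKC.
pose o (l : 'I_n) := nth None os l.
have sp' := splitting_map h sp.
have /choice[B1 hB1] l := @splitting_line Z (pull h V) _ _ _ _ sp' (o l).
have /choice[B1' hB1'] l := hB1 l; have /choice[s1 hs1] l := hB1' l.
pose phi (q : option (ff Z)) : mat (ff Z) (idx V) unit :=
  if q is Some zeta then map_mat (cm_fun h) B' - zeta *: map_mat (cm_fun h) N else map_mat (cm_fun h) N.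
have {}hs1 l : splitting (B1 l) (B1' l) (phi (o l)) (s1 l) := hs1 l.
pose W : bundle Z := pull h V.
pose Ql l : bundle Z := @bquot Z W _ _ _ _ _ _ (hs1 l).
pose Kl l : bundle Z := @bsub Z W _ _ _ _ _ _ (hs1 l).
pose f1 z := map_vec (cm_fun h) (e1 (cm_pt h z)).
pose f2 z := map_vec (cm_fun h) (e2 (cm_pt h z)).
have span z v : stalk W z v -> exists x1 x2, [/\ vge z 0 x1, vge z 0 x2 & v = x1 *: f1 z + x2 *: f2 z].
  elim=> [|b _ u hb [v' hv' <-] _ [x1 [x2 [h1 h2 ->]]]].
    by exists 0, 0; rewrite !vge0 !scale0r addr0.
  have [[_ _ _ sV] _] := he (cm_pt h z); have [t1 [t2 [g1 g2 ->]]] := sV _ hv'.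
  exists (b * cm_fun h t1 + x1), (b * cm_fun h t2 + x2).
  rewrite map_vecD !map_vecZ; split.
  - by apply: vgeD => //; rewrite -(addr0 0); apply: vgeM => //; rewrite vge_pull.
  - by apply: vgeD => //; rewrite -(addr0 0); apply: vgeM => //; rewrite vge_pull.
  - by rewrite scalerDr !scalerA !scalerDl addrACA.
pose lin l z := linp (app (phi (o l)) (f1 z) tt) (app (phi (o l)) (f2 z) tt).
(* The values of a linear form on the stalk generate the stalk of its quotient line, so the Gauss
   valuation of the linear form is the local degree of that line. *)
have exact_l l z : pexact z (ldeg (Ql l) z) (lin l z).
  have [g fg] := frames_ex (Ql l) z; rewrite (ldegE fg) frame_det_unit.
  have g0 : g tt tt != 0 by rewrite -frame_det_unit; exact: frame_neq0 fg.
  have [[g' gg'] hg] := fg.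
  have uE (w : vec (ff Z) unit) : app g w tt = w tt * g tt tt.
    by rewrite appE (bigD1 tt) //= big1 ?addr0 // => -[].
  have inQ v : stalk W z v -> vge z (vord z (g tt tt)) (app (phi (o l)) v tt).
    move=> hv; have : stalk (Ql l) z (app (phi (o l)) v) by exists v.
    rewrite -(minv_r (app (phi (o l)) v) gg') hg => /(_ tt) h1.
    by rewrite uE -[vord z _]add0r; apply: vgeM => //; exact: vge_vord.
  have [[i1 i2 _ _] _] := he (cm_pt h z).
  have h1 := inQ _ (pull_gen i1); have h2 := inQ _ (pull_gen i2).
  have [c0' c1' c2'] := coef_linp (app (phi (o l)) (f1 z) tt) (app (phi (o l)) (f2 z) tt).
  split.
    by case=> [|[|i]]; rewrite /lin ?c0' ?c1' ?c2' ?vge0.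
  have [v0 /span[x1 [x2 [hx1 hx2 v0E]]] e0] := frames_rows fg tt.
  have gE : g tt tt = x1 * app (phi (o l)) (f1 z) tt + x2 * app (phi (o l)) (f2 z) tt.
    by rewrite -e0 v0E appD !appZ !ffunE.
  have eqv x : vge z (vord z (g tt tt)) x -> ~~ vge z (vord z (g tt tt) + 1) x ->
      x != 0 /\ vord z x = vord z (g tt tt).
    have [->|x0] := eqVneq x 0; first by rewrite !vge0.
    rewrite !vgeE // -ltNge => le lt; split=> //; move: le lt; clear; lia.
  have [b1|b1] := boolP (vge z (vord z (g tt tt) + 1) (app (phi (o l)) (f1 z) tt)); last first.
    by exists 1%N; rewrite c1'; case: (eqv _ h1 b1).
  have [b2|b2] := boolP (vge z (vord z (g tt tt) + 1) (app (phi (o l)) (f2 z) tt)); last first.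
    by exists 0%N; rewrite c0'; case: (eqv _ h2 b2).
  have : vge z (vord z (g tt tt) + 1) (g tt tt).
    by rewrite {2}gE; apply: vgeD; rewrite -[_ + 1]add0r; apply: vgeM.
  by rewrite vgeE //; clear; lia.
have prod_lin z : map_poly (cm_fun h) (@form Y n al be ga (cm_pt h z) a) = c *: \prod_l lin l z.
  set y := cm_pt h z; pose g := cm_fun h (ga y).
  have g0 : g != 0 by rewrite fmorph_eq0.
  pose lx := linp (cm_fun h (al y)) (cm_fun h (be y)).
  pose linO (q : option (ff Z)) : {poly ff Z} := if q is Some zeta then lx - (zeta * g)%:P else g%:P.
  have linE l : lin l z = linO (o l).
    have [[_ _ Ne1 _] _] := he y.
    have B1E : app (map_mat (cm_fun h) B') (f1 z) tt = cm_fun h (al y) by rewrite -map_app ffunE.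
    have B2E : app (map_mat (cm_fun h) B') (f2 z) tt = cm_fun h (be y) by rewrite -map_app ffunE.
    have N1E : app (map_mat (cm_fun h) N) (f1 z) tt = 0 by rewrite -map_app Ne1 map_vec0 ffunE.
    have N2E : app (map_mat (cm_fun h) N) (f2 z) tt = g by rewrite -map_app ffunE.
    rewrite /lin; case: (o l) => [zeta|]; last by rewrite N1E N2E /linp scale0r add0r.
    have E v : app (map_mat (cm_fun h) B' - zeta *: map_mat (cm_fun h) N) v tt =
        app (map_mat (cm_fun h) B') v tt - zeta * app (map_mat (cm_fun h) N) v tt.
      by rewrite appDm appNm appZm ffunE; rewrite ffunE; rewrite ffunE.
    by rewrite !E B1E B2E N1E N2E mulr0 subr0 /linp polyCB addrA.
  transitivity (c *: (\prod_(zeta <- zs) (lx - (zeta * g)%:P) * g%:P ^+ (n - size zs))); last first.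
    congr (_ *: _); rewrite (eq_bigr (fun l : 'I_n => linO (nth None os l))) => [|l _]; last exact: linE.
    rewrite -(big_mkord xpredT (fun i => linO (nth None os i))) -{2}sos -(big_nth None xpredT linO).
    rewrite big_cat big_map big_nseq iter_mulr_1 //.
  rewrite -(homogenize lx c g0 szs) -e rmorph_sum; apply: eq_bigr => j _.
  change (map_poly (cm_fun h) (a j *: (ga y ^+ (n - j) *: linp (al y) (be y) ^+ j)) =
    (map_poly (cm_fun h) p)`_j *: (g ^+ (n - j) *: lx ^+ j)).
  rewrite !map_polyZ rmorphXn coef_map pE rmorphXn rmorphD /= map_polyZ map_polyX map_polyC.
  by [].
(* By Gauss' lemma the local degrees of the quotient lines add up, apart from [c], to the Gauss
   valuation of the form, which its allowed poles bound from below. *)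
have key z : ram h z * - mf (cm_pt h z) <= vord z c + \sum_l ldeg (Ql l) z.
  apply: (@pexact_le Z z _ _ (c *: \prod_l lin l z)).
    rewrite -mul_polyC; apply: pexactM; first exact: pexactC.
    exact: pexact_prod.
  move=> i; rewrite -prod_lin coef_map; have := ha (cm_pt h z) i.
  move: (_`_i) => b hb; change (vge z (ram h z * - mf (cm_pt h z)) (cm_fun h (b : ff Y))).
  have [b0|b0] := eqVneq (b : ff Y) 0; first by rewrite b0 (rmorph0 (cm_fun h)) vge0.
  rewrite vgeE ?fmorph_eq0 // vord_pull ler_pM2l ?ram_gt0 //.
  by move: hb; rewrite vgeE.
have [_ hdeg _] := gh.
have [fr tr] := htot _ (fin_suppN fm); rewrite totN tm in tr.
have [fs ts] := @tot_sum _ 'I_n (index_enum _) (fun l => ldeg (Ql l)) (fun l => fin_supp_ldeg (Ql l)).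
have tl := tot_le fr (fin_suppD (fin_supp_vord c) fs) key.
rewrite tr totD ?tot_vord ?add0r // in tl; last exact: fin_supp_vord.
rewrite ts in tl.
have dl l : M%:Z * d = degree (Kl l) - tot (ldeg (Ql l)).
  by rewrite -hdeg (@degree_ses Z W _ _ _ _ _ _ (hs1 l)).
have tl' : M%:Z * (n2%:Z * d - C.+1%:Z) <= \sum_l degree (Kl l).
  have -> : \sum_l degree (Kl l) = \sum_l (M%:Z * d + tot (ldeg (Ql l))).
    by apply: eq_bigr => l _; rewrite (dl l) subrK.
  rewrite big_split sumr_const card_ord -lerBlDl; apply: le_trans tl.
  by rewrite /n -muln2 /m0 le_eqVlt; apply/orP; left; apply/eqP; ring.
(* One of the [n] kernels has at least the average degree. *)
have [l hl] : exists l, M%:Z * (n2%:Z * d - C.+1%:Z) <= n%:Z * degree (Kl l).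
  apply: contrapT => hn; have {}hn l : n%:Z * degree (Kl l) <= M%:Z * (n2%:Z * d - C.+1%:Z) - 1.
    by rewrite lerBrDr lezD1 ltNge; apply/negP => h0; apply: hn; exists l.
  have : \sum_l n%:Z * degree (Kl l) <= \sum_(l < n) (M%:Z * (n2%:Z * d - C.+1%:Z) - 1).
    by apply: ler_sum => l _.
  rewrite -mulr_sumr sumr_const card_ord -[_ *+ n]mulr_natl natz ler_pM2l; last first.
    by rewrite ltz_nat double_gt0.
  by move=> /(le_trans tl'); rewrite lerDl.
exists (Kl l), (B1 l); split=> //; last by rewrite -[rank _]/#|{: unit}| card_unit.
by have [] := @bsub_sub_of Z W _ _ _ _ _ _ (hs1 l).
Qed.

End CharZeroCovers.

(** * Lines in tensor products *)

Section TensorLines.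
Variables (Y : curve k).
Local Notation L := (ff Y).
Implicit Types (A B V W S : bundle Y) (y : place Y).

Lemma card_range (I1 I2 J : finType) (M1 : mat L I1 J) (M2 : mat L I2 J) :
  injective (app M1) -> injective (app M2) ->
  (forall v, (exists c, v = app M1 c) <-> (exists c, v = app M2 c)) -> #|I1| = #|I2|.
Proof.
have key (K1 K2 : finType) (P1 : mat L K1 J) (P2 : mat L K2 J) : injective (app P1) -> injective (app P2) ->
    (forall v, (exists c, v = app P1 c) -> (exists c, v = app P2 c)) -> (#|K1| <= #|K2|)%N.
  move=> /inj_retract[Q1 h1] /inj_retract[Q2 h2] h.
  apply: (@card_compm _ _ _ (compm Q1 P2) (compm Q2 P1)).
  apply: matP => v; have [c hc] := h _ (ex_intro _ v erefl).
  rewrite appM (appM Q1) (appM Q2) hc -(appM Q2) h2 app_id -hc.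
  by rewrite -(appM Q1) h1.
by move=> i1 i2 e; apply/eqP; rewrite eqn_leq !(key _ _ _ _ i1 i2) ?(key _ _ _ _ i2 i1) // => v /e.
Qed.

Lemma sdeg_twist B (m : place Y -> int) (fm : fin_supp m) (U : set (vec L (idx B))) : lsub U ->
  sdeg (V := twist B fm) U = sdeg (V := B) U + tot m * (srk (V := B) U)%:Z.
Proof.
move=> /sub_of_ex[S [P hS]]; have [[hP iP rP] hU] := hS.
have hT : @sub_of Y (twist B fm) U (twist S fm) P.
  split=> //; split=> //.
    by move=> y v /stalk_twist h; apply/stalk_twist => c /h/hP; rewrite appZ.
  by move=> y v /stalk_twist h; apply/stalk_twist => c /h; rewrite -appZ; exact: rP.
by rewrite (sdegE hT).1 (sdegE hS).1 (sdegE hS).2 degree_twist.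
Qed.

(** A line [S] gives a nonzero homomorphism from the dual of [A] to the twist of [B] by the inverse
    of [S]. Its image has degree at least 0 because the dual of [A] is semistable, whereas for deg S
    > 0 all nonzero subbundles of the twist have negative degree. *)
Lemma tens_line A B S M : ss0 A -> ss0 B -> @is_subbundle k Y S (tens A B) M -> rank S = 1%N ->
  degree S <= 0.
Proof.
move=> sA sB hM r1; apply/negP => dS; have [hh iM rM] := hM.
have /card_gt0P[i0 _] : (0 < #|idx S|)%N by rewrite -/(rank S) r1.
have all0 i : i = i0 by apply: (fintype_le1P (leq_trans (eq_leq r1) (leqnn 1))).
pose s := app M (bvec L i0); pose m := ldeg S; have fm : fin_supp m := fin_supp_ldeg S.
pose f := ctr s; pose T := twist B fm.
have hf : @is_hom k Y (bdual A) T f.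
  move=> y v hv; apply/stalk_twist => c hc.
  have -> : c *: app f v = app (ctr (c *: s)) v by rewrite -[c *: s]addr0 ctr_lin ctr0 addr0.
  apply: ctr_stalk hv; rewrite -appZ; apply: hh.
  have [g fg [g' gg']] := frames_inv S y.
  apply/(framesP _ fg gg') => i.
  have [d0 d1] := minv_det gg'.
  have e1 : fdet g = g i0 i0.
    have bj : bijective (fun _ : 'I_1 => i0) by exists (fun=> ord0) => j; [rewrite (ord1 j)|rewrite (all0 j)].
    by rewrite (frame_det_enum g bj) det_mx11 mxE.
  have vg : app g' (c *: bvec L i0) i = c / g i0 i0.
    have gi : g i0 i0 != 0 by rewrite -e1.
    have -> : c *: bvec L i0 = app g ((c / g i0 i0) *: bvec L i0).
      apply/ffunP => j; rewrite (all0 j) appZ app_bvec !ffunE eqxx.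
      by change (c * 1 = c / g i0 i0 * g i0 i0); rewrite mulr1 divfK.
    by rewrite (minv_l _ gg') (all0 i) !ffunE eqxx; exact: mulr1.
  rewrite vg in_ringE -(subrr (m y)); apply: vgeM => //.
  by rewrite vgeE ?invr_eq0 -e1 // vordV /m (ldegE fg).
have [le _] := sdeg_hom hf (@lsubT _ _); rewrite setTI (sdegT (bdual A)).1 in le.
have [dA hA] := ss0_bdual sA.
have lI := lsub_im f (@lsubT _ _); set U := [set w | exists2 v, _ & _] in le lI.
rewrite (sdeg_twist fm lI) in le.
have tm : tot m = - degree S by rewrite opprK.
have := sB.2 _ lI; have := hA _ (lsub_ker f) => h1 h2.
have rk0 : srk (V := B) U = 0%N.
  move: le h1 h2.
  move: sdeg (sdeg _) => a b le h1 h2.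
  by move: le h1 h2; lia.
have U0 := @srk_eq Y B _ _ (@lsub0 _ _) lI (_ : [set 0] `<=` U).
have {}U0 : U `<=` [set 0].
  by apply: U0 => [_ ->|]; [case: lI|rewrite rk0].
have s0 : s = 0.
  apply/ffunP => -[i j]; rewrite -ctrE.
  by rewrite (U0 (app f (bvec L i))) ?ffunE //; exists (bvec L i).
have := iM (bvec L i0) 0; rewrite app0 => /(_ s0)/ffunP/(_ i0)/eqP.
by rewrite !ffunE eqxx oner_eq0.
Qed.

Definition cols (I1 I2 J : finType) (M1 : mat L I1 J) (M2 : mat L I2 J) : mat L (I1 + I2)%type J :=
  [ffun p => match p with inl i => M1 i | inr i => M2 i end].
Lemma app_cols (I1 I2 J : finType) (M1 : mat L I1 J) (M2 : mat L I2 J) c :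
  app (cols M1 M2) c = app M1 (lpart c) + app M2 (rpart c).
Proof.
rewrite /app big_sumType; congr (_ + _); apply: eq_bigr => i _; by rewrite !ffunE.
Qed.
Definition join (I1 I2 : finType) (v : vec L I1) (w : vec L I2) : vec L (I1 + I2)%type :=
  [ffun p => match p with inl i => v i | inr i => w i end].
Lemma lpart_join (I1 I2 : finType) (v : vec L I1) (w : vec L I2) : lpart (join v w) = v.
Proof. by apply/ffunP => i; rewrite !ffunE. Qed.
Lemma rpart_join (I1 I2 : finType) (v : vec L I1) (w : vec L I2) : rpart (join v w) = w.
Proof. by apply/ffunP => i; rewrite !ffunE. Qed.
Lemma rank2_splitting V : rank V = 2%N -> exists (B : mat L unit (idx V)) (B' : mat L (idx V) unit)
  (N : mat L (idx V) unit) (s : mat L unit (idx V)), splitting B B' N s.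
Proof.
move=> r2; have : size (enum (idx V)) = 2%N by rewrite -cardE.
have := mem_enum (idx V); have := enum_uniq (idx V).
case: (enum _) => [|i0 [|i1 []]] //= /andP[ne _] hI _.
have i01 : (i0 == i1) = false by move: ne; rewrite inE => /negbTE.
have all2 i : i != i0 -> i = i1.
  by move=> ii; have := hI i; rewrite !inE (negbTE ii) => /eqP.
exists [ffun=> bvec L i0], (pullm L (fun=> i0)), (pullm L (fun=> i1)), [ffun=> bvec L i1].
have uE (w : vec L unit) i : app ([ffun=> bvec L i] : mat L unit (idx V)) w = w tt *: bvec L i.
  by rewrite /app (bigD1 tt) //= big1 ?addr0 ?ffunE // => -[].
have a1 (a : L) : a *: (1 : L^o) = a by exact: mulr1.
apply: splittingP => c; rewrite ?uE ?app_pull; apply/ffunP => i; rewrite !ffunE.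
- by rewrite eqxx; case: i.
- by rewrite eqxx; case: i.
- by rewrite i01 scaler0.
- by rewrite eq_sym i01 scaler0.
- have [->|ii] := eqVneq i i0; first by rewrite eq_sym i01 scaler0 addr0.
  by rewrite (all2 i ii) eqxx scaler0 add0r.
Qed.

End TensorLines.

(** * Slopes reached by lines after a cover *)

Section AchievableSlopes.
Hypothesis ch0 : [pchar k] =i pred0.

(** Degrees on a cover of degree [M] count with the factor 1/M, so that the values [x] can be
    compared on different covers. *)
Definition ach (Y : curve k) (W : bundle Y) (x : rat) : Prop :=
  exists (Z : curve k) (h : curve_mor Z Y) (M : nat) (K : bundle Z) P,
    [/\ good h M, @is_subbundle k Z K (pull h W) P, rank K = 1%N & M%:R * x <= (degree K)%:~R].

Lemma ach_le (Y : curve k) (W : bundle Y) x x' : x' <= x -> ach W x -> ach W x'.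
Proof.
move=> le [Z [h [M [K [P [g1 g2 g3 g4]]]]]]; exists Z, h, M, K, P; split=> //.
by apply: le_trans g4; apply: ler_wpM2l.
Qed.

Lemma ach_refl (Y : curve k) (W K : bundle Y) P x : @is_subbundle k Y K W P -> rank K = 1%N ->
  x <= (degree K)%:~R -> ach W x.
Proof.
move=> hP r1 le; exists Y, (id_mor Y), 1%N, K, P; split=> //; last by rewrite mul1r.
  exact: good_id.
have [h1 h2 h3] : @is_iso k Y (pull (id_mor Y) W) W (mat1 _) (mat1 _) by exact: pull_id_iso.
by rewrite -[P](comp1m P); apply: (sub_iso (V := W)) hP; split; [exact: h2|exact: h1|exact: minv_sym].
Qed.

Lemma ach_pull (Z Y : curve k) (h : curve_mor Z Y) M (W : bundle Y) x :
  good h M -> ach (pull h W) (M%:R * x) -> ach W x.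
Proof.
move=> gh [Z' [h' [M' [K [P [g1 g2 g3 g4]]]]]].
exists Z', (comp_mor h' h), (M' * M)%N, K, P; split=> //.
- exact: good_comp.
- have [i1 i2 i3] := pull_comp_iso h' h W; rewrite -[P](comp1m P).
  by apply: (sub_iso (V := pull h' (pull h W))) g2; split; [exact: i2|exact: i1|exact: minv_sym].
- by rewrite natrM -mulrA.
Qed.

Lemma ach_sub (Y : curve k) (W S : bundle Y) Q x : @is_subbundle k Y S W Q -> ach S x -> ach W x.
Proof.
move=> hQ [Z [h [M [K [P [g1 [p1 p2 p3] g3 g4]]]]]].
exists Z, h, M, K, (compm (map_mat (cm_fun h) Q) P); split=> //.
have [q1 q2 q3] := pull_sub h hQ; split; first exact: (is_hom_comp (W := pull h S) q1 p1).
  by move=> v w; rewrite !appM => /q2/p2.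
by move=> y v; rewrite appM => /q3/p3.
Qed.

Lemma ach_rank2 (Y : curve k) (V : bundle Y) x : rank V = 2%N -> x < (degree V)%:~R / 2%:R -> ach V x.
Proof.
move=> /rank2_splitting[B [B' [N [s sp]]]] lt.
have [C hC] := siegel2 ch0 sp; set d : rat := (degree V)%:~R in lt.
pose e := d / 2%:R - x; have e0 : 0 < e by rewrite subr_gt0.
(* With this [n2] the error term [C + 1] of [siegel2] is at most [n2 * e]. *)
pose n2 := (Num.bound (C.+1%:R / e)).+1.
have n2e : C.+1%:R <= n2%:R * e.
  rewrite -ler_pdivrMr //; apply: ltW; apply: lt_le_trans (archi_boundP _) _.
    by rewrite divr_ge0 // ltW.
  by rewrite ler_nat.
have [Z [h [M [K [P [g1 g2 g3 g4]]]]]] := hC n2 isT.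
exists Z, h, M, K, P; split=> //.
have n20 : 0 < (n2.*2)%:R :> rat by rewrite ltr0n.
rewrite -(ler_pM2l n20); move: g4; rewrite -(ler_int rat) !rmorphM => g4.
apply: le_trans g4; rewrite mulrCA ler_wpM2l //.
rewrite -muln2.
have := mulr_ge0 (ler0n rat n2) (ltW e0); move: n2e; rewrite /e; lra.
Qed.

(* After a cover, a line K of V gives a line of V/K by induction, hence a    *)
(* rank 2 subbundle of V, and in turn a line about half its degree.          *)
Lemma ach_step (Y : curve k) (V K : bundle Y) P x w : rank V = w.+2 ->
  (forall (Z : curve k) (Q : bundle Z) x, rank Q = w.+1 -> x < (degree Q)%:~R / w.+1%:R -> ach Q x) ->
  @is_subbundle k Y K V P -> rank K = 1%N ->
  x < ((degree K)%:~R + ((degree V)%:~R - (degree K)%:~R) / w.+1%:R) / 2%:R -> ach V x.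
Proof.
move=> rV IH hP rK lt; set ka : rat := (degree K)%:~R in lt; set d : rat := (degree V)%:~R in lt.
have hK := sub_of_range hP.
have [J [J2 [B [B' [N [s [sp hN]]]]]]] := lsub_split (sub_of_lsub hK).
have hB := bsub_sub_of sp; have dB : degree (bsub sp) = degree K /\ #|J| = 1%N.
  have e : [set v | app N v = 0] = [set w | exists v, w = app P v].
    by apply/seteqP; split=> v /hN.
  rewrite e in hB; have [d1 r1] := sdegE hB; have [d2 r2] := sdegE hK.
  by split; [rewrite -d1|rewrite -[LHS]/(rank (bsub sp)) -r1 r2].
have cJ2 : #|J2| = w.+1.
  have := @card_range Y _ _ _ (cols B s) (mat1 (idx V)).
  rewrite card_sum dB.2 -/(rank V) rV => h; apply/eq_add_S/h => [v v'|v v'|v]; rewrite ?app_id //.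
    rewrite !app_cols => e; apply: partP.
      by rewrite -[LHS](sp_BK sp) -[RHS](sp_BK sp) -[LHS]addr0 -[RHS]addr0 -{1}(sp_Bs sp (rpart v)) -(sp_Bs sp (rpart v')) -!appD e.
    by rewrite -[LHS](sp_sK sp) -[RHS](sp_sK sp) -[LHS]add0r -[RHS]add0r -{1}(sp_NB sp (lpart v)) -(sp_NB sp (lpart v')) -!appD e.
  split=> _; first by exists v; rewrite app_id.
  by exists (join (app B' v) (app N v)); rewrite app_cols lpart_join rpart_join (sp_dec sp).
pose Q := bquot sp; have dQ : (degree Q)%:~R = d - ka :> rat.
  by rewrite /d (degree_ses sp) dB.1 rmorphD addrC addKr.
(* The midpoint between [2 x - ka], which the degree of the line in the quotient must exceed, and
   the slope of [Q], below which it can be reached by induction. *)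
pose x' : rat := (2%:R * x - ka + (d - ka) / w.+1%:R) / 2%:R.
have [||Z [h [M [K1 [P1 [gh hP1 r1 le1]]]]]] := IH Y Q x'; first exact: cJ2.
  by rewrite dQ /x'; move: lt; move: ((d - ka) / _) => q; lra.
apply: (ach_pull gh); set W := pull h V; set N' := map_mat (cm_fun h) N.
have hN' : @is_hom k Z W (pull h Q) N' by apply: pull_hom => y v hv; exists v.
have hR := sub_of_range hP1; set T := [set _ | _] in hR.
have lT := sub_of_lsub hR; have lU := lsub_preim N' lT.
have sp' := splitting_map h sp.
have [||cmp _] := @sdeg_compare Z W (pull h Q) N' [set v | T (app N' v)] setT T setT hN'
  lU (@lsubT _ _) lT (@lsubT _ _) (@subsetT _ _) (@subsetT _ _) (fun v h => h) (fun v h => h).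
- by [].
- move=> u _; exists (app (map_mat (cm_fun h) s) u) => //.
  by rewrite (sp_sK sp') subrr; case: lT.
have [S [R hS]] := @sub_of_ex Z W _ lU; have [sR SU] := hS.
have rS : rank S = 2%N.
  have [_ iP1 _] := hP1; have [_ iR _] := sR.
  have := @card_range Z _ _ _ R (cols (map_mat (cm_fun h) B) (compm (map_mat (cm_fun h) s) P1)).
  rewrite card_sum dB.2 -/(rank K1) r1; apply=> // [v v'|v].
    rewrite !app_cols => e; apply: partP.
      have := congr1 (app (map_mat (cm_fun h) B')) e.
      by rewrite !appD !(sp_BK sp') !appM !(sp_Bs sp') !addr0.
    apply: iP1; have := congr1 (app N') e.
    by rewrite !appD !(sp_NB sp') !add0r !appM !(sp_sK sp').
  rewrite -(SU v); split=> [[c hc]|[c ->]].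
    exists (join (app (map_mat (cm_fun h) B') v) c); rewrite app_cols lpart_join rpart_join.
    by rewrite appM -hc (sp_dec sp').
  exists (rpart c); rewrite app_cols appD (sp_NB sp') add0r appM (sp_sK sp') //.
apply: (ach_sub sR); apply: ach_rank2 => //.
have [M0 dM _] := gh; rewrite (sdegT W).1 (sdegT (pull h Q)).1 (sdegE hS).1 (sdegE hR).1 !dM in cmp.
have Mr : 0 < M%:R :> rat by rewrite ltr0n.
have c2 : M%:R * d - (degree S)%:~R <= M%:R * (d - ka) - (degree K1)%:~R :> rat.
  by move: cmp; rewrite -(ler_int rat) !rmorphB !rmorphM /= dQ.
have : M%:R * (2%:R * x) < M%:R * (ka + x').
  by rewrite ltr_pM2l /x'; move: lt; move: ((d - ka) / _) => q; lra.
move: c2 le1; lra.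
Qed.

(** The products (3/4)^n (n + 3) do not increase, because 3 (n + 4) <= 4 (n + 3). *)
Lemma geometric_small (g e : rat) : 0 < e -> exists n : nat, g * (3%:R / 4%:R) ^+ n <= e.
Proof.
move=> e0; have key (r : rat) n : 0 <= r -> 4%:R * r <= 3%:R -> r ^+ n * n.+3%:R <= 3%:R.
  move=> r0 r4; elim: n => [|n IH]; first by rewrite mul1r.
  apply: le_trans IH; rewrite exprSr -mulrA; apply: ler_wpM2l; first exact: exprn_ge0.
  have := ler_wpM2r (ler0n rat n.+4) r4.
  by rewrite -[n.+4]addn4 -[n.+3]addn3 !natrD; have := ler0n rat n; move: (n%:R : rat) => m; lra.
have r0 : 0 <= 3%:R / 4%:R :> rat by rewrite divr_ge0 ?ler0n.
have r4 : 4%:R * (3%:R / 4%:R) <= 3%:R :> rat by rewrite mulrCA divff ?mulr1 // pnatr_eq0.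
have [q [t [t0 kq <-]]] : exists q t : rat,
    [/\ 0 <= t, forall n, q ^+ n * n.+3%:R <= t & q = 3%:R / 4%:R].
  exists (3%:R / 4%:R), 3%:R; split; [exact: ler0n|by move=> n; exact: key|reflexivity].
have [g0|g0] := leP g 0.
  by exists 0%N; rewrite expr0 mulr1; apply: le_trans g0 (ltW e0).
have tg : 0 <= t * g / e by apply: divr_ge0 (ltW e0); apply: mulr_ge0 (ltW g0).
exists (Num.bound (t * g / e)); have nb := archi_boundP tg; move: (Num.bound _) nb => n nb.
have n3 : 0 < n.+3%:R :> rat by rewrite ltr0n.
rewrite -(ler_pM2r n3) -mulrA; apply: le_trans (ler_wpM2l (ltW g0) (kq n)) _.
rewrite mulrC; move: nb; rewrite ltr_pdivrMr // => /ltW/le_trans; apply.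
by rewrite mulrC; apply: ler_wpM2l; [exact: ltW|rewrite ler_nat -addn3 leq_addr].
Qed.

(** As a function of the degree of K, the bound of [ach_step] has the slope of [V] as fixed point
    and at most halves the distance to it. Iteration from an arbitrary line approaches the slope
    geometrically; the ratio 3/4 leaves room for the strict inequality. Lines in the quotients come
    from induction on the rank. *)
Lemma ach_slope w (Y : curve k) (V : bundle Y) x : rank V = w.+1 ->
  x < (degree V)%:~R / w.+1%:R -> ach V x.
Proof.
elim: w Y V x => [|w IH] Y V x rV lt.
  apply: (@ach_refl Y V V (mat1 _)) => //; last by move: lt; rewrite divr1 => /ltW.
  by split=> [y v|v v'|y v]; rewrite ?app_id.
have [w0|w0] := posnP w; first by rewrite w0 in rV lt *; exact: ach_rank2.
have /card_gt0P[i0 _] : (0 < #|idx V|)%N by rewrite -/(rank V) rV.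
set d : rat := (degree V)%:~R in lt; pose mu := d / w.+2%:R.
have [K [P hK]] := sub_of_ex (lsub_range ([ffun=> bvec (ff Y) i0] : mat (ff Y) unit (idx V))).
have rK : rank K = 1%N.
  rewrite -[RHS]card_unit; apply: (@card_range Y _ _ _ P [ffun=> bvec (ff Y) i0]).
  - by case: hK => -[].
  - move=> v v'; have uE (u : vec (ff Y) unit) :
        app ([ffun=> bvec (ff Y) i0] : mat (ff Y) unit (idx V)) u = u tt *: bvec (ff Y) i0.
      by rewrite /app (bigD1 tt) //= big1 ?addr0 ?ffunE // => -[].
    rewrite !uE => /ffunP/(_ i0); rewrite !ffunE eqxx => e; apply/ffunP => -[].
    by rewrite -[LHS]mulr1 -[RHS]mulr1; exact: e.
  - by move=> v; rewrite -(proj2 hK v).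
pose g := `|mu - (degree K)%:~R| + 1.
have g0 : 0 < g by rewrite ltr_wpDl ?normr_ge0.
have key n : ach V (mu - g * (3%:R / 4%:R) ^+ n).
  elim: n => [|n [Z [h [M [K' [P' [gh hP' rK' le]]]]]]].
    apply: (ach_refl (proj1 hK) rK); rewrite expr0 mulr1 /g.
    by have := ler_norm (mu - (degree K)%:~R); lra.
  apply: (ach_pull gh); apply: (@ach_step Z (pull h V) K' P' _ w) => //.
  have [M0 dM _] := gh; rewrite dM rmorphM /= -/d -[(_%:Z)%:~R]/(M%:R).
  have Mr : 0 < M%:R :> rat by rewrite ltr0n.
  have r0 : 0 < 3%:R / 4%:R :> rat by rewrite divr_gt0 ?ltr0n.
  have gn : 0 < g * (3%:R / 4%:R) ^+ n by apply: mulr_gt0 => //; exact: exprn_gt0.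
  rewrite exprS mulrCA; move: gn le; move: (g * _) => y y0 le.
  have dmu : d = mu * (w.+1%:R + 1) by rewrite /mu natr1 divfK // pnatr_eq0.
  have q1 : 1 <= w.+1%:R :> rat by rewrite ler1n.
  have q0 : 0 < w.+1%:R :> rat by rewrite ltr0n.
  move: (w.+1%:R) q1 q0 dmu => q q1 q0 ->; move: le; move: ((degree K')%:~R) => ka le.
  rewrite ltr_pdivlMr // -(ltr_pM2r q0) [(ka + _) * q]mulrDl divfK ?gt_eqF //.
  have h1 : M%:R * (mu - y) * (q - 1) <= ka * (q - 1) by rewrite ler_wpM2r // subr_ge0.
  have h2 : 0 < M%:R * y * q by rewrite !mulr_gt0.
  have h3 : 0 < M%:R * y by rewrite mulr_gt0.
  by move: h2 h3; lra.
have [|n hn] := @geometric_small g (mu - x); first by rewrite subr_gt0.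
by apply: ach_le (key n); lra.
Qed.

(** A subbundle of positive degree would contain, after a cover, a line of positive degree, against
    [tens_line]. *)
Lemma tens_le_char0 (Y : curve k) (E F W : bundle Y) M : ss0 E -> ss0 F ->
  @is_subbundle k Y W (tens E F) M -> degree W <= 0.
Proof.
move=> sE sF hM; rewrite leNgt; apply/negP => d0.
have [w rW] : exists w, rank W = w.+1.
  case rW : (rank W) => [|w]; last by exists w.
  by move: d0; rewrite degree_rank0.
have s0 : 0 < (degree W)%:~R / w.+1%:R :> rat by rewrite divr_gt0 ?ltr0z.
have [|Z [h [N [K [P [gh hP rK le]]]]]] := @ach_slope w Y W ((degree W)%:~R / w.+1%:R / 2%:R) rW.
  by move: s0; move: (_ / w.+1%:R) => s; lra.
have [N0 _ sg] := gh.
have dK : 0 < degree K.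
  rewrite -(ltr_int rat); apply: lt_le_trans le; rewrite mulr_gt0 ?ltr0n //.
  by move: s0; move: (_ / w.+1%:R) => s; lra.
have [hP1 hP2 hP3] := hP; have [hM1 hM2 hM3] := pull_sub h hM.
have hc : is_subbundle (compm (map_mat (cm_fun h) M) P : mat _ (idx K) (idx (pull h (tens E F)))).
  split; first exact: (is_hom_comp (W := pull h W) hM1 hP1).
    by move=> v v'; rewrite !appM => /hM2/hP2.
  by move=> y v; rewrite appM => /hM3/hP3.
have hc' := sub_iso (pull_tens_iso h E F) hc.
by have := tens_line (sg _ sE) (sg _ sF) hc' rK; rewrite leNgt dK.
Qed.

End AchievableSlopes.

Section Tannakian.
Variables (Y : curve k).
Local Notation L := (ff Y).

(** * Tensor products of strongly semistable bundles *)

Section StrongTensor.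
Implicit Types (E F V : bundle Y).

Lemma tens_ss0 E F : sss0 E -> sss0 F -> ss0 (tens E F).
Proof.
move=> [sE pE] [sF pF]; apply: ss0I.
  by rewrite degree_tens (proj1 sE) (proj1 sF).
have [[p pk]|ch0] := pselect (exists p, p \in [pchar k]).
  by move=> S M; exact: (tens_le_charp (pE p pk) (pF p pk)).
move=> S M; apply: tens_le_char0 => // p; apply/negP => pk; apply: ch0; by exists p.
Qed.

Lemma frobn_sss0 p (pk : p \in [pchar k]) n E : sss0 E -> sss0 (frobn pk n E).
Proof.
move=> [_ h]; split=> [|q qk m]; first exact: h.
have e : q = p by move: qk; rewrite (pcharf_eq pk) => /eqP.
rewrite e in qk *; rewrite (bool_irrelevance qk pk).
by have := h p pk (m + n)%N; rewrite /frobn iterD.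
Qed.

Lemma tens_sss0 E F : sss0 E -> sss0 F -> sss0 (tens E F).
Proof.
move=> sE sF; split=> [|p pk n]; first exact: tens_ss0.
apply: (isom_ss0 (isom_sym (frobn_tens pk n E F))); apply: tens_ss0.
  exact: frobn_sss0.
exact: frobn_sss0.
Qed.

End StrongTensor.

Variables (gT : finGroupType) (A : curve_action gT Y).

(** * Associativity, unit and symmetry constraints *)

Section TensorStructure.
Variables (S : Vect A -> Prop) (cl : tensor_closed S).
Local Notation C := (full_subcat cl).
Implicit Types (V W U : gbundle A).

Lemma ghom_eq V W (f g : ghom V W) : (forall v, app f v = app g v) -> f = g.
Proof. by move=> h; apply: val_inj; exact: matP. Qed.
(** Pure tensors span, so this reduces each coherence identity to a computation on them. *)
Lemma ghom_tens_eq V W U (f g : ghom (gtens V W) U) :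
  (forall v w, app f (vtens v w) = app g (vtens v w)) -> f = g.
Proof. by move=> h; apply: val_inj; exact: mat_tensP. Qed.
Lemma ghom_tens3_eq V W T U (f g : ghom (gtens (gtens V W) T) U) :
  (forall u v w, app f (vtens (vtens u v) w) = app g (vtens (vtens u v) w)) -> f = g.
Proof. by move=> h; apply: val_inj; exact: mat_tens3P. Qed.
Lemma ghom_tens4_eq V W T U H (f g : ghom (gtens (gtens (gtens V W) T) U) H) :
  (forall u v w t, app f (vtens (vtens (vtens u v) w) t) = app g (vtens (vtens (vtens u v) w) t)) ->
  f = g.
Proof.
move=> h; apply: val_inj; apply/ffunP => -[[[a b] c] d]; rewrite -!app_bvec.
rewrite (bvec_tens L (a, b, c, d)) (bvec_tens L (a, b, c)) (bvec_tens L (a, b)).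
exact: h.
Qed.

Lemma app_gcomp V W U (g : ghom W U) (f : ghom V W) v : app (gcomp g f) v = app g (app f v).
Proof. exact: appM. Qed.
Lemma app_gid V v : app (gid V) v = v. Proof. exact: app_id. Qed.
Lemma app_gadd V W (f g : ghom V W) v : app (f + g) v = app f v + app g v.
Proof. exact: appDm. Qed.
Lemma app_gscale V W a (f : ghom V W) v : app (a *: f) v = kcst Y a *: app f v.
Proof. exact: appZm. Qed.
Lemma app_gzero V W v : app (0 : ghom V W) v = 0. Proof. exact: app0m. Qed.
Lemma app_gtmor V V' W W' (f : ghom V V') (g : ghom W W') v w :
  app (gtmor f g) (vtens v w) = vtens (app f v) (app g w).
Proof. exact: app_tens. Qed.
Lemma app_gassoc V W U u v w : app (gassoc V W U) (vtens (vtens u v) w) = vtens u (vtens v w).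
Proof. exact: app_assoc. Qed.
Lemma app_glunit V u v : app (glunit V) (vtens u v) = u tt *: v.
Proof. by rewrite [LHS]app_pull; apply/ffunP => i; rewrite !ffunE. Qed.
Lemma app_grunit V u v : app (grunit V) (vtens v u) = u tt *: v.
Proof. by rewrite [LHS]app_pull; apply/ffunP => i; rewrite !ffunE mulrC. Qed.
Lemma app_gbraid V W v w : app (gbraid V W) (vtens v w) = vtens w v.
Proof. by rewrite [LHS]app_pull; apply/ffunP => i; rewrite !ffunE mulrC. Qed.

Definition app_gE := (app_gcomp, app_gid, app_gtmor, app_gassoc, app_glunit, app_grunit, app_gbraid).

Lemma full_linear : linear_category C.
Proof.
split=> [U V f|U V W T f g h|U V W a f f' g|U V W a f g g'].
- by split; apply: ghom_eq => v; rewrite !app_gE.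
- by apply: ghom_eq => v; rewrite !app_gE.
- by apply: ghom_eq => v; rewrite !(app_gE, app_gadd, app_gscale) appD appZ.
- by apply: ghom_eq => v; rewrite !(app_gE, app_gadd, app_gscale).
Qed.

Lemma full_bilinear : bilinear_tensor C.
Proof.
split=> [U V|U U' U'' V V' V'' f f' g g'|U U' V V' a f f' g|U U' V V' a f g g'].
- by apply: ghom_tens_eq => v w; rewrite !app_gE.
- by apply: ghom_tens_eq => v w; rewrite !app_gE.
- apply: ghom_tens_eq => v w; rewrite !(app_gE, app_gadd, app_gscale).
  by rewrite vtensDl vtensZl.
- apply: ghom_tens_eq => v w; rewrite !(app_gE, app_gadd, app_gscale).
  by rewrite vtensDr vtensZr.
Qed.

Lemma full_natural : natural_constraints C.
Proof.
split=> [U U' V V' W W' f g h|U U' f|U U' f|U U' V V' f g].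
- by apply: ghom_tens3_eq => u v w; rewrite !app_gE.
- by apply: ghom_tens_eq => v w; rewrite !app_gE appZ.
- by apply: ghom_tens_eq => v w; rewrite !app_gE appZ.
- by apply: ghom_tens_eq => v w; rewrite !app_gE.
Qed.

Lemma full_coherent : coherent_constraints C.
Proof.
split=> [U V W T|U V|U V W].
- by apply: ghom_tens4_eq => u v w t; rewrite !app_gE.
- apply: ghom_tens3_eq => u v w; rewrite !app_gE.
  by rewrite vtensZl vtensZr.
- by apply: ghom_tens3_eq => u v w; rewrite !app_gE.
Qed.

Lemma equivariant_inv V W (M : mat L (idx V) (idx W)) N : minv M N -> equivariant M -> equivariant N.
Proof.
move=> h eM g; have h' := map_minv (cm_fun (A g)) h; apply: matP => v.
rewrite !appM -[app (glam V g) _](minv_l _ h) -[in RHS](appM M) eM.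
by rewrite !appM (minv_r _ h').
Qed.

Lemma ghom_of V W (M : mat L (idx V) (idx W)) : @is_hom k Y V W M -> equivariant M ->
  exists f : ghom V W, f = M :> mat _ _ _.
Proof. by move=> h e; have hf : M \in @ghomb k Y gT A V W by [apply/asboolP]; exists (GHom hf). Qed.
Lemma ghomE V W (f : ghom V W) : @is_hom k Y V W f /\ equivariant f.
Proof. by have /asboolP := ghomP f. Qed.
Lemma ghom_inv V W (f : ghom V W) (N : mat L (idx W) (idx V)) : @is_hom k Y W V N -> minv f N ->
  exists g : ghom W V, gcomp g f = gid V /\ gcomp f g = gid W.
Proof.
move=> hN fN; have [_ ef] := ghomE f; have [g e] := ghom_of hN (equivariant_inv fN ef).
exists g; split; apply: ghom_eq => v; rewrite !app_gE e.
  exact: minv_l fN.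
exact: minv_r fN.
Qed.

Lemma full_invertible : invertible_constraints C.
Proof.
split=> [U V W|U|U|U V].
- rewrite /=.
  pose N := pullm L (fun p : idx (sval U) * idx (sval V) * idx (sval W) => (p.1.1, (p.1.2, p.2))).
  have EN u v w : app N (vtens u (vtens v w)) = vtens (vtens u v) w.
    by rewrite app_pull; apply/ffunP => p; rewrite !ffunE mulrA.
  have NT v : app N (app (gassoc (sval U) (sval V) (sval W)) v) = v.
    rewrite -appM -[RHS]app_id; congr app.
    by apply: mat_tens3P => u v' w; rewrite appM app_gE app_id.
  apply: (@ghom_inv _ _ (gassoc (sval U) (sval V) (sval W)) N); last first.
    apply: minvP => // v; rewrite -appM -[RHS]app_id; congr app.
    apply/ffunP => -[i [j l]]; rewrite -!app_bvec (bvec_tens L (i, (j, l))) (bvec_tens L (j, l)).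
    by rewrite appM EN app_gE app_id.
  move=> z v; apply: ospan_map => _ [u [vw [hu + ->]]].
  elim=> [|c _ x hc [v1 [w1 [h1 h2 ->]]] _ IH].
    by rewrite vtens0r app0; exact: ospan_nil.
  rewrite vtensDr vtensZr appD appZ; apply: ospan_add => //.
  apply: ospan_scale => //; apply: ospan_gen; exists (vtens u v1), w1.
  by split=> //; apply: ospan_gen; exists u, v1.
- rewrite /=; pose o : vec L unit := [ffun=> 1].
  pose N := [ffun i => vtens o (bvec L i)] : mat L (idx (sval U)) (unit * idx (sval U))%type.
  have EN v : app N v = vtens o v.
    by apply/ffunP => -[[] j]; rewrite -[in RHS](app_id v) appE !ffunE mul1r appE;
       apply: eq_bigr => i _; rewrite !ffunE mul1r.
  apply: (@ghom_inv _ _ (glunit (sval U)) N).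
    move=> z v hv; apply: ospan_gen; exists o, v; split=> // i.
    by rewrite ffunE; exact: in_ring1.
  apply: minvP => v; last by rewrite EN app_glunit ffunE scale1r.
  rewrite -appM -[RHS]app_id; congr app; apply: mat_tensP => u w.
  rewrite appM app_glunit EN app_id vtensZr -vtensZl; congr vtens.
  by apply/ffunP => -[]; rewrite !ffunE [_ *: _]mulr1.
- rewrite /=; pose o : vec L unit := [ffun=> 1].
  pose N := [ffun i => vtens (bvec L i) o] : mat L (idx (sval U)) (idx (sval U) * unit)%type.
  have EN v : app N v = vtens v o.
    by apply/ffunP => -[j []]; rewrite -[in RHS](app_id v) appE !ffunE mulr1 appE;
       apply: eq_bigr => i _; rewrite !ffunE mulr1.
  apply: (@ghom_inv _ _ (grunit (sval U)) N).
    move=> z v hv; apply: ospan_gen; exists v, o; split=> // i.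
    by rewrite ffunE; exact: in_ring1.
  apply: minvP => v; last by rewrite EN app_grunit ffunE scale1r.
  rewrite -appM -[RHS]app_id; congr app; apply: mat_tensP => u w.
  rewrite appM app_grunit EN app_id vtensZl -vtensZr; congr vtens.
  by apply/ffunP => -[]; rewrite !ffunE [_ *: _]mulr1.
- by split; apply: ghom_tens_eq => v w; rewrite !app_gE.
Qed.

Lemma full_symmetric : symmetric_tensor_category C.
Proof.
split; [exact: full_bilinear|exact: full_natural|exact: full_invertible|exact: full_coherent].
Qed.

End TensorStructure.

(** * Duals and endomorphisms of the unit *)

Section Rigidity.

Definition ev_mat I : mat L (I * I)%type unit := [ffun p => [ffun=> (p.1 == p.2)%:R]].
(** The tensor that corresponds to the identity, used as image of 1 under coevaluation. *)
Definition unit_tens I : vec L (I * I)%type := [ffun p => (p.1 == p.2)%:R].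
Definition coev_mat I : mat L unit (I * I)%type := [ffun=> unit_tens I].

Lemma app_ev I xi v : app (ev_mat I) (vtens xi v) = [ffun=> dotp xi v].
Proof.
apply/ffunP => -[]; rewrite appE ffunE.
rewrite (eq_bigr (fun p => (fun i j => xi i * v j * (i == j)%:R) p.1 p.2)); last first.
  by move=> p _; rewrite !ffunE.
rewrite -(pair_bigA _ (fun i j => xi i * v j * (i == j)%:R)); apply: eq_bigr => i _.
rewrite (bigD1 i) //= eqxx mulr1 big1 ?addr0 // => j ji.
by rewrite eq_sym (negbTE ji) mulr0.
Qed.

Lemma app_coev I u : app (coev_mat I) u = u tt *: unit_tens I.
Proof. by rewrite /app (bigD1 tt) //= big1 ?addr0 ?ffunE // => -[]. Qed.
(** Independence of the basis. Applied to a local frame it shows that coevaluation is regular,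
    applied to the matrices of the action that it is equivariant. *)
Lemma unit_tensE I J (e : mat L I J) e' : minv e e' -> unit_tens J = \sum_i vtens (e i) (trm e' i).
Proof.
move=> [_ h]; apply/ffunP => -[a b]; rewrite sum_ffunE.
move/ffunP: h => /(_ b)/ffunP/(_ a); rewrite !ffunE appE eq_sym => <-.
by apply: eq_bigr => i _; rewrite !ffunE mulrC.
Qed.

Lemma vtens_suml I J K (F : K -> vec L I) (w : vec L J) : vtens (\sum_i F i) w = \sum_i vtens (F i) w.
Proof. by elim/big_rec2: _ => [|i x z _ <-]; rewrite ?vtens0l // vtensDl. Qed.
Lemma vtens_sumr I J K (F : K -> vec L I) (w : vec L J) : vtens w (\sum_i F i) = \sum_i vtens w (F i).
Proof. by elim/big_rec2: _ => [|i x z _ <-]; rewrite ?vtens0r // vtensDr. Qed.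
Lemma unit_tens_bvec I : unit_tens I = \sum_i vtens (bvec L i) (bvec L i).
Proof.
rewrite (@unit_tensE I I (mat1 I) (mat1 I)); last by apply: minvP => v; rewrite !app_id.
apply: eq_bigr => i _; congr vtens; rewrite ffunE //.
by apply/ffunP => j; rewrite !ffunE eq_sym.
Qed.

Variables (S : Vect A -> Prop) (cl : tensor_closed S).
Local Notation C := (full_subcat cl).

Lemma ev_ex (V : gbundle A) : exists f : ghom (gtens (gdual V) V) (gone A), f = ev_mat (idx V) :> mat _ _ _.
Proof.
apply: ghom_of => [z u|g].
  apply: ospan_stalk_map => _ [xi [v [hx hv ->]]] i.
  by rewrite app_ev ffunE; exact: hx.
have [_ _ gg] := glamP V g.
apply: mat_tensP => xi v; rewrite !appM app_tens app_ev app_trm.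
rewrite (minv_l _ gg) app_id.
have -> : map_mat (cm_fun (A g)) (ev_mat (idx V)) = ev_mat (idx V).
  by apply/ffunP => p; apply/ffunP => q; rewrite !ffunE rmorph_nat.
by rewrite app_ev.
Qed.

Lemma coev_ex (V : gbundle A) : exists f : ghom (gone A) (gtens V (gdual V)), f = coev_mat (idx V) :> mat _ _ _.
Proof.
apply: ghom_of => [z u hu|g].
  rewrite app_coev; apply: ospan_scale; first exact: hu.
  have [e fe [e' ee']] := frames_inv V z; rewrite (unit_tensE ee').
  apply: ospan_sum => i; apply: ospan_gen; exists (e i), (trm e' i); split=> //.
    exact: frames_mem fe.
  exact: frames_mem (dual_frames fe ee').
have [_ _ gg] := glamP V g.
have -> : map_mat (cm_fun (A g)) (coev_mat (idx V)) = coev_mat (idx V).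
  by apply/ffunP => p; apply/ffunP => q; rewrite !ffunE rmorph_nat.
apply: matP => u; rewrite !appM app_id app_coev appZ; congr (_ *: _).
rewrite {2}unit_tens_bvec app_sum (unit_tensE gg); apply: eq_bigr => i _.
by rewrite [app _ _]app_tens !app_bvec.
Qed.

Lemma dotpC I (u v : vec L I) : dotp u v = dotp v u.
Proof. by apply: eq_bigr => i _; rewrite mulrC. Qed.
Lemma zigzag1 I (a : L) (v : vec L I) :
  app (pullm L (fun i : I => (i, tt))) (app (mtens (mat1 I) (ev_mat I))
    (app (pullm L (fun p : I * (I * I) => ((p.1, p.2.1), p.2.2))) (vtens (a *: unit_tens I) v))) = a *: v.
Proof.
rewrite vtensZl !appZ; congr (_ *: _); rewrite unit_tens_bvec vtens_suml !app_sum -[RHS]app_id.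
apply: eq_bigr => i _; rewrite app_assoc app_tens app_ev app_id app_pull.
by apply/ffunP => j; rewrite !ffunE dotpC dotp_bvec [_ *: _]mulrC.
Qed.

Lemma zigzag2 I (a : L) (v : vec L I) :
  app (pullm L (fun i : I => (tt, i))) (app (mtens (ev_mat I) (mat1 I))
    (app (pullm L (fun p : I * I * I => (p.1.1, (p.1.2, p.2)))) (vtens v (a *: unit_tens I)))) = a *: v.
Proof.
rewrite vtensZr !appZ; congr (_ *: _); rewrite unit_tens_bvec vtens_sumr !app_sum -[RHS]app_id.
apply: eq_bigr => i _; have -> : app (pullm L (fun p : I * I * I => (p.1.1, (p.1.2, p.2))))
  (vtens v (vtens (bvec L i) (bvec L i))) = vtens (vtens v (bvec L i)) (bvec L i).
  by rewrite app_pull; apply/ffunP => p; rewrite !ffunE mulrA.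
rewrite app_tens app_ev app_id app_pull.
by apply/ffunP => j; rewrite !ffunE dotp_bvec.
Qed.

Lemma full_rigid : rigid C.
Proof.
case=> V SV; have [ev hev] := ev_ex V; have [coev hco] := coev_ex V; exists ev, coev; split=> /=.
  apply: ghom_tens_eq => u v; rewrite !app_gE hco app_coev.
  apply: etrans (zigzag1 (u tt) v); rewrite -hev.
  by [].
move=> aV [/= aV1 _]; apply: ghom_tens_eq => xi u; rewrite !app_gE hco app_coev.
apply: etrans (zigzag2 (u tt) xi); rewrite -hev.
have -> : aV = pullm L (fun p => (p.1.1, (p.1.2, p.2))) :> mat _ _ _; last by [].
apply/ffunP => -[i [j l]]; rewrite -!app_bvec (bvec_tens L (i, (j, l))) (bvec_tens L (j, l)).
apply: etrans (congr1 (app aV) (esym (@app_gassoc (gdual V) V (gdual V) _ _ _))) _.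
apply: etrans (esym (app_gcomp _ _ _)) _; rewrite aV1 app_gid.
by rewrite app_pull; apply/ffunP => p; rewrite !ffunE mulrA.
Qed.

(** An endomorphism of the unit object is a function regular at all places, hence constant. *)
Lemma full_scalar : scalar_endomorphisms C.
Proof.
move=> f; have [hf _] := @ghomE (gone A) (gone A) f.
have hc z : vge z 0 (f tt tt).
  by rewrite -app_bvec; apply: hf => i; rewrite ffunE; case: eqP => _; [exact: in_ring1|exact: in_pow0].
have [c ec] := regular_cst hc; exists c; split=> [|d ed].
  apply: val_inj; apply/ffunP => -[]; apply/ffunP => -[].
  by rewrite !ffunE [RHS]mulr1.
apply: (fmorph_inj (kcst Y)); rewrite -ec ed !ffunE.
by rewrite [_ *: _]mulr1.
Qed.

End Rigidity.

(** * Fibres in coordinates *)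

Section FiberCoordinates.
Variables (y : place Y).
Implicit Types (V W : bundle Y).

(** The maximal ideal is generated by a uniformizer, so vanishing in the fibre is divisibility by
    it. *)
Lemma pi_fiberP V (v w : stalk_type y V) :
  (\pi_(fiber y V) v = \pi_(fiber y V) w) <-> stalk V y ((unif y)^-1 *: ((v : vec _ _) - (w : vec _ _))).
Proof.
have u0 := unif_neq0 y; have u1 := vord_unif1 y.
have E : (\pi_(fiber y V) v = \pi_(fiber y V) w) <->
  ospan y [set w | exists c u, [/\ in_pow y 1 c, stalk V y u & w = c *: u]] ((v : vec _ _) - (w : vec _ _)).
  by split=> [/eqP|h]; [rewrite -Quotient.idealrBE => /asboolP|apply/eqP; rewrite -Quotient.idealrBE; apply/asboolP].
apply: (iff_trans E); split=> [|h].
  elim=> [|c _ x hc [d [u [hd hu ->]]] _ IH]; first by rewrite scaler0; exact: stalk_nil.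
  rewrite scalerDr !scalerA; apply: (stalk_omod V y).2 => //.
  rewrite mulrC -[0]/(0 + 1 - 1 : int); apply: vgeM; first exact: vgeM.
  by rewrite vgeE ?invr_eq0 // vordV ?u1.
apply: ospan_gen; exists (unif y), ((unif y)^-1 *: ((v : vec _ _) - (w : vec _ _))).
by split=> //; [rewrite /in_pow u1 orbT|rewrite scalerA divff // scale1r].
Qed.

Lemma fiber_ind V (P : fiber y V -> Prop) : (forall v, P (\pi_(fiber y V) v)) -> forall a, P a.
Proof. by move=> h a; rewrite -[a]reprK. Qed.
Lemma stalkE V (v : stalk_type y V) : stalk V y v.
Proof. by have /asboolP := stalkP v. Qed.
Lemma pi_repr V (v : stalk_type y V) :
  stalk V y ((unif y)^-1 *: ((repr (\pi_(fiber y V) v) : vec _ _) - (v : vec _ _))).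
Proof. by apply/pi_fiberP; rewrite reprK. Qed.
Lemma pi_fiber_map V W M (hM : @is_hom k Y V W M) v :
  fiber_map hM (\pi_(fiber y V) v) = \pi_(fiber y W) (Stalk (fiber_mapP hM v)).
Proof.
apply/pi_fiberP; rewrite -scaleN1r -appZ -appD -appZ; apply: hM; rewrite scaleN1r.
exact: pi_repr.
Qed.

Lemma pi_fiber_tens V W v w : fiber_tens (\pi_(fiber y V) v) (\pi_(fiber y W) w) =
  \pi_(fiber y (tens V W)) (Stalk (fiber_tensP v w)).
Proof.
apply/pi_fiberP => /=; set v' := repr _; set w' := repr _.
have -> : vtens v' w' - vtens v w = vtens ((v' : vec _ _) - (v : vec _ _)) w' + vtens v ((w' : vec _ _) - (w : vec _ _)).
  by apply/ffunP => p; rewrite !ffunE; ring.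
rewrite scalerDr -vtensZl -vtensZr; apply: ospan_add; apply: ospan_gen.
  exists ((unif y)^-1 *: ((v' : vec _ _) - (v : vec _ _))), (w' : vec _ _).
  by split=> //; [exact: pi_repr|exact: stalkE].
exists (v : vec _ _), ((unif y)^-1 *: ((w' : vec _ _) - (w : vec _ _))).
by split=> //; [exact: stalkE|exact: pi_repr].
Qed.

Section Frame.
Variables (V : bundle Y) (e e' : mat L (idx V) (idx V)).
Hypotheses (fe : frames y e (stalk V y)) (ee' : minv e e').

Fact frame_stalkP i : e i \in @stalkb k Y y V.
Proof. by apply/asboolP; exact: frames_mem fe. Qed.
Definition fbase i : fiber y V := \pi_(fiber y V) (Stalk (frame_stalkP i)).
Definition fcoord (a : fiber y V) i : k := res y (app e' (repr a) i).

Lemma frame_coord (v : stalk_type y V) i : vge y 0 (app e' v i).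
Proof. by have /(framesP _ fe ee') := stalkE v; exact. Qed.
Lemma fcoord_pi v i : fcoord (\pi_(fiber y V) v) i = res y (app e' v i).
Proof.
have u0 := unif_neq0 y; have u1 := vord_unif1 y.
have /(framesP _ fe ee')/(_ i) := pi_repr v; rewrite appZ appD -[- _]scaleN1r appZ => h.
have ha := frame_coord (repr (\pi_(fiber y V) v)) i; have hb := frame_coord v i.
have hb' : vge y 0 (- app e' v i) by rewrite vgeN.
apply/eqP; rewrite -subr_eq0.
have N a : vge y 0 a -> - res y a = res y (- a).
  move=> ya; apply/eqP; rewrite eq_sym -addr_eq0 -resD ?vgeN // addNr.
  by rewrite -(rmorph0 (kcst Y)) res_cst.
rewrite N // -resD //; apply/eqP/res_eq0; first exact: vgeD.
move: h; rewrite scaleN1r !ffunE => h.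
rewrite -[X in vge y 1 X](mulVKf u0) -[1]/(1 + 0 : int); apply: vgeM => //.
by rewrite vgeE // u1.
Qed.

Lemma fcoord_lin c a b i : fcoord (c *: a + b) i = c * fcoord a i + fcoord b i.
Proof.
elim/fiber_ind: a => v; elim/fiber_ind: b => w.
rewrite [c *: _]pi_fiber_scale -raddfD !fcoord_pi appD appZ !ffunE.
have ha := frame_coord v i; have hb := frame_coord w i.
rewrite resD ?resM ?res_cst ?vge_cst //.
by rewrite -[0]/(0 + 0 : int); apply: vgeM => //; exact: vge_cst.
Qed.

Lemma fcoord_inj a b : (forall i, fcoord a i = fcoord b i) -> a = b.
Proof.
have u0 := unif_neq0 y; have u1 := vord_unif1 y.
elim/fiber_ind: a => v; elim/fiber_ind: b => w h; apply/pi_fiberP/(framesP _ fe ee') => i.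
have := h i; rewrite !fcoord_pi => hi; rewrite appZ appD -[- _]scaleN1r appZ scaleN1r !ffunE.
have h1 := resP (frame_coord v i); have h2 := resP (frame_coord w i).
rewrite in_ringE -[0]/(-1 + 1 : int); apply: vgeM; first by rewrite vgeE ?invr_eq0 // vordV ?u1.
have -> : app e' v i - app e' w i = (app e' v i - kcst Y (res y (app e' v i))) -
   (app e' w i - kcst Y (res y (app e' w i))) by rewrite hi; ring.
exact: vgeB.
Qed.

Lemma fcoord_base i j : fcoord (fbase i) j = (i == j)%:R.
Proof. by rewrite fcoord_pi /= -app_bvec (minv_l _ ee') ffunE -(rmorph_nat (kcst Y)) res_cst. Qed.
Lemma fcoord_sum I (c : I -> k) (F : I -> fiber y V) (P : seq I) i :
  fcoord (\sum_(j <- P) c j *: F j) i = \sum_(j <- P) c j * fcoord (F j) i.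
Proof.
elim: P => [|j P IH]; last by rewrite !big_cons fcoord_lin IH.
rewrite !big_nil; have := fcoord_lin (-1) 0 0 i.
by rewrite scaler0 addr0 mulN1r addNr.
Qed.

Lemma fcoordE a : a = \sum_i fcoord a i *: fbase i.
Proof.
apply: fcoord_inj => i; rewrite fcoord_sum (bigD1 i) //= fcoord_base eqxx mulr1.
by rewrite big1 ?addr0 // => j ji; rewrite fcoord_base (negbTE ji) mulr0.
Qed.

End Frame.
End FiberCoordinates.

(** * The fibre functor *)

Section FiberFunctor.
Variables (y : place Y) (S : Vect A -> Prop) (cl : tensor_closed S).
Local Notation C := (full_subcat cl).
Local Notation F := (restrict_functor cl (fiber_functor A y)).

Lemma pi_fiber_eq (V : bundle Y) (v w : stalk_type y V) : v = w :> vec _ _ ->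
  \pi_(fiber y V) v = \pi_(fiber y V) w.
Proof. by move=> e; congr (\pi_(fiber y V) _); exact: val_inj. Qed.
Lemma fiber_map_linear (V W : bundle Y) M (hM : @is_hom k Y V W M) : is_linear (@fiber_map k Y y V W M hM).
Proof.
move=> a; elim/fiber_ind=> v; elim/fiber_ind=> w.
rewrite [a *: _]pi_fiber_scale -raddfD !pi_fiber_map [a *: _]pi_fiber_scale -raddfD.
by apply: pi_fiber_eq; rewrite /= appD appZ.
Qed.

Lemma fiber_linear : linear_functor F.
Proof.
split=> [[V SV]|[V SV] [W SW] f|[V SV] [W SW] a f g|[V SV]|[U SU] [V SV] [W SW] f g] /=.
- have [e fe [e' ee']] := frames_inv V y.
  exists #|idx V|, (fun j => fbase fe (enum_val j)) => v; exists (fun j => fcoord e' v (enum_val j)).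
  rewrite [LHS](fcoordE fe ee') (reindex _ (onW_bij _ (enum_val_bij _))).
  by [].
- exact: fiber_map_linear.
- elim/fiber_ind=> v; rewrite [X in _ = X + _]pi_fiber_scale -raddfD.
  by apply: pi_fiber_eq; rewrite /= appDm appZm.
- by elim/fiber_ind=> v; rewrite pi_fiber_map; apply: pi_fiber_eq; rewrite /= app_id.
- by elim/fiber_ind=> v; rewrite !pi_fiber_map; apply: pi_fiber_eq; rewrite /= appM.
Qed.

Lemma fiber_one_basis (v : fiber y (triv Y unit)) : exists! a : k, v = a *: fiber_one y.
Proof.
have m1 : minv (mat1 unit) (mat1 unit : mat L unit unit) by apply: minvP => u; rewrite !app_id.
have fe : frames y (mat1 unit) (stalk (triv Y unit) y).
  by split=> [|c]; [exists (mat1 _)|rewrite app_id].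
have c1 a : @fcoord y (triv Y unit) (mat1 unit) (a *: fiber_one y) tt = a.
  have := fcoord_lin (V := triv Y unit) fe m1 a (fiber_one y) 0 tt; rewrite addr0 => ->.
  have -> : @fcoord y (triv Y unit) (mat1 unit) (0 : fiber y (triv Y unit)) tt = 0.
    have := fcoord_lin (V := triv Y unit) fe m1 (-1) 0 0 tt; rewrite scaler0 addr0 => ->.
    by rewrite mulN1r addNr.
  rewrite addr0 (@fcoord_pi y (triv Y unit) _ _ fe m1) app_id ffunE -[1](rmorph1 (kcst Y)) res_cst.
  by rewrite mulr1.
exists (@fcoord y (triv Y unit) (mat1 unit) v tt); split=> [|a ->]; last exact: c1.
by apply: (@fcoord_inj y (triv Y unit) _ _ fe m1) => -[].
Qed.

(** Products of basis vectors of the two fibres form a basis of the fibre of the tensor product. *)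
Lemma fiber_tensor_product (V W : bundle Y) : is_tensor_product (@fiber_tens k Y y V W).
Proof.
have [e fe [e' ee']] := frames_inv V y.
have [f ff [f' ff']] := frames_inv W y.
have ft := tens_frames fe ff; have mt := mtens_minv ee' ff'.
have bl : is_bilinear (@fiber_tens k Y y V W).
  split=> [a c|a c]; elim/fiber_ind: a => u; elim/fiber_ind=> v; elim/fiber_ind=> w;
    rewrite [c *: _]pi_fiber_scale -raddfD !pi_fiber_tens [c *: _]pi_fiber_scale -raddfD.
    by apply: pi_fiber_eq; rewrite /= vtensDl vtensZl.
  by apply: pi_fiber_eq; rewrite /= vtensDr vtensZr.
have lsum (E : lmodType k) (D : lmodType k) (u : E -> D) I (c : I -> k) (w : I -> E) :
    is_linear u -> u (\sum_i c i *: w i) = \sum_i c i *: u (w i).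
  move=> hu; elim/big_rec2: _ => [|i x z _ <-]; last by rewrite hu.
  by have := hu (-1) 0 0; rewrite scaler0 addr0 scaleN1r addNr.
have coordE a b p : @fcoord y (tens V W) (mtens e' f') (fiber_tens a b) p = fcoord e' a p.1 * fcoord f' b p.2.
  elim/fiber_ind: a => v; elim/fiber_ind: b => w.
  rewrite pi_fiber_tens (@fcoord_pi y (tens V W) _ _ ft mt) (fcoord_pi fe ee') (fcoord_pi ff ff') app_tens ffunE.
  by rewrite resM //; [exact: frame_coord fe ee' v _|exact: frame_coord ff ff' w _].
have baseE p : @fbase y (tens V W) _ ft p = fiber_tens (fbase fe p.1) (fbase ff p.2).
  rewrite pi_fiber_tens; apply: pi_fiber_eq; rewrite /=; by rewrite ffunE.
split=> // D b [b1 b2].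
pose u t := \sum_p @fcoord y (tens V W) (mtens e' f') t p *: b (fbase fe p.1) (fbase ff p.2).
have lu : is_linear u.
  move=> c v w; rewrite scaler_sumr -big_split; apply: eq_bigr => p _.
  by rewrite (@fcoord_lin y (tens V W) _ _ ft mt) scalerDl scalerA.
exists u; split=> [|u' [lu' hu']].
  split=> // v w; rewrite /u [in RHS](fcoordE fe ee' v) (lsum _ _ (b^~ w)) //.
  rewrite (eq_bigr (fun p => (fun i j => (fcoord e' v i * fcoord f' w j) *: b (fbase fe i) (fbase ff j)) p.1 p.2)); last first.
    by move=> p _; rewrite coordE.
  rewrite -(pair_bigA _ (fun i j => (fcoord e' v i * fcoord f' w j) *: b (fbase fe i) (fbase ff j))).
  apply: eq_bigr => i _; rewrite [in RHS](fcoordE ff ff' w) (lsum _ _ (b (fbase fe i))) // scaler_sumr.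
  by apply: eq_bigr => j _; rewrite scalerA.
apply: functional_extensionality_dep => t.
rewrite [in RHS](@fcoordE y (tens V W) _ _ ft mt t) lsum //; apply: eq_bigr => p _.
by rewrite baseE hu'.
Qed.

Lemma fiber_tensor : tensor_functor F.
Proof.
split; split=> /=.
- exact: fiber_one_basis.
- by move=> V W; exact: fiber_tensor_product.
- move=> U U' V V' f g; elim/fiber_ind=> v; elim/fiber_ind=> w.
  by rewrite !(pi_fiber_tens, pi_fiber_map); apply: pi_fiber_eq; rewrite /= app_tens.
- move=> U V W; elim/fiber_ind=> u; elim/fiber_ind=> v; elim/fiber_ind=> w.
  by rewrite !(pi_fiber_tens, pi_fiber_map); apply: pi_fiber_eq; rewrite /= app_assoc.
- move=> [V SV]; elim/fiber_ind=> v.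
  apply: etrans (congr1 (fiber_map _) (pi_fiber_tens _ _)) _.
  apply: etrans (pi_fiber_map _ _) _; apply: pi_fiber_eq.
  by apply: etrans (app_glunit _ _) _; rewrite ffunE scale1r.
- move=> [V SV]; elim/fiber_ind=> v.
  apply: etrans (congr1 (fiber_map _) (pi_fiber_tens _ _)) _.
  apply: etrans (pi_fiber_map _ _) _; apply: pi_fiber_eq.
  by apply: etrans (app_grunit _ _) _; rewrite ffunE scale1r.
- move=> V W; elim/fiber_ind=> v; elim/fiber_ind=> w.
  rewrite !(pi_fiber_tens, pi_fiber_map); apply: pi_fiber_eq.
  by rewrite /= app_gbraid.
Qed.

Hypothesis S0 : forall V, S V -> ss0 (gb V).

(** The difference of two homomorphisms that agree on the fibre at [y] has zero fibre there, so
    [ss0_rigid] applies. *)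
Lemma fiber_faithful : faithful_functor F.
Proof.
move=> [V SV] [W SW] f g /= h; have [hf _] := ghomE f; have [hg _] := ghomE g.
have dE v : app ((f : mat _ _ _) - (g : mat _ _ _)) v = app f v - app g v by rewrite appDm appNm.
have z := @ss0_rigid Y V W ((f : mat _ _ _) - (g : mat _ _ _)) y (S0 SV) (S0 SW) _ _.
apply: ghom_eq => v; apply/eqP; rewrite -subr_eq0 -dE z // => [z' w hw|w hw].
  by rewrite dE addrC -scaleN1r; apply: (stalk_omod W z').2; [rewrite vgeN vge1|exact: hg|exact: hf].
have sw : w \in @stalkb k Y y V by apply/asboolP.
by have := h (\pi_(fiber y V) (Stalk sw)); rewrite !pi_fiber_map => /pi_fiberP; rewrite dE.
Qed.

End FiberFunctor.

(** * Equivariant subbundles, quotients and direct sums *)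

Section EquivariantSubquotients.
Implicit Types (V W Q T : gbundle A) (g : gT).

Lemma ca_surjV I g (w : vec L I) : exists u, w = map_vec (cm_fun (A g)) u.
Proof. by exists (map_vec (cm_fun (A g^-1%g)) w); apply/ffunP => i; rewrite !ffunE ca_surj. Qed.
Lemma map_vec_inj0 I g (u : vec L I) : map_vec (cm_fun (A g)) u = 0 -> u = 0.
Proof.
move/ffunP => h; apply/ffunP => i; have := h i; rewrite !ffunE => /eqP.
by rewrite fmorph_eq0 => /eqP.
Qed.

Lemma eqv_app V W (f : ghom V W) g v :
  app f (app (glam V g) (map_vec (cm_fun (A g)) v)) = app (glam W g) (map_vec (cm_fun (A g)) (app f v)).
Proof. by have [_ ef] := ghomE f; rewrite map_app -!appM ef. Qed.
Lemma tw_ker V W (f : ghom V W) g : tw_im g (kerf f) = kerf f.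
Proof.
have [_ _ gV] := glamP V g; have [_ _ gW] := glamP W g.
apply/seteqP; split=> [_ [u hu ->]|w hw].
  by rewrite /kerf /= eqv_app hu map_vec0 app0.
have [u hu] := ca_surjV g (app (glamV V g) w).
have wE : w = app (glam V g) (map_vec (cm_fun (A g)) u) by rewrite -hu (minv_r _ gV).
exists u => //; apply: (@map_vec_inj0 _ g); rewrite -(minv_l (map_vec _ _) gW) -eqv_app -wE.
by rewrite [app f w]hw app0.
Qed.

Lemma tw_range V W (f : ghom V W) g : tw_im g (imf f) = imf f.
Proof.
have [_ _ gV] := glamP V g.
apply/seteqP; split=> [_ [_ [u _ ->] ->]|_ [v _ ->]].
  by exists (app (glam V g) (map_vec (cm_fun (A g)) u)); rewrite ?eqv_app.
have [u hu] := ca_surjV g (app (glamV V g) v).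
exists (app f u); first by exists u.
by rewrite -eqv_app -hu (minv_r _ gV).
Qed.

(** The action and its inverse preserve [U], so both descend to the quotient; [f1] and [f2] in the
    proof express this. *)
Lemma gquo_ex V (U : set (vec L (idx V))) : lsub U -> (forall g, tw_im g U = U) ->
  exists (Q : gbundle A) (N : mat L (idx V) (idx Q)),
    [/\ @is_surj k Y V Q N, equivariant N, forall v, U v <-> app N v = 0 & degree V = sdeg U + degree Q].
Proof.
move=> lU Ug; have [J [K [B [B' [N [s [sp hU]]]]]]] := lsub_split lU.
have UB c : U (app B c) by apply/hU; rewrite (sp_NB sp).
have Nhom : @is_hom k Y V (bquot sp) N by move=> y v hv; exists v.
pose sg g := cm_fun (A g).
pose lam g := compm N (compm (glam V g) (map_mat (sg g) s)).
pose lamV g := compm (map_mat (sg g) N) (compm (glamV V g) s).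
have f1 g : compm N (glam V g) = compm (lam g) (map_mat (sg g) N).
  apply: (@map_matP _ _ (sg g)) => v; rewrite !appM -!map_app -[in LHS](sp_dec sp v).
  rewrite map_vecD !appD; have /hU-> : U (app (glam V g) (map_vec (sg g) (app B (app B' v)))).
    by rewrite -(Ug g); exists (app B (app B' v)).
  by rewrite add0r.
have f2 g : compm (map_mat (sg g) N) (glamV V g) = compm (lamV g) N.
  have [_ _ gV] := glamP V g.
  apply: matP => v; rewrite !appM -[in LHS](sp_dec sp v) !appD.
  have := UB (app B' v); rewrite -{1}(Ug g) => -[u /hU hu ->].
  by rewrite (minv_l _ gV) -map_app hu map_vec0 add0r.
have lamP g : @is_iso k Y (pull (A g) (bquot sp)) (bquot sp) (lam g) (lamV g).
  have [gh gh' gV] := glamP V g; split.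
  - move=> y w; apply: ospan_stalk_map => _ [_ [v hv <-] <-].
    rewrite (map_app (sg g)) -appM -f1 appM; apply: Nhom; apply: gh.
    by apply: ospan_gen; exists v.
  - move=> y _ [v hv <-]; rewrite -appM -f2 appM; exact: (@pull_hom Y Y (A g) _ _ _ Nhom _ _ (gh' y v hv)).
  - apply: minvP => w.
      rewrite [app (lam g) _](appM N) -(appM (lamV g)) -f2 !appM (minv_l _ gV).
      by rewrite -[LHS]appM -map_compm; have [_ -> _ _ _] := sp; rewrite map_mat1 app_id.
    rewrite [app (lamV g) _](appM (map_mat (sg g) N)) -(appM (lam g)) -f1 !appM (minv_r _ gV).
    by rewrite (sp_sK sp).
have lamM g h : lam (g * h)%g = compm (lam h) (map_mat (sg h) (lam g)).
  have E M : map_mat (sg (g * h)%g) M = map_mat (sg h) (map_mat (sg g) M) :> mat L _ _.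
    by apply/ffunP => i; apply/ffunP => j; rewrite !ffunE caM.
  have canc (M M' : mat L K K) : compm M (map_mat (sg (g * h)%g) N) = compm M' (map_mat (sg (g * h)%g) N) -> M = M'.
    move=> e; rewrite -[M]compm1 -[M']compm1 -(map_mat1 (sg (g * h)%g)).
    by have [_ <- _ _ _] := sp; rewrite map_compm !compmA e.
  apply: canc; rewrite -f1 glamM E -[RHS]compmA -map_compm -f1 map_compm !compmA.
  by rewrite f1.
exists (GBundle lamP lamM), N.
  have -> : U = [set v | app N v = 0] by apply/seteqP; split=> v /hU.
  by rewrite (sdegE (bsub_sub_of sp)).1 (degree_ses sp).
Qed.

Lemma sub_lift (K V T : gbundle A) (i : ghom K V) (t : ghom T V) : @is_subbundle k Y K V i ->
  (forall v, exists c, app t v = app i c) -> exists u : ghom T K, gcomp i u = t.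
Proof.
move=> [hi ii ri] /choice[c hc]; have [i' i'i] := inj_retract ii.
have iU v : app i (app (compm i' t) v) = app t v.
  by rewrite appM hc -(appM i') i'i app_id.
move: (compm i' t) iU => m iU.
have [ht et] := ghomE t; have [u hu] : exists u : ghom T K, u = m :> mat _ _ _.
  apply: ghom_of => [y v hv|g]; first by apply: ri; rewrite iU; exact: ht.
  apply: (@map_matP _ _ (cm_fun (A g))) => v; apply: ii.
  by rewrite !appM iU -map_app !eqv_app iU.
by exists u; apply: ghom_eq => v; rewrite app_gcomp hu.
Qed.

Lemma surj_gen (V W : bundle Y) N : @is_surj k Y V W N -> forall w, exists v, app N v = w.
Proof.
move=> [_ sN] w; have [y] := @place_ex Y; have [e fe [e' ee']] := frames_inv W y.
have /choice[v hv] i : exists v, app N v = e i.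
  by have [v _ hv] := sN y (e i) (frames_mem i fe); exists v.
exists (\sum_i app e' w i *: v i); rewrite app_lsum -(minv_r w ee').
by rewrite (minv_l _ ee'); apply: eq_bigr => i _; rewrite hv.
Qed.

Lemma quo_desc V Q T (q : ghom V Q) (t : ghom V T) : @is_surj k Y V Q q ->
  (forall v, app q v = 0 -> app t v = 0) -> exists u : ghom Q T, gcomp u q = t.
Proof.
move=> sq h; have [s hs] := surj_section (surj_gen sq); have [hq' sq'] := sq.
have tU v : app (compm t s) (app q v) = app t v.
  rewrite appM; apply/eqP; rewrite -subr_eq0; apply/eqP.
  rewrite -scaleN1r -appZ -appD; apply: h.
  by rewrite appD appZ scaleN1r hs subrr.
have [ht _] := ghomE t; have [u hu] : exists u : ghom Q T, u = compm t s :> mat _ _ _.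
  apply: ghom_of => [y w /sq'[v hv <-]|g]; first by rewrite tU; exact: ht.
  apply: (@map_matP _ _ (cm_fun (A g))) => w; have [v <-] := surj_gen sq w.
  by rewrite appM -eqv_app tU appM -map_app tU eqv_app.
by exists u; apply: ghom_eq => v; rewrite app_gcomp hu.
Qed.

Definition inlm I J : mat L I (I + J)%type := [ffun i => bvec L (inl i)].
Definition inrm I J : mat L J (I + J)%type := [ffun i => bvec L (inr i)].
Lemma lpart_inl I J v : lpart (app (inlm I J) v) = v.
Proof.
apply/ffunP => i; rewrite ffunE appE -[in RHS](app_id v) appE.
by apply: eq_bigr => j _; rewrite !ffunE.
Qed.
Lemma rpart_inl I J v : rpart (app (inlm I J) v) = 0.
Proof. by apply/ffunP => i; rewrite !ffunE appE big1 // => j _; rewrite !ffunE mulr0. Qed.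
Lemma rpart_inr I J v : rpart (app (inrm I J) v) = v.
Proof.
apply/ffunP => i; rewrite ffunE appE -[in RHS](app_id v) appE.
by apply: eq_bigr => j _; rewrite !ffunE.
Qed.
Lemma lpart_inr I J v : lpart (app (inrm I J) v) = 0.
Proof. by apply/ffunP => i; rewrite !ffunE appE big1 // => j _; rewrite !ffunE mulr0. Qed.
Lemma lpart_map I J g (v : vec L (I + J)%type) :
  lpart (map_vec (cm_fun (A g)) v) = map_vec (cm_fun (A g)) (lpart v).
Proof. by apply/ffunP => i; rewrite !ffunE. Qed.
Lemma rpart_map I J g (v : vec L (I + J)%type) :
  rpart (map_vec (cm_fun (A g)) v) = map_vec (cm_fun (A g)) (rpart v).
Proof. by apply/ffunP => i; rewrite !ffunE. Qed.

Fact gdsum_iso V W g : @is_iso k Y (pull (A g) (dsum V W)) (dsum V W)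
  (msum (glam V g) (glam W g)) (msum (glamV V g) (glamV W g)).
Proof.
have [hV hV' gV] := glamP V g; have [hW hW' gW] := glamP W g.
have gg := msum_minv gV gW; split=> //.
  move=> y u; apply: ospan_stalk_map => _ [v [h1 h2] <-]; split.
    by rewrite lpart_msum lpart_map; apply: hV; apply: ospan_gen; exists (lpart v).
  by rewrite rpart_msum rpart_map; apply: hW; apply: ospan_gen; exists (rpart v).
move=> y v [h1 h2]; have {}h1 := hV' y _ h1; have {}h2 := hW' y _ h2.
rewrite -(lpart_msum _ (glamV W g)) in h1; rewrite -(rpart_msum (glamV V g)) in h2.
move: (app _ v) h1 h2 => {}v h1 h2.
have -> : v = app (inlm _ _) (lpart v) + app (inrm _ _) (rpart v).
  by apply: partP; apply/ffunP => i;
    [have /ffunP/(_ i) := lpart_inl (idx W) (lpart v); have /ffunP/(_ i) := lpart_inr (idx V) (rpart v)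
    |have /ffunP/(_ i) := rpart_inl (idx W) (lpart v); have /ffunP/(_ i) := rpart_inr (idx V) (rpart v)];
    rewrite !ffunE => -> ->; rewrite ?addr0 ?add0r.
have hl : @is_hom k Y V (dsum V W) (inlm _ _).
  by move=> z w hw; split; rewrite ?lpart_inl ?rpart_inl //; exact: stalk_nil.
have hr : @is_hom k Y W (dsum V W) (inrm _ _).
  by move=> z w hw; split; rewrite ?lpart_inr ?rpart_inr //; exact: stalk_nil.
have ml I J : map_mat (cm_fun (A g)) (inlm I J) = inlm I J.
  by apply/ffunP => i; rewrite !ffunE map_bvec.
have mr I J : map_mat (cm_fun (A g)) (inrm I J) = inrm I J.
  by apply/ffunP => i; rewrite !ffunE map_bvec.
apply: ospan_add.
  by have := @pull_hom Y Y (A g) _ _ _ hl _ _ h1; rewrite ml.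
by have := @pull_hom Y Y (A g) _ _ _ hr _ _ h2; rewrite mr.
Qed.

Fact gdsum_M V W g h : msum (glam V (g * h)%g) (glam W (g * h)%g) =
  compm (msum (glam V h) (glam W h)) (map_mat (cm_fun (A h)) (msum (glam V g) (glam W g))).
Proof.
apply: (@map_matP _ _ (cm_fun (A (g * h)%g))) => v; rewrite appM.
have -> : map_vec (cm_fun (A (g * h)%g)) v = map_vec (cm_fun (A h)) (map_vec (cm_fun (A g)) v).
  by apply/ffunP => i; rewrite !ffunE caM.
by rewrite -map_app; apply: partP; rewrite !(lpart_msum, rpart_msum, lpart_map, rpart_map) glamM
  appM map_app.
Qed.
Definition gdsum V W : gbundle A := GBundle (gdsum_iso V W) (gdsum_M V W).

Lemma biproduct_ex V W : exists (i1 : ghom V (gdsum V W)) (i2 : ghom W (gdsum V W))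
    (p1 : ghom (gdsum V W) V) (p2 : ghom (gdsum V W) W),
  [/\ gcomp p1 i1 = gid V, gcomp p2 i2 = gid W, gcomp p1 i2 = 0, gcomp p2 i1 = 0
    & gcomp i1 p1 + gcomp i2 p2 = gid (gdsum V W)].
Proof.
have [i1 e1] : exists f : ghom V (gdsum V W), f = inlm _ _ :> mat _ _ _.
  apply: ghom_of => [y v hv|g]; first by split; rewrite ?lpart_inl ?rpart_inl //; exact: stalk_nil.
  apply: (@map_matP _ _ (cm_fun (A g))) => v; rewrite !appM -map_app.
  by apply: partP; rewrite !(lpart_msum, rpart_msum, lpart_map, rpart_map, lpart_inl, rpart_inl) ?map_vec0 ?app0.
have [i2 e2] : exists f : ghom W (gdsum V W), f = inrm _ _ :> mat _ _ _.
  apply: ghom_of => [y v hv|g]; first by split; rewrite ?lpart_inr ?rpart_inr //; exact: stalk_nil.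
  apply: (@map_matP _ _ (cm_fun (A g))) => v; rewrite !appM -map_app.
  by apply: partP; rewrite !(lpart_msum, rpart_msum, lpart_map, rpart_map, lpart_inr, rpart_inr) ?map_vec0 ?app0.
have plE I J v : app (pullm L (@inl I J)) v = lpart v by exact: app_pull.
have prE I J v : app (pullm L (@inr I J)) v = rpart v by exact: app_pull.
have [p1 e3] : exists f : ghom (gdsum V W) V, f = pullm L inl :> mat _ _ _.
  apply: ghom_of => [y v [hv _]|g]; first by rewrite plE.
  apply: (@map_matP _ _ (cm_fun (A g))) => v; rewrite !appM -map_app !plE.
  by rewrite lpart_msum lpart_map.
have [p2 e4] : exists f : ghom (gdsum V W) W, f = pullm L inr :> mat _ _ _.
  apply: ghom_of => [y v [_ hv]|g]; first by rewrite prE.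
  apply: (@map_matP _ _ (cm_fun (A g))) => v; rewrite !appM -map_app !prE.
  by rewrite rpart_msum rpart_map.
exists i1, i2, p1, p2; split; apply: ghom_eq => v;
  rewrite ?app_gadd ?app_gzero ?app_gid ?app_gcomp ?e1 ?e2 ?e3 ?e4 ?plE ?prE.
- exact: lpart_inl.
- exact: rpart_inr.
- exact: lpart_inr.
- exact: rpart_inl.
- have lD I J (u w : vec L (I + J)%type) : lpart (u + w) = lpart u + lpart w.
    by apply/ffunP => i; rewrite !ffunE.
  have rD I J (u w : vec L (I + J)%type) : rpart (u + w) = rpart u + rpart w.
    by apply/ffunP => i; rewrite !ffunE.
  by apply: partP; rewrite ?lD ?rD ?lpart_inl ?lpart_inr ?rpart_inl ?rpart_inr ?addr0 ?add0r.
Qed.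

End EquivariantSubquotients.

(** * A criterion for neutral Tannakian subcategories *)

Section TannakianCriterion.
Variables (y : place Y) (S : Vect A -> Prop) (cl : tensor_closed S).
Local Notation C := (full_subcat cl).
Local Notation F := (restrict_functor cl (fiber_functor A y)).
Hypothesis S_ss0 : forall V : gbundle A, S V -> ss0 V.
Hypothesis S_dsum : forall V W : gbundle A, S V -> S W -> S (gdsum V W).
Hypothesis S_sub : forall (V W : gbundle A) (i : ghom W V), S V ->
  @is_subbundle k Y W V i -> degree W = 0 -> S W.
Hypothesis S_quo : forall (V W : gbundle A) (q : ghom V W), S V ->
  @is_surj k Y V W q -> degree W = 0 -> S W.

Lemma ghomEm (V W : gbundle A) (f : ghom V W) : @is_hom k Y V W f. Proof. exact: (ghomE f).1. Qed.

Lemma app_tzero (V W : C) v : app (ghom_mat (0 : thom V W)) v = 0.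
Proof. exact: app0m. Qed.
(** The kernel is an invariant subspace, of degree 0 by [ss0_hom], so its saturated subbundle is in
    the class by [S_sub]. *)
Lemma kernel_ex (V W : gbundle A) (f : ghom V W) : S V -> S W ->
  exists (K : gbundle A) (i : ghom K V), [/\ S K, @is_subbundle k Y K V i &
    forall v, app f v = 0 <-> exists c, v = app i c].
Proof.
move=> SV SW; have [d0 _ _] := ss0_hom (S_ss0 SV) (S_ss0 SW) (ghomEm f).
have [K [M [hK eM]]] := gsub_ex (lsub_ker f) (tw_ker f).
have [hM hU] := hK; have [hh _ _] := hM; have [i ei] := ghom_of hh eM.
rewrite -ei in hM hU hK; exists K, i; split=> //; first apply: (S_sub (i := i)) SV hM _.
by rewrite -(sdegE hK).1.
Qed.

Lemma cokernel_ex (V W : gbundle A) (f : ghom V W) : S V -> S W ->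
  exists (Q : gbundle A) (q : ghom W Q), [/\ S Q, @is_surj k Y W Q q &
    forall w, app q w = 0 <-> exists v, w = app f v].
Proof.
move=> SV SW; have [_ d0 _] := ss0_hom (S_ss0 SV) (S_ss0 SW) (ghomEm f).
have [Q [N [sN eN hN dN]]] := gquo_ex (@lsub_imf _ _ _ f) (tw_range f).
have [q eq] := ghom_of sN.1 eN.
rewrite -eq in sN hN; exists Q, q; split=> //.
  have [dW _] := S_ss0 SW; apply: (S_quo (q := q)) SW sN _.
  by move: dN; rewrite d0 add0r => <-.
by move=> w; rewrite -hN; split=> [[v _ ->]|[v ->]]; exists v.
Qed.

Lemma sub_inj (K V : gbundle A) (i : ghom K V) (T : gbundle A) (u u' : ghom T K) :
  @is_subbundle k Y K V i -> gcomp i u = gcomp i u' -> u = u'.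
Proof.
move=> [_ ii _] e; apply: ghom_eq => v; apply: ii.
by rewrite -!app_gcomp e.
Qed.

Lemma quo_inj (V Q : gbundle A) (q : ghom V Q) (T : gbundle A) (u u' : ghom Q T) :
  @is_surj k Y V Q q -> gcomp u q = gcomp u' q -> u = u'.
Proof.
move=> sq e; apply: ghom_eq => w; have [v <-] := surj_gen sq w.
by rewrite -!app_gcomp e.
Qed.

(** A monomorphism composed with the inclusion of its kernel is zero, so the kernel vanishes;
    strictness then makes the image saturated. *)
Lemma tmono_sub (V W : C) (f : thom V W) : tmono f -> @is_subbundle k Y (sval V) (sval W) f.
Proof.
case: V W f => V SV [W SW] f mf; have [K [i [SK si hi]]] := kernel_ex f SV SW.
have i0 : i = 0.
  apply: (mf (exist S K SK) i 0); apply: ghom_eq => v.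
  apply: etrans (app_gcomp f i v) _; rewrite (proj2 (hi _)); last by exists v.
  apply: esym; apply: etrans (app_gcomp f _ v) _.
  exact: etrans (congr1 (app f) (@app_tzero (exist S K SK) (exist S V SV) v)) (app0 _).
have fi : injective (app f).
  by apply: inj_ker => v /hi[c ->]; rewrite i0 app_gzero.
have [_ _ st] := ss0_hom (S_ss0 SV) (S_ss0 SW) (ghomEm f).
by split=> // [|z v /st[v' hv' /fi <-]]; first exact: ghomEm.
Qed.

Lemma tepi_surj (V W : C) (f : thom V W) : tepi f -> @is_surj k Y (sval V) (sval W) f.
Proof.
case: V W f => V SV [W SW] f ef; have [Q [q [SQ sq hq]]] := cokernel_ex f SV SW.
have q0 : q = 0.
  apply: (ef (exist S Q SQ) q 0); apply: ghom_eq => v.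
  apply: etrans (app_gcomp q f v) _; rewrite (proj2 (hq _)); last by exists v.
  apply: esym; apply: etrans (app_gcomp _ f v) _.
  exact: (@app_tzero (exist S W SW) (exist S Q SQ) _).
have [_ _ st] := ss0_hom (S_ss0 SV) (S_ss0 SW) (ghomEm f).
split=> [|z w hw]; first exact: ghomEm.
have [v ev] : exists v, w = app f v by apply/hq; rewrite q0 app_gzero.
by rewrite ev in hw *; exact: st.
Qed.

Lemma full_abelian : abelian_category C.
Proof.
have [c1 _ _] := cl; split; last split.
- have [K [i [SK si hi]]] := kernel_ex (gid (gone A)) c1 c1.
  have [_ ii _] := si.
  have c0 (c : vec L (idx K)) : c = 0.
    by apply: ii; rewrite app0; apply: etrans (esym (app_gid _)) _; apply/hi; exists c.
  exists (exist S K SK) => -[V SV]; split=> f; apply: ghom_eq => v; rewrite app_gzero.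
    exact: c0.
  by rewrite (c0 v) app0.
- move=> [V SV] [W SW]; have [i1 [i2 [p1 [p2 [h1 h2 h3 h4 h5]]]]] := biproduct_ex V W.
  by exists (exist S _ (S_dsum SV SW)), i1, i2, p1, p2.
- move=> [V SV] [W SW] f; have [K [i [SK si hi]]] := kernel_ex f SV SW.
  exists (exist S K SK), i; split=> [|[T ST] t /= e].
    by apply: ghom_eq => v; rewrite app_gzero [LHS]app_gcomp; apply/hi; exists v.
  have [u eu] : exists u, gcomp i u = t.
    by apply: sub_lift => // v; apply/hi; rewrite -[LHS]app_gcomp e app_gzero.
  by exists u; split=> // u' e'; apply: sub_inj si _; rewrite eu.
- move=> [V SV] [W SW] f; have [Q [q [SQ sq hq]]] := cokernel_ex f SV SW.
  exists (exist S Q SQ), q; split=> [|[T ST] t /= e].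
    by apply: ghom_eq => v; rewrite app_gzero [LHS]app_gcomp; apply/hq; exists v.
  have [u eu] : exists u, gcomp u q = t.
    by apply: quo_desc => // w /hq[v ->]; rewrite -[LHS]app_gcomp e app_gzero.
  by exists u; split=> // u' e'; apply: quo_inj sq _; rewrite eu.
- move=> V W f mf; have := tmono_sub mf; case: V W f {mf} => V SV [W SW] f sf.
  have [Q [q [SQ sq hq]]] := cokernel_ex f SV SW; exists (exist S Q SQ), q; split=> [|[T ST] t /= e].
    by apply: ghom_eq => v; rewrite app_gzero [LHS]app_gcomp; apply/hq; exists v.
  have [u eu] : exists u, gcomp f u = t.
    by apply: sub_lift => // v; apply/hq; rewrite -[LHS]app_gcomp e app_gzero.
  by exists u; split=> // u' e'; apply: sub_inj sf _; rewrite eu.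
- move=> V W f ef; have := tepi_surj ef; case: V W f {ef} => V SV [W SW] f sf.
  have [K [i [SK si hi]]] := kernel_ex f SV SW; exists (exist S K SK), i; split=> [|[T ST] t /= e].
    by apply: ghom_eq => v; rewrite app_gzero [LHS]app_gcomp; apply/hi; exists v.
  have [u eu] : exists u, gcomp u f = t.
    by apply: quo_desc => // w /hi[v ->]; rewrite -[LHS]app_gcomp e app_gzero.
  by exists u; split=> // u' e'; apply: quo_inj sf _; rewrite eu.
Qed.

(** In a short exact sequence the first map is a subbundle and the second is surjective on stalks;
    saturation and lifting allow division by the uniformizer, which gives exactness on fibres. *)
Lemma fiber_exact : exact_functor F.
Proof.
move=> U V W f g [gf kg] [_ qg].
have mf : tmono f.
  move=> T u v e; have [|w [_ uw]] := kg T (tcomp f u).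
    have [_ -> _ _] := full_linear cl; rewrite gf; apply: ghom_eq => x.
    apply: etrans (app_gcomp _ _ _) _; apply: etrans (@app_tzero U W _) _.
    by apply: esym; exact: (@app_tzero T W _).
  by rewrite -(uw u) // -(uw v).
have eg : tepi g.
  move=> T u v e; have [|w [_ uw]] := qg T (tcomp u g).
    have [_ ass _ _] := full_linear cl; rewrite -ass gf; apply: ghom_eq => x.
    apply: etrans (app_gcomp _ _ _) _; apply: etrans (congr1 (app u) (@app_tzero U W _)) _.
    by rewrite app0; apply: esym; exact: (@app_tzero U T _).
  by rewrite -(uw u) // -(uw v).
have sf := tmono_sub mf; have sg := tepi_surj eg.
move: kg qg sf sg gf mf eg; case: U V W f g => U SU [V SV] [W SW] f g /= kg qg sf sg gf _ _.
have ke v : app g v = 0 -> exists u, v = app f u.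
  have [K [i [SK si hi]]] := kernel_ex g SV SW.
  have [|w [ew _]] := kg (exist S K SK) i.
    by apply: ghom_eq => x; rewrite app_gzero [LHS]app_gcomp; apply/hi; exists x.
  by move=> /hi[c ->]; exists (app w c); rewrite -[RHS]app_gcomp; congr (app (ghom_mat _) c).
have u0 := unif_neq0 y; have [hf fi fr] := sf; have [hg gs] := sg.
have gf0 u : app g (app f u) = 0 by rewrite -app_gcomp [gcomp _ _]gf app_gzero.
split=> [a b|a|a].
- elim/fiber_ind: a => v; elim/fiber_ind: b => w; rewrite !pi_fiber_map => /pi_fiberP h.
  by apply/pi_fiberP/fr; rewrite appZ appD -scaleN1r appZ scaleN1r.
- elim/fiber_ind: a => v; split=> [|[b ->]]; last first.
    elim/fiber_ind: b => u; rewrite !pi_fiber_map -(raddf0 (\pi_(fiber y W))).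
    by apply/pi_fiberP; rewrite /= gf0 subrr scaler0; exact: stalk_nil.
  rewrite pi_fiber_map -(raddf0 (\pi_(fiber y W))) => /pi_fiberP; rewrite subr0.
  (* [b] lifts the quotient of g(v) by the uniformizer, so [v - unif y *: b] lies in the kernel of g
     and has the same class as [v] in the fibre. *)
  move=> /gs[b hb eb]; have [|u eu] := ke ((v : vec _ _) - unif y *: b).
    by rewrite appD -scaleNr appZ eb scalerA mulNr divff // scaleN1r subrr.
  have su : u \in @stalkb k Y y U.
    apply/asboolP/fr; rewrite -eu addrC -scaleNr; apply: (stalk_omod V y).2 => //.
      by rewrite vgeN vgeE // vord_unif1.
    exact: stalkE.
  exists (\pi_(fiber y U) (Stalk su)); rewrite pi_fiber_map; apply/pi_fiberP => /=.
  by rewrite -eu opprB addrC subrK scalerA mulVf // scale1r.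
- elim/fiber_ind: a => w; have [v hv e] := gs y w (stalkE w).
  have sv : v \in @stalkb k Y y V by apply/asboolP.
  exists (\pi_(fiber y V) (Stalk sv)); rewrite pi_fiber_map; exact: pi_fiber_eq.
Qed.

Lemma tannakian_criterion : neutral_tannakian F.
Proof.
split; split.
- exact: full_linear.
- exact: full_abelian.
- exact: full_symmetric.
- exact: full_rigid.
- exact: full_scalar.
- exact: fiber_linear.
- exact: fiber_tensor.
- exact: fiber_exact.
- exact: fiber_faithful S_ss0.
Qed.

End TannakianCriterion.

End Tannakian.

(** * Pull-back of sums, duals and trivial bundles *)

Section PullOperations.
Variables (Z Y : curve k) (h : curve_mor Z Y).
Local Notation s := (cm_fun h).
Implicit Types (V W : bundle Y).

Lemma frames_unique I z (e : mat (ff Z) I I) S T : frames z e S -> frames z e T -> forall v, S v <-> T v.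
Proof. by move=> fS fT v; have [[e' ee'] _] := fS; rewrite (framesP v fS ee') (framesP v fT ee'). Qed.
Lemma same_frames_isom I sS sT lS lT :
  (forall z, exists e : mat (ff Z) I I, frames z e (sS z) /\ frames z e (sT z)) ->
  isomorphic (@Bundle k Z I sS lS) (@Bundle k Z I sT lT).
Proof.
move=> H; exists (mat1 I), (mat1 I); split=> [z v hv|z v hv|]; rewrite ?app_id.
- by have [e [f1 f2]] := H z; apply/(frames_unique f1 f2).
- by have [e [f1 f2]] := H z; apply/(frames_unique f1 f2).
- by apply: minvP => v; rewrite !app_id.
Qed.

Lemma pull_triv I : isomorphic (pull h (triv Y I)) (triv Z I).
Proof.
have m1 (L : fieldType) : minv (mat1 I) (mat1 I : mat L I I) by apply: minvP => u; rewrite !app_id.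
apply: same_frames_isom => z; exists (mat1 I); split=> /=.
  have ft : frames (cm_pt h z) (mat1 I) (stalk (triv Y I) (cm_pt h z)).
    by split=> [|c]; [exists (mat1 I); exact: m1|rewrite app_id].
  by have := pull_frames (V := triv Y I) ft (m1 (ff Y)); rewrite map_mat1.
by split=> [|c]; [exists (mat1 I); exact: m1|rewrite app_id].
Qed.

Lemma pull_dsum V W : isomorphic (pull h (dsum V W)) (dsum (pull h V) (pull h W)).
Proof.
apply: same_frames_isom => z.
have [e fe [e' ee']] := frames_inv V (cm_pt h z).
have [f ff [f' ff']] := frames_inv W (cm_pt h z).
exists (msum (map_mat s e) (map_mat s f)); split.
  have := pull_frames (V := dsum V W) (dsum_frames fe ff) (msum_minv ee' ff').
  rewrite (_ : map_mat s (msum e f) = msum (map_mat s e) (map_mat s f)) //.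
  by apply/ffunP => -[i|i]; apply/ffunP => -[j|j]; rewrite !ffunE ?rmorph0.
exact: (@dsum_frames Z (pull h V) (pull h W) _ _ _ (pull_frames fe ee') (pull_frames ff ff')).
Qed.

Lemma pull_bdual V : isomorphic (pull h (bdual V)) (bdual (pull h V)).
Proof.
apply: same_frames_isom => z.
have [e fe [e' ee']] := frames_inv V (cm_pt h z).
have [ee1 ee2] := ee'; exists (trm (map_mat s e')); split.
  have := pull_frames (V := bdual V) (dual_frames fe ee') (trm_minv (conj ee2 ee1)).
  by rewrite map_trm.
exact: (@dual_frames k Z (pull h V) z _ _ (pull_frames fe ee') (map_minv _ ee')).
Qed.

End PullOperations.

(** * The category of strongly semistable bundles of degree 0 *)

Section Closure.
Variables (Y : curve k).
Implicit Types (V W : bundle Y).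

Section IsomOperations.

Lemma isom_dsum V V' W W' : isomorphic V V' -> isomorphic W W' -> isomorphic (dsum V W) (dsum V' W').
Proof.
case=> M [N [hM hN MN]] [M1 [N1 [hM1 hN1 MN1]]]; exists (msum M M1), (msum N N1).
by split=> [y v [h1 h2]|y v [h1 h2]|]; [split|split|exact: msum_minv];
  rewrite ?lpart_msum ?rpart_msum; [exact: hM|exact: hM1|exact: hN|exact: hN1].
Qed.

Lemma isom_bdual V W : isomorphic V W -> isomorphic (bdual V) (bdual W).
Proof.
case=> M [N [hM hN MN]]; have [e1 e2] := MN; exists (trm N), (trm M); split.
- by move=> y xi hxi v hv; rewrite app_trm; apply: hxi; exact: hN.
- by move=> y xi hxi v hv; rewrite app_trm; apply: hxi; exact: hM.
- exact: (trm_minv (conj e2 e1)).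
Qed.

Variables (p : nat) (pk : p \in [pchar k]).

Lemma frobn_triv n I : isomorphic (frobn pk n (triv Y I)) (triv Y I).
Proof.
elim: n => [|n IH]; first exact: isom_refl.
exact: isom_trans (isom_pull _ IH) (pull_triv _ _).
Qed.
Lemma frobn_dsum n V W : isomorphic (frobn pk n (dsum V W)) (dsum (frobn pk n V) (frobn pk n W)).
Proof.
elim: n => [|n IH]; first exact: isom_refl.
exact: isom_trans (isom_pull _ IH) (pull_dsum _ _ _).
Qed.
Lemma frobn_bdual n V : isomorphic (frobn pk n (bdual V)) (bdual (frobn pk n V)).
Proof.
elim: n => [|n IH]; first exact: isom_refl.
exact: isom_trans (isom_pull _ IH) (pull_bdual _ _).
Qed.
Lemma frobn_surj n V W N : @is_surj k Y V W N ->
  exists N', @is_surj k Y (frobn pk n V) (frobn pk n W) N'.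
Proof.
elim: n => [|n IH] hN; first by exists N.
by have [N' hN'] := IH hN; eexists; exact: pull_surj hN'.
Qed.

End IsomOperations.

Lemma sss0_triv I : sss0 (triv Y I).
Proof.
split=> [|p pk n]; first exact: ss0_triv.
exact: isom_ss0 (isom_sym (frobn_triv pk n I)) (ss0_triv _ _).
Qed.
Lemma sss0_dsum V W : sss0 V -> sss0 W -> sss0 (dsum V W).
Proof.
move=> [h1 h2] [h3 h4]; split=> [|p pk n]; first exact: ss0_dsum.
exact: isom_ss0 (isom_sym (frobn_dsum pk n V W)) (ss0_dsum (h2 _ _ _) (h4 _ _ _)).
Qed.
Lemma sss0_bdual V : sss0 V -> sss0 (bdual V).
Proof.
move=> [h1 h2]; split=> [|p pk n]; first exact: ss0_bdual.
exact: isom_ss0 (isom_sym (frobn_bdual pk n V)) (ss0_bdual (h2 _ _ _)).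
Qed.
Lemma sss0_sub V W M : sss0 V -> @is_subbundle k Y W V M -> degree W = 0 -> sss0 W.
Proof.
move=> [h1 h2] hM d0; split=> [|p pk n]; first exact: ss0_subbundle h1 hM d0.
have [M' hM'] := frobn_sub pk n hM; apply: ss0_subbundle (h2 p pk n) hM' _.
by rewrite degree_frobn d0 mulr0.
Qed.
Lemma sss0_surj V W N : sss0 V -> @is_surj k Y V W N -> degree W = 0 -> sss0 W.
Proof.
move=> [h1 h2] hN d0; split=> [|p pk n]; first exact: ss0_surj h1 hN d0.
have [N' hN'] := frobn_surj pk n hN; apply: ss0_surj (h2 p pk n) hN' _.
by rewrite degree_frobn d0 mulr0.
Qed.

Variables (gT : finGroupType) (A : curve_action gT Y) (y : place Y).

Lemma Vect0ss_tannakian : neutral_tannakian_sub (fiber_functor A y) (@Vect0ss k Y gT A).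
Proof.
have cl : tensor_closed (@Vect0ss k Y gT A).
  split=> [|V W|V]; first by apply/Vect0ssP; exact: sss0_triv.
    by move=> /Vect0ssP h1 /Vect0ssP h2; apply/Vect0ssP; exact: tens_sss0.
  by move=> /Vect0ssP h; apply/Vect0ssP; exact: sss0_bdual.
exists cl; apply: tannakian_criterion => [V|V W|V W i|V W q] /Vect0ssP.
- by case.
- by move=> h1 /Vect0ssP h2; apply/Vect0ssP; exact: sss0_dsum.
- by move=> h1 h2 h3; apply/Vect0ssP; exact: sss0_sub h1 h2 h3.
- by move=> h1 h2 h3; apply/Vect0ssP; exact: sss0_surj h1 h2 h3.
Qed.

End Closure.

(** * Algebraic elements of commutative semirings *)

Section SemiringFiniteness.
Variable S : comNzSemiRingType.
Implicit Types (x y z c : S) (f g : {poly nat}).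

Definition nev x : {poly nat} -> S := fun f => (map_poly (GRing.natmul 1) f).[x].
HB.instance Definition _ x := GRing.RMorphism.copy (nev x)
  (horner_eval x \o map_poly (GRing.natmul 1 : {rmorphism nat -> S})).

Lemma nevX x : nev x 'X = x. Proof. by rewrite /nev map_polyX hornerX. Qed.

Lemma nevE x f : nev x f = \sum_(i < size f) x ^+ i *+ (f`_i)%R.
Proof.
rewrite /nev horner_poly; apply: eq_bigr => i _.
by rewrite mulr_natl.
Qed.

(** Without subtraction or cancellation an algebraic equation has to keep its two sides. *)
Definition sfinite x := exists f g, f != g /\ nev x f = nev x g.

Definition nev2 x y : {poly {poly nat}} -> S := fun p => (map_poly (nev x) p).[y].
HB.instance Definition _ x y := GRing.RMorphism.copy (nev2 x y) (horner_eval y \o map_poly (nev x)).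

Lemma nev2C x y f : nev2 x y f%:P = nev x f.
Proof. by rewrite /nev2 map_polyC hornerC. Qed.
Lemma nev2X x y : nev2 x y 'X = y. Proof. by rewrite /nev2 map_polyX hornerX. Qed.

(** For isomorphism classes of bundles this is the relation of being a direct summand. *)
Definition sle x y := exists c, x + c = y.
Lemma sle_refl x : sle x x. Proof. by exists 0; rewrite addr0. Qed.
Lemma sle_trans y x z : sle x y -> sle y z -> sle x z.
Proof. by case=> c <- [d <-]; exists (c + d); rewrite addrA. Qed.
Lemma sleD x x' y y' : sle x x' -> sle y y' -> sle (x + y) (x' + y').
Proof. by case=> c <- [d <-]; exists (c + d); rewrite addrACA. Qed.
Lemma sleM x x' y y' : sle x x' -> sle y y' -> sle (x * y) (x' * y').
Proof.
case=> c <- [d <-]; exists (c * y + x * d + c * d).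
by rewrite mulrDl !mulrDr !addrA; congr (_ + _); rewrite addrAC.
Qed.
Lemma sle_exp z m n : sle 1 z -> (m <= n)%N -> sle (z ^+ m) (z ^+ n).
Proof.
move=> z1 /subnK<-; elim: (n - m)%N => [|d IH]; first exact: sle_refl.
by rewrite exprS -[z ^+ m]mul1r; exact: sleM.
Qed.

Definition dominated z c := exists m n, sle c (z ^+ m *+ n).
Lemma dominatedD z c d : sle 1 z -> dominated z c -> dominated z d -> dominated z (c + d).
Proof.
move=> z1 [m [n h1]] [m' [n' h2]]; exists (m + m')%N, (n + n')%N; rewrite mulrnDr.
have sM a b l : sle a b -> sle (a *+ l) (b *+ l).
  by move=> h; rewrite -[a *+ l]mulr_natr -[b *+ l]mulr_natr; apply: sleM h (sle_refl _).
apply: sleD; [apply: sle_trans h1 _|apply: sle_trans h2 _]; apply: sM; apply: sle_exp => //.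
  exact: leq_addr.
exact: leq_addl.
Qed.
Lemma dominatedM z c d : dominated z c -> dominated z d -> dominated z (c * d).
Proof.
move=> [m [n h1]] [m' [n' h2]]; exists (m + m')%N, (n * n')%N.
by have := sleM h1 h2; rewrite mulrnAl mulrnAr -exprD -mulrnA mulnC.
Qed.
Lemma dominated_nat z n : dominated z (n%:R).
Proof. by exists 0%N, n; exact: sle_refl. Qed.
Lemma dominated_self z c : sle c z -> dominated z c.
Proof. by move=> h; exists 1%N, 1%N. Qed.
Lemma nev_dominated z x f : sle 1 z -> sle x z -> dominated z (nev x f).
Proof.
move=> z1 xz; elim/poly_ind: f => [|f n IH]; first by rewrite rmorph0; exact: (dominated_nat z 0).
rewrite rmorphD rmorphM /= nevX; apply: dominatedD => //.
  by apply: dominatedM IH (dominated_self xz).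
by rewrite /nev map_polyC hornerC; exact: dominated_nat.
Qed.
Lemma nev2_dominated z x y p : sle 1 z -> sle x z -> sle y z -> dominated z (nev2 x y p).
Proof.
move=> z1 xz yz; elim/poly_ind: p => [|p f IH]; first by rewrite rmorph0; exact: (dominated_nat z 0).
rewrite rmorphD rmorphM /= nev2X nev2C; apply: dominatedD => //.
  by apply: dominatedM IH (dominated_self yz).
exact: nev_dominated.
Qed.

End SemiringFiniteness.

(** * Clearing signs and denominators *)

Section IntegralDifferences.
Variables (T : comNzSemiRingType) (R : comNzRingType) (j : {rmorphism T -> R}).

Definition diffb (r : R) := exists (n : nat) (a b : T), (0 < n)%N /\ r *+ n + j b = j a.

Lemma diffbD r s : diffb r -> diffb s -> diffb (r + s).
Proof.
move=> [n [a [b [n0 h1]]]] [m [c [d [m0 h2]]]].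
exists (n * m)%N, (a *+ m + c *+ n), (b *+ m + d *+ n); split; first by rewrite muln_gt0 n0.
rewrite !rmorphD !rmorphMn -h1 -h2 !mulrnDl -!mulrnA [(m * n)%N]mulnC.
by rewrite addrACA.
Qed.
Lemma diffbM r s : diffb r -> diffb s -> diffb (r * s).
Proof.
move=> [n [a [b [n0 h1]]]] [m [c [d [m0 h2]]]].
exists (n * m)%N, (a * c + b * d), (a * d + b * c); split; first by rewrite muln_gt0 n0.
rewrite !rmorphD !rmorphM -h1 -h2.
ring.
Qed.
End IntegralDifferences.

Lemma diffb_poly (T : comNzSemiRingType) (R : comNzRingType) (j : {rmorphism T -> R}) :
  (forall r, diffb j r) -> forall p : {poly R}, diffb (map_poly j) p.
Proof.
move=> hj p; elim/poly_ind: p => [|p c IH].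
  by exists 1%N, 0, 0; rewrite !rmorph0 addr0.
apply: diffbD; first apply: diffbM IH _.
  by exists 1%N, 'X, 0; rewrite rmorph0 addr0 /= map_polyX.
have [n [a [b [n0 h]]]] := hj c; exists n, a%:P, b%:P.
by rewrite /= !map_polyC /= -h polyCD polyCMn.
Qed.

Local Notation jn := (GRing.natmul 1 : {rmorphism nat -> rat}).

Lemma diffb_rat r : diffb jn r.
Proof.
have := divq_num_den r; have := denq_gt0 r; set d := denq r; case: d => // d d0 <-.
have d1 : d%:R != 0 :> rat by rewrite pnatr_eq0 -lt0n.
case: (numq r) => n.
  by exists d, n, 0%N; rewrite addr0 -[LHS]mulr_natr divfK.
exists d, 0%N, n.+1.
by rewrite -[X in X + _]mulr_natr divfK // addNr.
Qed.

Section Dependence.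
Variables (P1 P2 : {poly rat}) (n10 : P1 != 0) (n20 : P2 != 0).
Local Notation R := {poly {poly rat}}.
Local Notation Q2 := (map_poly (@polyC rat) P2).
Variable z : R.
Let ideal (p : R) := exists A B : R, p = A * P1%:P + B * Q2.

Lemma ideal_lin I (a F : I -> R) : (forall i, ideal (F i)) -> ideal (\sum_i a i * F i).
move=> h; elim/big_rec: _ => [|i x _ [A [B ->]]]; first by exists 0, 0; rewrite !mul0r addr0.
have [A' [B' ->]] := h i; exists (a i * A' + A), (a i * B' + B); ring.
Qed.

(** Division by [Q2] in the outer variable, then of every coefficient by [P1] in the inner one. *)
Lemma reduced_span (p : R) : exists c : 'M[rat]_(size P2, size P1),
  ideal (p - \sum_j (\sum_i c j i *: 'X^i)%:P * 'X^j).
Proof.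
pose a := lead_coef P2; have a0 : a != 0 by rewrite lead_coef_eq0.
pose M2 : R := map_poly (@polyC rat) (a^-1 *: P2).
have mM2 : M2 \is monic.
  rewrite monicE lead_coef_map_inj //; last exact: polyC_inj.
  by rewrite lead_coefZ mulVf.
have sM2 : size M2 = size P2.
  by rewrite size_map_inj_poly //; [rewrite size_scale ?invr_eq0|exact: polyC_inj].
have eM2 : M2 = (a^-1)%:P%:P * Q2 by rewrite /M2 -mul_polyC rmorphM /= map_polyC.
set r := Pdiv.Ring.rmodp p M2.
have sr : (size r <= size P2)%N.
  by rewrite -sM2 ltnW // Pdiv.Ring.ltn_rmodp monic_neq0.
exists (\matrix_(j, i) (r`_j %% P1)`_i).
have E j : \sum_(i < size P1) (\matrix_(j < size P2, i < size P1) (r`_j %% P1)`_i) j i *: 'X^i = r`_j %% P1.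
  rewrite -[RHS]coefK (poly_def (size (r`_j %% P1))).
  have /ltnW s1 := ltn_modpN0 r`_j n10.
  rewrite (big_ord_widen _ (fun i => (r`_j %% P1)`_i *: 'X^i) s1) [RHS]big_mkcond.
  apply: eq_bigr => i _; rewrite mxE; case: ltnP => // h.
  by rewrite nth_default // scale0r.
exists (\sum_(j < size P2) (r`_j %/ P1)%:P * 'X^j), (Pdiv.Ring.rdivp p M2 * (a^-1)%:P%:P).
rewrite -mulrA -eM2 {1}(Pdiv.RingMonic.rdivp_eq mM2 p).
rewrite -addrA addrC; congr (_ + _); apply/eqP; rewrite subr_eq mulr_suml -big_split /=.
rewrite [X in X == _](_ : r = \sum_(j < size P2) (r`_j)%:P * 'X^j); last first.
  rewrite -{1}[r]coefK poly_def (big_ord_widen _ (fun i => r`_i *: 'X^i) sr) big_mkcond.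
  apply: eq_bigr => i _; rewrite mul_polyC; case: ltnP => // h.
  by rewrite nth_default // scale0r.
apply/eqP/eq_bigr => j _; rewrite E {1}(divp_eq r`_j P1).
by rewrite polyCD; ring.
Qed.

(** The quotient of Q[x, y] by P1(x) and P2(y) has finite dimension, so the powers of [z] are
    linearly dependent in it. *)
Lemma dependence : exists (q : {poly rat}) (A B : R), q != 0 /\
  (map_poly (fun c => c%:P%:P) q).[z] = A * P1%:P + B * Q2.
Proof.
have /choice[c hc] (n : 'I_(size P2 * size P1).+1) := reduced_span (z ^+ n).
pose M := \matrix_n mxvec (c n).
have /rowV0Pn[v /sub_kermxP vM v0] : kermx M != 0.
  by rewrite -mxrank_eq0 mxrank_ker -lt0n subn_gt0 ltnS rank_leq_col.
pose q := \sum_n v 0 n *: 'X^n; pose E : {rmorphism {poly rat} -> R} := horner_eval z \o map_poly (polyC \o @polyC rat).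
have [A [B e]] := ideal_lin (fun n => (v 0 n)%:P%:P) hc.
exists q, A, B; split.
  apply: contraNneq v0 => q0; apply/eqP/rowP => n; rewrite mxE.
  have := congr1 (fun p : {poly rat} => p`_n) q0; rewrite coef0 => <-.
  rewrite coef_sum (bigD1 n) //= coefZ coefXn eqxx mulr1 big1 ?addr0 // => i ni.
  rewrite coefZ coefXn (_ : (n == i :> nat) = false) ?mulr0 //.
  by apply/negbTE; rewrite eq_sym.
rewrite -e -[LHS]/(E q) (raddf_sum E).
under [RHS]eq_bigr do rewrite mulrBr.
rewrite sumrB [X in _ - X](_ : _ = 0) ?subr0.
  apply: eq_bigr => n _; rewrite /= -mul_polyC rmorphM /= map_polyC map_polyXn /horner_eval.
  by rewrite hornerM hornerC hornerXn.
under eq_bigr do rewrite mulr_sumr.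
rewrite exchange_big big1 //= => j _.
under eq_bigr do rewrite mulrA.
rewrite -mulr_suml (_ : \sum_n _ = 0) ?mul0r //.
under eq_bigr do rewrite -polyCM mulr_sumr.
rewrite -raddf_sum exchange_big big1 //= => i _.
under eq_bigr do rewrite -mul_polyC mulrA -polyCM.
rewrite -mulr_suml -raddf_sum.
have := congr1 (fun w : 'rV_ _ => w 0 (mxvec_index j i)) vM; rewrite !mxE => h.
rewrite (eq_bigr (fun n => v 0 n * M n (mxvec_index j i))) ?h ?mul0r // => n _.
by rewrite !mxE mxvecE.
Qed.

End Dependence.

Section FiniteElements.
Variable S : comNzSemiRingType.

Lemma difference_relation (R : comNzRingType) (u up um n A Ap Am a B Bp Bm b F1 G1 F2 G2 : R) :
  u = A * (F1 - G1) + B * (F2 - G2) -> u * n + um = up -> A * a + Am = Ap -> B * b + Bm = Bp ->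
  up * (a * b) + ((Ap * G1 + Am * F1) * (n * b) + (Bp * G2 + Bm * F2) * (n * a)) =
  um * (a * b) + ((Ap * F1 + Am * G1) * (n * b) + (Bp * F2 + Bm * G2) * (n * a)).
Proof. by move=> -> <- <- <-; ring. Qed.
(** Over Q some nonzero polynomial in z = (1 + x)(1 + y) is a combination of f1 - g1 and f2 - g2, by
    [dependence]. With signs and denominators cleared, it becomes an equality of two sums whose
    error terms [c] and [d] take the same value at (x, y). This value cannot be cancelled in a
    semiring, but since z dominates 1, x and y, adding a complement turns it into a multiple of a
    power of z, and an equation in z alone remains. *)
Lemma sfinite_join (x y : S) : sfinite x -> sfinite y -> sfinite ((1 + x) * (1 + y)).
Proof.
move=> [f1 [g1 [n1 e1]]] [f2 [g2 [n2 e2]]].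
pose j : {rmorphism {poly nat} -> {poly rat}} := map_poly jn.
pose j2 : {rmorphism {poly {poly nat}} -> {poly {poly rat}}} := map_poly j.
have jI : injective j.
  apply: map_inj_poly => //; by move=> m n /eqP; rewrite eqr_nat => /eqP.
have j2I : injective j2 by apply: map_inj_poly => //; exact: rmorph0.
pose Z : {poly {poly nat}} := (1 + 'X%:P) * (1 + 'X).
have sub0 f g : f != g -> j f - j g != 0 by rewrite subr_eq0 (inj_eq jI).
have [q [A [B [q0 E]]]] := dependence (sub0 _ _ n1) (sub0 _ _ n2) (j2 Z).
have [n [qp [qm [n0 eq]]]] := diffb_poly diffb_rat q.
have [a [Ap [Am [a0 eA]]]] := diffb_poly (diffb_poly diffb_rat) A.
have [b [Bp [Bm [b0 eB]]]] := diffb_poly (diffb_poly diffb_rat) B.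
pose liftC f : {poly {poly nat}} := map_poly (@polyC nat) f.
pose ev : {rmorphism {poly nat} -> {poly {poly nat}}} := horner_eval Z \o map_poly (polyC \o @polyC nat).
pose EV : {rmorphism {poly rat} -> {poly {poly rat}}} := horner_eval (j2 Z) \o map_poly (polyC \o @polyC rat).
have cc c : j2 c%:P%:P = (jn c)%:P%:P by rewrite /= map_polyC /= map_polyC.
have evE f : EV (j f) = j2 (ev f).
  rewrite /= -[RHS](horner_map j2); congr (_.[_]).
  rewrite -!map_poly_comp; apply: eq_map_poly => c; exact: esym (cc c).
have liftE f : map_poly (@polyC rat) (j f) = j2 (liftC f).
  rewrite /= -!map_poly_comp; apply: eq_map_poly => c /=.
  by rewrite map_polyC.
pose c := (Ap * g1%:P + Am * f1%:P) * (n%:R * b%:R) + (Bp * liftC g2 + Bm * liftC f2) * (n%:R * a%:R).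
pose d := (Ap * f1%:P + Am * g1%:P) * (n%:R * b%:R) + (Bp * liftC f2 + Bm * liftC g2) * (n%:R * a%:R).
have rel : ev qp * (a%:R * b%:R) + c = ev qm * (a%:R * b%:R) + d.
  apply: j2I; rewrite !(rmorphD, rmorphM, rmorph_nat).
  apply: (difference_relation (u := EV q) (A := A) (B := B)).
  - rewrite [LHS]E polyCB rmorphB /= !liftE.
    by congr (_ * (_ - _) + _); rewrite map_polyC.
  - by rewrite -!evE mulr_natr -rmorphMn -rmorphD; congr (EV _).
  - by rewrite mulr_natr.
  - by rewrite mulr_natr.
pose z := (1 + x) * (1 + y); pose N : {rmorphism {poly {poly nat}} -> S} := nev2 x y.
have NZ : N Z = z by rewrite rmorphM !rmorphD rmorph1 /= nev2C nevX nev2X.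
have nevC t : nev x t%:P = t%:R by rewrite /nev map_polyC hornerC.
have Nev f : N (ev f) = nev z f.
  rewrite -[LHS](horner_map N) NZ -map_poly_comp; congr (_.[_]).
  by apply: eq_map_poly => t /=; rewrite nev2C.
have Nlift f : N (liftC f) = nev y f.
  rewrite -[LHS]/((map_poly (nev x) (map_poly (@polyC nat) f)).[y]) -map_poly_comp; congr (_.[_]).
  by apply: eq_map_poly => t /=.
have Ncd : N c = N d.
  by rewrite !(rmorphD, rmorphM, rmorph_nat) /= !Nlift !nev2C e1 e2.
have z1 : sle 1 z by exists (x + y + x * y); rewrite /z; ring.
have xz : sle x z by exists (1 + y + x * y); rewrite /z; ring.
have yz : sle y z by exists (1 + x + x * y); rewrite /z; ring.
(* [c'] completes the value of the error term to [l] times the m-th power of [z]. *)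
have [m [l [c' ec]]] := nev2_dominated c z1 xz yz.
exists (qp * (a%:R * b%:R) + 'X^m *+ l), (qm * (a%:R * b%:R) + 'X^m *+ l); split.
  apply: contraNneq q0 => /(congr1 j); rewrite !(rmorphD, rmorphM, rmorph_nat) => /addIr.
  have ab0 : (a%:R * b%:R : {poly rat}) != 0.
    by rewrite -natrM -polyC_natr polyC_eq0 pnatr_eq0 -lt0n muln_gt0 a0.
  move/(mulIf ab0)/(etrans eq)/eqP.
  rewrite -subr_eq0 addrK -mulr_natr mulf_eq0 => /orP[//|].
  by rewrite -polyC_natr polyC_eq0 pnatr_eq0 => /eqP n00; rewrite n00 in n0.
rewrite !(rmorphD, rmorphM, rmorph_nat, rmorphMn, rmorphXn) /= !nevX -ec !addrA.
congr (_ + _); move: (congr1 N rel); clearbody c d.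
by rewrite !(rmorphD, rmorphM, rmorph_nat) !Nev -Ncd.
Qed.

End FiniteElements.

(** * The semiring of isomorphism classes of bundles *)

Section Reindexing.
Variables (Y : curve k).
Local Notation L := (ff Y).

(** For isomorphisms that permute index sets, such as those for associativity, commutativity and
    distributivity: matching frames suffice. *)
Lemma reindex_isom I J (h : J -> I) (h' : I -> J) sS sT lS lT : cancel h h' -> cancel h' h ->
  (forall z, exists (e : mat L I I) (f : mat L J J),
    [/\ frames z e (sS z), frames z f (sT z) & forall j j', f j j' = e (h j) (h j')]) ->
  isomorphic (@Bundle k Y I sS lS) (@Bundle k Y J sT lT).
Proof.
move=> hK h'K H; have mm : minv (pullm L h) (pullm L h').
  by apply: minvP => v; rewrite !app_pull; apply/ffunP => i; rewrite !ffunE ?hK ?h'K.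
have E (e : mat L I I) (f : mat L J J) c : (forall j j', f j j' = e (h j) (h j')) ->
  app f (app (pullm L h) c) = app (pullm L h) (app e c).
  move=> fe; apply/ffunP => j; rewrite !app_pull ffunE !appE (reindex h); last first.
    by apply: onW_bij; exists h'.
  by apply: eq_bigr => i _; rewrite ffunE fe.
exists (pullm L h), (pullm L h'); split=> //= z v hv; have [e [f [fS fT fe]]] := H z.
  have [[e' ee'] _] := fS; rewrite -(minv_r v ee') -(E e f) //.
  by apply/fT.2 => i; rewrite app_pull ffunE; exact: (proj1 (framesP v fS ee')).
have [[f' ff'] _] := fT; rewrite -(minv_r v ff').
rewrite -(minv_r (app f' v) mm) (E e f) // (minv_l _ mm).
by apply/fS.2 => i; rewrite app_pull ffunE; exact: (proj1 (framesP v fT ff')).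
Qed.
End Reindexing.

Section IsomClasses.
Variables (Y : curve k).
Local Notation L := (ff Y).
Implicit Types (U V W : bundle Y).

Lemma triv_frames z I : frames z (mat1 I) (stalk (triv Y I) z).
Proof.
split=> [|c]; last by rewrite app_id.
by exists (mat1 I); apply: minvP => u; rewrite !app_id.
Qed.

Lemma dsumA U V W : isomorphic (dsum U (dsum V W)) (dsum (dsum U V) W).
Proof.
pose h (p : (idx U + idx V + idx W)%type) : (idx U + (idx V + idx W))%type := match p with
  inl (inl i) => inl i | inl (inr i) => inr (inl i) | inr i => inr (inr i) end.
pose h' (p : (idx U + (idx V + idx W))%type) : (idx U + idx V + idx W)%type := match p with
  inl i => inl (inl i) | inr (inl i) => inl (inr i) | inr (inr i) => inr i end.
apply: (reindex_isom (h := h) (h' := h')); [by case=> [[]|]|by case=> [|[]]|] => z.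
have [e fe] := frames_ex U z; have [f ff] := frames_ex V z; have [g fg] := frames_ex W z.
exists (msum e (msum f g)), (msum (msum e f) g); split.
- exact: (@dsum_frames _ U (dsum V W) _ _ _ fe (@dsum_frames _ V W _ _ _ ff fg)).
- exact: (@dsum_frames _ (dsum U V) W _ _ _ (dsum_frames fe ff) fg).
- by move=> [[i|i]|i] [[j|j]|j]; rewrite /= ?ffunE.
Qed.

Lemma dsumC U V : isomorphic (dsum U V) (dsum V U).
Proof.
pose h (A B : Type) (p : (A + B)%type) : (B + A)%type := match p with inl i => inr i | inr i => inl i end.
apply: (reindex_isom (h := @h (idx V) (idx U)) (h' := @h (idx U) (idx V))); [by case|by case|] => z.
have [e fe] := frames_ex U z; have [f ff] := frames_ex V z.
exists (msum e f), (msum f e); split; [exact: dsum_frames|exact: dsum_frames|].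
by move=> [i|i] [j|j]; rewrite !ffunE.
Qed.

Lemma dsum0 V : isomorphic (dsum (triv Y void) V) V.
Proof.
case: V => I s l.
pose h' (p : (void + I)%type) : I := match p with inl i => match i with end | inr i => i end.
apply: (reindex_isom (h := @inr void I) (h' := h')); [by []|by case=> [[]|]|] => z.
have [e fe] := frames_ex (Bundle l) z; exists (msum (mat1 void) e), e; split=> //.
  exact: (@dsum_frames _ (triv Y void) (Bundle l) _ _ _ (triv_frames z void) fe).
by move=> i j; rewrite !ffunE.
Qed.

Lemma tensA U V W : isomorphic (tens U (tens V W)) (tens (tens U V) W).
Proof.
pose h (p : idx U * idx V * idx W) : idx U * (idx V * idx W) := (p.1.1, (p.1.2, p.2)).
pose h' (p : idx U * (idx V * idx W)) : idx U * idx V * idx W := ((p.1, p.2.1), p.2.2).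
apply: (reindex_isom (h := h) (h' := h')); [by move=> [[]]|by move=> [i []]|] => z.
have [e fe] := frames_ex U z; have [f ff] := frames_ex V z; have [g fg] := frames_ex W z.
exists (mtens e (mtens f g)), (mtens (mtens e f) g); split.
- exact: (@tens_frames _ U (tens V W) _ _ _ fe (tens_frames ff fg)).
- exact: (@tens_frames _ (tens U V) W _ _ _ (tens_frames fe ff) fg).
- by move=> [[i1 i2] i3] [[j1 j2] j3]; rewrite !ffunE mulrA.
Qed.

Lemma tensC U V : isomorphic (tens U V) (tens V U).
Proof.
pose h (A B : Type) (p : A * B) : B * A := (p.2, p.1).
apply: (reindex_isom (h := @h (idx V) (idx U)) (h' := @h (idx U) (idx V))); [by case|by case|] => z.
have [e fe] := frames_ex U z; have [f ff] := frames_ex V z.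
exists (mtens e f), (mtens f e); split; [exact: tens_frames|exact: tens_frames|].
by move=> [i1 i2] [j1 j2]; rewrite !ffunE mulrC.
Qed.

Lemma tens1 V : isomorphic (tens (triv Y unit) V) V.
Proof.
case: V => I s l.
apply: (reindex_isom (h := fun i => (tt, i)) (h' := fun p : unit * I => p.2)); [by []|by case=> [[]]|] => z.
have [e fe] := frames_ex (Bundle l) z; exists (mtens (mat1 unit) e), e; split=> //.
  exact: (@tens_frames _ (triv Y unit) (Bundle l) _ _ _ (triv_frames z unit) fe).
by move=> i j; rewrite !ffunE ?mul1r.
Qed.

Lemma tensDl U V W : isomorphic (tens (dsum U V) W) (dsum (tens U W) (tens V W)).
Proof.
pose h (p : (idx U * idx W + idx V * idx W)%type) : ((idx U + idx V) * idx W)%type := match p with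
  inl i => (inl i.1, i.2) | inr i => (inr i.1, i.2) end.
pose h' (p : ((idx U + idx V) * idx W)%type) : (idx U * idx W + idx V * idx W)%type := match p with
  (inl i, j) => inl (i, j) | (inr i, j) => inr (i, j) end.
apply: (reindex_isom (h := h) (h' := h')); [by case=> [[]|[]]|by case=> [[]]|] => z.
have [e fe] := frames_ex U z; have [f ff] := frames_ex V z; have [g fg] := frames_ex W z.
exists (mtens (msum e f) g), (msum (mtens e g) (mtens f g)); split.
- exact: (@tens_frames _ (dsum U V) W _ _ _ (dsum_frames fe ff) fg).
- exact: (@dsum_frames _ (tens U W) (tens V W) _ _ _ (tens_frames fe fg) (tens_frames ff fg)).
- by move=> [[i1 i2]|[i1 i2]] [[j1 j2]|[j1 j2]]; rewrite ?ffunE ?mul0r.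
Qed.

Lemma tens0 V : isomorphic (tens (triv Y void) V) (triv Y void).
Proof.
pose h' (p : void * idx V) : void := p.1.
pose h (p : void) : void * idx V := match p with end.
apply: (reindex_isom (h := h) (h' := h')); [by case|by case=> [[]]|] => z.
have [e fe] := frames_ex V z; exists (mtens (mat1 void) e), (mat1 void); split.
- exact: (@tens_frames _ (triv Y void) V _ _ _ (triv_frames z void) fe).
- exact: triv_frames.
- by case.
Qed.

(* The type of bundles lives in a universe too large for a quotient by an    *)
(* equivalence relation; that of the bundles indexed by ordinals does not.   *)
Record obundle := OBundle { osize : nat; ostalk : place Y -> set (vec L 'I_osize);
  oloc_free : forall y, exists U : set (place Y), [/\ zopen U, U y &
    exists e : mat L 'I_osize 'I_osize, forall z, U z -> frames z e (ostalk z)] }.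
Coercion bundle_of (s : obundle) : bundle Y := Bundle (@oloc_free s).

Lemma obundle_ex V : exists s : obundle, isomorphic V s.
Proof.
have MN : minv (pullm L (@enum_rank (idx V))) (pullm L (@enum_val _ (idx V))).
  by apply: minvP => v; rewrite !app_pull; apply/ffunP => i; rewrite !ffunE ?enum_rankK ?enum_valK.
exists (@OBundle #|idx V| (stalk (transport MN)) (@loc_free k Y (transport MN))).
exists (pullm L (@enum_val _ (idx V))), (pullm L (@enum_rank (idx V))); split=> [z v hv|z v hv|] //.
  by rewrite /= (minv_r _ MN).
exact: minv_sym.
Qed.
Definition obundle_of V : obundle := projT1 (cid (obundle_ex V)).
Lemma obundle_isom V : isomorphic V (obundle_of V).
Proof. by rewrite /obundle_of; case: cid. Qed.

HB.instance Definition _ := gen_eqMixin obundle.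
HB.instance Definition _ := gen_choiceMixin obundle.

Definition isomb (s t : obundle) : bool := `[< isomorphic s t >].
Fact isomb_refl : reflexive isomb. Proof. by move=> V; apply/asboolP; exact: isom_refl. Qed.
Fact isomb_sym : symmetric isomb.
Proof. by move=> U V; apply/asboolP/asboolP; exact: isom_sym. Qed.
Fact isomb_trans : transitive isomb.
Proof. by move=> V U W /asboolP h1 /asboolP h2; apply/asboolP; exact: isom_trans h1 h2. Qed.
Canonical isom_equiv := EquivRel isomb isomb_refl isomb_sym isomb_trans.
Canonical isom_encmod := defaultEncModRel isomb.
Definition isom_class := {eq_quot isomb}.
HB.instance Definition _ := Choice.on isom_class.

Definition cls V : isom_class := \pi_isom_class (obundle_of V).
Lemma clsP U V : cls U = cls V <-> isomorphic U V.
Proof.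
have hU := obundle_isom U; have hV := obundle_isom V; split.
  move/eqmodP => /asboolP h; apply: isom_trans hU (isom_trans h _); exact: isom_sym.
move=> h; apply/eqmodP/asboolP; apply: isom_trans (isom_sym hU) _; exact: isom_trans h hV.
Qed.
Lemma cls_repr (a : isom_class) : cls (repr a) = a.
Proof.
rewrite -[RHS]reprK; apply/eqmodP/asboolP/isom_sym; exact: obundle_isom.
Qed.

Definition cadd (a b : isom_class) := cls (dsum (repr a) (repr b)).
Definition cmul (a b : isom_class) := cls (tens (repr a) (repr b)).
Lemma caddE U V : cadd (cls U) (cls V) = cls (dsum U V).
Proof. by apply/clsP/isom_dsum; apply/clsP; rewrite cls_repr. Qed.
Lemma cmulE U V : cmul (cls U) (cls V) = cls (tens U V).
Proof. by apply/clsP/isom_tens; apply/clsP; rewrite cls_repr. Qed.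
Lemma cls_ind (P : isom_class -> Prop) : (forall V, P (cls V)) -> forall a, P a.
Proof. by move=> h a; rewrite -[a]cls_repr. Qed.

Fact caddA : associative cadd.
Proof. by do 3!elim/cls_ind=> ?; rewrite !caddE; apply/clsP; exact: dsumA. Qed.
Fact caddC : commutative cadd.
Proof. by do 2!elim/cls_ind=> ?; apply/clsP; exact: dsumC. Qed.
Fact cadd0 : left_id (cls (triv Y void)) cadd.
Proof. by elim/cls_ind=> ?; rewrite !caddE; apply/clsP; exact: dsum0. Qed.
HB.instance Definition _ := GRing.isNmodule.Build isom_class caddA caddC cadd0.
Fact cmulA : associative cmul.
Proof. by do 3!elim/cls_ind=> ?; rewrite !cmulE; apply/clsP; exact: tensA. Qed.
Fact cmulC : commutative cmul.
Proof. by do 2!elim/cls_ind=> ?; apply/clsP; exact: tensC. Qed.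
Fact cmul1 : left_id (cls (triv Y unit)) cmul.
Proof. by elim/cls_ind=> ?; rewrite !cmulE; apply/clsP; exact: tens1. Qed.
Fact cmulD : left_distributive cmul cadd.
Proof. by do 3!elim/cls_ind=> ?; rewrite caddE !cmulE caddE; apply/clsP; exact: tensDl. Qed.
Fact cmul0 : left_zero 0 cmul.
Proof. by elim/cls_ind=> ?; rewrite [LHS]cmulE; apply/clsP; exact: tens0. Qed.
Fact cls_neq0 : cls (triv Y unit) != 0.
Proof.
apply/eqP => /clsP[M [N [_ _ /minv_card]]].
by rewrite !card_unit !card_void.
Qed.
HB.instance Definition _ :=
  GRing.Nmodule_isComNzSemiRing.Build isom_class cmulA cmulC cmul1 cmulD cmul0 cls_neq0.

Lemma clsD U V : cls (dsum U V) = cls U + cls V. Proof. exact: esym (caddE U V). Qed.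
Lemma clsM U V : cls (tens U V) = cls U * cls V. Proof. exact: esym (cmulE U V). Qed.
Lemma cls_pow V n : cls (tens_pow V n) = cls V ^+ n.
Proof. by elim: n => [|n IH] //; rewrite exprS -IH -clsM. Qed.
Lemma cls_mul V n : cls (dsum_mul n V) = cls V *+ n.
Proof. by elim: n => [|n IH] //; rewrite mulrS -IH -clsD. Qed.
Lemma cls_poly f V : cls (poly_bundle f V) = nev (cls V) f.
Proof.
have E (s : seq nat) : cls (foldr (@dsum k Y) (triv Y void) [seq dsum_mul (f`_i)%R (tens_pow V i) | i <- s]) =
    \sum_(i <- s) cls V ^+ i *+ (f`_i)%R.
  elim: s => [|i s IH]; first by rewrite big_nil.
  by rewrite big_cons -IH clsD cls_mul cls_pow.
rewrite nevE -(big_mkord xpredT (fun i => cls V ^+ i *+ (f`_i)%R)) /index_iota subn0.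
exact: E.
Qed.

Lemma finite_bundleP V : finite_bundle V <-> sfinite (cls V).
Proof.
split=> -[f [g [fg h]]]; exists f, g; move: h; rewrite -?cls_poly; first by move/clsP.
by move/clsP.
Qed.

Lemma finite_triv : finite_bundle (triv Y unit).
Proof.
apply/finite_bundleP; exists 1, 'X; split; last by rewrite rmorph1 nevX.
by apply/eqP => /(congr1 (fun p : {poly nat} => size p)); rewrite size_poly1 size_polyX.
Qed.

(** The class of this bundle is (1 + cls U)(1 + cls V). It contains the direct sum and the tensor
    product of [U] and [V] as subbundles, which is what essential finiteness requires. *)
Lemma finite_join U V : finite_bundle U -> finite_bundle V ->
  finite_bundle (dsum (dsum U V) (dsum (triv Y unit) (tens U V))).
Proof.
move=> /finite_bundleP h1 /finite_bundleP h2; apply/finite_bundleP.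
have := sfinite_join h1 h2; rewrite !clsD clsM.
by rewrite [in X in X -> _](_ : (1 + cls U) * (1 + cls V) = cls U + cls V + (1 + cls U * cls V)) //; ring.
Qed.

End IsomClasses.

(** * Operations that preserve finiteness *)

Section FunctorialFiniteness.
Variables (Z Y : curve k) (Phi : bundle Y -> bundle Z).
Hypothesis Phi_isom : forall U V, isomorphic U V -> isomorphic (Phi U) (Phi V).
Hypothesis Phi_dsum : forall U V, isomorphic (Phi (dsum U V)) (dsum (Phi U) (Phi V)).
Hypothesis Phi_tens : forall U V, isomorphic (Phi (tens U V)) (tens (Phi U) (Phi V)).
Hypothesis Phi_triv : forall I, isomorphic (Phi (triv Y I)) (triv Z I).

Lemma Phi_poly f V : isomorphic (Phi (poly_bundle f V)) (poly_bundle f (Phi V)).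
Proof.
have tP n : isomorphic (Phi (tens_pow V n)) (tens_pow (Phi V) n).
  elim: n => [|n IH]; first exact: Phi_triv.
  exact: isom_trans (Phi_tens _ _) (isom_tens (isom_refl _) IH).
have mP n U W : isomorphic (Phi U) W -> isomorphic (Phi (dsum_mul n U)) (dsum_mul n W).
  move=> h; elim: n => [|n IH]; first exact: Phi_triv.
  exact: isom_trans (Phi_dsum _ _) (isom_dsum h IH).
rewrite /poly_bundle; elim: iota => [|i s IH]; first exact: Phi_triv.
exact: isom_trans (Phi_dsum _ _) (isom_dsum (mP _ _ _ (tP _)) IH).
Qed.

Lemma Phi_finite V : finite_bundle V -> finite_bundle (Phi V).
Proof.
case=> f [g [fg h]]; exists f, g; split=> //.
exact: isom_trans (isom_sym (Phi_poly f V)) (isom_trans (Phi_isom h) (Phi_poly g V)).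
Qed.
End FunctorialFiniteness.

(** * Finite and essentially finite bundles *)

Section EssentiallyFinite.
Variables (Y : curve k).
Local Notation L := (ff Y).
Implicit Types (U V W E : bundle Y).

Lemma bdual_triv I : isomorphic (bdual (triv Y I)) (triv Y I).
Proof.
apply: same_frames_isom => z; exists (mat1 I); split; last exact: triv_frames.
have m1 : minv (mat1 I) (mat1 I : mat L I I) by apply: minvP => u; rewrite !app_id.
have := @dual_frames k Y (triv Y I) z _ _ (triv_frames z I) m1.
rewrite (_ : trm (mat1 I) = mat1 I) //; apply/ffunP => i; apply/ffunP => j.
by rewrite !ffunE eq_sym.
Qed.
Lemma bdual_dsum U V : isomorphic (bdual (dsum U V)) (dsum (bdual U) (bdual V)).
Proof.
apply: same_frames_isom => z.
have [e fe [e' ee']] := frames_inv U z.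
have [f ff [f' ff']] := frames_inv V z.
exists (msum (trm e') (trm f')); split; last first.
  exact: (@dsum_frames Y (bdual U) (bdual V) _ _ _ (dual_frames fe ee') (dual_frames ff ff')).
have := @dual_frames k Y (dsum U V) z _ _ (dsum_frames fe ff) (msum_minv ee' ff').
rewrite (_ : trm (msum e' f') = msum (trm e') (trm f')) //.
by apply/ffunP => -[i|i]; apply/ffunP => -[j|j]; rewrite !ffunE.
Qed.
Lemma bdual_tens U V : isomorphic (bdual (tens U V)) (tens (bdual U) (bdual V)).
Proof.
apply: same_frames_isom => z.
have [e fe [e' ee']] := frames_inv U z.
have [f ff [f' ff']] := frames_inv V z.
exists (mtens (trm e') (trm f')); split; last first.
  exact: (@tens_frames Y (bdual U) (bdual V) _ _ _ (dual_frames fe ee') (dual_frames ff ff')).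
have := @dual_frames k Y (tens U V) z _ _ (tens_frames fe ff) (mtens_minv ee' ff').
rewrite (_ : trm (mtens e' f') = mtens (trm e') (trm f')) //.
by apply/ffunP => i; apply/ffunP => j; rewrite !ffunE.
Qed.

Lemma finite_bdual V : finite_bundle V -> finite_bundle (bdual V).
Proof.
apply: Phi_finite; [exact: isom_bdual|exact: bdual_dsum|exact: bdual_tens|exact: bdual_triv].
Qed.
(** Subobjects in the sense of injective homomorphisms, saturated or not. *)
Definition inj_hom S V (M : mat L (idx S) (idx V)) : Prop := @is_hom k Y S V M /\ injective (app M).

Lemma inj_hom_bounds V : exists B : nat, forall S M, @inj_hom S V M ->
  degree S <= B%:Z /\ (rank S <= rank V)%N.
Proof.
have [B hB] := sdeg_bounded V; exists B => S M [hM iM]; split; last first.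
  by have [M' /card_compm] := inj_retract iM.
have [le _] := sdeg_hom hM (@lsubT _ _).
have ker0 : (setT `&` [set v | app M v = 0]) = [set 0].
  apply/seteqP; split=> [v [_ hv]|_ ->]; last by split=> //; exact: app0.
  by apply: iM; rewrite app0.
rewrite ker0 sdeg0 (sdegT S).1 subr0 in le; apply: le_trans le _; apply: hB.
exact/lsub_im/lsubT.
Qed.

Lemma inj_hom_void V : exists M, @inj_hom (triv Y void) V M.
Proof.
exists 0; split=> [y v _|v w _]; first by rewrite app0m; exact: stalk_nil.
by apply/ffunP => -[].
Qed.

Section LegendreTransform.
Variables (a b : int).
Hypothesis a0 : 0 <= a.
Definition wt V : int := a * degree V - b * (rank V)%:Z.

(** The Legendre transform of the Harder-Narasimhan polygon. It is additive on direct sums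
    ([maxwt_dsum]), so a relation between sums of tensor powers becomes a linear equation between
    integers. *)
Definition maxwt V m : Prop := (forall S M, @inj_hom S V M -> wt S <= m) /\
  exists S M, @inj_hom S V M /\ wt S = m.

Lemma wt_void : wt (triv Y void) = 0.
Proof. by rewrite /wt degree_triv /rank card_void !mulr0. Qed.
Lemma maxwt_ex V : exists m, 0 <= m /\ maxwt V m.
Proof.
have [B hB] := inj_hom_bounds V.
pose P m := `[< exists S M, @inj_hom S V M /\ wt S = m%:Z >].
have P0 : exists m, P m.
  exists 0%N; apply/asboolP; have [M hM] := inj_hom_void V.
  by exists (triv Y void), M; rewrite wt_void.
have bd S M : @inj_hom S V M -> wt S <= a * B%:Z + `|b| * (rank V)%:Z.
  move=> /hB[h1 h2]; apply: lerD; first exact: ler_wpM2l.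
  rewrite -mulNr; apply: le_trans (_ : `|b| * (rank S)%:Z <= _).
    by apply: ler_wpM2r => //; rewrite -normrN; exact: ler_norm.
  by apply: ler_wpM2l => //.
have bdP m : P m -> (m <= absz (a * B%:Z + `|b| * (rank V)%:Z)%R)%N.
  move=> /asboolP[S [M [/bd + e]]]; rewrite e => h.
  by rewrite -lez_nat; apply: le_trans h _; exact: ler_norm.
case: (ex_maxnP P0 bdP) => m /asboolP hm mx; exists m%:Z; split=> //; split=> // S M hM.
have [w0|w0] := leP 0 (wt S); last by apply: le_trans (ltW w0) _.
rewrite -[wt S]gez0_abs //; apply: mx; apply/asboolP; exists S, M.
by rewrite gez0_abs.
Qed.

Lemma maxwt_uniq V m n : maxwt V m -> maxwt V n -> m = n.
Proof.
move=> [h1 [S [M [hM eS]]]] [h2 [T [N [hN eT]]]]; apply/eqP; rewrite eq_le.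
by rewrite -{1}eS (h2 _ _ hM) -eT (h1 _ _ hN).
Qed.

Lemma inj_hom_comp S V W M N : @inj_hom S V M -> @inj_hom V W N -> inj_hom (compm N M).
Proof.
move=> [h1 i1] [h2 i2]; split; first exact: is_hom_comp.
by move=> v w; rewrite !appM => /i2/i1.
Qed.

Lemma isom_inj_hom V W : isomorphic V W -> exists M, @inj_hom V W M.
Proof. by case=> M [N [hM _ MN]]; exists M; split=> // v w e; rewrite -(minv_l v MN) e (minv_l _ MN). Qed.
Lemma maxwt_isom V W m : isomorphic V W -> maxwt V m -> maxwt W m.
Proof.
move=> i [h1 [S [M [hM eS]]]]; have [P hP] := isom_inj_hom i.
have [Q hQ] := isom_inj_hom (isom_sym i); split=> [T N hN|].
  exact: h1 (inj_hom_comp hN hQ).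
by exists S, (compm P M); split=> //; exact: inj_hom_comp.
Qed.

Lemma card_splitting I J K (B : mat L J I) B' (N : mat L I K) s :
  splitting B B' N s -> #|I| = (#|J| + #|K|)%N.
Proof.
move=> sp; rewrite -card_sum; apply/esym; apply: (@card_range Y _ _ _ (cols B s) (mat1 I)).
- apply: inj_ker => v; rewrite app_cols => e; apply: partP; apply/ffunP => i.
    have := congr1 (app B') e; rewrite appD (sp_BK sp) (sp_Bs sp) app0 addr0 => ->.
    by rewrite !ffunE.
  have := congr1 (app N) e; rewrite appD (sp_NB sp) (sp_sK sp) app0 add0r => ->.
  by rewrite !ffunE.
- by move=> v w; rewrite !app_id.
- move=> w; split=> _; first by exists w; rewrite app_id.
  by exists (join (app B' w) (app N w)); rewrite app_cols lpart_join rpart_join (sp_dec sp).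
Qed.

Lemma wt_dsum V W : wt (dsum V W) = wt V + wt W.
Proof. rewrite /wt degree_dsum /rank card_sum; ring. Qed.
(** A subobject of the sum is an extension of its image in [W] by its intersection with [V], and
    weights are additive in extensions. *)
Lemma maxwt_dsum V W m n : maxwt V m -> maxwt W n -> maxwt (dsum V W) (m + n).
Proof.
move=> [h1 [S1 [M1 [[hM1 iM1] e1]]]] [h2 [S2 [M2 [[hM2 iM2] e2]]]]; split; last first.
  exists (dsum S1 S2), (msum M1 M2); split; last by rewrite wt_dsum e1 e2.
  split=> [y v [v1 v2]|v w e]; first by split; rewrite ?lpart_msum ?rpart_msum; [exact: hM1|exact: hM2].
  apply: partP; [apply: iM1; rewrite -!(lpart_msum _ M2)|apply: iM2; rewrite -!(rpart_msum M1)];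
    by rewrite e.
move=> S M [hM iM]; pose f : mat L (idx S) (idx W) := compm (pullm L inr) M.
have fE v : app f v = rpart (app M v) by rewrite appM app_pull.
have [J [K [B [B' [N [s [sp hU]]]]]]] := lsub_split (lsub_ker f).
have kf v : app N v = 0 -> rpart (app M v) = 0 by move=> /hU; rewrite /= fE.
have -> : wt S = wt (bsub sp) + wt (bquot sp).
  have rk : rank S = (rank (bsub sp) + rank (bquot sp))%N := card_splitting sp.
  by rewrite /wt (degree_ses sp) rk; ring.
have [[hB iB rB] _] := bsub_sub_of sp.
apply: lerD.
  pose pl : mat L (idx V + idx W)%type (idx V) := pullm L inl.
  apply: (h1 (bsub sp) (compm pl (compm M B))).
  have E c : app (compm pl (compm M B)) c = lpart (app M (app B c)).
    by rewrite appM app_pull appM.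
  split=> [y c hc|c c' e]; first by rewrite E; have [] := hM y _ (hB y c hc).
  apply: iB; apply: iM; apply: partP; first by rewrite -!E.
  by rewrite !kf // (sp_NB sp).
apply: (h2 (bquot sp) (compm f s)); split.
  move=> y _ [v hv <-]; rewrite appM (_ : app f (app s (app N v)) = app f v).
    by rewrite fE; have [] := hM y _ hv.
  have := sp_dec sp v; move/(congr1 (app f)); rewrite appD => <-.
  by rewrite [app f (app B _)](proj2 (hU _)) ?add0r // (sp_NB sp).
apply: inj_ker => w; rewrite appM => /hU; by rewrite (sp_sK sp).
Qed.

Lemma maxwt_void : maxwt (triv Y void) 0.
Proof.
split=> [S M [hM iM]|]; last first.
  by have [M hM] := inj_hom_void (triv Y void); exists (triv Y void), M; rewrite wt_void.
have r0 : rank S = 0%N.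
  apply/eqP; rewrite -leqn0; have [M' /card_compm] := inj_retract iM; by rewrite card_void.
by rewrite /wt r0 (degree_rank0 r0) !mulr0.
Qed.

Lemma maxwt_poly E (D : nat -> int) (f : {poly nat}) n : (size f <= n)%N ->
  (forall i, maxwt (tens_pow E i) (D i)) -> maxwt (poly_bundle f E) (\sum_(i < n) (f`_i)%R%:Z * D i).
Proof.
move=> sf hD.
have mm V m l : maxwt V m -> maxwt (dsum_mul l V) (l%:Z * m).
  move=> h; elim: l => [|l IH]; first by rewrite mul0r; exact: maxwt_void.
  by rewrite intS mulrDl mul1r; exact: maxwt_dsum.
have -> : \sum_(i < n) (f`_i)%R%:Z * D i = \sum_(i < size f) (f`_i)%R%:Z * D i.
  rewrite (big_ord_widen _ (fun i => (f`_i)%R%:Z * D i) sf) [RHS]big_mkcond; apply: eq_bigr => i _.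
  by case: ltnP => // h; rewrite nth_default // mul0r.
rewrite -(big_mkord xpredT (fun i => (f`_i)%R%:Z * D i)) /index_iota subn0.
rewrite /poly_bundle; elim: iota => [|i s IH]; first by rewrite big_nil; exact: maxwt_void.
by rewrite big_cons; apply: maxwt_dsum IH; exact: mm.
Qed.

End LegendreTransform.

(* A subobject of positive slope makes the maximal slopes of the tensor      *)
(* powers strictly increasing; for the slope reached below degree m, the     *)
(* top relation only sees the m-th power.                                    *)
Lemma finite_sub_le E S M : finite_bundle E -> @inj_hom S E M -> degree S <= 0.
Proof.
case=> f [g [fg iso]] [hM iM]; rewrite leNgt; apply/negP => dS.
pose n := maxn (size f) (size g).
have sf : (size f <= n)%N by exact: leq_maxl.
have sg : (size g <= n)%N by exact: leq_maxr.
have [m [fm mlt]] : exists m, f`_m <> g`_m /\ forall i, (m < i)%N -> f`_i = g`_i.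
  pose P i := f`_i != g`_i.
  have exP : exists i, P i.
    apply/not_existsP => h; case/eqP: fg; apply/polyP => i; apply/eqP/negPn/negP.
    exact: h.
  have bdP i : P i -> (i <= n)%N.
    by apply: contraR; rewrite -ltnNge => h; rewrite !nth_default // (leq_trans _ (ltnW h)).
  case: (ex_maxnP exP bdP) => m /eqP h mx; exists m; split=> // i mi; apply/eqP/negPn/negP => /mx.
  by rewrite leqNgt mi.
(* If the powers below the m-th have maximal weight 0, comparing both sides of the relation leaves
   (f_m - g_m) D_m = 0, while a subobject of positive weight in the m-th power makes D_m nonzero. *)
have key a b : 0 <= a -> (forall i, (i < m)%N -> maxwt a b (tens_pow E i) 0) ->
    (exists T N, @inj_hom T (tens_pow E m) N /\ 0 < wt a b T) -> False.
  move=> a0 lo [T [N [hN wT]]].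
  have /choice[D hD] i := maxwt_ex b a0 (tens_pow E i).
  have D0 i : (i < m)%N -> D i = 0.
    by move=> /lo h; apply: maxwt_uniq h; exact: (hD i).2.
  have Dm : D m != 0.
    by have [_ [h _]] := hD m; have := lt_le_trans wT (h _ _ hN); rewrite lt0r => /andP[].
  have e := maxwt_uniq (maxwt_isom iso (maxwt_poly sf (fun i => (hD i).2)))
    (maxwt_poly sg (fun i => (hD i).2)).
  have mn : (m < n)%N.
    rewrite ltnNge; apply/negP => h; apply: fm; rewrite !nth_default //.
      exact: leq_trans sg h.
    exact: leq_trans sf h.
  move/eqP: e; rewrite -subr_eq0 -sumrB (bigD1 (Ordinal mn)) //= big1 ?addr0.
    rewrite -mulrBl mulf_eq0 (negbTE Dm) orbF subr_eq0 => /eqP[]; exact: fm.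
  move=> i; rewrite neq_ltn => /orP[h|h]; first by rewrite D0 // !mulr0.
  by rewrite mlt // subrr.
(* For m = 0 the weight deg + rank serves, with value 1 on the unit bundle. *)
have [m0|m0] := posnP m.
  apply: (key 1 (-1)) => [//|i|]; first by rewrite m0.
  rewrite m0; exists (triv Y unit), (mat1 unit); split.
    by split=> [y v|v w]; rewrite ?app_id.
  by rewrite /wt degree_triv /rank card_unit.
(* A common multiple of all ranks that occur, so that [R] times a slope is an integer. *)
pose R := (\prod_(i < m) (rank (tens_pow E i))`!)%N.
have R0 : (0 < R)%N by apply: prodn_gt0 => i; exact: fact_gt0.
have rR i T N : (i < m)%N -> @inj_hom T (tens_pow E i) N -> (0 < rank T)%N ->
    (R %/ rank T * rank T)%N = R.
  move=> im [_ /inj_retract[N' /card_compm le]] r0; apply/divnK.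
  apply: (@dvdn_trans (rank (tens_pow E i))`!); first by rewrite dvdn_fact // r0.
  by rewrite /R (bigD1 (Ordinal im)) //= dvdn_mulr.
pose P v := `[< exists i T N, [/\ (i < m)%N, @inj_hom T (tens_pow E i) N, (0 < rank T)%N &
  degree T * (R %/ rank T)%:Z = v%:Z] >].
have exP : exists v, P v.
  exists 0%N; apply/asboolP; exists 0%N, (triv Y unit), (mat1 unit); split=> //.
  - by split=> [y v|v w]; rewrite ?app_id.
  - by rewrite /rank card_unit.
  - by rewrite degree_triv.
have /choice[B hB] i := inj_hom_bounds (tens_pow E i).
have bdP v : P v -> (v <= (\sum_(i < m) B i) * R)%N.
  move=> /asboolP[i [T [N [im /hB[h1 _] r0 e]]]].
  have h2 : degree T <= (\sum_(i < m) B i)%N%:Z.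
    by apply: le_trans h1 _; rewrite lez_nat (bigD1 (Ordinal im)) //= leq_addr.
  rewrite -lez_nat -e PoszM; apply: le_trans (_ : (\sum_(i < m) B i)%N%:Z * (R %/ rank T)%:Z <= _).
    exact: ler_wpM2r.
  by apply: ler_wpM2l => //; rewrite lez_nat leq_div.
(* [S0] has the largest slope among the nonzero subobjects of the powers below the m-th. *)
case: (ex_maxnP exP bdP) => v /asboolP[i0 [S0 [M0 [im0 hM0 r0 ev]]]] vmax.
have e0 := rR _ _ _ im0 hM0 r0.
have d0 : 0 <= degree S0.
  have q0 : 0 < (R %/ rank S0)%:Z by rewrite ltz_nat; move: e0 R0; case: (R %/ _)%N => // <-.
  by rewrite -(pmulr_lge0 _ q0) ev.
have low i T N : (i < m)%N -> @inj_hom T (tens_pow E i) N -> wt (rank S0)%:Z (degree S0) T <= 0.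
  move=> im hN; rewrite subr_le0; have [rT|rT] := posnP (rank T).
    by rewrite (degree_rank0 rT) rT !mulr0.
  have [dT|/ltW dT] := leP (degree T) 0.
    by apply: le_trans (_ : 0 <= _); [rewrite mulr_ge0_le0|rewrite mulr_ge0].
  have e1 := rR _ _ _ im hN rT.
  have : degree T * (R %/ rank T)%:Z <= v%:Z.
    rewrite -[X in X <= _]gez0_abs ?mulr_ge0 //; apply: vmax; apply/asboolP.
    by exists i, T, N; rewrite gez0_abs ?mulr_ge0.
  rewrite -ev => h; have R1 : 0 < R%:Z by rewrite ltz_nat.
  move: e1 e0 h; move: (R %/ rank T)%N (R %/ rank S0)%N => q1 q0 e1 e0 h.
  rewrite -(ler_pM2r R1).
  have -> : (rank S0)%:Z * degree T * R%:Z = degree T * q1%:Z * ((rank S0)%:Z * (rank T)%:Z).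
    by rewrite -e1; ring.
  have -> : degree S0 * (rank T)%:Z * R%:Z = degree S0 * q0%:Z * ((rank S0)%:Z * (rank T)%:Z).
    by rewrite -e0; ring.
  exact: ler_wpM2r.
have hT : @inj_hom (tens S S0) (tens_pow E i0.+1) (mtens M M0).
  have [hh0 /inj_retract[M0' e0']] := hM0; have [M' e'] := inj_retract iM.
  split=> [|u w e]; first exact: tens_hom.
  have rK x : app (mtens M' M0') (app (mtens M M0) x) = x.
    by rewrite -appM mtens_comp e' e0' mtens_id app_id.
  by rewrite -[u]rK e.
(* Tensoring with [S], of positive degree, raises the slope above that of [S0]; by the choice of
   [S0] this can only happen in the m-th power. *)
have wT : 0 < wt (rank S0)%:Z (degree S0) (tens S S0).
  rewrite /wt degree_tens rank_tens.
  have -> : (rank S0)%:Z * (degree S * (rank S0)%:Z + degree S0 * (rank S)%:Z) -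
    degree S0 * ((rank S)%:Z * (rank S0)%:Z) = (rank S0)%:Z * (rank S0)%:Z * degree S by ring.
  by rewrite !mulr_gt0.
have im1 : (i0.+1 = m)%N.
  apply/eqP; rewrite eqn_leq im0 leqNgt; apply/negP => h.
  by have := low _ _ _ h hT; rewrite leNgt wT.
apply: (key (rank S0)%:Z (degree S0)) => // [i im|]; last by rewrite -im1; exists (tens S S0), (mtens M M0).
split=> [T N|]; first exact: low.
by have [N hN] := inj_hom_void (tens_pow E i); exists (triv Y void), N; rewrite wt_void.
Qed.

(** [finite_sub_le], applied to the whole of [E] and to the whole of its dual, gives degree 0. *)
Lemma finite_ss0 E : finite_bundle E -> ss0 E.
Proof.
have sI V W M : @is_subbundle k Y V W M -> @inj_hom V W M by case.
move=> fE; apply: ss0I => [|S M /sI]; last exact: finite_sub_le.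
have i1 V : @inj_hom V V (mat1 _) by split=> [y v|v w]; rewrite ?app_id.
apply/eqP; rewrite eq_le (finite_sub_le fE (i1 E)) -oppr_le0 -degree_bdual.
exact: finite_sub_le (finite_bdual fE) (i1 _).
Qed.

Definition subquo V E : Prop := exists W M N,
  [/\ @is_subbundle k Y W E M, @is_surj k Y W V N, degree W = 0 & degree V = 0].

Lemma sub_comp U V W M N : @is_subbundle k Y U V M -> @is_subbundle k Y V W N ->
  is_subbundle (compm N M).
Proof.
move=> [h1 i1 r1] [h2 i2 r2]; split; first exact: is_hom_comp.
  by move=> v w; rewrite !appM => /i2/i1.
by move=> y v; rewrite appM => /r2/r1.
Qed.
Lemma surj_comp U V W M N : @is_surj k Y U V M -> @is_surj k Y V W N -> is_surj (compm N M).
Proof.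
move=> [h1 s1] [h2 s2]; split; first exact: is_hom_comp.
by move=> y w /s2[v /s1[u hu <-] <-]; exists u; rewrite ?appM.
Qed.

Lemma quo_ex V S M : @is_subbundle k Y S V M -> exists Q N,
  [/\ @is_surj k Y V Q N, forall v, app N v = 0 <-> exists c, v = app M c & degree V = degree S + degree Q].
Proof.
move=> hM; have hS := sub_of_range hM.
have [J [K [B [B' [N [s [sp hU]]]]]]] := lsub_split (sub_of_lsub hS).
exists (bquot sp), N; split; last 2 first.
- by move=> v; rewrite -hU.
- rewrite (degree_ses sp) -(sdegE hS).1 -(sdegE (bsub_sub_of sp)).1.
  by congr (sdeg _ + _); apply/seteqP; split=> v /hU.
- by split=> [y v hv|y _ [v hv <-]]; exists v.
Qed.

(** The preimage of [V'] in [E] is the kernel of the composite of [E] onto [W] and [W] onto its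
    quotient by [V']. This is a homomorphism of semistable bundles of degree 0, so the preimage has
    degree 0, and it maps onto [V']. *)
Lemma preim_sub E W V' M N : ss0 E -> @is_surj k Y E W N -> degree W = 0 ->
  @is_subbundle k Y V' W M -> degree V' = 0 -> subquo V' E.
Proof.
move=> sE sN dW hM dV; have sW := ss0_surj sE sN dW.
have [Q [q [sq hq]]] := quo_ex hM; rewrite dW dV add0r => /esym dQ.
have sQ := ss0_surj sW sq dQ; have h := surj_comp sN sq.
have [d0 _ _] := ss0_hom sE sQ h.1.
have [T [P hP]] := sub_of_ex (lsub_ker (compm q N)); have [hTP TU] := hP.
have [hM1 iM rM] := hM; have [M' M'M] := inj_retract iM; have [hP1 iP rP] := hTP.
have inV c : exists u, app N (app P c) = app M u.
  by apply/hq; rewrite -appM; apply/TU; exists c.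
have E1 c : app M (app (compm M' (compm N P)) c) = app N (app P c).
  by have [u hu] := inV c; rewrite !appM hu -(appM M') M'M app_id.
exists T, P, (compm M' (compm N P)); split=> //; last by rewrite -(sdegE hP).1.
split=> [y c hc|y w hw]; first by apply: rM; rewrite E1; apply: sN.1; exact: hP1.
have [v hv ev] := sN.2 y _ (hM1 y w hw).
have [c ec] : exists c, v = app P c.
  by apply/TU; rewrite /= appM; apply/hq; exists w.
by exists c; [apply: rP; rewrite -ec|apply: iM; rewrite E1 -ec].
Qed.

Lemma subquo_refl E : degree E = 0 -> subquo E E.
Proof.
move=> d0; exists E, (mat1 _), (mat1 _); split=> //.
  by split=> [y v|v w|y v]; rewrite ?app_id.
by split=> [y v|y v hv]; [rewrite app_id|exists v; rewrite ?app_id].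
Qed.
Lemma subquo_sub E F V M : @is_subbundle k Y E F M -> subquo V E -> subquo V F.
Proof.
by move=> hM [W [P [N [h1 h2 h3 h4]]]]; exists W, (compm M P), N; split=> //; exact: sub_comp.
Qed.
Lemma subquo_quo E V V' N : @is_surj k Y V V' N -> degree V' = 0 -> subquo V E -> subquo V' E.
Proof.
by move=> hN d0 [W [P [N' [h1 h2 h3 h4]]]]; exists W, P, (compm N N'); split=> //; exact: surj_comp h2 hN.
Qed.
Lemma subquo_subobj E V V' M : ss0 E -> @is_subbundle k Y V' V M -> degree V' = 0 -> subquo V E ->
  subquo V' E.
Proof.
move=> sE hM d0 [W [P [N [h1 h2 h3 h4]]]].
exact: subquo_sub h1 (preim_sub (ss0_subbundle sE h1 h3) h2 h4 hM d0).
Qed.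

(** The tensor product of local retractions is a local retraction, whence saturation. *)
Lemma tens_subbundle U U' V V' M N : @is_subbundle k Y U V M -> @is_subbundle k Y U' V' N ->
  @is_subbundle k Y (tens U U') (tens V V') (mtens M N).
Proof.
move=> hM hN; have [hM1 iM rM] := hM; have [hN1 iN rN] := hN.
have [M' e1] := inj_retract iM; have [N' e2] := inj_retract iN.
split=> [|v w e|y v hv]; first exact: tens_hom.
  have rK x : app (mtens M' N') (app (mtens M N) x) = x.
    by rewrite -appM mtens_comp e1 e2 mtens_id app_id.
  by rewrite -[v]rK e.
have [R1 [f1 g1]] := local_retract y (sub_of_range hM).
have [R2 [f2 g2]] := local_retract y (sub_of_range hN).
have -> : v = app (mtens R1 R2) (app (mtens M N) v).
  by rewrite -appM mtens_comp f1 f2 mtens_id app_id.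
apply: ospan_map hv => _ [a [b [ha hb ->]]]; rewrite app_tens; apply: ospan_gen.
by exists (app R1 a), (app R2 b); split=> //; [exact: g1|exact: g2].
Qed.
Lemma tens_surj U U' V V' M N : @is_surj k Y U V M -> @is_surj k Y U' V' N ->
  @is_surj k Y (tens U U') (tens V V') (mtens M N).
Proof.
move=> [h1 s1] [h2 s2]; split; first exact: tens_hom.
move=> y w; elim=> [|c _ x hc [a [b [/s1[a' ha <-] /s2[b' hb <-] ->]]] _ [v hv <-]].
  by exists 0; [exact: stalk_nil|rewrite app0].
exists (c *: vtens a' b' + v); last by rewrite appD appZ app_tens.
by apply: stalk_lin => //; apply: ospan_gen; exists a', b'.
Qed.
Lemma subquo_tens V V' E E' : subquo V E -> subquo V' E' -> subquo (tens V V') (tens E E').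
Proof.
move=> [W [M [N [h1 h2 h3 h4]]]] [W' [M' [N' [h1' h2' h3' h4']]]].
exists (tens W W'), (mtens M M'), (mtens N N'); split.
- exact: tens_subbundle.
- exact: tens_surj.
- by rewrite degree_tens h3 h3'.
- by rewrite degree_tens h4 h4'.
Qed.
Lemma subquo_dsum V V' E E' : subquo V E -> subquo V' E' -> subquo (dsum V V') (dsum E E').
Proof.
move=> [W [M [N [[a1 a2 a3] [b1 b2] h3 h4]]]] [W' [M' [N' [[a1' a2' a3'] [b1' b2'] h3' h4']]]].
exists (dsum W W'), (msum M M'), (msum N N'); split.
- split=> [y v [v1 v2]|v w e|y v].
  + by split; rewrite ?lpart_msum ?rpart_msum; [exact: a1|exact: a1'].
  + by apply: partP; [apply: a2; rewrite -!(lpart_msum _ M')|apply: a2'; rewrite -!(rpart_msum M)]; rewrite e.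
  + by case; rewrite lpart_msum rpart_msum => /a3 ? /a3'.
- split=> [y v [v1 v2]|y w [/b2[v hv ev] /b2'[v' hv' ev']]].
    by split; rewrite ?lpart_msum ?rpart_msum; [exact: b1|exact: b1'].
  exists (join v v'); first by split; rewrite ?lpart_join ?rpart_join.
  by apply: partP; rewrite ?lpart_msum ?rpart_msum ?lpart_join ?rpart_join.
- by rewrite degree_dsum h3 h3'.
- by rewrite degree_dsum h4 h4'.
Qed.

Lemma trm_subbundle V W N : @is_surj k Y W V N -> @is_subbundle k Y (bdual V) (bdual W) (trm N).
Proof.
move=> sN; have [hN s] := sN; split=> [y xi hxi v hv|xi eta e|y xi hxi w /s[v hv <-]].
- by rewrite app_trm; apply: hxi; exact: hN.
- by apply: dotpP => w; have [v <-] := surj_gen sN w; rewrite -!app_trm e.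
- by rewrite -app_trm; exact: hxi.
Qed.
Lemma trm_surj V W M : @is_subbundle k Y W V M -> @is_surj k Y (bdual V) (bdual W) (trm M).
Proof.
move=> hM; have [h1 iM rM] := hM; split=> [y xi hxi v hv|y xi hxi].
  by rewrite app_trm; apply: hxi; exact: h1.
have [R [f g]] := local_retract y (sub_of_range hM); exists (app (trm R) xi).
  by move=> v hv; rewrite app_trm; apply: hxi; exact: g.
by apply: dotpP => v; rewrite !app_trm -(appM R) f app_id.
Qed.
Lemma subquo_bdual V E : ss0 E -> subquo V E -> subquo (bdual V) (bdual E).
Proof.
move=> sE [W [M [N [h1 h2 h3 h4]]]]; apply: (preim_sub (ss0_bdual sE) (trm_surj h1) _ (trm_subbundle h2)).
  by rewrite degree_bdual h3.
by rewrite degree_bdual h4.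
Qed.

Lemma sub_inl U V : @is_subbundle k Y U (dsum U V) (inlm Y (idx U) (idx V)).
Proof.
split=> [y v hv|v w e|y v]; first by split; rewrite ?lpart_inl ?rpart_inl //; exact: stalk_nil.
  by rewrite -(lpart_inl (idx V) v) e lpart_inl.
by case; rewrite lpart_inl.
Qed.
Lemma sub_inr U V : @is_subbundle k Y V (dsum U V) (inrm Y (idx U) (idx V)).
Proof.
split=> [y v hv|v w e|y v]; first by split; rewrite ?lpart_inr ?rpart_inr //; exact: stalk_nil.
  by rewrite -(rpart_inr (idx U) v) e rpart_inr.
by case; rewrite rpart_inr.
Qed.

(** Subquotients of degree 0 inherit semistability from the finite bundle, by [finite_ss0]. *)
Lemma essentially_finiteP V : essentially_finite V <-> exists2 E, finite_bundle E & subquo V E.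
Proof.
split=> [[E [W [M [N [fE h1 h2 [_ h3] [_ h4]]]]]]|[E fE [W [M [N [h1 h2 h3 h4]]]]]].
  by exists E => //; exists W, M, N.
have sE := finite_ss0 fE; have sW := ss0_subbundle sE h1 h3.
exists E, W, M, N; split=> //; apply/semistable0P => //.
exact: ss0_surj sW h2 h4.
Qed.

Variables (gT : finGroupType) (A : curve_action gT Y) (y : place Y).

Lemma Nori_tannakian : neutral_tannakian_sub (fiber_functor A y) (@Nori k Y gT A).
Proof.
have cl : tensor_closed (@Nori k Y gT A).
  split=> [|V W|V].
  - apply/essentially_finiteP; exists (triv Y unit); first exact: finite_triv.
    exact: subquo_refl (degree_triv _ _).
  - move=> /essentially_finiteP[E fE hE] /essentially_finiteP[F fF hF]; apply/essentially_finiteP.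
    (* The finite bundle of [finite_join], whose last summand is the tensor product. *)
    exists (dsum (dsum E F) (dsum (triv Y unit) (tens E F))); first exact: finite_join.
    apply: subquo_sub (sub_inr _ _) _; apply: subquo_sub (sub_inr _ _) _; exact: subquo_tens.
  - move=> /essentially_finiteP[E fE hE]; apply/essentially_finiteP; exists (bdual E).
      exact: finite_bdual.
    exact: subquo_bdual (finite_ss0 fE) hE.
exists cl; apply: tannakian_criterion.
- by move=> V [E [W [M [N [_ _ _ _ /semistable0P]]]]].
- move=> V W /essentially_finiteP[E fE hE] /essentially_finiteP[F fF hF]; apply/essentially_finiteP.
  exists (dsum (dsum E F) (dsum (triv Y unit) (tens E F))); first exact: finite_join.
  apply: subquo_sub (sub_inl _ _) _; exact: subquo_dsum.
- move=> V W i /essentially_finiteP[E fE hE] hi d0; apply/essentially_finiteP; exists E => //.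
  exact: subquo_subobj (finite_ss0 fE) hi d0 hE.
- move=> V W q /essentially_finiteP[E fE hE] hq d0; apply/essentially_finiteP; exists E => //.
  exact: subquo_quo hq d0 hE.
Qed.

End EssentiallyFinite.

(** * Primitive elements of Galois covers *)

Section PrimitiveElement.
Variables (Y X : curve k) (gT : finGroupType) (f : galois_cover gT Y X).
Local Notation s := (cm_fun f).
Local Notation sg := (fun g => cm_fun (gc_act f g)).

Lemma closed_uniq_seq n : exists2 rs : seq k, uniq rs & size rs = n.
Proof.
elim: n => [|n [rs u sz]]; first by exists [::].
have [|x] := @closed_rootP k (\prod_(c <- rs) ('X - c%:P) * 'X + 1) _.
  rewrite size_polyDl ?size_mulX ?monic_neq0 ?monic_prod_XsubC ?size_prod_XsubC ?size_poly1 //.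
rewrite /root !hornerE => /eqP h; exists (x :: rs); rewrite /= ?sz // u andbT.
apply: contra_eqN h => xrs; rewrite (_ : (_).[x] = 0) ?mul0r ?add0r ?oner_neq0 //.
by apply/eqP; rewrite -/(root _ x) root_prod_XsubC.
Qed.

Lemma cst_nonroot (p : {poly ff Y}) : p != 0 -> exists c, p.[kcst Y c] != 0.
Proof.
move=> p0; have [rs u sz] := closed_uniq_seq (size p); apply: contrapT => h.
have : (size (map (kcst Y) rs) < size p)%N; last by rewrite size_map sz ltnn.
apply: max_poly_roots => //; last by rewrite map_inj_uniq //; exact: fmorph_inj.
apply/allP => _ /mapP[c _ ->]; apply: contra_notT h => h; by exists c.
Qed.

Lemma sgM g h a : sg (g * h)%g a = sg h (sg g a). Proof. exact: caM. Qed.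
Lemma sg1 a : sg 1%g a = a. Proof. exact: ca1. Qed.

(** The polynomial with generators of [ff Y] over [ff X] as coefficients is moved by every
    nontrivial group element. Its value at a constant, which the group fixes, has the same property
    unless the constant is among finitely many roots. *)
Lemma primitive_ex : exists t : ff Y, forall g, sg g t = t -> g = 1%g.
Proof.
have [_ [n [b hb]] _] := gc_cov f.
pose a := \poly_(j < n) (if insub j is Some i then b i else 0).
have aE (j : 'I_n) : a`_j = b j by rewrite coef_poly ltn_ord valK.
pose d g := map_poly (sg g) a - a.
have d0 g : g != 1%g -> d g != 0.
  apply: contra_neq => /eqP; rewrite subr_eq0 => /eqP e; apply: (@gc_faithful _ _ _ _ f g) => x.
  have [c ->] := hb x; rewrite rmorph_sum; apply: eq_bigr => j _.
  rewrite rmorphM gc_over; congr (_ * _).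
  by have := congr1 (fun p : {poly ff Y} => p`_j) e; rewrite coef_map !aE.
have [|c hc] := @cst_nonroot (\prod_(g | g != 1%g) d g).
  by apply/prodf_neq0.
exists a.[kcst Y c] => g e; apply: contra_neqP hc => g1.
rewrite horner_prod (bigD1 g) /=; last exact/eqP.
rewrite hornerD hornerN.
by rewrite -{1}(ca_lin (gc_act f) g c) horner_map e subrr mul0r.
Qed.

Variable t : ff Y.
Hypothesis ht : forall g, sg g t = t -> g = 1%g.

Lemma conj_inj g h : sg g t = sg h t -> g = h.
Proof.
move=> e; apply/eqP; rewrite eq_mulgV1; apply/eqP/ht.
by rewrite sgM e -sgM mulgV sg1.
Qed.

Lemma invariant_poly (p : {poly ff Y}) : (forall g, map_poly (sg g) p = p) ->
  exists r : {poly ff X}, p = map_poly s r.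
Proof.
move=> h; have /choice[c hc] i : exists c, p`_i = s c.
  apply: gc_quotient => g; have := congr1 (fun q : {poly ff Y} => q`_i) (h g).
  by rewrite coef_map.
exists (\poly_(i < size p) c i); apply/polyP => i; rewrite coef_map coef_poly.
by case: ltnP => [_|h']; [exact: hc|rewrite nth_default //; exact: esym (rmorph0 s)].
Qed.

(** The Lagrange polynomial taking the value g(a) at each conjugate g(t) is invariant, so its
    coefficients are in [ff X]. *)
Lemma primitive_span a : exists r : {poly ff X}, (map_poly s r).[t] = a.
Proof.
pose R := \sum_g (sg g a)%:P * \prod_(h | h != g) (('X - (sg h t)%:P) * ((sg g t - sg h t)^-1)%:P).
have [g|r eR] := @invariant_poly R.
  rewrite rmorph_sum [RHS](reindex_inj (mulIg g)); apply: eq_bigr => u _.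
  rewrite rmorphM /= map_polyC /= -sgM rmorph_prod; congr (_ * _).
  rewrite [RHS](reindex_inj (mulIg g)); apply: eq_big => [h|h _]; first by rewrite (inj_eq (mulIg g)).
  rewrite rmorphM rmorphB /= map_polyX !map_polyC /= fmorphV rmorphB.
  by rewrite -[cm_fun _ (cm_fun _ _)](sgM h g) -[cm_fun _ (cm_fun _ _)](sgM u g).
exists r; rewrite -eR horner_sum (bigD1 1%g) //= hornerM hornerC sg1 horner_prod.
rewrite [X in a * X]big1 ?mulr1 => [|h h1]; last first.
  rewrite hornerM hornerXsubC hornerC sg1 divff // subr_eq0; apply: contra_neq h1 => /esym.
  by move/ht.
rewrite big1 ?addr0 // => g g1; rewrite hornerM horner_prod (bigD1 1%g) 1?eq_sym //=.
by rewrite hornerM hornerXsubC sg1 subrr !mul0r mulr0.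
Qed.

Lemma conj_poly_ex : exists m : {poly ff X}, map_poly s m = \prod_g ('X - (sg g t)%:P).
Proof.
have [g|m ->] := @invariant_poly (\prod_g ('X - (sg g t)%:P)); last by exists m.
rewrite rmorph_prod [RHS](reindex_inj (mulIg g)); apply: eq_bigr => h _.
by rewrite rmorphB /= map_polyX map_polyC sgM.
Qed.

Variable m : {poly ff X}.
Hypothesis hm : map_poly s m = \prod_g ('X - (sg g t)%:P).

Lemma conj_poly_seq : map_poly s m = \prod_(z <- [seq sg g t | g <- enum gT]) ('X - z%:P).
Proof. by rewrite big_map big_enum. Qed.
Lemma conj_uniq : uniq [seq sg g t | g <- enum gT].
Proof. by rewrite map_inj_uniq ?enum_uniq //; exact: conj_inj. Qed.
Lemma conj_poly_dvd r : (map_poly s r).[t] = 0 -> m %| r.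
Proof.
move=> r0; rewrite -(dvdp_map s) conj_poly_seq; apply: uniq_roots_dvdp; last first.
  by rewrite uniq_rootsE; exact: conj_uniq.
apply/allP => _ /mapP[g _ ->]; rewrite /root.
have -> : map_poly s r = map_poly (sg g) (map_poly s r).
  by rewrite -map_poly_comp; apply: eq_map_poly => x; rewrite /= gc_over.
by rewrite horner_map r0 rmorph0.
Qed.

Lemma conj_poly_sep : separable_poly m.
Proof.
rewrite -(separable_map s) conj_poly_seq separable_prod_XsubC; exact: conj_uniq.
Qed.

Lemma conj_poly_size : (1 < size m)%N.
Proof.
rewrite -(size_map_poly s) conj_poly_seq size_prod_XsubC size_map -cardE.
by rewrite (cardD1 1%g).
Qed.

Variables (E : fieldType) (i : {rmorphism ff X -> E}).

(** By [primitive_span] and [conj_poly_dvd], [ff Y] is the quotient of the polynomial ring over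
    [ff X] by [m]. *)
Lemma embedding_ex t' : root (map_poly i m) t' ->
  exists2 e : {rmorphism ff Y -> E}, forall b, e (s b) = i b & e t = t'.
Proof.
move=> rt; have /choice[r hr] := primitive_span.
have well p q : (map_poly s p).[t] = (map_poly s q).[t] -> (map_poly i p).[t'] = (map_poly i q).[t'].
  move=> e; apply/eqP; rewrite -subr_eq0 -hornerN -hornerD -rmorphB.
  have /dvdpP[u ->] : m %| p - q by apply: conj_poly_dvd; rewrite rmorphB hornerD hornerN e subrr.
  by rewrite rmorphM hornerM (rootP rt) mulr0.
pose e a := (map_poly i (r a)).[t'].
have eE p : e (map_poly s p).[t] = (map_poly i p).[t'] by apply: well.
have eB : zmod_morphism e.
  by move=> a b; rewrite -{1}[a]hr -{1}[b]hr -hornerN -hornerD -rmorphB eE rmorphB hornerD hornerN.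
have eM : monoid_morphism e.
  split=> [|a b]; last by rewrite -{1}[a]hr -{1}[b]hr -hornerM -rmorphM eE rmorphM hornerM.
  by have := eE 1; rewrite !rmorph1 !hornerC.
pose mz := GRing.isZmodMorphism.Build _ _ e eB.
pose mm := GRing.isMonoidMorphism.Build _ _ e eM.
pose e' : {rmorphism ff Y -> E} := HB.pack e mz mm.
exists e' => [b|]; first by have := eE b%:P; rewrite !map_polyC !hornerC.
by have := eE 'X; rewrite !map_polyX !hornerX.
Qed.

(** [v t] is a root of the image of [m] under [u], hence the image of a conjugate of [t], and [t]
    generates [ff Y]. *)
Lemma embedding_uniq (u v : {rmorphism ff Y -> E}) : (forall b, u (s b) = v (s b)) ->
  exists g, forall a, v a = u (sg g a).
Proof.
move=> uv; have rv : root (map_poly u (map_poly s m)) (v t).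
  have -> : map_poly u (map_poly s m) = map_poly v (map_poly s m).
    by rewrite -!map_poly_comp; apply: eq_map_poly => x /=.
  rewrite /root horner_map conj_poly_seq (_ : (_).[t] = 0) ?rmorph0 //.
  apply/eqP; rewrite -/(root _ t) root_prod_XsubC; apply/mapP; exists 1%g; rewrite ?mem_enum //.
  by rewrite sg1.
have [g eg] : exists g, v t = u (sg g t).
  move: rv; rewrite hm rmorph_prod; rewrite (eq_bigr (fun g => 'X - (u (sg g t))%:P)) => [|g _].
    rewrite /root horner_prod => /prodf_eq0[g _]; rewrite hornerXsubC subr_eq0 => /eqP eg.
    by exists g.
  by rewrite rmorphB /= map_polyX map_polyC.
exists g => a; have [r <-] := primitive_span a.
rewrite -[cm_fun _ _](horner_map (sg g)) -[u _]horner_map -[v _]horner_map eg; congr (_.[_]).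
by rewrite -!map_poly_comp; apply: eq_map_poly => x /=; rewrite gc_over.
Qed.

End PrimitiveElement.

(** Elements of a simple extension of finite degree are polynomials in the generator, so closure
    under sums and products is enough. *)
Lemma adjoin_seq_ind (F : fieldType) (L : fieldExtType F) (S : set L) (rs : seq L) :
  (forall a b, S a -> S b -> S (a + b)) -> (forall a b, S a -> S b -> S (a * b)) ->
  (forall c, S c%:A) -> (forall z, z \in rs -> S z) -> forall a, a \in <<1 & rs>>%VS -> S a.
Proof.
move=> SD SM SC Srs.
suff key (E : {subfield L}) : (forall a, a \in E -> S a) -> forall a, a \in <<E & rs>>%VS -> S a.
  by apply: key => _ /vlineP[c ->].
elim: rs E Srs => [|z rs IH] E Srs SE a; first by rewrite adjoin_nil subfield_closed; exact: SE.
rewrite adjoin_cons; apply: IH => [w wrs|b bE]; first by apply: Srs; rewrite inE wrs orbT.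
have Sz : S z by apply: Srs; rewrite mem_head.
rewrite -(Fadjoin_poly_eq bE); move: (Fadjoin_polyOver E z b); move: (Fadjoin_poly _ _ _) => p.
elim/poly_ind: p => [|p c IHp] pE; first by rewrite horner0 -(scale0r 1).
rewrite hornerMXaddC; apply: (SD); first apply: (SM) => //.
  apply: IHp; apply/polyOverP => i; have /polyOverP/(_ i.+1) := pE.
  by rewrite coefD coefMX coefC addr0.
by apply: SE; have /polyOverP/(_ 0%N) := pE; rewrite coefD coefMX coefC add0r.
Qed.

(** * The compositum of two Galois covers *)

Section Compositum.
Variables (X Y1 Y2 : curve k) (gT1 gT2 : finGroupType).
Variables (f1 : galois_cover gT1 Y1 X) (f2 : galois_cover gT2 Y2 X).

Lemma embed_mor (L : splittingFieldType (ff X)) (galL : galois 1 {:L}) (Y : curve k)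
    (gT : finGroupType) (f : galois_cover gT Y X) (e : {rmorphism ff Y -> L}) :
  (forall b, e (cm_fun f b) = in_alg L b) ->
  exists2 u : curve_mor (gal_curve L) Y, cm_fun u = e & forall b, cm_fun u (cm_fun f b) = cm_fun (gal_cover galL) b.
Proof.
move=> he; have lin c : (e : {rmorphism ff Y -> ff (gal_curve L)}) (kcst Y c) = kcst (gal_curve L) c.
  by have [lf _ _] := gc_cov f; rewrite -lf.
have sp (a : (ff (gal_curve L))^o) : in_span (e : {rmorphism ff Y -> ff (gal_curve L)})
    (fun i : 'I_(\dim {:L}) => (vbasis {:L})`_i : (ff (gal_curve L))^o) a.
  have [c ->] := @vect_span X L a; exists (fun i => cm_fun f (c i)).
  by apply: eq_bigr => i _; rewrite he.
by exists (mor_of lin sp).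
Qed.

(** The curve of the splitting field of [m1 * m2], for the conjugate polynomials of two primitive
    elements. Each root generating this field is in the image of [ff Y1] or of [ff Y2], which gives
    the last property. *)
Lemma compositum_ex : exists (Z : curve k) (gT : finGroupType) (f : galois_cover gT Z X)
    (u1 : curve_mor Z Y1) (u2 : curve_mor Z Y2), [/\ forall b, cm_fun u1 (cm_fun f1 b) = cm_fun f b,
      forall b, cm_fun u2 (cm_fun f2 b) = cm_fun f b &
      forall S : set (ff Z), (forall a b, S a -> S b -> S (a + b)) ->
        (forall a b, S a -> S b -> S (a * b)) -> (forall c, S (cm_fun u1 c)) ->
        (forall c, S (cm_fun u2 c)) -> forall a, S a].
Proof.
have [t1 ht1] := primitive_ex f1; have [m1 hm1] := conj_poly_ex f1 t1.
have [t2 ht2] := primitive_ex f2; have [m2 hm2] := conj_poly_ex f2 t2.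
have z1 := conj_poly_size hm1; have z2 := conj_poly_size hm2.
have n1 : m1 != 0 by rewrite -size_poly_gt0 ltnW.
have n2 : m2 != 0 by rewrite -size_poly_gt0 ltnW.
have [L sL] := splitting_ex (mulf_neq0 n1 n2); have [rs ers grs] := sL.
have sp1 := conj_poly_sep ht1 hm1; have sp2 := conj_poly_sep ht2 hm2.
have rootE z : z \in rs -> root (map_poly (in_alg L) m1) z || root (map_poly (in_alg L) m2) z.
  by rewrite -root_prod_XsubC -(eqp_root ers) rmorphM rootM.
have galL : galois 1 {:L}.
  apply/and3P; split; first exact: sub1v.
    rewrite -grs; apply: separable_Fadjoin_seq; apply/allP => z /rootE h; apply/separable_elementP.
    have [r|r] := orP h; [exists (map_poly (in_alg L) m1)|exists (map_poly (in_alg L) m2)];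
      by rewrite separable_map; split=> //; apply/polyOver1P; eexists.
  apply/splitting_normalField; first exact: sub1v.
  by exists (map_poly (in_alg L) (m1 * m2)) => //; apply/polyOver1P; exists (m1 * m2).
have rex (m : {poly ff X}) : (1 < size m)%N -> m %| m1 * m2 -> exists z, root (map_poly (in_alg L) m) z.
  move=> zm; rewrite -(dvdp_map (in_alg L)) (eqp_dvdr _ ers) => /dvdp_prod_XsubC[ma].
  move=> e; move: (eqp_size e); rewrite size_map_poly size_prod_XsubC.
  case: mask e => [|z zs] e es; first by rewrite es in zm.
  by exists z; rewrite (eqp_root e) root_prod_XsubC mem_head.
have [r1 hr1] := rex m1 z1 (dvdp_mulr _ (dvdpp _)).
have [r2 hr2] := rex m2 z2 (dvdp_mull _ (dvdpp _)).
have [e1 he1 et1] := embedding_ex ht1 hm1 hr1; have [e2 he2 et2] := embedding_ex ht2 hm2 hr2.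
have [u1 eu1 hu1] := embed_mor galL he1; have [u2 eu2 hu2] := embed_mor galL he2.
exists (gal_curve L), (gal_of {:L}), (gal_cover galL), u1, u2; split=> // S SD SM S1 S2 a.
apply: (@adjoin_seq_ind _ L S rs) => //; last by rewrite grs memvf.
  by move=> c; rewrite -[_%:A](hu1 c).
have conj_im (Y : curve k) gT (f : galois_cover gT Y X) (t : ff Y) m (e : {rmorphism ff Y -> L}) z :
    map_poly (cm_fun f) m = \prod_g ('X - (cm_fun (gc_act f g) t)%:P) ->
    (forall b, e (cm_fun f b) = in_alg L b) -> root (map_poly (in_alg L) m) z -> exists c, z = e c.
  move=> hm he; have -> : map_poly (in_alg L) m = map_poly e (map_poly (cm_fun f) m).
    by rewrite -map_poly_comp; apply: eq_map_poly => x /=.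
  rewrite hm rmorph_prod /root horner_prod => /prodf_eq0[g _].
  rewrite rmorphB /= map_polyX map_polyC hornerXsubC subr_eq0 => /eqP->.
  by exists (cm_fun (gc_act f g) t).
move=> z /rootE/orP[h|h].
  by have [c ->] := conj_im _ _ _ _ _ _ _ hm1 he1 h; rewrite -eu1.
by have [c ->] := conj_im _ _ _ _ _ _ _ hm2 he2 h; rewrite -eu2.
Qed.

End Compositum.

(** * Maps between fraction fields and between completions *)

Section FractionMaps.
Variables (R S : idomainType).

Lemma frac_ex (w : {fraction R}) : exists a b : R, b != 0 /\ w = tofrac a / tofrac b.
Proof.
elim/quotW: w => x; have d0 := denom_ratioP x; exists \n_x, \d_x; split=> //.
apply: (mulIf (_ : tofrac \d_x != 0)); first by rewrite tofrac_eq0.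
rewrite divfK ?tofrac_eq0 // !piE; apply/eqmodP.
by rewrite /= FracField.equivfE !numden_Ratio ?mulr1 ?oner_neq0 // mulrC.
Qed.

Lemma frac_map_ex (phi : {rmorphism R -> S}) : injective phi ->
  exists kappa : {rmorphism {fraction R} -> {fraction S}}, forall a, kappa (tofrac a) = tofrac (phi a).
Proof.
move=> inj; have /choice[n /choice[d h]] := frac_ex.
have phi0 b : b != 0 -> tofrac (phi b) != 0.
  by move=> b0; rewrite tofrac_eq0 -(rmorph0 phi) (inj_eq inj).
pose kp w : {fraction S} := tofrac (phi (n w)) / tofrac (phi (d w)).
have kE a b : b != 0 -> kp (tofrac a / tofrac b) = tofrac (phi a) / tofrac (phi b).
  move=> b0; set w := _ / _; have [d0 e] := h w.
  have b1 : tofrac b != 0 by rewrite tofrac_eq0.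
  have d1 : tofrac (d w) != 0 by rewrite tofrac_eq0.
  apply/eqP; rewrite eqr_div ?phi0 // -!rmorphM; apply/eqP; congr (tofrac (phi _)).
  apply/eqP; rewrite -tofrac_eq !rmorphM -eqr_div // -e.
  by [].
have kB : zmod_morphism kp.
  move=> v w; have [a [b [b0 ->]]] := frac_ex v; have [a' [b' [b0' ->]]] := frac_ex w.
  rewrite -mulNr addf_div ?tofrac_eq0 // -!rmorphN -!rmorphM -rmorphD !kE ?mulf_neq0 //.
  by rewrite -mulNr addf_div ?phi0 // !(rmorphM, rmorphD, rmorphN).
have kM : monoid_morphism kp.
  split=> [|v w].
    by rewrite -[1 in LHS](divff (oner_neq0 _)) kE ?oner_neq0 // rmorph1 divff ?oner_neq0.
  have [a [b [b0 ->]]] := frac_ex v; have [a' [b' [b0' ->]]] := frac_ex w.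
  by rewrite mulf_div -!rmorphM !kE ?mulf_neq0 // mulf_div -!rmorphM.
pose mz := GRing.isZmodMorphism.Build _ _ kp kB.
pose mm := GRing.isMonoidMorphism.Build _ _ kp kM.
pose kappa : {rmorphism {fraction R} -> {fraction S}} := HB.pack kp mz mm.
exists kappa => a; have := kE a 1 (oner_neq0 _).
by rewrite !rmorph1 !divr1.
Qed.
End FractionMaps.

Section CompletionRelation.
Variables (X : curve k) (x : place X).

Lemma compl_piP (u v : cseq x) : (\pi_(compl_ring x) u = \pi_(compl_ring x) v) <->
  forall n, exists N, forall i, (N <= i)%N -> in_pow x n (u i - v i).
Proof.
split=> [/eqP|h]; first by rewrite -Quotient.idealrBE => /asboolP.
by apply/eqP; rewrite -Quotient.idealrBE; apply/asboolP.
Qed.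

Lemma compl_ind (T : compl_ring x -> Prop) : (forall u, T (\pi_(compl_ring x) u)) -> forall a, T a.
Proof. by move=> h a; rewrite -[a]reprK. Qed.
Lemma compl_piB (u v : cseq x) : \pi_(compl_ring x) (u - v) = \pi_(compl_ring x) u - \pi_(compl_ring x) v.
Proof. exact: (raddfB (\pi_(compl_ring x))). Qed.
Lemma compl_piM (u v : cseq x) : \pi_(compl_ring x) (u * v) = \pi_(compl_ring x) u * \pi_(compl_ring x) v.
Proof. exact: (rmorphM (\pi_(compl_ring x))). Qed.
Lemma compl_pi1 : \pi_(compl_ring x) 1 = 1.
Proof. exact: (rmorph1 (\pi_(compl_ring x))). Qed.

Fact const_cauchy a : in_ring x a -> (fun=> a) \in cauchyb x.
Proof.
by move=> ha; apply/asboolP; split=> // n; exists 0%N => i j _ _; rewrite subrr in_pow0.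
Qed.
Definition const (a : ff X) : compl_ring x :=
  if pselect (in_ring x a) is left h then \pi_(compl_ring x) (CSeq (const_cauchy h)) else 0.
Lemma constE a (u : cseq x) : (forall i, u i = a) -> const a = \pi_(compl_ring x) u.
Proof.
move=> hu; rewrite /const; case: pselect => [h|[]]; last first.
  by rewrite -(hu 0%N); have /asboolP[] := cseqP u.
by apply/compl_piP => n; exists 0%N => i _; rewrite hu subrr in_pow0.
Qed.
Lemma const_seq a : in_ring x a -> exists2 u : cseq x, forall i, u i = a & const a = \pi_(compl_ring x) u.
Proof. by move=> h; exists (CSeq (const_cauchy h)) => //; exact: constE. Qed.
Lemma constD a b : in_ring x a -> in_ring x b -> const (a + b) = const a + const b.
Proof.
move=> /const_seq[u hu ->] /const_seq[v hv ->].
rewrite -[RHS](raddfD (\pi_(compl_ring x))).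
by apply: constE => i; rewrite /= fctE hu hv.
Qed.
Lemma constM a b : in_ring x a -> in_ring x b -> const (a * b) = const a * const b.
Proof.
by move=> /const_seq[u hu ->] /const_seq[v hv ->]; rewrite -compl_piM; apply: constE => i; rewrite /= fctE hu hv.
Qed.
Lemma const_eq0 a : in_ring x a -> const a = 0 -> a = 0.
Proof.
move=> ha; have [u hu ->] := const_seq ha; have -> : 0 = \pi_(compl_ring x) 0 by rewrite raddf0.
move/compl_piP => h; apply/eqP/negP => /negP a0.
have [n] : exists n : nat, ~~ in_pow x n a.
  by exists (absz (vord x a)).+1; rewrite /in_pow; lia.
by apply/negP/negPn; have [N /(_ N (leqnn N))] := h n; rewrite hu subr0.
Qed.

Lemma frac_of_ring a : exists b c, [/\ in_ring x b, in_ring x c, c != 0 & a = b / c].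
Proof.
have [ha|ha] := boolP (in_ring x a).
  by exists a, 1; rewrite in_ring1 oner_neq0 divr1.
have a0 : a != 0 by apply: contraNneq ha => ->; exact: in_pow0.
exists 1, a^-1; rewrite in_ring1 invr_eq0 invrK mul1r; split=> //.
by move: ha; rewrite !in_ringE !vgeE ?invr_eq0 // vordV; lia.
Qed.

End CompletionRelation.

Section CompletionMaps.
Variables (Y X : curve k) (f : curve_mor Y X).
Local Notation s := (cm_fun f).
Implicit Types (y : place Y) (x : place X).

(* b is the image of a in the completion at y; unlike compl_map, this makes  *)
(* sense when cm_pt f y is only provably equal to x.                         *)
Definition compl_rel y x (a : compl_ring x) (b : compl_ring y) : Prop :=
  exists (u : cseq x) (v : cseq y),
    [/\ a = \pi_(compl_ring x) u, b = \pi_(compl_ring y) v & forall i, v i = s (u i)].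

Lemma compl_rel_map y (a : compl_ring (cm_pt f y)) : compl_rel a (compl_map a).
Proof. by exists (repr a), (CSeq (cauchy_map (repr a))); rewrite reprK. Qed.
Lemma compl_rel_seq y x (u : cseq x) : cm_pt f y = x ->
  exists2 v : cseq y, forall i, v i = s (u i) & compl_rel (\pi_(compl_ring x) u) (\pi_(compl_ring y) v).
Proof.
move=> E; case: x / E u => u; exists (CSeq (cauchy_map u)) => //.
by exists u, (CSeq (cauchy_map u)).
Qed.

Lemma compl_rel_fun y x (a : compl_ring x) (b b' : compl_ring y) : cm_pt f y = x ->
  compl_rel a b -> compl_rel a b' -> b = b'.
Proof.
move=> E; case: x / E a => a [u [v [-> -> uv]]] [u' [v' [/compl_piP h -> uv']]].
apply/compl_piP => n; have [N hN] := h n; exists N => i /hN.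
by rewrite uv uv' -rmorphB; exact: cm_pow.
Qed.

Lemma compl_mapE y (u : cseq (cm_pt f y)) (v : cseq y) : (forall i, v i = s (u i)) ->
  compl_map (\pi_(compl_ring (cm_pt f y)) u) = \pi_(compl_ring y) v.
Proof.
move=> uv; apply: (compl_rel_fun erefl (compl_rel_map _)).
by exists u, v.
Qed.

Lemma compl_map_zmod y : zmod_morphism (@compl_map k Y X f y).
Proof.
elim/compl_ind=> u; elim/compl_ind=> v; rewrite -compl_piB.
rewrite (@compl_mapE y u (CSeq (cauchy_map u))) // (@compl_mapE y v (CSeq (cauchy_map v))) //.
rewrite -compl_piB; apply: compl_mapE => i.
exact: esym (rmorphB s _ _).
Qed.
Lemma compl_map_monoid y : monoid_morphism (@compl_map k Y X f y).
Proof.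
split.
  by rewrite -!compl_pi1; apply: compl_mapE => i; rewrite rmorph1.
elim/compl_ind=> u; elim/compl_ind=> v; rewrite -compl_piM.
rewrite (@compl_mapE y u (CSeq (cauchy_map u))) // (@compl_mapE y v (CSeq (cauchy_map v))) //.
rewrite -compl_piM; apply: compl_mapE => i.
exact: esym (rmorphM s _ _).
Qed.
HB.instance Definition _ y := GRing.isZmodMorphism.Build _ _ (@compl_map k Y X f y) (@compl_map_zmod y).
HB.instance Definition _ y := GRing.isMonoidMorphism.Build _ _ (@compl_map k Y X f y) (@compl_map_monoid y).

Lemma in_pow_pull y n a : in_pow y (n * absz (ram f y)) (s a) -> in_pow (cm_pt f y) n a.
Proof.
rewrite /in_pow fmorph_eq0; rewrite vord_pull PoszM gtz0_abs ?ram_gt0 //.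
by rewrite mulrC ler_pM2l ?ram_gt0.
Qed.

Lemma compl_map_inj y : injective (@compl_map k Y X f y).
Proof.
elim/compl_ind=> u; elim/compl_ind=> v.
rewrite (compl_mapE (v := CSeq (cauchy_map u))) // (compl_mapE (v := CSeq (cauchy_map v))) //.
move/compl_piP => h; apply/compl_piP => n; have [N hN] := h (n * absz (ram f y))%N.
by exists N => i /hN; rewrite -rmorphB; exact: in_pow_pull.
Qed.

Lemma compl_map_const y c : in_ring (cm_pt f y) c -> compl_map (const (cm_pt f y) c) = const y (s c).
Proof.
move=> hc; have [u hu ->] := const_seq hc; rewrite (compl_mapE (v := CSeq (cauchy_map u))) //.
by apply/esym/constE => i /=; rewrite hu.
Qed.

(** The pull-back of the uniformizer is a uniformizer and both residue fields are k, so functions on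
    Y are approximated by functions on X digit by digit. *)
Lemma compl_map_surj y : k_linear f -> ram f y = 1 -> forall b, exists a, compl_map (f := f) (y := y) a = b.
Proof.
move=> lf r1; pose t := unif (cm_pt f y).
have t0 : t != 0 := unif_neq0 _; have vt : vord y (s t) = 1 by [].
have approx n c : in_ring y c -> exists a, in_ring (cm_pt f y) a /\ in_pow y n (c - s a).
  move=> hc; elim: n => [|n [a [ha hn]]]; first by exists 0; split; [exact: in_pow0|rewrite rmorph0 subr0].
  have hd : vge y 0 ((c - s a) / s t ^+ n).
    rewrite -(subrr n%:Z); apply: vgeM; first by exact: hn.
    by rewrite vgeE ?invr_eq0 ?expf_neq0 ?fmorph_eq0 // vordV vordX vt natz.
  set r := res y ((c - s a) / s t ^+ n); exists (a + kcst X r * t ^+ n); split.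
    apply: in_powD => //; apply: in_ringM; first exact: in_pow_cst.
    rewrite -[in_pow _ _ _]/(vge _ 0 _) vgeE ?expf_neq0 // vordX.
    by rewrite vord_unif1.
  have -> : c - s (a + kcst X r * t ^+ n) = s t ^+ n * ((c - s a) / s t ^+ n - kcst Y r).
    rewrite rmorphD rmorphM lf rmorphXn mulrBr mulrCA divff ?expf_neq0 ?fmorph_eq0 //; ring.
  rewrite -addn1; apply: in_powM; last exact: (resP hd).
  by rewrite /in_pow vordX vt natz lexx orbT.
elim/compl_ind=> v; have /asboolP[rv cv] := cseqP v.
have /choice[u hu] i := approx i (v i) (rv i).
have cu : u \in cauchyb (cm_pt f y).
  apply/asboolP; split=> [i|n]; first by case: (hu i).
  have [N hN] := cv n; exists (maxn N n) => i j.
  rewrite !geq_max => /andP[iN ni] /andP[jN nj].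
  apply: (@in_pow_pull y); rewrite r1 muln1 rmorphB.
  have -> : s (u i) - s (u j) = (v i - v j) + (- (v i - s (u i)) + (v j - s (u j))) by ring.
  have W m a : (n <= m)%N -> in_pow y m a -> in_pow y n a.
    by move=> nm; apply: (@vgeW _ y n%:Z m%:Z).
  apply: in_powD; first exact: hN.
  by apply: in_powD; [rewrite in_powN; apply: (W i _ ni); case: (hu i)|apply: (W j _ nj); case: (hu j)].
exists (\pi_(compl_ring (cm_pt f y)) (CSeq cu)).
rewrite (compl_mapE (v := CSeq (cauchy_map (CSeq cu)))) //; apply/compl_piP => n; exists n => i ni.
by rewrite -in_powN opprB; apply: (@vgeW _ y n%:Z i%:Z) => //=; case: (hu i).
Qed.

End CompletionMaps.

(** * The compositum of etale covers is etale *)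

Section EtaleCompositum.
Variables (X : curve k) (P : branch_data X).

(** Isomorphy of P(x) with the completed function field at [y], in a form that also applies when the
    image of [y] is only provably equal to [x]; hence the relation [compl_rel]. *)
Definition etale_at (Y : curve k) (f : curve_mor Y X) (y : place Y) (x : place X) : Prop :=
  exists psi : {rmorphism P x -> compl_field y},
    (forall a b, compl_rel f a b -> psi (tofrac a)%:A = tofrac b) /\ bijective psi.

Lemma orb_etale_at (Y : curve k) (f : curve_mor Y X) y x :
  orb_etale f (trivial_branch Y) P -> cm_pt f y = x -> etale_at f y x.
Proof.
move=> [_ h] E; case: x / E; have [psi [hpsi bpsi]] := h y.
exists psi; split=> // a b ab; apply: etrans (hpsi a) _.
by rewrite (compl_rel_fun erefl (compl_rel_map a) ab); exact: mulr1.
Qed.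

(** Over [P x] the minimal polynomial of m splits, since [P x] is normal, so all its roots in [K]
    are images under [v]. *)
Lemma normal_images (x : place X) (K : fieldType) (u v : {rmorphism P x -> K}) :
  (forall c, u c%:A = v c%:A) -> forall m, exists m', u m = v m'.
Proof.
move=> uv m; have /and3P[_ _ /normalFieldP/(_ m (memvf _))[r _ hr]] := @br_galois k X P x.
have /polyOver1P[q hq] := minPolyOver 1 m.
have rm : root (map_poly u (minPoly 1 m)) (u m) by rewrite fmorph_root; exact: root_minPoly.
have e : map_poly u (minPoly 1 m) = map_poly v (minPoly 1 m).
  by rewrite hq -!map_poly_comp; apply: eq_map_poly => c /=.
move: rm; rewrite e hr rmorph_prod.
rewrite (eq_bigr (fun z => 'X - (v z)%:P)) => [|z _]; last by rewrite rmorphB /= map_polyX map_polyC.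
rewrite -(big_map v xpredT (fun z => 'X - z%:P)) root_prod_XsubC => /mapP[z _ ->].
by exists z.
Qed.

Variables (Y1 Y2 Z : curve k) (f1 : curve_mor Y1 X) (f2 : curve_mor Y2 X) (f : curve_mor Z X).
Variables (u1 : curve_mor Z Y1) (u2 : curve_mor Z Y2).
Hypothesis e1 : forall b, cm_fun u1 (cm_fun f1 b) = cm_fun f b.
Hypothesis e2 : forall b, cm_fun u2 (cm_fun f2 b) = cm_fun f b.
Hypothesis gen : forall S : set (ff Z), (forall a b, S a -> S b -> S (a + b)) ->
  (forall a b, S a -> S b -> S (a * b)) -> (forall c, S (cm_fun u1 c)) ->
  (forall c, S (cm_fun u2 c)) -> forall a, S a.
Hypothesis lin1 : k_linear u1.
Variable z : place Z.
Hypothesis h1 : etale_at f1 (cm_pt u1 z) (cm_pt f z).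
Hypothesis h2 : etale_at f2 (cm_pt u2 z) (cm_pt f z).

Lemma comp_pt (Y : curve k) (g : curve_mor Y X) (u : curve_mor Z Y) :
  (forall b, cm_fun u (cm_fun g b) = cm_fun f b) -> cm_pt g (cm_pt u z) = cm_pt f z.
Proof. by move=> e; apply: place_eq => a; rewrite -!in_ringE !cm_loc e. Qed.
Lemma compl_rel_comp (Y : curve k) (g : curve_mor Y X) (u : curve_mor Z Y) a :
  (forall b, cm_fun u (cm_fun g b) = cm_fun f b) ->
  exists2 b : compl_ring (cm_pt u z), compl_rel g a b & compl_map (f := u) b = compl_map (f := f) a.
Proof.
move=> e; elim/compl_ind: a => w; have [v vw r] := compl_rel_seq w (comp_pt e).
exists (\pi_(compl_ring (cm_pt u z)) v) => //.
rewrite (compl_mapE (v := CSeq (cauchy_map v))) // (compl_mapE (v := CSeq (cauchy_map w))) //.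
by congr (\pi_(compl_ring z) _); apply: val_inj; apply: functional_extensionality_dep => i; rewrite /= vw.
Qed.

(** The completed fields of [Y1] and [Y2] are both P(x), so by normality they have the same image in
    that of Z. The functions on Z whose image lies there form a ring containing both function
    fields, hence are all functions. A uniformizer at [z] is thus a quotient of elements of the
    completed ring of [Y1], and its order 1 is a multiple of the ramification index. *)
Lemma unramified_compositum : ram u1 z = 1.
Proof.
have [k1 hk1] := frac_map_ex (@compl_map_inj Z Y1 u1 z).
have [k2 hk2] := frac_map_ex (@compl_map_inj Z Y2 u2 z).
have [psi1 [hp1 [qi1 pK1 qK1]]] := h1; have [psi2 [hp2 [qi2 pK2 qK2]]] := h2.
have ag c : k1 (psi1 c%:A) = k2 (psi2 c%:A).
  have [a [b [b0 ->]]] := frac_ex c.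
  have E (d : compl_ring (cm_pt f z)) : k1 (psi1 (tofrac d)%:A) = k2 (psi2 (tofrac d)%:A).
    have [d1 r1 m1] := compl_rel_comp d e1; have [d2 r2 m2] := compl_rel_comp d e2.
    by rewrite (hp1 _ _ r1) (hp2 _ _ r2) hk1 hk2 /= m1 m2.
  have dA (w v : compl_field (cm_pt f z)) : (w / v)%:A = w%:A / v%:A :> P (cm_pt f z).
    exact: (fmorph_div (in_alg (P (cm_pt f z)))).
  by rewrite dA !fmorph_div !E.
have im w' : exists w, k2 w' = k1 w.
  have [m' e] := @normal_images _ _ (k2 \o psi2) (k1 \o psi1) (fun c => esym (ag c)) (qi2 w').
  by move: e; rewrite /= qK2 => e; exists (psi1 m').
have CD a b : in_ring z a -> in_ring z b ->
  tofrac (const z (a + b)) = tofrac (const z a) + tofrac (const z b).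
  by move=> ra rb; exact: etrans (congr1 (@tofrac _) (constD ra rb)) (tofracD _ _).
have CM a b : in_ring z a -> in_ring z b ->
  tofrac (const z (a * b)) = tofrac (const z a) * tofrac (const z b).
  by move=> ra rb; exact: etrans (congr1 (@tofrac _) (constM ra rb)) (tofracM _ _).
(* The functions coming from the completion of [Y1], written as quotients because [const] is
   meaningful on the local ring only. *)
pose S a := exists b c w, [/\ in_ring z b, in_ring z c, c != 0, a = b / c &
  k1 w * tofrac (const z c) = tofrac (const z b)].
have c0 c : in_ring z c -> c != 0 -> tofrac (const z c) != 0.
  by move=> hc cn; rewrite tofrac_eq0; apply: contra_neq cn => /const_eq0; exact.
have SD a b : S a -> S b -> S (a + b).
  move=> [b1 [c1 [w1 [rb rc cn -> ew]]]] [b2 [c2 [w2 [rb' rc' cn' -> ew']]]].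
  exists (b1 * c2 + b2 * c1), (c1 * c2), (w1 + w2); split.
  - by apply: in_powD; apply: in_ringM.
  - exact: in_ringM.
  - exact: mulf_neq0.
  - by rewrite addf_div.
  - rewrite (rmorphD k1) (CD _ _ (in_ringM rb rc') (in_ringM rb' rc)).
    rewrite (CM _ _ rb rc') (CM _ _ rb' rc) (CM _ _ rc rc') -ew -ew'; ring.
have SM a b : S a -> S b -> S (a * b).
  move=> [b1 [c1 [w1 [rb rc cn -> ew]]]] [b2 [c2 [w2 [rb' rc' cn' -> ew']]]].
  exists (b1 * b2), (c1 * c2), (w1 * w2); split.
  - exact: in_ringM.
  - exact: in_ringM.
  - exact: mulf_neq0.
  - by rewrite mulf_div.
  - rewrite !CM // -ew -ew'; ring.
have Sim (Y : curve k) (u : curve_mor Z Y) (ku : {rmorphism compl_field (cm_pt u z) -> compl_field z}) c :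
    (forall a, ku (tofrac a) = tofrac (compl_map (f := u) a)) -> (forall w', exists w, ku w' = k1 w) ->
    S (cm_fun u c).
  move=> hku imu; have [b [d [rb rd d0 ->]]] := frac_of_ring (cm_pt u z) c.
  have [w ew] := imu (tofrac (const _ b) / tofrac (const _ d)).
  exists (cm_fun u b), (cm_fun u d), w; split; rewrite -?cm_loc ?fmorph_eq0 //.
    by rewrite fmorph_div.
  rewrite -ew fmorph_div !hku !compl_map_const // divfK //.
  by apply: c0; rewrite -?cm_loc ?fmorph_eq0.
have Sall := gen SD SM (fun c => Sim Y1 u1 k1 c hk1 (fun w => ex_intro _ w erefl))
  (fun c => Sim Y2 u2 k2 c hk2 im).
have [b [c [w [rb rc cn et ew]]]] := Sall (unif z).
have [p [q [q0 ewq]]] := frac_ex w.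
have b0 : b != 0 by apply: contraNneq (unif_neq0 z) => b0; rewrite et b0 mul0r.
have rel : compl_map (f := u1) p * const z c = const z b * compl_map (f := u1) q.
  have tq : tofrac (compl_map (f := u1) q) != 0.
    by rewrite tofrac_eq0 -(rmorph0 (@compl_map k Z Y1 u1 z)) (inj_eq (@compl_map_inj _ _ u1 z)).
  apply/eqP; rewrite -tofrac_eq !rmorphM /= -ew ewq fmorph_div !hk1.
  by rewrite [X in _ == X]mulrAC divfK.
move: rel q0; elim/compl_ind: p {ewq} => pu; elim/compl_ind: q => qv.
rewrite (compl_mapE (v := CSeq (cauchy_map pu))) // (compl_mapE (v := CSeq (cauchy_map qv))) //.
have [cs hcs ->] := const_seq rc; have [bs hbs ->] := const_seq rb.
rewrite -!compl_piM => /compl_piP rel q0.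
have [n [N hn]] : exists n N, forall i, (N <= i)%N -> ~~ in_pow (cm_pt u1 z) n (qv i).
  apply: null_away; apply: contraNN q0 => /asboolP hq.
  have -> : 0 = \pi_(compl_ring (cm_pt u1 z)) 0 by rewrite raddf0.
  apply/eqP/compl_piP => n; have [N hN] := hq n; exists N => i /hN.
  by rewrite subr0.
(* A precision beyond the order of [b] times the approximated denominator, so that both sides of the
   relation have the same order at [z]. *)
pose M := (absz (vord z b) + absz (ram u1 z) * n)%N.
have [N' hN'] := rel M; pose i := maxn N N'.
have {}hn := hn i (leq_maxl _ _); have {}hN' := hN' i (leq_maxr _ _).
move: hN'; rewrite /= !fctE hcs hbs => hd.
have q1 : qv i != 0 by apply: contraNneq hn => ->; exact: in_pow0.
have vq : vord (cm_pt u1 z) (qv i) < n%:Z by move: hn; rewrite /in_pow (negbTE q1) -ltNge.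
have rg := ram_gt0 u1 z; set r := ram u1 z in rg M hd *.
have vb : vord z (b * cm_fun u1 (qv i)) = vord z b + r * vord (cm_pt u1 z) (qv i).
  by rewrite vordM ?fmorph_eq0 // vord_pull.
have vbM : vord z (b * cm_fun u1 (qv i)) < M%:Z.
  rewrite vb PoszD PoszM; apply: ler_ltD; first by rewrite ler_norm.
  by rewrite gtz0_abs // ltr_pM2l.
have bq0 : b * cm_fun u1 (qv i) != 0 by rewrite mulf_neq0 ?fmorph_eq0.
have veq : vord z (cm_fun u1 (pu i) * c) = vord z (b * cm_fun u1 (qv i)) /\ cm_fun u1 (pu i) * c != 0.
  move: hd; set A := cm_fun u1 (pu i) * c; set B := b * _ in vbM bq0 *.
  case/orP => [|hd]; first by rewrite subr_eq0 => /eqP ->.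
  have [D0|D0] := eqVneq (A - B) 0; first by move/eqP: D0; rewrite subr_eq0 => /eqP ->.
  have A0 : A != 0.
    by apply: contraTneq hd => ->; rewrite sub0r vordN -ltNge.
  split=> //; have AE : A = (A - B) + B by rewrite subrK.
  apply/eqP; rewrite eq_le; apply/andP; split; last first.
    rewrite AE; apply: le_trans (vordD z D0 bq0 _); last by rewrite subrK.
    by rewrite le_min lexx ltW // (lt_le_trans vbM).
  rewrite leNgt; apply/negP => lt.
  have BE : B = A - (A - B) by ring.
  have := vordD z A0 (_ : - (A - B) != 0) (_ : A - (A - B) != 0).
  rewrite oppr_eq0 -BE => /(_ D0 bq0); rewrite vordN ge_min => /orP[|].
    by rewrite leNgt lt.
  by rewrite leNgt (lt_le_trans vbM hd).
case: veq => veq; rewrite mulf_eq0 negb_or fmorph_eq0 => /andP[p1 _].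
move: veq; rewrite vordM ?fmorph_eq0 // vord_pull => veq.
have vs : vord z b - vord z c = 1.
  have := vord_unif1 z.
  by rewrite et vordM ?invr_eq0 // vordV.
have : r * (vord (cm_pt u1 z) (pu i) - vord (cm_pt u1 z) (qv i)) = 1.
  by rewrite -vs; lia.
move: (_ - _) => d.
have [d0|d0] := leP d 0; nia.
Qed.

(** Without ramification the completion of Z at [z] equals that of [Y1], by [compl_map_surj], and
    the latter is P(x). *)
Lemma etale_compositum : exists psi : {rmorphism P (cm_pt f z) -> trivial_branch Z z},
  ext_hom psi /\ bijective psi.
Proof.
have [k1 hk1] := frac_map_ex (@compl_map_inj Z Y1 u1 z).
have [psi1 [hp1 bp1]] := h1.
exists (k1 \o psi1); split.
  move=> a; have [d r m] := compl_rel_comp a e1.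
  by rewrite /= (hp1 _ _ r) hk1 /= m; apply: esym; exact: mulr1.
have sk w : exists v, k1 v = w.
  have sj := compl_map_surj lin1 unramified_compositum.
  have [a [b [b0 ->]]] := frac_ex w; have [a' <-] := sj a; have [b' <-] := sj b.
  by exists (tofrac a' / tofrac b'); rewrite fmorph_div !hk1.
have /choice[g hg] := sk.
have bk : bijective k1 by exists g => w; [apply: (fmorph_inj k1)|].
exact: (bij_comp bk bp1).
Qed.

End EtaleCompositum.

(** * Degree 0 subbundles and quotients of trivial bundles *)

Section TrivialSubquotients.
Variables (Y : curve k).
Local Notation L := (ff Y).
Implicit Types (V W S Q : bundle Y).

(* Some coordinate projection of a subbundle is generically an isomorphism   *)
(* onto a trivial bundle, hence an isomorphism when both have degree 0.      *)
Lemma triv_subbundle I S M : @is_subbundle k Y S (triv Y I) M -> degree S = 0 ->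
  isomorphic S (triv Y (idx S)).
Proof.
move=> [hM iM _] d0; have [M' /(congr1 (@mxof _ _ _))] := inj_retract iM.
rewrite mxof_comp mxof1 => MM.
have fA : row_full (mxof M)^T.
  rewrite /row_full mxrank_tr; apply/row_freeP; by exists (mxof M').
pose h (j : idx S) := enum_val (fullrankfun fA (enum_rank j)).
pose C : mat L (idx S) (idx S) := compm (pullm L h) M.
have CE : mxof C = (rowsub (fullrankfun fA) (mxof M)^T)^T.
  apply/matrixP => i j; rewrite !mxE ffunE app_pull ffunE.
  by rewrite /h enum_valK.
have uC : fdet C != 0.
  rewrite frame_detE CE det_tr -unitfE -unitmxE -row_full_unit.
  exact: fullrowsub_full.
have CC := det_minv uC; set C' := ofmx _ in CC.
have hC : @is_hom k Y S (triv Y (idx S)) C.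
  by move=> y v hv j; rewrite appM app_pull ffunE; exact: hM.
exists C, C'; apply: (proj2 (@degree_hom Y S (triv Y (idx S)) C C' CC hC)).
by rewrite d0 degree_triv.
Qed.

Lemma bdual_bdual V : isomorphic (bdual (bdual V)) V.
Proof.
case: V => I s l; apply: same_frames_isom => z.
have [e fe [e' ee']] := frames_inv (Bundle l) z; have [e1 e2] := ee'.
exists e.
have := @dual_frames k Y (bdual (Bundle l)) z _ _ (dual_frames fe ee') (trm_minv (conj e2 e1)).
by rewrite (_ : trm (trm e) = e) //; apply/ffunP => i; apply/ffunP => j; rewrite !ffunE.
Qed.

(** Dual to [triv_subbundle]. *)
Lemma triv_quotient I Q N : @is_surj k Y (triv Y I) Q N -> degree Q = 0 ->
  exists J, isomorphic Q (triv Y J).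
Proof.
move=> sN d0; have hS := trm_subbundle sN; have [P [P' PP]] := bdual_triv Y I.
have i := triv_subbundle (sub_iso PP hS) _.
exists (idx Q); apply: isom_trans (isom_sym (bdual_bdual Q)) _.
by apply: isom_trans (isom_bdual (i _)) (bdual_triv _ _); rewrite degree_bdual d0.
Qed.

Lemma tens_triv I J : isomorphic (tens (triv Y I) (triv Y J)) (triv Y (I * J)%type).
Proof.
apply: same_frames_isom => z; exists (mtens (mat1 I) (mat1 J)); split.
  exact: (@tens_frames Y (triv Y I) (triv Y J) _ _ _ (triv_frames z I) (triv_frames z J)).
by rewrite mtens_id; exact: triv_frames.
Qed.
Lemma dsum_triv I J : isomorphic (dsum (triv Y I) (triv Y J)) (triv Y (I + J)%type).
Proof.
apply: same_frames_isom => z; exists (msum (mat1 I) (mat1 J)); split.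
  exact: (@dsum_frames Y (triv Y I) (triv Y J) _ _ _ (triv_frames z I) (triv_frames z J)).
rewrite (_ : msum _ _ = mat1 (I + J)%type); first exact: triv_frames.
by apply/ffunP => -[i|i]; apply/ffunP => -[j|j]; rewrite !ffunE.
Qed.

End TrivialSubquotients.

(** * Bundles trivialized by etale covers *)

Section EtaleBundles.
Variables (X : curve k) (P : branch_data X) (Y : curve k) (gT : finGroupType).
Variables (f : galois_cover gT Y X) (hf : orb_etale f (trivial_branch Y) P).
Implicit Types (V W : bundle Y).

Definition trivialized (Z : curve k) (gZ : finGroupType) (fZ : galois_cover gZ Z X)
    (h : curve_mor Z Y) V : Prop :=
  [/\ orb_etale fZ (trivial_branch Z) P, forall b, cm_fun h (cm_fun f b) = cm_fun fZ b
    & exists I : finType, isomorphic (pull h V) (triv Z I)].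

Lemma over_degree (Z : curve k) (gZ : finGroupType) (fZ : galois_cover gZ Z X) (h : curve_mor Z Y) :
  (forall b, cm_fun h (cm_fun f b) = cm_fun fZ b) ->
  exists N : int, 0 < N /\ forall V, degree (pull h V) = N * degree V.
Proof.
move=> e; have [lf _ _] := gc_cov f; have [lZ [n [b hb]] _] := gc_cov fZ.
have lin : k_linear h by move=> c; rewrite -lf e.
have sp (a : (ff Z)^o) : in_span (cm_fun h) (b : 'I_n -> (ff Z)^o) a.
  have [c ->] := hb a; exists (fun j => cm_fun f (c j)).
  by apply: eq_bigr => j _; rewrite e.
have [N [w [N0 fw sw]]] := finite_basis sp; exists N%:Z; split=> // V.
exact: (@degree_cover _ _ h lin N w).
Qed.

Lemma trivialized_comp (Z Z' : curve k) (gZ gZ' : finGroupType) (fZ : galois_cover gZ Z X)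
    (fZ' : galois_cover gZ' Z' X) (h : curve_mor Z Y) (u : curve_mor Z' Z) V :
  orb_etale fZ' (trivial_branch Z') P -> (forall b, cm_fun u (cm_fun fZ b) = cm_fun fZ' b) ->
  trivialized fZ h V -> trivialized fZ' (comp_mor u h) V.
Proof.
move=> eZ' eu [eZ eh [I iI]]; split=> //; first by move=> b; rewrite /= eh.
exists I; apply: isom_trans (_ : isomorphic _ (pull u (pull h V))) _.
  by exists (mat1 _), (mat1 _); exact: pull_comp_iso.
exact: isom_trans (isom_pull u iI) (pull_triv _ _).
Qed.

(* Two trivialising covers are dominated by their compositum; the two maps   *)
(* from it to Y differ by an element of the group, and V is equivariant.     *)
Lemma common_trivialization (V W : gbundle (gc_act f)) (Z1 Z2 : curve k) (g1 g2 : finGroupType)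
    (f1 : galois_cover g1 Z1 X) (f2 : galois_cover g2 Z2 X) h1 h2 :
  trivialized f1 h1 V -> trivialized f2 h2 W ->
  exists (Z : curve k) (gZ : finGroupType) (fZ : galois_cover gZ Z X) h,
    trivialized fZ h V /\ trivialized fZ h W.
Proof.
move=> tV tW; have [eZ1 eh1 _] := tV; have [eZ2 eh2 _] := tW.
have [Z [gZ [fZ [u1 [u2 [e1 e2 gen]]]]]] := compositum_ex f1 f2.
have lin1 : k_linear u1.
  have [l1 _ _] := gc_cov f1; have [lZ _ _] := gc_cov fZ.
  by move=> c; rewrite -l1 e1.
have eZ : orb_etale fZ (trivial_branch Z) P.
  split; first exact: gc_cov.
  move=> z; apply: (etale_compositum e1 e2 gen lin1).
    by apply: orb_etale_at eZ1 _; exact: comp_pt.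
  by apply: orb_etale_at eZ2 _; exact: comp_pt.
have tV' := trivialized_comp eZ e1 tV; have [_ eh' [J iJ]] := trivialized_comp eZ e2 tW.
exists Z, gZ, fZ, (comp_mor u1 h1); split=> //; have [_ eh _] := tV'; split=> //.
have [t ht] := primitive_ex f; have [m hm] := conj_poly_ex f t.
have [|g eg] := @embedding_uniq Y X gT f t ht m hm _ (cm_fun (comp_mor u1 h1)) (cm_fun (comp_mor u2 h2)).
  by move=> b; rewrite eh.
exists J; apply: isom_trans iJ; apply: isom_sym.
apply: isom_trans (_ : isomorphic _ (pull (comp_mor (comp_mor u1 h1) (gc_act f g)) W)) _.
  by exists (mat1 _), (mat1 _); exact: pull_eq_iso.
apply: isom_trans (_ : isomorphic _ (pull (comp_mor u1 h1) (pull (gc_act f g) W))) _.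
  by exists (mat1 _), (mat1 _); exact: pull_comp_iso.
by apply: isom_pull; exists (glam W g), (glamV W g); exact: glamP.
Qed.

Local Notation Etl := (@Etale k X P Y gT f).

Variable y : place Y.

(** Sums and tensor products are examined on a common trivializing cover. Semistability descends
    along a cover by [ss0_pull], and degree 0 sub- and quotient bundles stay trivial there. *)
Lemma Etale_tannakian : neutral_tannakian_sub (fiber_functor (gc_act f) y) Etl.
Proof.
have cl : tensor_closed Etl.
  split.
  - exists Y, gT, f, (id_mor Y); split=> //; exists unit; exact: pull_triv.
  - move=> V W [Z1 [g1 [f1 [h1 tV]]]] [Z2 [g2 [f2 [h2 tW]]]].
    have [Z [gZ [fZ [h [[eZ eh [I iI]] [_ _ [J iJ]]]]]]] := common_trivialization tV tW.
    exists Z, gZ, fZ, h; split=> //; exists (I * J)%type.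
    apply: isom_trans (isom_pull_tens h V W) _.
    exact: isom_trans (isom_tens iI iJ) (tens_triv _ _ _).
  - move=> V [Z [gZ [fZ [h [eZ eh [I iI]]]]]]; exists Z, gZ, fZ, h; split=> //; exists I.
    exact: isom_trans (pull_bdual h V) (isom_trans (isom_bdual iI) (bdual_triv _ _)).
exists cl; apply: tannakian_criterion.
- move=> V [Z [gZ [fZ [h [eZ eh [I iI]]]]]]; have [N [N0 dN]] := over_degree eh.
  apply: (ss0_pull N0 dN); exact: isom_ss0 (isom_sym iI) (ss0_triv _ _).
- move=> V W [Z1 [g1 [f1 [h1 tV]]]] [Z2 [g2 [f2 [h2 tW]]]].
  have [Z [gZ [fZ [h [[eZ eh [I iI]] [_ _ [J iJ]]]]]]] := common_trivialization tV tW.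
  exists Z, gZ, fZ, h; split=> //; exists (I + J)%type.
  apply: isom_trans (pull_dsum h V W) _.
  exact: isom_trans (isom_dsum iI iJ) (dsum_triv _ _ _).
- move=> V W i [Z [gZ [fZ [h [eZ eh [I [M [M' MM]]]]]]]] hi d0; have [N [N0 dN]] := over_degree eh.
  exists Z, gZ, fZ, h; split=> //; exists (idx (pull h W)).
  by apply: (triv_subbundle (sub_iso MM (pull_sub h hi))); rewrite dN d0 mulr0.
- move=> V W q [Z [gZ [fZ [h [eZ eh [I [M [M' [hM hM' MM]]]]]]]]] hq d0; have [N [N0 dN]] := over_degree eh.
  exists Z, gZ, fZ, h; split=> //.
  have sM : @is_surj k Z (triv Z I) (pull h V) M'.
    split=> // z v hv; exists (app M v); [exact: hM|exact: minv_l MM].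
  by apply: (triv_quotient (surj_comp sM (pull_surj h hq))); rewrite dN d0 mulr0.
Qed.

End EtaleBundles.

End Curves.

Theorem theorem3p11 (k : closedFieldType) (X : curve k) (P : branch_data X)
    (hP : geometric P)
    (Y : curve k) (Gamma : finGroupType) (f : galois_cover Gamma Y X)
    (hf : orb_etale f (trivial_branch Y) P)
    (x : place X) (y : place Y) (hxy : cm_pt f y = x) :
  neutral_tannakian_sub (fiber_functor (gc_act f) y) (@Vect0ss k Y Gamma (gc_act f)) /\
  neutral_tannakian_sub (fiber_functor (gc_act f) y) (@Nori k Y Gamma (gc_act f)) /\
  neutral_tannakian_sub (fiber_functor (gc_act f) y) (@Etale k X P Y Gamma f).
Proof.
split; [exact: Vect0ss_tannakian|split; [exact: Nori_tannakian|exact: Etale_tannakian]].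
Qed.
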